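(* Let $\phi$ be an even Hecke–Maass cusp form. For every $\varepsilon>0$ and fixed $Y>0$, \[ t_\phi^{\frac1{12}-\varepsilon}\ll_\varepsilon\#\{z\in\mathcal{C}_Y:\phi(z)=0\}\ll t_\phi , \] where $\mathcal{C}_Y=\{x+iY:-\frac12<x\le\frac12\}$ is the closed horocycle at height $Y$ in $\mathbb{X}$.
   Context: $\mathbb{X}=\mathrm{SL}_2(\mathbb{Z})\backslash\mathbb{H}$. An even Hecke–Maass cusp form is a real-valued $\phi$ on $\mathbb{H}$ with $y^2(\partial_x^2+\partial_y^2)\phi+(\frac14+t_\phi^2)\phi=0$, $t_\phi>0$, $\mathrm{SL}_2(\mathbb{Z})$-invariant, $\phi(-\bar z)=\phi(z)$, $L^2$-normalized on $\mathbb{X}$, eigenfunction of all Hecke operators. Asymptotics as $t_\phi\to\infty$; implied constants may depend on $Y$. *)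

(* Defs.v *)
From HB Require Import structures.
From mathcomp Require Import all_boot all_order all_algebra.
From mathcomp Require Import complex.
From mathcomp Require Import all_classical all_reals all_analysis.

Set Implicit Arguments.
Unset Strict Implicit.
Unset Printing Implicit Defensive.

Import Order.TTheory GRing.Theory Num.Theory.
Import numFieldNormedType.Exports.

Local Open Scope classical_set_scope.
Local Open Scope ring_scope.
Local Open Scope complex_scope.

Section HeckeMaass.
Variable R : realType.
Implicit Types (phi : R[i] -> R) (f : R * R -> R) (t Y : R) (z : R[i]).

(* A function on H is represented by a total function R[i] -> R, of which only
   the values on [upper_half] are ever used. *)
Definition upper_half : set R[i] := [set z | 0 < complex.Im z].

Definition in_coords phi : R * R -> R := fun p => phi (p.1 +i* p.2).

Definition d_x f : R * R -> R := fun p => derive f p (1, 0).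
Definition d_y f : R * R -> R := fun p => derive f p (0, 1).

Definition C1_upper_half f :=
  forall p : R * R, 0 < p.2 ->
    [/\ derivable f p (1, 0), derivable f p (0, 1),
        {for p, continuous (d_x f)} & {for p, continuous (d_y f)}].

Definition C2_upper_half f :=
  [/\ C1_upper_half f, C1_upper_half (d_x f) & C1_upper_half (d_y f)].

Definition laplace_eigenfunction phi t :=
  let f := in_coords phi in
  forall p : R * R, 0 < p.2 ->
    p.2 ^+ 2 * (d_x (d_x f) p + d_y (d_y f) p) + (4^-1 + t ^+ 2) * f p = 0.

Definition mobius (g : 'M[int]_2) z : R[i] :=
  ((g 0 0)%:~R * z + (g 0 1)%:~R) / ((g 1 0)%:~R * z + (g 1 1)%:~R).

Definition SL2Z_invariant phi :=
  forall (g : 'M[int]_2) z, \det g = 1 -> upper_half z ->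
    phi (mobius g z) = phi z.

Definition even_form phi :=
  forall z, upper_half z -> phi (- conjc z) = phi z.

Definition cuspidal phi :=
  forall y : R, 0 < y ->
    (\int[lebesgue_measure]_(x in `[0%R, 1%R]) phi (x +i* y))%R = 0.

(* The standard fundamental domain of SL_2(Z); its boundary identifications
   only concern a null set. *)
Definition fundamental_domain : set (R * R) :=
  [set p | [/\ 0 < p.2, `|p.1| <= 2^-1 & 1 <= p.1 ^+ 2 + p.2 ^+ 2]].

(* Unit norm for the hyperbolic area dx dy / y^2. *)
Definition L2_normalized phi :=
  (\int[(lebesgue_measure \x lebesgue_measure)%E]_(p in fundamental_domain)
     (in_coords phi p ^+ 2 / p.2 ^+ 2)%R%:E = 1)%E.

(* (T_n phi)(z) = n^{-1/2} \sum_{ad = n} \sum_{0 <= b < d} phi((az + b)/d) *)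
Definition hecke (n : nat) phi z : R :=
  (Num.sqrt n%:R)^-1 *
  \sum_(d <- divisors n) \sum_(0 <= b < d)
    phi (((n %/ d)%N%:R * z + b%:R) / d%:R).

Definition hecke_eigenfunction phi :=
  forall n : nat, (0 < n)%N ->
    exists lambda : R, forall z, upper_half z -> hecke n phi z = lambda * phi z.

Record even_hecke_maass_cusp_form phi t : Prop := EvenHeckeMaassCuspForm {
  ehm_spectral_gt0 : 0 < t ;
  ehm_C2 : C2_upper_half (in_coords phi) ;
  ehm_laplace : laplace_eigenfunction phi t ;
  ehm_invariant : SL2Z_invariant phi ;
  ehm_even : even_form phi ;
  ehm_cuspidal : cuspidal phi ;
  ehm_normalized : L2_normalized phi ;
  ehm_hecke : hecke_eigenfunction phi }.

Definition closed_horocycle Y : set R[i] :=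
  [set x +i* Y | x in [set x : R | - 2^-1 < x <= 2^-1]].

Definition horocycle_zeros phi Y : set R[i] :=
  [set z | closed_horocycle Y z /\ phi z = 0].

End HeckeMaass.

(* Main.v *)
(* On the horocycle, phi(x + iY) = 2 sum_n a_n cos(2 pi n x) with
   a_n = lam(n) sqrt(Y) K(2 pi n Y), where lam(n) are the Hecke eigenvalues and K
   is the solution of the modified Bessel equation that decays at infinity.

   Lower bound.  Below the turning point, K oscillates with an explicit phase.  The
   signs of phi at grid points form a sequence with few changes, so their cosine
   coefficients are O(V/n), V being twice the number of changes; pairing phi with its
   own signs bounds its L^1 norm by (V sum_n lam(n)^2/n)^(1/2), up to logarithms, and
   the Hecke relations together with sup-norm bounds keep the last sum below t^eps.
   Conversely the L^1 norm is bounded below by pairing with test polynomials whose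
   frequencies are products uv, with u running over primes or squares of primes, where
   lam is bounded below thanks to lam(p)^2 = 1 + lam(p^2); van der Corput's inequality
   shows that the phases of K at uv and u'v are decorrelated.

   Upper bound.  The derivatives of x |-> phi(x + iY) satisfy |f^(i)| <= G i! rho^(-i)
   with rho of order Y.  Were there more than C t zeros, many would lie in a short
   interval, where interpolation makes all derivatives of low order tiny; Taylor
   expansion propagates this to the whole horocycle and gives |phi| <= G 4^(-n) with n
   of order t.  But some a_n with nY of order t is at least exp(-C' t), because K cannot
   be too small near its turning point and lam(2^k), lam(2^(k+1)) cannot both be. *)

Require Import Defs.
From HB Require Import structures.
From mathcomp Require Import all_boot all_order all_algebra.
From mathcomp Require Import complex.
From mathcomp Require Import all_classical all_reals all_analysis.
From mathcomp Require Import measurable_realfun ring lra zify.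
Import Order.TTheory GRing.Theory Num.Theory.
Import numFieldNormedType.Exports.

Set Implicit Arguments.
Unset Strict Implicit.
Unset Printing Implicit Defensive.

Local Open Scope classical_set_scope.
Local Open Scope ring_scope.

(* The exponent 1/12 is twice 1/24. With $t\approx W^{24m}$, a bounded power of $W$ counts as
   $t^\varepsilon$; the normalized $L^1$ norm is shown to be at least $W^{m-16}$, and the number of
   sign changes is bounded below by its square. The obstacle is that neither Ramanujan's bound nor a
   lower bound for $\sum\lambda(n)^2$ over short ranges is at hand. The argument therefore branches
   on the mass $D=\sum_{n\le N}(\lambda(n)\kappa(n))^2$, $N\approx t^{2/3}$, where $\kappa$ is the
   Bessel factor divided by its amplitude. If $D$ is large, the test polynomial lives on products uv
   with v running over all integers up to $N$, weighted by $\lambda(v)\kappa(v)^2$, and u over about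
   $t^{1/6}$ prime powers; its sup norm yields a norm of at least $(Dt^{1/6}/N)^{1/2}$. If $D$ is
   small, it bounds the $L^2$ norm, and a test polynomial over about $t^{1/3}$ frequencies $uq^2$,
   controlled by its fourth moment only, yields at least $t^{1/3}D^{-1/2}$. Both bounds equal
   $t^{1/24}$ at $D=t^{7/12}$. A single $\lambda\kappa$ exceeding $t^{1/24}$ settles the matter at
   once. *)
Tactic Notation "lra_from" ne_hyp_list(hs) := clear - hs; intros; lra.
Tactic Notation "nra_from" ne_hyp_list(hs) := clear - hs; intros; nra.

(** * Exponential sums *)

Section ExponentialSums.
Variable R : realType.
Implicit Types (x y : R) (G D s : nat -> R).

(** Half angles: $\sin x=2\sin(x/2)\cos(x/2)$, where $\sin(x/2)\ge(x/2)\cos(x/2)$ by the mean value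
    theorem and $\cos^2(x/2)\ge\frac12$ because $\cos x\ge0$. *)
Lemma sin_ge_half x : 0 <= x <= pi / 2 -> x / 2 <= sin x.
Proof.
move=> /andP[x0 xp].
have [->|xn0] := eqVneq x 0; first by rewrite sin0 mul0r.
have xgt0 : 0 < x / 2 by rewrite divr_gt0 // lt0r xn0.
have p0 := pi_gt0 R.
have [|c] := @MVT R sin cos 0 (x / 2) xgt0.
  by apply: continuous_subspaceT => z; exact: continuous_sin.
rewrite in_itv /= sin0 !subr0 => /andP[c0 cx] es.
have cc : cos (x / 2) <= cos c.
  by rewrite le_eqVlt ltr_cos ?cx ?orbT // in_itv /=; apply/andP; split; lra.
have ch0 : 0 <= cos (x / 2) by apply: cos_ge0_pihalf; apply/andP; split; lra.
have c2 : 2^-1 <= cos (x / 2) ^+ 2.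
  have : cos x = cos (x / 2) ^+ 2 *+ 2 - 1.
    by rewrite -cos_mulr2n; congr cos; rewrite -mulr_natr; field.
  have : 0 <= cos x by apply: cos_ge0_pihalf; apply/andP; split; lra.
  rewrite -mulr_natr; lra.
have -> : sin x = 2 * (sin (x / 2) * cos (x / 2)).
  rewrite {1}(_ : x = x / 2 *+ 2) ?sin_mulr2n; last by rewrite -mulr_natr; field.
  by rewrite -mulr_natr; ring.
rewrite es; set a := cos c in cc *; set b := cos (x / 2) in cc ch0 c2 *.
have : b ^+ 2 <= a * b by rewrite expr2 ler_wpM2r.
nra.
Qed.

(** Summation by parts: s is bounded by 1 and x is nonincreasing, so the variation of x telescopes
    to [x a - x b.-1]. The boundary term at b is kept on the left. *)
Lemma abel_bound (x : nat -> R) s a b : (a < b)%N ->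
  (forall n, (a <= n)%N -> (n.+1 < b)%N -> x n.+1 <= x n) ->
  (forall n, `|s n| <= 1) ->
  `|\sum_(a <= n < b) x n * (s n.+1 - s n) - x b.-1 * s b|
    <= `|x a| + (x a - x b.-1).
Proof.
elim: b => // b IH; rewrite ltnS leq_eqVlt => /orP[/eqP<- _ sb|ab mx sb].
  rewrite big_nat1 subrr addr0 /= (_ : _ - _ = - (x a * s a)); last by ring.
  by rewrite normrN normrM ler_piMr.
have {}IH := IH ab (fun n an nb => mx n an (ltnW nb)) sb.
rewrite big_nat_recr ?(ltnW ab) //=.
have bE : b = b.-1.+1 by rewrite prednK // (leq_trans _ ab).
have mb : x b <= x b.-1 by rewrite {1}bE; apply: mx; rewrite -?bE //; lia.
rewrite (_ : _ - _ = (\sum_(a <= n < b) x n * (s n.+1 - s n) - x b.-1 * s b)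
   + (x b.-1 - x b) * s b); last by ring.
apply: (le_trans (ler_normD _ _)).
have : `|(x b.-1 - x b) * s b| <= x b.-1 - x b.
  by rewrite normrM ger0_norm ?subr_ge0 // ler_piMr ?subr_ge0.
lra.
Qed.

Lemma cos2pik x (k : int) : cos (x + 2 * pi * k%:~R) = cos x.
Proof.
have P (n : nat) (z : R) : cos (z + 2 * pi * n%:R) = cos z.
  elim: n z => [|n IH] z; first by rewrite mulr0 addr0.
  rewrite -[in RHS](IH z) -(cosD2pi (z + 2 * pi * n%:R)); congr cos.
  by rewrite -natr1 -mulr_natr; ring.
case: k => n; first exact: P.
rewrite NegzE -[in RHS](subrK (2 * pi * n.+1%:R) x) P; congr cos.
by rewrite rmorphN /= mulrN.
Qed.

(** With $D_n=G_{n+1}-G_n$, the identity $\cot(D_n/2)(\sin G_{n+1}-\sin G_n)=\cos G_{n+1}+\cos G_n$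
    writes each term as half of a telescoping difference plus half of a difference of sines weighted
    by a cotangent. The cotangents are nonincreasing and at most $4/d$ in size, so summation by
    parts applies. *)
Lemma kusmin_landau0 G (d : R) a b : 0 < d ->
  (forall n, (a <= n < b)%N -> d <= G n.+1 - G n <= 2 * pi - d) ->
  (forall n, (a <= n)%N -> (n.+1 < b)%N -> G n.+1 - G n <= G n.+2 - G n.+1) ->
  `|\sum_(a <= n < b) cos (G n)| <= 1 + 8 / d.
Proof.
move=> d0 Dd mD.
have [ba|ab] := leqP b a.
  by rewrite big_geq // normr0 addr_ge0 ?divr_ge0 // ltW.
pose D n := G n.+1 - G n.
pose ct n := cos (D n / 2) / sin (D n / 2).
have p0 := pi_gt0 R.
have sD n : (a <= n < b)%N -> d / 4 <= sin (D n / 2).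
  move=> /Dd /andP[]; rewrite -/(D n) => h1 h2.
  have [h3|h3] := leP (D n / 2) (pi / 2).
    by apply: le_trans (sin_ge_half _); [lra|apply/andP; split; lra].
  rewrite -[sin _]opprK -[- sin _]sinN -sinDpi.
  by apply: le_trans (sin_ge_half _); [lra|apply/andP; split; lra].
have ctE n : (a <= n < b)%N ->
    cos (G n) = - ((cos (G n.+1) - cos (G n)) / 2)
                + (ct n * (sin (G n.+1) - sin (G n))) / 2.
  move=> nb; have := sD _ nb; set sn := sin _ => sn0.
  have -> : ct n * (sin (G n.+1) - sin (G n)) = cos (G n.+1) + cos (G n).
    have -> : G n.+1 = (G n + D n / 2) + D n / 2 by rewrite /D; field.
    have -> : sin (G n) = sin ((G n + D n / 2) - D n / 2) by congr sin; ring.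
    have -> : cos (G n) = cos ((G n + D n / 2) - D n / 2) by congr cos; ring.
    rewrite [in LHS]sinD sinB [in RHS]cosD cosB /ct -/sn.
    have sn1 : sn != 0 by apply: lt0r_neq0; apply: lt_le_trans sn0; rewrite divr_gt0.
    by set sg := sin (G n + _); set cg := cos (G n + _); field.
  by field.
have ctb n : (a <= n < b)%N -> `|ct n| <= 4 / d.
  move=> nb; have h := sD _ nb; have h0 : 0 < sin (D n / 2).
    by apply: lt_le_trans h; rewrite divr_gt0.
  rewrite /ct normrM normfV (gtr0_norm h0) ler_pdivrMr //.
  apply: (le_trans (cos_max _)).
  by rewrite mulrAC ler_pdivlMr // mul1r mulrC -ler_pdivrMr.
have mct n : (a <= n)%N -> (n.+1 < b)%N -> ct n.+1 <= ct n.
  move=> an nb; have h1 : (a <= n < b)%N by lia.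
  have h2 : (a <= n.+1 < b)%N by lia.
  have s1 := sD _ h1; have s2 := sD _ h2; have m := mD _ an nb.
  have /andP[l1 u1] := Dd _ h1; have /andP[l2 u2] := Dd _ h2.
  rewrite -/(D n) -/(D n.+1) in m l1 u1 l2 u2.
  have s10 : 0 < sin (D n / 2) by lra.
  have s20 : 0 < sin (D n.+1 / 2) by lra.
  rewrite -subr_ge0 (_ : _ - _ = sin (D n.+1 / 2 - D n / 2)
      / (sin (D n / 2) * sin (D n.+1 / 2))); last first.
    by rewrite sinB /ct; field; apply/andP; split; apply: lt0r_neq0.
  apply: divr_ge0; last by rewrite mulr_ge0 // ltW.
  by apply: sin_ge0_pi; apply/andP; split; lra.
rewrite (eq_big_nat _ _ (F2 := fun n => (- 2^-1) * (cos (G n.+1) - cos (G n))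
    + 2^-1 * (ct n * (sin (G n.+1) - sin (G n))))); last first.
  by move=> n nb; rewrite {1}ctE //; field.
rewrite big_split /= -!mulr_sumr telescope_sumr ?(ltnW ab) //.
have hb : (a <= b.-1 < b)%N by lia.
have ha : (a <= a < b)%N by lia.
have := abel_bound ab mct (fun n => sin_max (G n)).
have c1 := ctb _ ha; have c2 := ctb _ hb.
have : `|ct b.-1 * sin (G b)| <= 4 / d.
  by rewrite normrM (le_trans _ c2) // ler_piMr // sin_max.
set Sg := \sum_(_ <= _ < _) _; set e := 4 / d in c1 c2 *.
have -> : 8 / d = 2 * e by rewrite /e; field; exact: lt0r_neq0.
have := cos_max (G a); have := cos_max (G b).
have := ler_norm (ct a).
move: (`|ct a|) c1 c2 => N; clear.
rewrite !ler_norml => ? /andP[? ?] ? /andP[? ?] /andP[? ?] /andP[? ?] /andP[? ?].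
by apply/andP; split; lra.
Qed.

(** Subtracting $2\pi kn$ from the phase changes no cosine and moves the increments to the period k
    = 0. *)
Lemma kusmin_landau G (d : R) (k : int) a b : 0 < d ->
  (forall n, (a <= n < b)%N -> 2 * pi * k%:~R + d <= G n.+1 - G n <= 2 * pi * (k%:~R + 1) - d) ->
  (forall n, (a <= n)%N -> (n.+1 < b)%N -> G n.+1 - G n <= G n.+2 - G n.+1) ->
  `|\sum_(a <= n < b) cos (G n)| <= 1 + 8 / d.
Proof.
move=> d0 Dd mD.
pose G' n := G n - 2 * pi * k%:~R * n%:R.
have -> : \sum_(a <= n < b) cos (G n) = \sum_(a <= n < b) cos (G' n).
  apply: eq_bigr => n _; rewrite -[in RHS](@cos2pik _ (k * n)); congr cos.
  by rewrite rmorphM /= /G' pmulrn; ring.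
apply: kusmin_landau0 => // n.
  by move=> /Dd /andP[? ?]; rewrite /G' -natr1; apply/andP; split; lra.
by move=> an nb; have := mD _ an nb; rewrite /G' -!natr1; lra.
Qed.

Lemma threshold D (y : R) a b : (a <= b)%N ->
  (forall n, (a <= n)%N -> (n.+1 < b)%N -> D n <= D n.+1) ->
  exists c, [/\ (a <= c <= b)%N, forall n, (a <= n < c)%N -> D n < y &
    forall n, (c <= n < b)%N -> y <= D n].
Proof.
elim: b => [|b IH] ab mD.
  by exists 0%N; split=> [|n|n]; rewrite ?leq0n ?andbT ?ltn0 ?andbF //; lia.
move: ab; rewrite leq_eqVlt => /orP[/eqP<-|ab].
  by exists a; split=> [|n|n]; rewrite ?leqnn //; lia.
have [|c [/andP[ac cb] c1 c2]] := IH ab; first by move=> n an nb; apply: mD; lia.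
have [yb|yb] := leP y (D b).
  exists c; split=> // [|n]; first by rewrite ac leqW.
  by rewrite ltnS [(n <= b)%N]leq_eqVlt => /andP[cn /orP[/eqP->//|nb]]; apply: c2; rewrite cn.
have cb' : c = b.
  apply/eqP; rewrite eqn_leq cb leqNgt; apply/negP => cb'.
  have := c2 b.-1 ltac:(lia).
  have bE : b = b.-1.+1 by lia.
  have : D b.-1 <= D b by rewrite {2}bE; apply: mD; lia.
  lra.
exists b.+1; split=> [|n|n]; first by rewrite leqnn ltnW.
  move=> nb; have [->//|nnb] := eqVneq n b; apply: c1; rewrite cb'; lia.
by lia.
Qed.

Lemma sum_increments D (l : R) a n : (forall i, (a <= i < a + n)%N -> l <= D i.+1 - D i) ->
  n%:R * l <= D (a + n)%N - D a.
Proof.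
elim: n => [|n IH] h; first by rewrite addn0 subrr mul0r.
have h1 : n%:R * l <= D (a + n)%N - D a by apply: IH => i ?; apply: h; lia.
have := h (a + n)%N ltac:(lia); rewrite addnS -natr1; lra.
Qed.

(* One period of the increments: near a multiple of 2 pi there are few terms,
   elsewhere the Kusmin-Landau inequality applies. *)
Lemma vdc_one_period G (l : R) (k : int) a b : 0 < l <= 1 ->
  (forall n, (a <= n)%N -> (n.+1 < b)%N -> l <= (G n.+2 - G n.+1) - (G n.+1 - G n)) ->
  (forall n, (a <= n < b)%N ->
     2 * pi * k%:~R <= G n.+1 - G n + Num.sqrt l < 2 * pi * (k%:~R + 1)) ->
  `|\sum_(a <= n < b) cos (G n)| <= 12 / Num.sqrt l.
Proof.
move=> /andP[l0 l1] mD Dk.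
set q := Num.sqrt l; have q0 : 0 < q by rewrite sqrtr_gt0.
have q2 : q ^+ 2 = l by rewrite sqr_sqrtr // ltW.
have q1 : q <= 1 by rewrite -(ler_pXn2r (n := 2)) ?nnegrE ?(ltW q0) // q2 expr1n.
have iq : 1 <= q^-1 by rewrite invf_ge1.
have [ba|ab] := leqP b a.
  by rewrite big_geq // normr0 divr_ge0 // ltW.
pose D n := G n.+1 - G n.
have [n an nb|c [/andP[ac cb] c1 c2]] :=
   @threshold D (2 * pi * k%:~R + q) a b (ltnW ab).
  by have := mD _ an nb; rewrite /D; lra.
rewrite (@big_cat_nat _ _ _ c) //=.
have near : `|\sum_(a <= n < c) cos (G n)| <= 3 / q.
  have [ca|lac] := leqP c a.
    by rewrite big_geq // normr0 divr_ge0 // ltW.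
  apply: (le_trans (ler_norm_sum _ _ _)).
  apply: (@le_trans _ _ (\sum_(a <= n < c) 1)).
    by apply: ler_sum => n _; exact: cos_max.
  rewrite sumr_const_nat -[(c - a)%N](@prednK) ?subn_gt0 //.
  have := @sum_increments D l a (c - a).-1.
  rewrite (_ : (a + _)%N = c.-1); last by lia.
  move=> /(_ _) h.
  have {}h : (c - a).-1%:R * l <= D c.-1 - D a.
    by apply: h => i ?; apply: mD; lia.
  have := c1 c.-1 ltac:(lia).
  have /andP[+ _] := Dk a ltac:(lia); rewrite -/(D a) => ha hc.
  have h2 : (c - a).-1%:R * l <= 2 * q by rewrite -/q in ha; lra.
  have : (c - a).-1%:R <= 2 / q.
    by rewrite ler_pdivlMr // -(ler_pM2r q0) -mulrA -expr2 q2.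
  rewrite -[(c - a).-1.+1%:R]natr1; lra.
have far : `|\sum_(c <= n < b) cos (G n)| <= 1 + 8 / q.
  apply: (@kusmin_landau G q k) => // n cn.
    have := c2 _ cn; rewrite /D => ->.
    by have /andP[_] := Dk n ltac:(lia); rewrite -/q /=; lra.
  by move=> nb; have := mD n ltac:(lia) nb; lra.
by apply: (le_trans (ler_normD _ _)); lra.
Qed.

(** Induction on the number of periods met by the increments. Shifting the increments by $\sqrt l$
    puts both sides of a multiple of $2\pi$ into the same period, so that each period has only one
    short stretch where the Kusmin-Landau bound fails. *)
Lemma vdc_periods G (l : R) (N : nat) (k : int) a b : 0 < l <= 1 ->
  (forall n, (a <= n)%N -> (n.+1 < b)%N -> l <= (G n.+2 - G n.+1) - (G n.+1 - G n)) ->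
  (forall n, (a <= n < b)%N ->
     2 * pi * k%:~R <= G n.+1 - G n + Num.sqrt l < 2 * pi * (k%:~R + N%:R)) ->
  `|\sum_(a <= n < b) cos (G n)| <= N%:R * (12 / Num.sqrt l).
Proof.
move=> l01; have l0 : 0 < l by case/andP: l01.
have q0 : 0 < Num.sqrt l by rewrite sqrtr_gt0.
elim: N k a => [|N IH] k a mD Dk.
  have [ba|ab] := leqP b a; first by rewrite big_geq // normr0 mul0r.
  by have := Dk a ltac:(lia); rewrite addr0; lra.
have [ba|ab] := leqP b a.
  by rewrite big_geq // normr0 mulr_ge0 // divr_ge0 // ltW.
pose D n := G n.+1 - G n + Num.sqrt l.
have [n an nb|c [/andP[ac cb] c1 c2]] :=
   @threshold D (2 * pi * (k%:~R + 1)) a b (ltnW ab).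
  by have := mD _ an nb; rewrite /D; lra.
rewrite (@big_cat_nat _ _ _ c) //=.
have h1 : `|\sum_(a <= n < c) cos (G n)| <= 12 / Num.sqrt l.
  apply: (@vdc_one_period G l k) => // [n an nb|n anc]; first by apply: mD => //; lia.
  by rewrite [X in _ && X]c1 // andbT; have /andP[] := Dk n ltac:(lia).
have h2 : `|\sum_(c <= n < b) cos (G n)| <= N%:R * (12 / Num.sqrt l).
  apply: (IH (k + 1)) => [n cn nb|n cnb]; first by apply: mD => //; lia.
  rewrite intrD [X in X && _]c2 //=.
  by have /andP[_] := Dk n ltac:(lia); rewrite -natr1; lra.
by rewrite -natr1 mulrDl mul1r addrC; apply: (le_trans (ler_normD _ _)); lra.
Qed.

(** The second derivative test with second differences in place of derivatives. The increments
    spread over at most r, hence over at most r + 3 periods, and each period costs $12/\sqrt l$. A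
    linear term in G leaves the hypotheses unchanged. *)
Lemma van_der_corput G (l r : R) a b : 0 < l <= 1 ->
  (forall n, (a <= n)%N -> (n.+1 < b)%N -> l <= (G n.+2 - G n.+1) - (G n.+1 - G n)) ->
  (forall n, (a <= n < b)%N -> (G n.+1 - G n) - (G a.+1 - G a) <= r) -> 0 <= r ->
  `|\sum_(a <= n < b) cos (G n)| <= (r + 3) * (12 / Num.sqrt l).
Proof.
move=> l01 mD rD r0; have l0 : 0 < l by case/andP: l01.
have q0 : 0 < Num.sqrt l by rewrite sqrtr_gt0.
have p2 := pi_ge2 R.
pose k : int := Num.floor ((G a.+1 - G a + Num.sqrt l) / (2 * pi)).
pose N := (Num.truncn r + 2)%N.
have rN : r + 1 <= N%:R by rewrite /N natrD; have := truncnS_gt r; rewrite -natr1; lra.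
have Nr : N%:R <= r + 3.
  by rewrite /N natrD; have := truncn_itv r0; case/andP; lra.
apply: (@le_trans _ _ (N%:R * (12 / Num.sqrt l))); last first.
  by rewrite ler_wpM2r // divr_ge0 // ltW.
have tp : 0 < 2 * pi :> R by lra.
have k1 : 2 * pi * k%:~R <= G a.+1 - G a + Num.sqrt l.
  by rewrite mulrC -ler_pdivlMr // /k floor_le_tmp.
have k2 : G a.+1 - G a + Num.sqrt l < 2 * pi * (k%:~R + 1).
  by rewrite mulrC -ltr_pdivrMr // /k -[1]/(1%:~R) -intrD floorD1_gt.
apply: (@vdc_periods G l N k) => // n nab.
have mono : G a.+1 - G a <= G n.+1 - G n.
  have := @sum_increments (fun n => G n.+1 - G n) 0 a (n - a).
  rewrite subnKC; last by case/andP: nab.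
  rewrite mulr0 subr_ge0; apply => i /andP[ai ib].
  have ib' : (i.+1 < b)%N by move: nab ib; clear; lia.
  by have := mD i ai ib'; clear -l0 => h; lra.
have := rD _ nab => rn.
apply/andP; split; first lra.
have : 2 * pi * (k%:~R + N%:R) >= 2 * pi * (k%:~R + 1) + 2 * r by nra.
lra.
Qed.

Lemma cauchy_schwarz_sum (I : Type) (rr : seq I) (P : pred I) (f g : I -> R) :
  (\sum_(i <- rr | P i) f i * g i) ^+ 2
    <= (\sum_(i <- rr | P i) f i ^+ 2) * (\sum_(i <- rr | P i) g i ^+ 2).
Proof.
elim: rr => [|i rr IH]; first by rewrite !big_nil expr0n mul0r.
rewrite !big_cons; case: ifP => // _.
set A := \sum_(_ <- _ | _) _ in IH *; set B := \sum_(_ <- _ | _) _ in IH *.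
set C := \sum_(_ <- _ | _) _ in IH *.
have B0 : 0 <= B by apply: sumr_ge0 => j _; exact: sqr_ge0.
have C0 : 0 <= C by apply: sumr_ge0 => j _; exact: sqr_ge0.
have key : (2 * (f i * g i) * A) <= f i ^+ 2 * C + B * g i ^+ 2.
  have : (2 * (f i * g i) * A) ^+ 2 <= (f i ^+ 2 * C + B * g i ^+ 2) ^+ 2.
    have : 0 <= (f i ^+ 2 * C - B * g i ^+ 2) ^+ 2 by exact: sqr_ge0.
    have : (f i * g i) ^+ 2 * A ^+ 2 <= (f i * g i) ^+ 2 * (B * C).
      by rewrite ler_wpM2l // sqr_ge0.
    rewrite !expr2; lra.
  rewrite -ler_sqrt ?sqr_ge0 // !sqrtr_sqr => h.
  apply: le_trans (ler_norm _) (le_trans h _).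
  by rewrite ger0_norm // addr_ge0 // mulr_ge0 // sqr_ge0.
rewrite !expr2 in IH key *; lra.
Qed.

End ExponentialSums.

(** * Fourier analysis on a grid *)

Section GridFourier.
Variable R : realType.
Variable L : nat.
Hypothesis L0 : (0 < L)%N.
Implicit Types (u s d : nat -> R).

Definition grid_angle (n j : nat) : R := 2 * pi * (n%:R * j%:R) / L%:R.

Let LR0 : 0 < L%:R :> R. Proof. by rewrite ltr0n. Qed.
Let LRn0 : L%:R != 0 :> R. Proof. exact: lt0r_neq0. Qed.

(** Multiplied by $\sin(\theta/2)$ with $\theta=2\pi k/L$, the sum telescopes, and its two end
    values agree by periodicity. *)
Lemma sum_cos_grid (k : nat) (x : R) : (0 < k < L)%N ->
  \sum_(0 <= j < L) cos (grid_angle k j + x) = 0.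
Proof.
move=> /andP[k0 kL]; have p0 := pi_gt0 R.
pose th : R := 2 * pi * k%:R / L%:R.
have sth : 0 < sin (th / 2).
  have kLR : k%:R / L%:R < 1 :> R by rewrite ltr_pdivrMr // mul1r ltr_nat.
  have kLR0 : 0 < k%:R / L%:R :> R by rewrite divr_gt0 // ltr0n.
  apply: sin_gt0_pi; rewrite /th (_ : _ / 2 = pi * (k%:R / L%:R)); last by field.
  by rewrite mulr_gt0 //= gtr_pMr.
apply: (mulfI (lt0r_neq0 sth)); rewrite mulr0.
pose S j := sin (th * j%:R - th / 2 + x) / 2.
rewrite mulr_sumr (eq_big_nat _ _ (F2 := fun j => S j.+1 - S j)); last first.
  move=> j _; rewrite /S /grid_angle.
  have -> : th * j.+1%:R - th / 2 + x = (th * j%:R + x) + th / 2.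
    by rewrite -natr1; field.
  have -> : th * j%:R - th / 2 + x = (th * j%:R + x) - th / 2 by ring.
  have -> : 2 * pi * (k%:R * j%:R) / L%:R + x = th * j%:R + x.
    by rewrite /th; field.
  by rewrite sinD sinB; field.
rewrite telescope_sumr // /S mulr0 sub0r.
suff -> : sin (th * L%:R - th / 2 + x) = sin (- (th / 2) + x) by rewrite subrr.
have -> : th * L%:R - th / 2 + x = (- (th / 2) + x) + 2 * pi * k%:R.
  by rewrite /th; field.
rewrite -[RHS]opprK -[- sin _ in RHS]cosDpihalf -[LHS]opprK -[- sin _ in LHS]cosDpihalf.
congr (- _); rewrite -[RHS](@cos2pik _ _ (k : int)) -pmulrn; congr cos; ring.
Qed.

Lemma grid_angleD n m j : grid_angle (n + m) j = grid_angle n j + grid_angle m j.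
Proof. by rewrite /grid_angle natrD; field. Qed.

Lemma grid_angleB n m j : (m <= n)%N -> grid_angle (n - m) j = grid_angle n j - grid_angle m j.
Proof. by move=> mn; rewrite /grid_angle natrB //; field. Qed.

(** Both frequencies lie below L/2, so n + m stays strictly between 0 and L and its wave sums to
    zero; only the difference frequency can survive, when n = m. *)
Lemma grid_ortho (n m : nat) (x y : R) : (0 < n)%N -> (n.*2 < L)%N -> (0 < m)%N -> (m.*2 < L)%N ->
  \sum_(0 <= j < L) cos (grid_angle n j + x) * cos (grid_angle m j + y)
    = if n == m then L%:R / 2 * cos (x - y) else 0.
Proof.
move=> n0 nL m0 mL.
have E j : cos (grid_angle n j + x) * cos (grid_angle m j + y) =
  2^-1 * cos (grid_angle (n + m) j + (x + y)) +
  2^-1 * cos ((grid_angle n j - grid_angle m j) + (x - y)).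
  rewrite grid_angleD.
  have -> : grid_angle n j + grid_angle m j + (x + y) =
    (grid_angle n j + x) + (grid_angle m j + y) by ring.
  have -> : grid_angle n j - grid_angle m j + (x - y) =
    (grid_angle n j + x) - (grid_angle m j + y) by ring.
  set a := _ + x; set b := _ + y.
  by rewrite cosB cosD; field.
rewrite (eq_bigr _ (fun j _ => E j)) big_split /= -!mulr_sumr sum_cos_grid; last by lia.
rewrite mulr0 add0r; case: eqVneq => [->|nm].
  rewrite (eq_bigr (fun _ => cos (x - y))); last by move=> j _; rewrite subrr add0r.
  by rewrite sumr_const_nat subn0 -mulr_natr; ring.
have [lnm|] := ltnP m n.
  under eq_bigr do rewrite -(grid_angleB _ (ltnW lnm)).
  by rewrite sum_cos_grid ?mulr0 //; lia.
rewrite leq_eqVlt (negPf nm) /= => lnm.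
rewrite (eq_bigr (fun j => cos (grid_angle (m - n) j + (y - x)))); last first.
  by move=> j _; rewrite -cosN (grid_angleB _ (ltnW lnm)); congr cos; ring.
by rewrite sum_cos_grid ?mulr0 //; lia.
Qed.

(** The projection p of d onto the system satisfies $\langle d,p\rangle=\langle p,p\rangle$, and the
    claim is $\|d-p\|^2\ge0$. The vectors have square norm h in place of 1. *)
Lemma bessel (I : seq nat) (e : nat -> nat -> R) d (h : R) : uniq I -> 0 < h ->
  (forall n m, n \in I -> m \in I ->
     \sum_(0 <= j < L) e n j * e m j = if n == m then h else 0) ->
  \sum_(n <- I) (\sum_(0 <= j < L) d j * e n j) ^+ 2 <= h * \sum_(0 <= j < L) d j ^+ 2.
Proof.
move=> uI h0 oe.
pose c n := \sum_(0 <= j < L) d j * e n j.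
pose p j := \sum_(n <- I) h^-1 * c n * e n j.
have : 0 <= \sum_(0 <= j < L) (d j - p j) ^+ 2 by apply: sumr_ge0 => j _; exact: sqr_ge0.
have dp : \sum_(0 <= j < L) d j * p j = h^-1 * \sum_(n <- I) c n ^+ 2.
  rewrite (eq_bigr (fun j => \sum_(n <- I) d j * (h^-1 * c n * e n j))); last first.
    by move=> j _; rewrite mulr_sumr.
  rewrite exchange_big mulr_sumr; apply: eq_bigr => n _ /=.
  transitivity (h^-1 * c n * c n); last by rewrite expr2 mulrA.
  by rewrite [in RHS]mulr_sumr; apply: eq_bigr => j _; rewrite mulrCA.
have pp : \sum_(0 <= j < L) p j * p j = h^-1 * \sum_(n <- I) c n ^+ 2.
  rewrite (eq_bigr (fun j => \sum_(n <- I) h^-1 * c n * (e n j * p j))); last first.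
    by move=> j _; rewrite {1}/p mulr_suml; apply: eq_bigr => n _; rewrite mulrA.
  rewrite exchange_big mulr_sumr !big_seq; apply: eq_bigr => n nI /=.
  rewrite -mulr_sumr expr2 mulrA; congr (_ * _).
  rewrite (eq_bigr (fun j => \sum_(m <- I) h^-1 * c m * (e n j * e m j))); last first.
    by move=> j _; rewrite mulr_sumr; apply: eq_bigr => m _; ring.
  rewrite exchange_big /= (bigD1_seq n) //= -mulr_sumr oe // eqxx.
  rewrite big_seq_cond big1 ?addr0; first by field; exact: lt0r_neq0.
  by move=> m /andP[mI mn]; rewrite -mulr_sumr oe // eq_sym (negPf mn) mulr0.
rewrite (eq_bigr (fun j => d j ^+ 2 + ((- 2) * (d j * p j) + p j * p j))); last first.
  by move=> j _; ring.
rewrite !big_split /= -mulr_sumr dp pp => H.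
have : 0 <= h * (\sum_(0 <= j < L) d j ^+ 2 - h^-1 * \sum_(n <- I) c n ^+ 2).
  by rewrite mulr_ge0 ?(ltW h0) //; lra.
by rewrite mulrBr mulrA mulfV ?mul1r ?subr_ge0 ?lt0r_neq0.
Qed.

Definition periodicL u := forall j, u (j + L)%N = u j.

Lemma periodic_shift u r : periodicL u ->
  \sum_(0 <= j < L) u (j + r)%N = \sum_(0 <= j < L) u j.
Proof.
move=> pu; elim: r => [|r <-]; first by under eq_bigr do rewrite addn0.
have [l lE] : exists l, L = l.+1 by case: L L0 => // l _; exists l.
rewrite lE big_nat_recr //= [in RHS]big_nat_recl //=.
rewrite addrC; congr (_ + _); last by apply: eq_bigr => j _; rewrite addnS.
by rewrite add0n -(pu r) addnC lE addSn addnS.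
Qed.

Definition cos_coef s (n : nat) : R :=
  L%:R^-1 * \sum_(0 <= j < L) s j * cos (grid_angle n j).

Lemma grid_angleL n j : grid_angle n (j + L) = grid_angle n j + 2 * pi * (n : int)%:~R.
Proof. by rewrite /grid_angle natrD -pmulrn; field. Qed.

Lemma sum_shift_diff s (V : R) r : periodicL s ->
  \sum_(0 <= j < L) `|s j.+1 - s j| <= V ->
  \sum_(0 <= j < L) `|s (j + r)%N - s j| <= r%:R * V.
Proof.
move=> ps sV; elim: r => [|r IH].
  by rewrite mul0r; under eq_bigr do rewrite addn0 subrr normr0; rewrite sumr_const_nat mul0rn.
rewrite -natr1 mulrDl mul1r.
apply: le_trans (lerD IH sV).
rewrite -(@periodic_shift (fun j => `|s j.+1 - s j|) r); last first.
  by move=> j; rewrite -addSn !ps.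
rewrite -big_split /=; apply: ler_sum => j _.
rewrite addnS; apply: le_trans (ler_normD _ _); rewrite le_eqVlt; apply/orP; left.
by apply/eqP; congr `|_|; ring.
Qed.

(** The difference $s(j+2r)-s(j)$, paired with the sine wave shifted by r, gives $-2L\sin(2\pi
    nr/L)$ times the cosine coefficient of s. Bessel's inequality then bounds the left side by the
    square sum of the differences, which is at most $4rV$: each difference is at most 2, and their
    absolute values add up to at most $2rV$. *)
Lemma cos_coef_shift s (V : R) r : periodicL s -> (forall j, `|s j| <= 1) ->
  \sum_(0 <= j < L) `|s j.+1 - s j| <= V ->
  \sum_(1 <= n < L | (n.*2 < L)%N) sin (grid_angle n r) ^+ 2 * cos_coef s n ^+ 2
    <= r%:R * V / (2 * L%:R).
Proof.
move=> ps s1 sV.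
pose d j := s (j + r.*2)%N - s j.
pose e n j := cos (grid_angle n j + (grid_angle n r - pi / 2)).
have eE n j : e n j = sin (grid_angle n (j + r)).
  rewrite /e addrA cosBpihalf; congr sin; rewrite /grid_angle natrD; field.
  exact: LRn0.
pose I := [seq n <- index_iota 1 L | (n.*2 < L)%N].
have uI : uniq I by rewrite filter_uniq // iota_uniq.
have oe n m : n \in I -> m \in I ->
    \sum_(0 <= j < L) e n j * e m j = if n == m then L%:R / 2 else 0.
  rewrite !mem_filter !mem_index_iota => /andP[n1 /andP[n2 _]] /andP[m1 /andP[m2 _]].
  rewrite /e grid_ortho //; case: eqVneq => // ->.
  by rewrite subrr cos0 mulr1.
have h0 : 0 < L%:R / 2 :> R by rewrite divr_gt0.
have := bessel d uI h0 oe.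
have dE n : \sum_(0 <= j < L) d j * e n j =
    - 2 * L%:R * (sin (grid_angle n r) * cos_coef s n).
  rewrite /cos_coef.
  rewrite (eq_bigr (fun j => s (j + r.*2)%N * e n j - s j * e n j)); last first.
    by move=> j _; rewrite /d mulrBl.
  rewrite big_split /= sumrN.
  rewrite (_ : \sum_(0 <= i < L) s (i + r.*2)%N * e n i =
     \sum_(0 <= j < L) s j * sin (grid_angle n j - grid_angle n r)); last first.
    rewrite -(@periodic_shift (fun j => s j * sin (grid_angle n j - grid_angle n r)) r.*2).
      apply: eq_bigr => j _; rewrite eE; congr (_ * sin _).
      by rewrite /grid_angle -addnn !natrD; field; exact: LRn0.
    move=> j; rewrite ps grid_angleL; congr (_ * _).
    rewrite -[LHS]opprK -cosDpihalf -[RHS]opprK -cosDpihalf; congr (- _).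
    by rewrite -[RHS](@cos2pik _ _ (n : int)); congr cos; ring.
  rewrite -sumrN -big_split /= !mulr_sumr; apply: eq_bigr => j _ /=.
  rewrite eE (_ : grid_angle n (j + r) = grid_angle n j + grid_angle n r).
    by rewrite sinB sinD; field; exact: LRn0.
  by rewrite /grid_angle natrD; field; exact: LRn0.
rewrite (eq_bigr (fun n => 4 * L%:R ^+ 2 * (sin (grid_angle n r) ^+ 2 * cos_coef s n ^+ 2))); last first.
  by move=> n _; rewrite dE; ring.
rewrite -mulr_sumr big_filter.
set X := \sum_(_ <= _ < _ | _) _ => HX.
have dV : \sum_(0 <= j < L) d j ^+ 2 <= 4 * r%:R * V.
  apply: (@le_trans _ _ (2 * \sum_(0 <= j < L) `|s (j + r.*2)%N - s j|)).
    rewrite mulr_sumr; apply: ler_sum => j _.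
    rewrite /d -real_normK ?num_real // expr2 ler_wpM2r //.
    by apply: (le_trans (ler_normB _ _)); have := s1 j; have := s1 (j + r.*2)%N; lra.
  have := @sum_shift_diff s V r.*2 ps sV; rewrite -mul2n natrM; lra.
rewrite ler_pdivlMr ?mulr_gt0 //.
have : L%:R / 2 * \sum_(0 <= j < L) d j ^+ 2 <= L%:R / 2 * (4 * r%:R * V).
  by rewrite ler_wpM2l // ltW.
move=> H2; have {}HX := le_trans HX H2.
have l0 := LR0.
have : 4 * L%:R ^+ 2 * X = (2 * L%:R) * (X * (2 * L%:R)) by ring.
have : L%:R / 2 * (4 * r%:R * V) = (2 * L%:R) * (r%:R * V) by field.
by move=> e1 e2; move: HX; rewrite e1 e2 ler_pM2l ?mulr_gt0.
Qed.

End GridFourier.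

(** * Cosine coefficients of a sequence of small variation *)

Section Dyadic.
Variable R : realType.
Variable J : nat.
Let L := (2 ^ J)%N.
Let L0 : (0 < L)%N. Proof. by rewrite expn_gt0. Qed.
Implicit Types (u s : nat -> R).

(** The decay $V/n$ is obtained in mean square. For each n some dyadic shift $r=2^i$ has $4nr\le
    L<8nr$; its sine is then at least 1/4, and [cos_coef_shift] sees the coefficient. Each of the J
    scales contributes at most $2V$. *)
Lemma cos_coef_variation s (V : R) : periodicL L s -> (forall j, `|s j| <= 1) ->
  \sum_(0 <= j < L) `|s j.+1 - s j| <= V ->
  \sum_(1 <= n < L | (4 * n <= L)%N) n%:R * cos_coef L s n ^+ 2 <= 2 * J%:R * V.
Proof.
move=> ps s1 sV.
have LR0 : 0 < L%:R :> R by rewrite ltr0n.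
have p2 := pi_ge2 R.
have V0 : 0 <= V by apply: le_trans sV; apply: sumr_ge0.
pose X i n := sin (grid_angle R L n (2 ^ i)) ^+ 2 * cos_coef L s n ^+ 2.
have X0 i n : 0 <= X i n by rewrite mulr_ge0 ?sqr_ge0.
have c0 i : 0 <= 4 * (L%:R / (2 ^ i)%:R) :> R by rewrite mulr_ge0 ?divr_ge0.
have step n : (0 < n)%N -> (4 * n <= L)%N ->
    n%:R * cos_coef L s n ^+ 2 <= \sum_(0 <= i < J) 4 * (L%:R / (2 ^ i)%:R) * X i n.
  move=> n0 n4.
  have [i [iJ i1 i2]] : exists i, [/\ (i < J)%N, (4 * n * 2 ^ i <= L)%N & (L < 8 * n * 2 ^ i)%N].
    have ex : exists i, (4 * n * 2 ^ i <= L)%N by exists 0%N; rewrite muln1.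
    have ub i : (4 * n * 2 ^ i <= L)%N -> (i <= J)%N.
      move=> h; rewrite -(@leq_exp2l 2) //; apply: leq_trans h.
      by rewrite leq_pmull // muln_gt0.
    case: (ex_maxnP ex ub) => i i1 imax; exists i; split => //.
      rewrite ltn_neqAle ub // andbT; apply: contraTneq i1 => ->.
      rewrite -ltnNge -/L; have : (0 < L)%N by []. nia.
    rewrite ltnNge; apply/negP => h.
    have /imax : (4 * n * 2 ^ i.+1 <= L)%N by rewrite expnS; nia.
    by rewrite ltnn.
  rewrite big_mkord (bigD1 (Ordinal iJ)) //=.
  apply: ler_wpDr.
    by apply: sumr_ge0 => k _; rewrite mulr_ge0.
  have i1R : 4 * n%:R * (2 ^ i)%:R <= L%:R :> R.
    by rewrite -[4]/(4%:R) -!natrM ler_nat.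
  have i2R : L%:R <= 8 * n%:R * (2 ^ i)%:R :> R.
    by rewrite -[8]/(8%:R) -!natrM ler_nat ltnW.
  have P0 : 0 < (2 ^ i)%:R :> R by rewrite ltr0n expn_gt0.
  have s0 : 4^-1 <= sin (grid_angle R L n (2 ^ i)).
    have a1 : grid_angle R L n (2 ^ i) <= pi / 2.
      rewrite /grid_angle ler_pdivrMr //.
      rewrite (_ : pi / 2 * L%:R = (2^-1 * L%:R) * pi); last by ring.
      rewrite (_ : 2 * pi * _ = (2 * (n%:R * (2 ^ i)%:R)) * pi); last by ring.
      by rewrite ler_wpM2r //; lra.
    have a2 : pi / 4 <= grid_angle R L n (2 ^ i).
      rewrite /grid_angle ler_pdivlMr //.
      rewrite (_ : pi / 4 * L%:R = (4^-1 * L%:R) * pi); last by ring.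
      rewrite (_ : 2 * pi * _ = (2 * (n%:R * (2 ^ i)%:R)) * pi); last by ring.
      by rewrite ler_wpM2r //; lra.
    by apply: le_trans (sin_ge_half _); [lra|apply/andP; split; lra].
  have s2 : 16^-1 <= sin (grid_angle R L n (2 ^ i)) ^+ 2.
    rewrite (_ : 16^-1 = 4^-1 ^+ 2); last by rewrite expr2; field.
    by rewrite ler_pXn2r // nnegrE; lra.
  have c4 : 4 * n%:R <= L%:R / (2 ^ i)%:R :> R by rewrite ler_pdivlMr.
  rewrite /X [leRHS]mulrA ler_wpM2r ?sqr_ge0 //.
  apply: (@le_trans _ _ (4 * (4 * n%:R) * 16^-1)).
    by rewrite le_eqVlt; apply/orP; left; apply/eqP; field.
  by apply: ler_pM => //; rewrite ler_pM2l.
apply: (@le_trans _ _ (\sum_(1 <= n < L | (n.*2 < L)%N)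
   \sum_(0 <= i < J) 4 * (L%:R / (2 ^ i)%:R) * X i n)).
  rewrite big_nat_cond [leRHS]big_nat_cond.
  rewrite [leLHS]big_mkcond [leRHS]big_mkcond /=; apply: ler_sum => n _.
  have pos : 0 <= \sum_(0 <= i < J) 4 * (L%:R / (2 ^ i)%:R) * X i n.
    by apply: sumr_ge0 => i _; rewrite mulr_ge0.
  case: ifP => [/andP[/andP[n0 nL] n4]|_]; last by case: ifP.
  by rewrite n0 nL /= ifT ?step //; lia.
rewrite exchange_big /=.
apply: (@le_trans _ _ (\sum_(0 <= i < J) 2 * V)); last first.
  by rewrite sumr_const_nat subn0 -mulr_natr le_eqVlt; apply/orP; left; apply/eqP; ring.
apply: ler_sum => i _; rewrite -mulr_sumr.
have P0 : 0 < (2 ^ i)%:R :> R by rewrite ltr0n expn_gt0.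
have := @cos_coef_shift R L L0 s V (2 ^ i) ps s1 sV; rewrite -/(X i) => H.
apply: (@le_trans _ _ (4 * (L%:R / (2 ^ i)%:R) * ((2 ^ i)%:R * V / (2 * L%:R)))).
  by rewrite ler_wpM2l // mulr_ge0 // divr_ge0 // ltW.
rewrite le_eqVlt; apply/orP; left; apply/eqP; field.
by rewrite !lt0r_neq0.
Qed.

End Dyadic.

(** * Averaging creates no sign changes *)

Section VariationDiminishing.
Variable R : realType.
Variable L : nat.
Hypothesis L0 : (0 < L)%N.
Implicit Types (u s : nat -> R).

(* V bounds the total variation of the signs over a period: twice the number of changes. *)
Definition few_changes u (V : R) := exists s : nat -> R,
  [/\ periodicL L s, forall j, s j = 1 \/ s j = - 1, forall j, 0 <= s j * u j
    & \sum_(0 <= j < L) `|s j.+1 - s j| <= V].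

Definition average u j : R := (u j + u j.+1) / 2.

(** The sign given to the average of two neighbours is their common sign if they agree, and
    otherwise either sign splits the jump between them without adding to it. Regrouping the half
    jumps around the new points bounds the new variation by the old one. *)
Lemma few_changes_average u V : periodicL L u -> few_changes u V -> few_changes (average u) V.
Proof.
move=> pu [s [ps s1 su sV]].
pose v := average u.
pose s' j : R := if s j == s j.+1 then s j else if 0 <= v j then 1 else -1.
have pv : periodicL L v by move=> j; rewrite /v /average -addSn !pu.
have ps' : periodicL L s' by move=> j; rewrite /s' pv -addSn !ps.
have mid j : `|s' j - s j| + `|s j.+1 - s' j| = `|s j.+1 - s j|.
  rewrite /s'; case: eqVneq => [->|]; first by rewrite !subrr normr0 addr0.
  by case: (s1 j) => ->; case: (s1 j.+1) => ->; rewrite ?eqxx // => _;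
    case: ifP => _; rewrite ?subrr ?normr0 ?addr0 ?add0r.
exists s'; split => //.
- move=> j; rewrite /s'; case: ifP => _; first exact: s1.
  by case: ifP; [left|right].
- move=> j; rewrite /s' -/(v j); case: eqP => [e|_].
    rewrite /v /average mulrA mulrDr divr_ge0 // addr_ge0 ?su //.
    by rewrite e su.
  by case: ifP => [|/negbT]; rewrite ?mul1r // -ltNge mulN1r oppr_ge0 => /ltW.
- apply: le_trans sV.
  apply: (@le_trans _ _ (\sum_(0 <= j < L) (`|s j.+1 - s' j| + `|s' j.+1 - s j.+1|))).
    apply: ler_sum => j _; rewrite addrC.
    apply: le_trans (ler_normD _ _); rewrite le_eqVlt; apply/orP; left; apply/eqP.
    by congr `|_|; ring.
  rewrite big_split /=.
  rewrite [X in _ + X](_ : _ = \sum_(0 <= j < L) `|s' j - s j|); last first.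
    rewrite -[RHS](@periodic_shift R L L0 _ 1); last by move=> j; rewrite ps ps'.
    by apply: eq_bigr => j _; rewrite addn1.
  rewrite -big_split /= le_eqVlt; apply/orP; left; apply/eqP.
  by apply: eq_bigr => j _; rewrite addrC mid.
Qed.

Lemma few_changes_iter u V m : periodicL L u -> few_changes u V ->
  periodicL L (iter m average u) /\ few_changes (iter m average u) V.
Proof.
move=> pu fu; elim: m => [//|m [pm fm]] /=; split; last exact: few_changes_average.
by move=> j; rewrite /average -addSn !pm.
Qed.

(** Each average multiplies a wave of frequency n by $\cos(\pi n/L)$ and moves it by half a grid
    step. Repeated averaging therefore damps high frequencies, while the number of sign changes does
    not grow. *)
Lemma iter_average_cos m n (x : R) j :
  iter m average (fun j => cos (grid_angle R L n j + x)) j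
  = cos (pi * n%:R / L%:R) ^+ m * cos (grid_angle R L n j + x + m%:R * (pi * n%:R / L%:R)).
Proof.
have LR0 : L%:R != 0 :> R by rewrite pnatr_eq0 -lt0n.
elim: m j => [|m IH] j; first by rewrite /= mul0r addr0 expr0 mul1r.
rewrite iterS /average !IH -mulrDr exprSr.
set a := pi * n%:R / L%:R.
have -> : grid_angle R L n j.+1 + x + m%:R * a = (grid_angle R L n j + x + m.+1%:R * a) + a.
  by rewrite /grid_angle -!natr1 /a; field.
have -> : grid_angle R L n j + x + m%:R * a = (grid_angle R L n j + x + m.+1%:R * a) - a.
  by rewrite -natr1; ring.
set z := _ + _ * a.
by rewrite cosB cosD; field.
Qed.

End VariationDiminishing.

(** * Divisors, primes and multiplicative functions *)

Section Arithmetic.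
Local Open Scope nat_scope.

Lemma succ_expn_le (k a : nat) : 0 < k -> (a.+1) ^ k <= k ^ k * 2 ^ a.
Proof.
move=> k0.
have h : a.+1 <= k * 2 ^ (a %/ k).
  apply: (@leq_trans (k * (a %/ k).+1)); first by rewrite mulnC ltn_ceil.
  by rewrite leq_mul2l ltn_expl ?orbT.
apply: (@leq_trans ((k * 2 ^ (a %/ k)) ^ k)); first by rewrite leq_exp2r.
by rewrite expnMn leq_mul2l -expnM leq_exp2l // leq_divM orbT.
Qed.

Definition tau n := size (divisors n).

Lemma tau_prime_part p a m : prime p -> 0 < m -> tau (p ^ a * m) <= a.+1 * tau m.
Proof.
move=> pp m0.
rewrite /tau -(size_iota 0 a.+1) -(size_allpairs (fun i d => p ^ i * d)).
have p0 := prime_gt0 pp.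
apply: uniq_leq_size; first exact: divisors_uniq.
move=> d; rewrite -dvdn_divisors ?muln_gt0 ?expn_gt0 ?p0 // => dd.
have d0 : 0 < d by apply: dvdn_gt0 dd; rewrite muln_gt0 expn_gt0 p0.
have [i ia [e ed em]] : exists2 i, i <= a & exists2 e, d = p ^ i * e & e %| m.
  have g1 : gcdn d (p ^ a) %| p ^ a by rewrite dvdn_gcdr.
  have /(dvdn_pfactor _ _ pp) [i ia gi] := g1.
  exists i => //; exists (d %/ p ^ i); first by rewrite mulnC divnK // -gi dvdn_gcdl.
  have pi0 : 0 < p ^ i by rewrite expn_gt0 p0.
  have co : coprime (d %/ p ^ i) (p ^ a %/ p ^ i).
    have g0 : 0 < gcdn d (p ^ a) by rewrite gcdn_gt0 d0.
    by rewrite /coprime -gi -(eqn_pmul2r g0) muln_gcdl !divnK ?dvdn_gcdl ?dvdn_gcdr // mul1n.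
  have : d %/ p ^ i %| p ^ a %/ p ^ i * m.
    rewrite -(dvdn_pmul2r pi0) mulnAC !divnK //; first by rewrite -gi.
    by rewrite -gi dvdn_gcdl.
  by rewrite Gauss_dvdr.
by rewrite ed; apply/allpairsP; exists (i, e); split; rewrite ?mem_iota -?dvdn_divisors //=; lia.
Qed.

(** Induction along the least prime factor p of n. The part $p^a$ contributes $(a+1)^k$, which is at
    most $p^a$ once $p\ge2^k$ and at most $k^kp^a$ otherwise; the exponent $2^k-q$ leaves one factor
    $k^k$ for every possible small prime from q on. *)
Lemma tau_bound_rough k q n : 0 < k -> 0 < n ->
  (forall p, prime p -> p %| n -> q <= p) ->
  tau n ^ k <= (k ^ k) ^ (2 ^ k - q) * n.
Proof.
move=> k0; have kk : 0 < k ^ k by rewrite expn_gt0 k0.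
elim/ltn_ind: n q => n IH q n0 hq.
have [->|n1] := eqVneq n 1; first by rewrite /tau (_ : divisors 1 = [:: 1]) // exp1n muln1 expn_gt0 kk.
have n2 : 1 < n by rewrite ltn_neqAle eq_sym n1.
pose p := pdiv n; have pp : prime p by rewrite pdiv_prime.
have p1 := prime_gt1 pp.
have pq : q <= p by apply: hq => //; exact: pdiv_dvd.
have [m pm nE] := pfactor_coprime pp n0.
set a := logn p n in nE.
have m0 : 0 < m by move: n0; rewrite nE muln_gt0 => /andP[].
have a0 : 0 < a by rewrite logn_gt0 mem_primes pp n0 pdiv_dvd.
have mn : m < n by rewrite nE ltn_Pmulr // -(expn0 p) ltn_exp2l.
have hm r : prime r -> r %| m -> p.+1 <= r.
  move=> pr rm; rewrite ltn_neqAle; apply/andP; split.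
    by apply: contraTneq pm => ->; rewrite prime_coprime // rm.
  by apply: pdiv_min_dvd; [exact: prime_gt1|rewrite nE dvdn_mulr].
have {}IH := IH m mn p.+1 m0 hm.
rewrite {1}nE mulnC.
apply: (@leq_trans ((a.+1 * tau m) ^ k)).
  by rewrite leq_exp2r // tau_prime_part.
rewrite expnMn nE [m * _]mulnC mulnA.
have [hp|hp] := leqP (2 ^ k) p.
  apply: (@leq_trans ((p ^ a) * ((k ^ k) ^ (2 ^ k - p.+1) * m))).
    apply: leq_mul => //; apply: (@leq_trans ((2 ^ a) ^ k)).
      by rewrite leq_exp2r // ltn_expl.
    by rewrite -expnM mulnC expnM leq_exp2r.
  have -> : 2 ^ k - p.+1 = 0 by apply/eqP; rewrite subn_eq0 leqW.
  by rewrite expn0 mul1n leq_mul2r leq_pmull ?orbT // expn_gt0 kk.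
apply: (@leq_trans ((k ^ k * p ^ a) * ((k ^ k) ^ (2 ^ k - p.+1) * m))).
  apply: leq_mul => //; apply: leq_trans (succ_expn_le a k0) _.
  by rewrite leq_mul2l leq_exp2r ?p1 ?orbT.
rewrite mulnACA -[k ^ k * _]expnS mulnA leq_mul2r; apply/orP; right.
by rewrite leq_mul2r leq_pexp2l ?orbT // -subSn // subSS leq_sub2l.
Qed.

Lemma tau_bound k : 0 < k -> exists2 C, 0 < C & forall n, 0 < n -> tau n ^ k <= C * n.
Proof.
move=> k0; exists ((k ^ k) ^ (2 ^ k)); first by rewrite !expn_gt0 k0.
by move=> n n0; have := @tau_bound_rough k 0 n k0 n0; rewrite subn0; apply.
Qed.

Definition primes_upto N := [seq p <- iota 1 N | prime p].

(** Legendre's formula: $\lfloor2n/p^k\rfloor-2\lfloor n/p^k\rfloor$ is at most 1, and it vanishes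
    as soon as $p^k>2n$. *)
Lemma logn_central_binomial p n : prime p -> 0 < n ->
  p ^ logn p 'C(2 * n, n) <= 2 * n.
Proof.
move=> pp n0; have p1 := prime_gt1 pp.
have nn : n <= 2 * n by rewrite leq_pmull.
have b0 : 0 < 'C(2 * n, n) by rewrite bin_gt0.
have E := bin_fact nn; rewrite (_ : 2 * n - n = n) in E; last by lia.
have le : logn p 'C(2 * n, n) + (logn p n`! + logn p n`!) = logn p (2 * n)`!.
  by rewrite -E !lognM // ?muln_gt0 ?fact_gt0.
have fn : logn p n`! = \sum_(1 <= k < (2 * n).+1) n %/ p ^ k.
  rewrite logn_fact // (@big_cat_nat _ _ _ n.+1 1 (2 * n).+1) //=.
  rewrite [X in _ = _ + X]big_nat_cond [X in _ = _ + X]big1 ?addn0 // => k /andP[/andP[nk _] _].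
  by rewrite divn_small // (leq_trans nk) // ltnW // ltn_expl.
move: le; rewrite fn logn_fact // -big_split /= => le.
pose l := trunc_log p (2 * n).
suff : logn p 'C(2 * n, n) <= l.
  move=> h; apply: leq_trans (trunc_logP p1 _); last by lia.
  by rewrite leq_exp2l.
have key k : 2 * n %/ p ^ k <= (k <= l) + (n %/ p ^ k + n %/ p ^ k).
  have [kl|lk] := leqP k l; last first.
    rewrite divn_small //; apply: (leq_trans (trunc_log_ltn _ p1)).
    by rewrite leq_exp2l.
  have pk : 0 < p ^ k by rewrite expn_gt0 prime_gt0.
  rewrite -ltnS ltn_divLR //.
  have := ltn_ceil n pk; lia.
have : \sum_(1 <= k < (2 * n).+1) 2 * n %/ p ^ k <=
   \sum_(1 <= k < (2 * n).+1) (k <= l) + \sum_(1 <= k < (2 * n).+1) (n %/ p ^ k + n %/ p ^ k).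
  by rewrite -big_split /=; apply: leq_sum => k _; exact: key.
have : \sum_(1 <= k < (2 * n).+1) (k <= l) <= l.
  rewrite -[X in _ <= X](subn0 l) -[in X in _ <= X](subSS 0 l).
  have ln : l <= 2 * n.
    apply: leq_trans (trunc_logP p1 (_ : 0 < 2 * n)); last by lia.
    by apply: ltnW; rewrite ltn_expl.
  rewrite (@big_cat_nat _ _ _ l.+1 1 (2 * n).+1) //=.
  rewrite [X in _ + X <= _]big_nat_cond [X in _ + X <= _]big1 ?addn0; last first.
    by move=> k /andP[/andP[lk _] _]; rewrite leqNgt lk.
  rewrite -[X in _ <= X]muln1 -sum_nat_const_nat.
  by apply: leq_sum => k _; exact: leq_b1.
lia.
Qed.

Lemma central_binomial_ge n : 2 ^ n <= 'C(2 * n, n).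
Proof.
elim: n => [|n IH]; first by rewrite bin0.
have h := mul_bin_diag (2 * n).+2 n.
have -> : 2 * n.+1 = (2 * n).+2 by lia.
have : 'C((2 * n).+2, n.+1) = 2 * 'C((2 * n).+1, n).
  apply/eqP; rewrite -(@eqn_pmul2l n.+1) // -h; apply/eqP.
  by rewrite mulnA; congr (_ * _); lia.
move=> ->; rewrite expnS leq_mul2l /=; apply: leq_trans IH _.
exact: leq_bin2l.
Qed.

Lemma prime_dvd_fact p m : prime p -> p %| m`! -> p <= m.
Proof.
move=> pp; elim: m => [|m IH]; first by rewrite dvdn1 => /eqP p1; rewrite p1 in pp.
rewrite factS Euclid_dvdM // => /orP[/dvdn_leq -> //|/IH]; exact: leqW.
Qed.

(** Chebyshev's argument: the exact prime powers in $\binom{2n}{n}\ge2^n$ are at most $2n$, and so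
    are their primes. *)
Lemma chebyshev_lower n : 0 < n -> 2 ^ n <= (2 * n) ^ size (primes_upto (2 * n)).
Proof.
move=> n0; apply: leq_trans (central_binomial_ge n) _.
have b0 : 0 < 'C(2 * n, n) by rewrite bin_gt0; lia.
rewrite {1}(prod_prime_decomp b0) prime_decompE big_map /=.
apply: (@leq_trans (\prod_(p <- primes 'C(2 * n, n)) (2 * n))).
  rewrite big_seq [X in _ <= X]big_seq; apply: leq_prod => p.
  by rewrite mem_primes => /and3P[pp _ _]; exact: logn_central_binomial.
rewrite big_const_seq count_predT iter_muln_1 leq_pexp2l //; first by lia.
apply: uniq_leq_size; first exact: primes_uniq.
move=> p; rewrite mem_primes mem_filter mem_iota => /and3P[pp _ pd].
rewrite pp /= prime_gt0 //= add1n ltnS; apply: (@prime_dvd_fact p (2 * n)) => //.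
by rewrite -(bin_fact (_ : n <= 2 * n)) ?dvdn_mulr //; lia.
Qed.

End Arithmetic.

(** * Mean squares of multiplicative eigenvalues *)

Section IwaniecBound.
Variable R : realType.
Variable lam : nat -> R.
Hypothesis hecke_rel : forall m n, (0 < m)%N -> (0 < n)%N ->
  lam m * lam n = \sum_(d <- divisors (gcdn m n)) lam (m * n %/ d ^ 2)%N.

Definition square_sum N := \sum_(1 <= n < N.+1) lam n ^+ 2 / n%:R.

Lemma square_sum_ge0 N : 0 <= square_sum N.
Proof. by apply: sumr_ge0 => n _; rewrite divr_ge0 ?sqr_ge0. Qed.

Lemma le_square_sum M N : (M <= N)%N -> square_sum M <= square_sum N.
Proof.
move=> MN; rewrite /square_sum (@big_cat_nat _ _ _ M.+1 1 N.+1) //= lerDl.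
by apply: sumr_ge0 => n _; rewrite divr_ge0 ?sqr_ge0.
Qed.

Lemma sum_multiples_le (N d : nat) (G : nat -> R) : (0 < d)%N -> (forall n, 0 <= G n) ->
  \sum_(1 <= n < N.+1 | (d %| n)%N) G (n %/ d)%N <= \sum_(1 <= n < N.+1) G n.
Proof.
move=> d0 G0.
apply: (@le_trans _ _ (\sum_(1 <= n < N.+1 | (d %| n)%N) \sum_(1 <= m < N.+1) (if n == (m * d)%N then G m else 0))).
  rewrite big_nat_cond [leRHS]big_nat_cond; apply: ler_sum => n /andP[/andP[n0 nN] dn].
  have h1 : (1 <= n %/ d)%N by rewrite divn_gt0 // dvdn_leq.
  have h2 : (n %/ d < N.+1)%N by rewrite ltnS (leq_trans (leq_div _ _)).
  rewrite (bigD1_seq (n %/ d)%N) ?iota_uniq ?mem_index_iota ?h1 //=.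
  by rewrite divnK // eqxx lerDl; apply: sumr_ge0 => m _; case: ifP.
rewrite exchange_big /=; apply: ler_sum => m _.
apply: (@le_trans _ _ (\sum_(n <- index_iota 1 N.+1 | n == (m * d)%N) G m)).
  rewrite big_mkcond [leRHS]big_mkcond /=; apply: ler_sum => n _.
  by case: ifP => _; case: ifP.
rewrite -big_filter big_const_seq count_predT iter_addr_0.
have : (size [seq n <- index_iota 1 N.+1 | n == (m * d)%N] <= 1)%N.
  apply: (@uniq_leq_size _ _ [:: (m * d)%N]); first by rewrite filter_uniq // iota_uniq.
  by move=> n; rewrite mem_filter inE => /andP[].
by case: (size _) => [|[|]] //= _; rewrite ?mulr0n ?G0.
Qed.

Lemma sum_products_le (N : nat) (H : nat -> R) : (forall n, 0 <= H n) ->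
  \sum_(1 <= n < N.+1) \sum_(1 <= m < N.+1) H (n * m)%N
    <= \sum_(1 <= l < (N ^ 2).+1) (tau l)%:R * H l.
Proof.
move=> H0.
apply: (@le_trans _ _ (\sum_(1 <= n < N.+1) \sum_(1 <= l < (N ^ 2).+1 | (n %| l)%N) H l)).
  rewrite big_nat_cond [leRHS]big_nat_cond; apply: ler_sum => n /andP[/andP[n0 nN] _].
  apply: (@le_trans _ _ (\sum_(1 <= m < N.+1) \sum_(1 <= l < (N ^ 2).+1 | (n %| l)%N)
     (if l == (n * m)%N then H l else 0))).
    rewrite big_nat_cond [leRHS]big_nat_cond; apply: ler_sum => m /andP[/andP[m0 mN] _].
    rewrite big_mkcond (bigD1_seq (n * m)%N) ?iota_uniq //=; last first.
      by rewrite mem_index_iota muln_gt0 n0 m0 ltnS -mulnn leq_mul.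
    rewrite dvdn_mulr // eqxx lerDl.
    by apply: sumr_ge0 => l _; case: ifP => //; case: ifP.
  rewrite exchange_big /=; apply: ler_sum => l nl.
  apply: (@le_trans _ _ (\sum_(m <- index_iota 1 N.+1 | m == (l %/ n)%N) H l)).
    rewrite [leRHS]big_mkcond /=; apply: ler_sum => m _.
    case: ifP => [/eqP -> |_]; last by case: ifP.
    by rewrite mulKn // eqxx.
  rewrite -big_filter big_const_seq count_predT iter_addr_0.
  have : (size [seq m <- index_iota 1 N.+1 | m == (l %/ n)%N] <= 1)%N.
    apply: (@uniq_leq_size _ _ [:: (l %/ n)%N]); first by rewrite filter_uniq // iota_uniq.
    by move=> m; rewrite mem_filter inE => /andP[].
  by case: (size _) => [|[|]] //= _; rewrite ?mulr0n ?H0.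
rewrite (exchange_big_dep predT) //= big_nat_cond [leRHS]big_nat_cond.
apply: ler_sum => l /andP[/andP[l0 _] _].
rewrite -big_filter big_const_seq count_predT iter_addr_0 -[H l *+ _]mulr_natl.
rewrite ler_wpM2r // ler_nat; apply: uniq_leq_size.
  by rewrite filter_uniq // iota_uniq.
by move=> n; rewrite mem_filter -dvdn_divisors // => /andP[].
Qed.

(** By the Hecke relation and Cauchy-Schwarz, $\lambda(n)^2\lambda(m)^2\le
    T\sum_{d\mid(n,m)}\lambda(nm/d^2)^2$. Dividing n and m by d brings out the weight $d^{-2}$,
    whose sum is at most 2, and every $l\le N^2$ is a product of the two quotients at most
    $\tau(l)\le T$ times. *)
Lemma square_sum_sqr (N T : nat) :
  (forall l, (0 < l <= N ^ 2)%N -> (tau l <= T)%N) -> 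
  square_sum N ^+ 2 <= 2 * T%:R ^+ 2 * square_sum (N ^ 2).
Proof.
move=> tT.
have [->|N0] := posnP N.
  by rewrite /square_sum big_geq // expr0n mulr_ge0 ?square_sum_ge0 // mulr_ge0 // sqr_ge0.
pose H l : R := lam l ^+ 2 / l%:R.
have H0 l : 0 <= H l by rewrite divr_ge0 ?sqr_ge0.
have NN : (N <= N ^ 2)%N by rewrite -mulnn leq_pmull.
have step n m : (0 < n <= N)%N -> (0 < m <= N)%N ->
    H n * H m <= \sum_(1 <= d < N.+1 | ((d %| n) && (d %| m))%N)
      T%:R * (d%:R ^+ 2)^-1 * H ((n %/ d) * (m %/ d))%N.
  move=> /andP[n0 nN] /andP[m0 mN].
  have g0 : (0 < gcdn n m)%N by rewrite gcdn_gt0 n0.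
  have gN : (gcdn n m <= N)%N by rewrite (leq_trans _ nN) // dvdn_leq // dvdn_gcdl.
  have -> : H n * H m = (lam n * lam m) ^+ 2 / (n%:R * m%:R).
    by rewrite /H exprMn invfM; ring.
  rewrite hecke_rel //.
  have cs : (\sum_(d <- divisors (gcdn n m)) lam (n * m %/ d ^ 2)%N) ^+ 2
     <= T%:R * \sum_(d <- divisors (gcdn n m)) lam (n * m %/ d ^ 2)%N ^+ 2.
    have := @cauchy_schwarz_sum R _ (divisors (gcdn n m)) predT (fun => 1) (fun d => lam (n * m %/ d ^ 2)%N).
    under eq_bigr do rewrite mul1r.
    move=> /le_trans; apply; rewrite ler_wpM2r //.
      by apply: sumr_ge0 => d _; exact: sqr_ge0.
    rewrite (eq_bigr (fun => 1)); last by move=> *; rewrite expr1n.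
    by rewrite big_const_seq count_predT iter_addr_0 ler_nat tT // g0 (leq_trans gN).
  apply: (@le_trans _ _ (T%:R * (\sum_(d <- divisors (gcdn n m)) lam (n * m %/ d ^ 2)%N ^+ 2) / (n%:R * m%:R))).
    by rewrite ler_wpM2r // invr_ge0 mulr_ge0.
  rewrite mulr_sumr mulr_suml.
  rewrite [leRHS](_ : _ = \sum_(d <- divisors (gcdn n m))
      T%:R * (d%:R ^+ 2)^-1 * H ((n %/ d) * (m %/ d))%N); last first.
    rewrite -big_filter; apply: perm_big.
    apply: uniq_perm; [by rewrite filter_uniq // iota_uniq|exact: divisors_uniq|].
    move=> d; rewrite mem_filter mem_index_iota -dvdn_divisors // -dvdn_gcd.
    case dg : (d %| gcdn n m)%N => //=.
    have d0 := dvdn_gt0 g0 dg; rewrite d0 ltnS (leq_trans _ gN) //.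
    exact: dvdn_leq.
  rewrite big_seq [leRHS]big_seq; apply: ler_sum => d.
  rewrite -dvdn_divisors // dvdn_gcd => /andP[dn dm].
  have d0 : (0 < d)%N by apply: dvdn_gt0 dn.
  have [n' n'E] : exists n', n = (n' * d)%N by exists (n %/ d)%N; rewrite divnK.
  have [m' m'E] : exists m', m = (m' * d)%N by exists (m %/ d)%N; rewrite divnK.
  rewrite n'E m'E !mulnK // mulnACA mulnn mulnK ?expn_gt0 ?d0 // /H.
  rewrite le_eqVlt; apply/orP; left; apply/eqP; rewrite !natrM.
  have n'0 : n'%:R != 0 :> R by rewrite pnatr_eq0; move: n0; rewrite n'E; case: n' {n'E}.
  have m'0 : m'%:R != 0 :> R by rewrite pnatr_eq0; move: m0; rewrite m'E; case: m' {m'E}.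
  have dR : d%:R != 0 :> R by rewrite pnatr_eq0 -lt0n.
  by field; rewrite dR n'0 m'0.
rewrite expr2 /square_sum mulr_suml.
apply: (@le_trans _ _ (\sum_(1 <= n < N.+1) \sum_(1 <= m < N.+1)
   \sum_(1 <= d < N.+1 | ((d %| n) && (d %| m))%N)
      T%:R * (d%:R ^+ 2)^-1 * H ((n %/ d) * (m %/ d))%N)).
  rewrite big_nat_cond [leRHS]big_nat_cond; apply: ler_sum => n /andP[n0 _].
  rewrite mulr_sumr big_nat_cond [leRHS]big_nat_cond; apply: ler_sum => m /andP[m0 _].
  exact: step.
rewrite (eq_bigr (fun n => \sum_(1 <= d < N.+1 | (d %| n)%N) \sum_(1 <= m < N.+1 | (d %| m)%N)
      T%:R * (d%:R ^+ 2)^-1 * H ((n %/ d) * (m %/ d))%N)); last first.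
  move=> n _; rewrite (exchange_big_dep (fun d => (d %| n)%N)) /=; last by move=> m d _ /andP[].
  apply: eq_bigr => d dn; apply: eq_bigl => m; by rewrite dn.
rewrite (exchange_big_dep predT) //=.
have Tsum : \sum_(1 <= l < (N ^ 2).+1) (tau l)%:R * H l <= T%:R * square_sum (N ^ 2).
  rewrite /square_sum mulr_sumr big_nat_cond [leRHS]big_nat_cond.
  apply: ler_sum => l /andP[/andP[l0 lN] _].
  by rewrite ler_wpM2r // ler_nat tT // l0.
apply: (@le_trans _ _ (\sum_(1 <= d < N.+1) T%:R * (d%:R ^+ 2)^-1 * (T%:R * square_sum (N ^ 2)))).
  rewrite big_nat_cond [leRHS]big_nat_cond; apply: ler_sum => d /andP[/andP[d0 dN] _].
  rewrite (eq_bigr (fun n => T%:R * (d%:R ^+ 2)^-1 * \sum_(1 <= m < N.+1 | (d %| m)%N) H ((n %/ d) * (m %/ d))%N)); last first.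
    by move=> n _; rewrite mulr_sumr.
  rewrite -mulr_sumr ler_wpM2l ?mulr_ge0 ?invr_ge0 ?sqr_ge0 //.
  apply: le_trans Tsum; apply: le_trans (sum_products_le N H0).
  apply: (@le_trans _ _ (\sum_(1 <= n < N.+1 | (d %| n)%N) \sum_(1 <= m < N.+1) H ((n %/ d) * m)%N)).
    apply: ler_sum => n _.
    by apply: (@sum_multiples_le N d (fun k => H (n %/ d * k)%N)).
  apply: (@sum_multiples_le N d (fun k => \sum_(1 <= m < N.+1) H (k * m)%N)) => // k.
  by apply: sumr_ge0.
rewrite -mulr_suml -mulr_sumr.
have zeta2 : \sum_(1 <= d < N.+1) (d%:R ^+ 2)^-1 <= 2 :> R.
  suff : forall M, \sum_(1 <= d < M.+2) (d%:R ^+ 2)^-1 <= 2 - M.+1%:R^-1 :> R.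
    move=> h; case: N N0 {tT NN step Tsum} => // M _.
    by apply: (le_trans (h M)); rewrite lerBlDr lerDl invr_ge0.
  elim=> [|M IH]; first by rewrite big_nat1 expr1n !invr1; lra.
  rewrite big_nat_recr //=; apply: (le_trans (lerD IH (lexx _))).
  have a0 : 0 < M.+1%:R :> R by [].
  have b0 : 0 < M.+2%:R :> R by [].
  have ab : M.+2%:R = M.+1%:R + 1 :> R by rewrite -natr1.
  rewrite -subr_ge0 (_ : _ - _ = (M.+1%:R * M.+2%:R ^+ 2)^-1 :> R).
    by rewrite invr_ge0 mulr_ge0 ?sqr_ge0.
  by rewrite ab; field; apply/andP; split; apply: lt0r_neq0; lra.
rewrite -/(square_sum (N ^ 2)) (_ : 2 * T%:R ^+ 2 * _ = (T%:R * 2) * (T%:R * square_sum (N ^ 2))); last by ring.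
rewrite ler_wpM2r ?mulr_ge0 ?square_sum_ge0 //.
by rewrite ler_wpM2l.
Qed.

(** Iwaniec's device: a polynomial bound at the very long range $N^{2^k}$ becomes, after the
    $2^k$-th root, a bound $t^\varepsilon$ at N, with a loss of only $2T^2$. *)
Lemma square_sum_iter (k N T : nat) : (0 < T)%N ->
  (forall l, (0 < l <= N ^ (2 ^ k))%N -> (tau l <= T)%N) ->
  square_sum N ^+ (2 ^ k) <= (2 * T%:R ^+ 2) ^+ (2 ^ k) * square_sum (N ^ (2 ^ k)).
Proof.
move=> T0; have TR : 1 <= T%:R :> R by rewrite ler1n.
have c1 : 1 <= 2 * T%:R ^+ 2 :> R.
  by apply: (@le_trans _ _ (2 * 1)); [lra|rewrite ler_pM2l // exprn_ege1].
elim: k N => [|k IH] N tT.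
  by rewrite expr1 expn0 expn1 expr1 ler_peMl ?square_sum_ge0.
have [->|N0] := posnP N.
  have e : square_sum 0 = 0 by rewrite /square_sum big_geq.
  rewrite e expr0n expn_eq0 /= mulr_ge0 ?square_sum_ge0 ?exprn_ge0 //; lra.
have h2 : square_sum N ^+ 2 <= 2 * T%:R ^+ 2 * square_sum (N ^ 2).
  apply: square_sum_sqr => l /andP[l0 lN]; apply: tT; rewrite l0 /=.
  apply: (leq_trans lN); rewrite leq_pexp2l // expnS leq_pmulr ?expn_gt0 //.
have {}IH : square_sum (N ^ 2) ^+ (2 ^ k) <= (2 * T%:R ^+ 2) ^+ (2 ^ k) * square_sum ((N ^ 2) ^ (2 ^ k)).
  by apply: IH => l; rewrite -expnM -expnS; exact: tT.
rewrite -expnM -expnS in IH.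
rewrite {1}expnS exprM.
apply: (@le_trans _ _ ((2 * T%:R ^+ 2 * square_sum (N ^ 2)) ^+ (2 ^ k))).
  by rewrite lerXn2r ?nnegrE ?sqr_ge0 // mulr_ge0 ?square_sum_ge0 //; lra.
rewrite exprMn.
apply: (@le_trans _ _ ((2 * T%:R ^+ 2) ^+ (2 ^ k) * ((2 * T%:R ^+ 2) ^+ (2 ^ k) * square_sum (N ^ 2 ^ k.+1)))).
  by rewrite ler_wpM2l // exprn_ge0 //; lra.
by rewrite mulrA -exprD addnn -mul2n -expnS.
Qed.

End IwaniecBound.

(** * Fourier series *)

Section UnitInterval.
Variable R : realType.
Notation mu := (@lebesgue_measure R).
Implicit Types (f g h : R -> R).

Definition int01 g : R := (\int[mu]_(x in `[0%R, 1%R]) g x)%R.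

Lemma cont_integrable g a b : continuous g -> mu.-integrable `[a, b] (EFin \o g).
Proof.
move=> cg; apply: continuous_compact_integrable; first exact: segment_compact.
exact: continuous_subspaceT.
Qed.

Lemma int01D f g : continuous f -> continuous g ->
  int01 (fun x => f x + g x) = int01 f + int01 g.
Proof. by move=> cf cg; apply: RintegralD => //; exact: cont_integrable. Qed.

Lemma int01Z r g : continuous g -> int01 (fun x => r * g x) = r * int01 g.
Proof. by move=> cg; apply: RintegralZl => //; exact: cont_integrable. Qed.

Lemma le_int01 f g : continuous f -> continuous g ->
  (forall x, 0 <= x <= 1 -> f x <= g x) -> int01 f <= int01 g.
Proof.
move=> cf cg fg; by apply: le_Rintegral => //; try exact: cont_integrable; move=> x /=; rewrite in_itv /=; exact: fg.

Qed.

Lemma int01_cst r : int01 (fun=> r) = r.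
Proof.
rewrite /int01 Rintegral_cst //= lebesgue_measure_itv /= lte_fin ltr01.
by rewrite oppr0 adde0 /= mulr1.
Qed.

Lemma int01_bound g B : continuous g -> (forall x, 0 <= x <= 1 -> `|g x| <= B) ->
  `|int01 g| <= B.
Proof.
move=> cg gB.
have cN : continuous (fun x => `|g x|).
  by move=> x; apply: (@cvg_norm _ _ _ _ _ _ _ (cg x)).
apply: (@le_trans _ _ (int01 (fun x => `|g x|))).
  by apply: le_normr_Rintegral => //; exact: cont_integrable.
by rewrite -[leRHS]int01_cst; apply: le_int01 => // x; exact: cvg_cst.
Qed.

Lemma is_derive_continuous g g' : (forall x : R, is_derive x 1 g (g' x)) -> continuous g.
Proof.
by move=> dg x; apply: differentiable_continuous; apply/derivable1_diffP; case: (dg x).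
Qed.

Lemma is_derive_LR g g' a b : (forall x : R, is_derive x 1 g (g' x)) ->
  derivable_oo_LRcontinuous g a b.
Proof.
move=> dg; have cg := is_derive_continuous dg; split.
- by move=> x _; case: (dg x).
- by apply: cvg_within_filter; exact: cg.
- by apply: cvg_within_filter; exact: cg.
Qed.

Lemma int01_by_parts f f' g g' :
  (forall x : R, is_derive x 1 f (f' x)) -> (forall x : R, is_derive x 1 g (g' x)) ->
  continuous f' -> continuous g' ->
  int01 (fun x => f x * g' x) = (f 1 * g 1 - f 0 * g 0) - int01 (fun x => f' x * g x).
Proof.
move=> df dg cf' cg'; rewrite /int01 (@Rintegration_by_parts _ f g f' g') //.
- exact: continuous_subspaceT.
- exact: is_derive_LR df.
- by move=> x _; rewrite derive1E; apply: derive_val; case: (df x).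
- exact: continuous_subspaceT.
- exact: is_derive_LR dg.
- by move=> x _; rewrite derive1E; apply: derive_val; case: (dg x).
Qed.

Lemma riemann_sum g B L : (0 < L)%N -> continuous g ->
  (forall x y, 0 <= x <= 1 -> 0 <= y <= 1 -> `|g x - g y| <= B * `|x - y|) ->
  `|int01 g - L%:R^-1 * \sum_(0 <= j < L) g (j%:R / L%:R)| <= B / L%:R.
Proof.
move=> L0 cg gB.
have LR : 0 < L%:R :> R by rewrite ltr0n.
have B0 : 0 <= B.
  have := gB 0 1 (_ : _) (_ : _); rewrite !lexx !ler01 sub0r normrN normr1 mulr1.
  by move=> /(_ isT isT); exact: le_trans.
pose G m := (\int[mu]_(x in `[0%R, m%:R / L%:R]) g x)%R.
have step m : (m < L)%N -> `|G m.+1 - G m - L%:R^-1 * g (m%:R / L%:R)| <= B / L%:R ^+ 2.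
  move=> mL.
  have a0 : 0 <= m%:R / L%:R :> R by rewrite divr_ge0.
  have ab : m%:R / L%:R <= m.+1%:R / L%:R :> R by rewrite ler_pM2r ?invr_gt0 // ler_nat.
  have b1 : m.+1%:R / L%:R <= 1 :> R by rewrite ler_pdivrMr // mul1r ler_nat.
  rewrite /G Rintegral_itvB ?bnd_simp //; last exact: cont_integrable.
  set a := m%:R / L%:R in a0 ab *; set b := m.+1%:R / L%:R in ab b1 *.
  have bma : b - a = L%:R^-1 by rewrite /b /a -mulrBl -natr1 addrAC subrr add0r mul1r.
  have ig h : continuous h -> mu.-integrable `]a, b] (EFin \o h).
    move=> ch; apply: (integrableS _ _ _ (cont_integrable a b ch)) => //.
    by apply: subset_itv; rewrite bnd_simp.
  have muab : fine (mu `]a, b]) = L%:R^-1.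
    rewrite lebesgue_measure_itv /= lte_fin ifT /= ?bma //.
    by rewrite -subr_gt0 bma invr_gt0.
  have -> : L%:R^-1 * g a = (\int[mu]_(x in `]a, b]) (fun=> g a) x)%R.
    by rewrite Rintegral_cst // muab mulrC.
  have cgc : continuous (fun _ : R => g a) by move=> x; exact: cvg_cst.
  rewrite -RintegralB //; [|exact: ig|exact: ig].
  have cgg : continuous (fun x => g x - g a).
    by move=> x; apply: cvgB; [exact: cg|exact: cvg_cst].
  have cN : continuous (fun x => `|g x - g a|).
    by move=> x; apply: (@cvg_norm _ _ _ _ _ _ _ (cgg x)).
  apply: (le_trans (le_normr_Rintegral _ _)) => //; first exact: ig.
  apply: (@le_trans _ _ (\int[mu]_(x in `]a, b]) (fun=> B / L%:R) x)%R).
    apply: le_Rintegral => //; [exact: ig| by apply: ig => x; exact: cvg_cst|].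
    move=> x /=; rewrite in_itv /= => /andP[ax xb].
    apply: (le_trans (gB _ _ _ _)); [by apply/andP; split; lra|by apply/andP; split; lra|].
    by rewrite ler_wpM2l // -bma ger0_norm; lra.
  by rewrite Rintegral_cst // muab expr2 invfM mulrA.
have tot m : (m <= L)%N ->
    `|G m - L%:R^-1 * \sum_(0 <= j < m) g (j%:R / L%:R)| <= m%:R * (B / L%:R ^+ 2).
  elim: m => [|m IH] mL.
    rewrite big_geq // mulr0 subr0 mul0r /G mul0r.
    by rewrite set_itv1 Rintegral_set1 normr0.
  have h1 := IH (ltnW mL); have h2 := step m mL.
  rewrite big_nat_recr //= -natr1 mulrDl mul1r.
  apply: le_trans (lerD h1 h2); apply: le_trans (ler_normD _ _).
  rewrite le_eqVlt; apply/orP; left; apply/eqP; congr `|_|; ring.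
have := tot L (leqnn L); rewrite /G divff ?lt0r_neq0 // => h.
apply: (le_trans h); rewrite le_eqVlt; apply/orP; left; apply/eqP; field.
exact: lt0r_neq0.
Qed.

End UnitInterval.

(** * Fourier inversion through finite transforms *)

Section FourierInversion.
Variable R : realType.
Variables h h1 h2 : R -> R.
Hypothesis hper : forall x, h (x + 1) = h x.
Hypothesis heven : forall x, h (- x) = h x.
Hypothesis dh : forall x : R, is_derive x 1 h (h1 x).
Hypothesis dh1 : forall x : R, is_derive x 1 h1 (h2 x).
Hypothesis ch2 : continuous h2.

Definition fcoef (n : nat) : R := int01 (fun x => h x * cos (2 * pi * n%:R * x)).

Let ch : continuous h. Proof. exact: is_derive_continuous dh. Qed.
Let ch1 : continuous h1. Proof. exact: is_derive_continuous dh1. Qed.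

Lemma bounded_segment (g : R -> R) a b : continuous g ->
  exists2 B, 0 <= B & forall x, a <= x <= b -> `|g x| <= B.
Proof.
move=> cg.
have := @continuous_compact _ _ g `[a, b] (continuous_subspaceT cg) (@segment_compact _ a b).
move=> /compact_bounded[M [Mr HM]].
exists (`|M| + 1) => [|x xab]; first by rewrite addr_ge0.
apply: (HM (`|M| + 1)); first by rewrite ltr_pwDr // ler_norm.
by exists x => //=; rewrite in_itv.
Qed.

Lemma lipschitz_of_bound (g g' : R -> R) B a b : (forall x : R, is_derive x 1 g (g' x)) ->
  (forall x, a <= x <= b -> `|g' x| <= B) ->
  forall x y, a <= x <= b -> a <= y <= b -> `|g x - g y| <= B * `|x - y|.
Proof.
move=> dg gB.
have key x y : a <= x <= b -> a <= y <= b -> x < y -> `|g x - g y| <= B * `|x - y|.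
  move=> /andP[ax xb] /andP[ay yb] xy.
  have [|c] := @MVT R g g' x y xy (fun z _ => dg z).
    by apply: continuous_subspaceT; exact: is_derive_continuous dg.
  rewrite in_itv /= => /andP[xc cy] e.
  rewrite distrC e normrM [`|y - x|]distrC ler_wpM2r // gB //.
  by apply/andP; split; lra.
move=> x y xab yab; have [xy|yx|->] := ltgtP x y; first exact: key.
  by rewrite distrC [`|x - y|]distrC; exact: key.
by rewrite !subrr normr0 mulr0.
Qed.

Lemma is_derive_cosax (a x : R) : is_derive x 1 (fun z => cos (a * z)) (- (a * sin (a * x))).
Proof.
have da : is_derive x (1 : R) ( *%R a) a.
  by apply: (is_derive_eq (is_deriveZ a (is_derive_id x 1))); rewrite /GRing.scale /= mulr1.
have dc := is_derive_cos (a * x).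
have := @is_derive1_comp R cos ( *%R a) x _ _ dc da.
by rewrite mulNr mulrC.
Qed.

Lemma cont_cosax (a : R) : continuous (fun z => cos (a * z)).
Proof. exact: is_derive_continuous (is_derive_cosax a). Qed.

Lemma cont_coef_integrand n : continuous (fun x => h x * cos (2 * pi * n%:R * x)).
Proof. by move=> x; apply: cvgM; [exact: ch|exact: cont_cosax]. Qed.

Lemma hperN x n : h (x + n%:R) = h x.
Proof. by elim: n => [|n IH]; rewrite ?addr0 // -natr1 addrA hper. Qed.

Definition dft L n : R := L%:R^-1 * \sum_(0 <= j < L) h (j%:R / L%:R) * cos (grid_angle R L n j).

Lemma dft_cvg : exists2 B, 0 <= B & forall n L, (0 < L)%N ->
  `|fcoef n - dft L n| <= (B * n.+1%:R) / L%:R.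
Proof.
have [B0 B00 hB0] := bounded_segment 0 1 ch.
have [B1 B10 hB1] := bounded_segment 0 1 ch1.
have p0 := pi_gt0 R.
exists (B1 + B0 * (2 * pi)); first by rewrite addr_ge0 // mulr_ge0 // mulr_ge0 // ltW.
move=> n L L0.
have LR : 0 < L%:R :> R by rewrite ltr0n.
have lipc (x y : R) : 0 <= x <= 1 -> 0 <= y <= 1 ->
    `|cos (2 * pi * n%:R * x) - cos (2 * pi * n%:R * y)| <= 2 * pi * n%:R * `|x - y|.
  apply: (lipschitz_of_bound (is_derive_cosax (2 * pi * n%:R))) => z _.
  have q0 : 0 <= 2 * pi * n%:R :> R by rewrite !mulr_ge0 // ltW.
  by rewrite normrN normrM (ger0_norm q0) ler_piMr ?sin_max.
have liph := lipschitz_of_bound dh hB1.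
have -> : dft L n = L%:R^-1 * \sum_(0 <= j < L) (fun x => h x * cos (2 * pi * n%:R * x)) (j%:R / L%:R).
  congr (_ * _); apply: eq_bigr => j _; congr (_ * cos _).
  by rewrite /grid_angle; field; exact: lt0r_neq0.
apply: riemann_sum => //; first exact: cont_coef_integrand.
move=> x y x01 y01.
set cx := cos _; set cy := cos _.
rewrite (_ : _ - _ = (h x - h y) * cx + h y * (cx - cy)); last by ring.
apply: (le_trans (ler_normD _ _)); rewrite !normrM.
have a1 : `|h x - h y| * `|cx| <= B1 * `|x - y|.
  by apply: (le_trans _ (liph _ _ x01 y01)); rewrite ler_piMr // cos_max.
have a2 : `|h y| * `|cx - cy| <= B0 * (2 * pi * n%:R * `|x - y|).
  by apply: ler_pM => //; [exact: hB0|exact: lipc].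
apply: (le_trans (lerD a1 a2)).
have d0 : 0 <= `|x - y| by [].
have n0 : 0 <= n%:R :> R by [].
rewrite -natr1; have : 0 <= B1 * n%:R * `|x - y| by rewrite !mulr_ge0.
have : 0 <= B0 * (2 * pi) * `|x - y| by rewrite !mulr_ge0 // ltW.
lra.
Qed.

(* Two summations by parts on the grid. *)
Lemma dft_decay : exists2 B, 0 <= B & forall n L, (0 < n)%N -> (n.*2 <= L)%N ->
  `|dft L n| <= B / n%:R ^+ 2.
Proof.
have [B2 B20 hB2] := bounded_segment (-1) 2 ch2.
have lip1 := lipschitz_of_bound dh1 hB2.
exists B2 => // n L n0 nL.
have L0 : (0 < L)%N by lia.
have LR : 0 < L%:R :> R by rewrite ltr0n.
have nR : 0 < n%:R :> R by rewrite ltr0n.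
have p2 := pi_ge2 R.
pose e : R := L%:R^-1; have e0 : 0 < e by rewrite invr_gt0.
have e1 : e <= 1 by rewrite invf_le1 // ler1n.
have sd x : 0 <= x <= 1 -> `|h (x + e) - h x *+ 2 + h (x - e)| <= 2 * B2 * e ^+ 2.
  move=> /andP[x0 x1].
  have [||c1] := @MVT R h h1 x (x + e) (_ : x < x + e) (fun z _ => dh z).
  - by rewrite ltrDl.
  - exact: continuous_subspaceT.
  rewrite in_itv /= => /andP[? ?] E1.
  have [||c2] := @MVT R h h1 (x - e) x (_ : x - e < x) (fun z _ => dh z).
  - by rewrite ltrBlDr ltrDl.
  - exact: continuous_subspaceT.
  rewrite in_itv /= => /andP[? ?] E2.
  have -> : h (x + e) - h x *+ 2 + h (x - e) = (h1 c1 - h1 c2) * e.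
    have -> : h (x + e) - h x *+ 2 + h (x - e) = (h (x + e) - h x) - (h x - h (x - e)).
      by rewrite -mulr_natr; ring.
    by rewrite E1 E2; ring.
  rewrite normrM (gtr0_norm e0) expr2 mulrA ler_wpM2r ?(ltW e0) //.
  apply: (le_trans (lip1 _ _ _ _)); try by apply/andP; split; lra.
  rewrite -mulrA mulrCA ler_wpM2l // ler_norml; apply/andP; split; lra.
pose u j := h (j%:R / L%:R).
have pu j : u (j + L)%N = u j by rewrite /u natrD mulrDl divff ?lt0r_neq0 // hper.
pose c (j : nat) := cos (grid_angle R L n j).
have cD j : c j.+2 + c j = 2 * cos (2 * pi * n%:R / L%:R) * c j.+1.
  rewrite /c; set a := 2 * pi * n%:R / L%:R.
  have -> : grid_angle R L n j.+2 = grid_angle R L n j.+1 + a.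
    by rewrite /grid_angle /a -!natr1; field; exact: lt0r_neq0.
  have -> : grid_angle R L n j = grid_angle R L n j.+1 - a.
    by rewrite /grid_angle /a -!natr1; field; exact: lt0r_neq0.
  by rewrite cosB cosD; ring.
have pc j : c (j + L)%N = c j by rewrite /c grid_angleL // cos2pik.
have key : (2 - 2 * cos (2 * pi * n%:R / L%:R)) * dft L n
    = - (L%:R^-1 * \sum_(0 <= j < L) (u j.+2 - u j.+1 *+ 2 + u j) * c j.+1).
  have shift1 : \sum_(0 <= j < L) u j * c j = \sum_(0 <= j < L) u j.+1 * c j.+1.
    rewrite -(@periodic_shift R L L0 (fun j => u j * c j) 1); last by move=> j; rewrite pu pc.
    by apply: eq_bigr => j _; rewrite addn1.
  have shift2 : \sum_(0 <= j < L) u j.+2 * c j.+1 = \sum_(0 <= j < L) u j.+1 * c j.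
    rewrite -(@periodic_shift R L L0 (fun j => u j.+1 * c j) 1); last by move=> j; rewrite -addSn pu pc.
    by apply: eq_bigr => j _; rewrite addn1.
  have shift3 : \sum_(0 <= j < L) u j * c j.+1 = \sum_(0 <= j < L) u j.+1 * c j.+2.
    rewrite -(@periodic_shift R L L0 (fun j => u j * c j.+1) 1); last by move=> j; rewrite -addSn pu pc.
    by apply: eq_bigr => j _; rewrite addn1.
  rewrite (eq_bigr (fun j => (u j.+2 * c j.+1 + u j * c j.+1) - 2 * (u j.+1 * c j.+1))); last first.
    by move=> j _; rewrite -mulr_natr; ring.
  rewrite big_split /= sumrN -mulr_sumr big_split /= shift2 shift3 -big_split /=.
  rewrite (eq_bigr (fun j => 2 * cos (2 * pi * n%:R / L%:R) * (u j.+1 * c j.+1))); last first.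
    by move=> j _; have := cD j => E; rewrite -mulrDr addrC E; ring.
  by rewrite -mulr_sumr /dft -/u shift1; ring.
have num : `|(2 - 2 * cos (2 * pi * n%:R / L%:R)) * dft L n| <= 2 * B2 * e ^+ 2.
  rewrite key normrN normrM (gtr0_norm e0).
  rewrite -(ler_pM2l LR) mulrA mulfV ?lt0r_neq0 // mul1r.
  apply: (le_trans (ler_norm_sum _ _ _)).
  apply: (@le_trans _ _ (\sum_(0 <= j < L) 2 * B2 * e ^+ 2)); last first.
    by rewrite sumr_const_nat subn0 -[_ *+ L]mulr_natl.
  rewrite big_nat_cond [leRHS]big_nat_cond; apply: ler_sum => j /andP[/andP[_ jL] _].
  rewrite normrM; apply: (@le_trans _ _ `|u j.+2 - u j.+1 *+ 2 + u j|).
    by rewrite ler_piMr // cos_max.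
  have := sd (j.+1%:R / L%:R); rewrite /u.
  have -> : j.+2%:R / L%:R = j.+1%:R / L%:R + e :> R.
    by rewrite /e -[j.+2%:R]natr1 mulrDl mul1r.
  have -> : j%:R / L%:R = j.+1%:R / L%:R - e :> R.
    by rewrite /e -[j.+1%:R]natr1 mulrDl mul1r addrK.
  by apply; rewrite divr_ge0 //= ler_pdivrMr // mul1r ler_nat.
pose y : R := n%:R / L%:R.
have y0 : 0 < y by rewrite divr_gt0.
have y2 : y <= 2^-1.
  rewrite /y ler_pdivrMr // mulrC ler_pdivlMr // -[2]/(2%:R) -natrM ler_nat; lia.
have den : 2 * y ^+ 2 * 2 <= 2 - 2 * cos (2 * pi * n%:R / L%:R).
  have -> : 2 * pi * n%:R / L%:R = (pi * y) *+ 2 by rewrite /y -mulr_natr; ring.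
  rewrite cos_mulr2n cos2sin2.
  have s1 : y <= sin (pi * y).
    apply: le_trans (_ : pi * y / 2 <= _); first by rewrite ler_pdivlMr // mulrC ler_pM2r.
    by apply: sin_ge_half; apply/andP; split; [rewrite mulr_ge0 //; lra|rewrite ler_pM2l //; lra].
  have : y ^+ 2 <= sin (pi * y) ^+ 2 by rewrite ler_pXn2r // nnegrE; lra.
  rewrite -mulr_natr; lra.
have y20 : 0 < y ^+ 2 by rewrite exprn_gt0.
have : 4 * y ^+ 2 * `|dft L n| <= 2 * B2 * e ^+ 2.
  apply: (le_trans _ num); rewrite [leRHS]normrM; apply: ler_wpM2r => //.
  by apply: le_trans (ler_norm _); lra.
have -> : e ^+ 2 = y ^+ 2 / n%:R ^+ 2 by rewrite /e /y; field; rewrite !lt0r_neq0.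
have B2n : 0 <= B2 / n%:R ^+ 2 by rewrite divr_ge0 // sqr_ge0.
move=> h4; rewrite -(ler_pM2l y20); have : 0 <= y ^+ 2 * (B2 / n%:R ^+ 2) by rewrite mulr_ge0 // ltW.
move: h4; lra.
Qed.

Lemma dft_sym L n : (n <= L)%N -> (0 < L)%N -> dft L (L - n) = dft L n.
Proof.
move=> nL L0; congr (_ * _); apply: eq_bigr => j _; congr (_ * _).
rewrite (@grid_angleB _ _ L0) // (_ : grid_angle R L L j = 2 * pi * (j : int)%:~R); last first.
  by rewrite /grid_angle -pmulrn; field; rewrite pnatr_eq0 -lt0n.
by rewrite addrC cos2pik cosN.
Qed.

Lemma dft_inversion L i : (0 < L)%N -> h (i%:R / L%:R) =
  \sum_(0 <= n < L) dft L n * cos (grid_angle R L n i).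
Proof.
move=> L0; have LR : 0 < L%:R :> R by rewrite ltr0n.
have [i' [iL iE]] : exists i', (i' < L)%N /\ exists q, i = (i' + q * L)%N.
  by exists (i %% L)%N; split; [rewrite ltn_mod|exists (i %/ L)%N; rewrite addnC -divn_eq].
have hE : h (i%:R / L%:R) = h (i'%:R / L%:R).
  case: iE => q ->; rewrite natrD natrM mulrDl mulfK ?lt0r_neq0 //; exact: hperN.
have cE n : cos (grid_angle R L n i) = cos (grid_angle R L n i').
  case: iE => q ->; rewrite -[RHS](@cos2pik _ _ ((n * q)%N : int)); congr cos.
  by rewrite /grid_angle -pmulrn !natrD !natrM; field; exact: lt0r_neq0.
rewrite hE; under eq_bigr do rewrite cE.
(* for even h, the sines cancel in the inversion formula *)
rewrite /dft (eq_bigr (fun n => \sum_(0 <= j < L) L%:R^-1 * (h (j%:R / L%:R) *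
   (cos (grid_angle R L j n) * cos (grid_angle R L i' n))))); last first.
  move=> n _; rewrite mulr_sumr mulr_suml; apply: eq_bigr => j _.
  have sw a b : grid_angle R L a b = grid_angle R L b a by rewrite /grid_angle [a%:R * _]mulrC.
  by rewrite (sw n j) (sw n i'); ring.
rewrite exchange_big /=.
have orth j : (j < L)%N -> \sum_(0 <= n < L) cos (grid_angle R L j n) * cos (grid_angle R L i' n)
   = L%:R / 2 * ((j == i')%:R + ((j + i') %% L == 0)%N%:R).
  move=> jL.
  have S0 k : \sum_(0 <= n < L) cos (grid_angle R L k n) = L%:R * ((k %% L == 0)%N%:R).
    have -> : \sum_(0 <= n < L) cos (grid_angle R L k n) = \sum_(0 <= n < L) cos (grid_angle R L (k %% L) n).
      apply: eq_bigr => n _; rewrite -[RHS](@cos2pik _ _ ((k %/ L * n)%N : int)); congr cos.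
      rewrite {1}(divn_eq k L) /grid_angle -pmulrn !natrD !natrM; field; exact: lt0r_neq0.
    have := ltn_pmod k L0; move: (k %% L)%N => r rL.
    have [->|r0] := eqVneq r 0%N.
      rewrite (eq_bigr (fun=> 1)) ?sumr_const_nat ?subn0 ?mulr1 //.
      by move=> n _; rewrite /grid_angle mul0r mulr0 mul0r cos0.
    have := @sum_cos_grid R L L0 r 0; rewrite lt0n r0 rL => /(_ isT) S.
    rewrite mulr0 -[RHS]S; apply: eq_bigr => n _; by rewrite addr0.
  have E n : cos (grid_angle R L j n) * cos (grid_angle R L i' n) =
    2^-1 * cos (grid_angle R L (j + i') n) + 2^-1 * cos (grid_angle R L (j + L - i') n).
    rewrite (_ : cos (grid_angle R L (j + L - i') n) = cos (grid_angle R L j n - grid_angle R L i' n)).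
      by rewrite (@grid_angleD _ _ L0) cosB cosD; field.
    rewrite (@grid_angleB _ _ L0); last by rewrite (leq_trans (ltnW iL)) // leq_addl.
    rewrite (@grid_angleD _ _ L0) -[RHS](@cos2pik _ _ (n : int)); congr cos.
    by rewrite /grid_angle -pmulrn; field; exact: lt0r_neq0.
  rewrite (eq_bigr _ (fun n _ => E n)) big_split /= -!mulr_sumr !S0.
  have -> : ((j + L - i') %% L == 0)%N = (j == i').
    have [ij|ji] := leqP i' j.
      rewrite -addnBAC // modnDr modn_small; last by rewrite (leq_ltn_trans _ jL) // leq_subr.
      by rewrite subn_eq0 eqn_leq ij andbT.
    rewrite modn_small; last by lia.
    by apply/eqP/eqP; lia.
  by field.
rewrite big_nat_cond (eq_bigr (fun j => 2^-1 * (h (j%:R / L%:R) * (j == i')%:R) +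
     2^-1 * (h (j%:R / L%:R) * ((j + i') %% L == 0)%N%:R))); last first.
  move=> j /andP[/andP[_ jL] _]; rewrite -mulr_sumr -mulr_sumr orth //.
  by field; exact: lt0r_neq0.
rewrite -big_nat_cond big_split /= -!mulr_sumr.
have one k (P : pred nat) (v : R) : (k < L)%N -> (forall j, (j < L)%N -> P j = (j == k)) ->
    h (k%:R / L%:R) = v -> \sum_(0 <= j < L) h (j%:R / L%:R) * (P j)%:R = v.
  move=> kL Pk <-; rewrite (bigD1_seq k) ?iota_uniq ?mem_index_iota //= Pk // eqxx mulr1.
  rewrite big_nat_cond big1 ?addr0 // => j /andP[/andP[_ jL] jk].
  by rewrite Pk // (negPf jk) mulr0.
rewrite (one i' (fun j => j == i') (h (i'%:R / L%:R))) //.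
rewrite (one ((L - i') %% L)%N (fun j => (j + i') %% L == 0)%N (h (i'%:R / L%:R))) ?ltn_mod //.
- by field.
- move=> j jL; case: i' iL {iE hE cE orth} => [_|i2 iL].
    by rewrite subn0 modnn addn0 modn_small.
  rewrite (@modn_small (L - i2.+1)); last by lia.
  have [h1'|h1'] := leqP L (j + i2.+1).
    rewrite -(subnK h1') modnDr modn_small; last by lia.
    by apply/eqP/eqP; lia.
  by rewrite modn_small //; apply/eqP/eqP; lia.
- case: i' iL {iE hE cE orth} => [_|i2 iL]; first by rewrite subn0 modnn.
  rewrite modn_small; last by lia.
  rewrite natrB; last by lia.
  by rewrite mulrBl divff ?lt0r_neq0 // -[RHS]heven -[RHS]hper addrC.
Qed.


(** Takes the place of a passage to the limit in L; most limits below are taken in this form. *)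
Lemma le_of_le_div (x y C : R) L0 :
  (forall L, (L0 <= L)%N -> x <= y + C / L%:R) -> x <= y.
Proof.
move=> H; rewrite leNgt; apply/negP => yx.
pose d := x - y; have d0 : 0 < d by rewrite subr_gt0.
have cd : 0 <= `|C| / d by rewrite divr_ge0 // ltW.
pose m := Num.bound (`|C| / d).
have hm := archi_boundP cd; rewrite -/m in hm.
have L1 : 0 < (L0 + m).+1%:R :> R by rewrite ltr0n.
have := H (L0 + m).+1; rewrite leqW ?leq_addr // => /(_ isT).
rewrite -lerBlDl -/d ler_pdivlMr // => h'.
have : d * m%:R <= d * (L0 + m).+1%:R by rewrite ler_pM2l // ler_nat leqW // leq_addl.
move: hm; rewrite ltr_pdivrMr // mulrC; have := ler_norm C; lra.
Qed.

Lemma fcoef_le A n : (forall x, 0 <= x <= 1 -> `|h x| <= A) -> `|fcoef n| <= A.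
Proof.
move=> hA; apply: int01_bound => [|x x01]; first exact: cont_coef_integrand.
by rewrite normrM; apply: (le_trans _ (hA x x01)); rewrite ler_piMr // cos_max.
Qed.

Lemma dft_le A L n : (0 < L)%N -> (forall x, 0 <= x <= 1 -> `|h x| <= A) -> `|dft L n| <= A.
Proof.
move=> L0 hA; have LR : 0 < L%:R :> R by rewrite ltr0n.
have Li : 0 < L%:R^-1 :> R by rewrite invr_gt0.
rewrite normrM (gtr0_norm Li) -(ler_pM2l LR) mulVKf ?lt0r_neq0 //.
apply: (le_trans (ler_norm_sum _ _ _)).
apply: (@le_trans _ _ (\sum_(0 <= j < L) A)); last by rewrite sumr_const_nat subn0 -[_ *+ L]mulr_natl.
rewrite big_nat_cond [leRHS]big_nat_cond; apply: ler_sum => j /andP[/andP[_ jL] _].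
rewrite normrM; apply: (@le_trans _ _ `|h (j%:R / L%:R)|); first by rewrite ler_piMr // cos_max.
by apply: hA; rewrite divr_ge0 //= ler_pdivrMr // mul1r ler_nat ltnW.
Qed.

Lemma sum_inv_sqr K M : (0 < K)%N -> \sum_(K.+1 <= n < M.+1) (n%:R ^+ 2)^-1 <= K%:R^-1 :> R.
Proof.
move=> K0; have [MK|KM] := leqP M K.
  by rewrite big_geq ?invr_ge0.
suff : \sum_(K.+1 <= n < M.+1) (n%:R ^+ 2)^-1 <= K%:R^-1 - M%:R^-1 :> R.
  by move=> /le_trans; apply; rewrite lerBlDr lerDl invr_ge0.
have inc n : (0 < n)%N -> (n.+1%:R ^+ 2)^-1 <= n%:R^-1 - n.+1%:R^-1 :> R.
  move=> n0; have nR : 0 < n%:R :> R by rewrite ltr0n.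
  rewrite -natr1 (_ : n%:R^-1 - (n%:R + 1)^-1 = (n%:R * (n%:R + 1))^-1); last by field; rewrite !lt0r_neq0 // addr_gt0.
  by rewrite lef_pV2 ?posrE ?mulr_gt0 ?exprn_gt0 ?addr_gt0 //; nra.
elim: M KM => // M IH; rewrite ltnS leq_eqVlt => /predU1P[<-|KM].
  by rewrite big_nat1 inc.
rewrite (@big_nat_recr _ _ _ M.+1) /=; last by rewrite ltnS ltnW. 
by apply: (le_trans (lerD (IH KM) (inc M (leq_trans K0 (ltnW KM))))); rewrite addrA subrK.
Qed.

Lemma hperZ x (k : int) : h (x + k%:~R) = h x.
Proof.
case: k => n; first by rewrite -pmulrn hperN.
by rewrite -[LHS](hperN _ n.+1) NegzE mulrNz -pmulrn addrNK.
Qed.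

Definition fourier_sum K x := fcoef 0 + 2 * \sum_(1 <= n < K.+1) fcoef n * cos (2 * pi * n%:R * x).

(** The grid length is odd, so the frequencies n and L - n pair off and no middle one is left. *)
Lemma dft_fold M i : h (i%:R / (M.*2.+1)%:R) = dft M.*2.+1 0 +
  2 * \sum_(1 <= n < M.+1) dft M.*2.+1 n * cos (grid_angle R M.*2.+1 n i).
Proof.
set L := M.*2.+1; have L0 : (0 < L)%N by [].
rewrite (dft_inversion i L0) {1}/L big_nat_recl // -/L; congr (_ + _).
  by rewrite /grid_angle mul0r mulr0 mul0r cos0 mulr1.
rewrite -(big_add1 _ _ 0 L xpredT (fun n => dft L n * cos (grid_angle R L n i))).
rewrite (@big_cat_nat _ _ _ M.+1) //=; last by rewrite /L ltnS -addnn leq_addr.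
rewrite mulr_natl mulr2n; congr (_ + _).
rewrite big_nat_rev /= (_ : M.+1 = 1 + M)%N // big_addn (_ : L - M = 1 + M)%N; last by rewrite /L; lia.
rewrite big_nat_cond [RHS]big_nat_cond; apply: eq_bigr => n /andP[/andP[n1 nM] _].
have -> : (1 + M + L - (n + M).+1 = L - n)%N by lia.
rewrite dft_sym //; last by rewrite /L; lia.
congr (_ * _).
rewrite (@grid_angleB _ _ L0); last by rewrite /L; lia.
rewrite (_ : grid_angle R L L i = 2 * pi * (i : int)%:~R); last first.
  by rewrite /grid_angle -pmulrn; field; rewrite pnatr_eq0 -lt0n.
by rewrite addrC cos2pik cosN.
Qed.

(** The finite inversion formula is exact at grid points. Its tail beyond K is $O(1/K)$ uniformly in
    L by [dft_decay]; as L grows, the finite transforms tend to the Fourier coefficients and the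
    grid point just below y tends to y. *)
Lemma fourier_inversion : exists2 C, 0 <= C & forall K x, (0 < K)%N ->
  `|h x - fourier_sum K x| <= C / K%:R.
Proof.
have [B B0 hB] := dft_cvg; have [D D0 hD] := dft_decay.
have [B1 B10 hB1] := bounded_segment 0 1 ch1.
have [A A0 hA] := bounded_segment 0 1 ch.
have p0 := pi_gt0 R.
exists (2 * D) => [|K x K0]; first by rewrite mulr_ge0.
suff H y : 0 <= y <= 1 -> `|h y - fourier_sum K y| <= 2 * D / K%:R.
  have := H (x - (Num.floor x)%:~R); rewrite subr_ge0 floor_le.
  have := lt_succ_floor x; rewrite intrD => /ltW; rewrite -lerBlDl => -> /(_ isT).
  move: (Num.floor x) => k; rewrite -[h (x - _)](hperZ _ k) subrK.
  rewrite (_ : fourier_sum K (x - k%:~R) = fourier_sum K x) //.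
  congr (_ + _ * _); apply: eq_bigr => n _; congr (_ * _).
  rewrite -[LHS](@cos2pik _ _ (n%:Z * k)); congr cos.
  by rewrite rmorphM /= -pmulrn; ring.
move=> /andP[y0 y1].
pose E (n : nat) := B * n.+1%:R + A * (2 * pi * n%:R).
apply: (@le_of_le_div _ _ ((B1 + (B * 1%:R + 2 * \sum_(1 <= n < K.+1) E n)) / 1) K) => M KM.
have M0 : (0 < M)%N by lia.
set L := M.*2.+1; have L0 : (0 < L)%N by [].
have LR : 0 < L%:R :> R by rewrite ltr0n.
have MR : 0 < M%:R :> R by rewrite ltr0n.
pose i := Num.truncn (y * L%:R).
have yL : 0 <= y * L%:R by rewrite mulr_ge0.
have /andP[i1 i2] := truncn_itv yL; rewrite -/i in i1 i2.
pose z : R := i%:R / L%:R.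
have zy : z <= y by rewrite /z ler_pdivrMr.
have yz : `|y - z| <= L%:R^-1.
  rewrite ger0_norm ?subr_ge0 // /z -(ler_pM2r LR) mulrBl divfK ?lt0r_neq0 // mulVf ?lt0r_neq0 //.
  by move: i2; rewrite -natr1; lra.
have z01 : 0 <= z <= 1 by rewrite (le_trans zy y1) /z divr_ge0.
have y01 : 0 <= y <= 1 by rewrite y0 y1.
have e1 : `|h y - h z| <= B1 / L%:R.
  apply: (le_trans (lipschitz_of_bound dh hB1 y01 z01)); by rewrite ler_wpM2l.
pose S := dft L 0 + 2 * \sum_(1 <= n < K.+1) dft L n * cos (grid_angle R L n i).
have e2 : `|h z - S| <= 2 * D / K%:R.
  rewrite /z /L dft_fold -/L (@big_cat_nat _ _ _ K.+1) //= /S.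
  rewrite (_ : forall a b c : R, a + 2 * (b + c) - (a + 2 * b) = 2 * c); last by move=> *; ring.
  rewrite normrM ger0_norm // -mulrA ler_pM2l //.
  apply: (le_trans (ler_norm_sum _ _ _)).
  apply: (@le_trans _ _ (\sum_(K.+1 <= n < M.+1) D * (n%:R ^+ 2)^-1)).
    rewrite big_nat_cond [leRHS]big_nat_cond; apply: ler_sum => n /andP[/andP[n1 nM] _].
    rewrite normrM; apply: (@le_trans _ _ `|dft L n|); first by rewrite ler_piMr // cos_max.
    by apply: hD; [exact: leq_trans n1|rewrite ltnS in nM; rewrite /L ltnW // ltnS leq_double].
  by rewrite -mulr_sumr ler_wpM2l // sum_inv_sqr.
have e3 : `|S - fourier_sum K y| <= (B * 1%:R + 2 * \sum_(1 <= n < K.+1) E n) / L%:R.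
  rewrite /S /fourier_sum (_ : forall a b c d : R, a + 2 * b - (c + 2 * d) = - (c - a) + 2 * (b - d)); last by move=> *; ring.
  rewrite [leRHS]mulrDl; apply: (le_trans (ler_normD _ _)); rewrite normrN; apply: lerD; first exact: hB.
  rewrite normrM ger0_norm // -mulrA ler_pM2l // -sumrB mulr_suml.
  apply: (le_trans (ler_norm_sum _ _ _)); apply: ler_sum => n _.
  have -> : grid_angle R L n i = 2 * pi * n%:R * z by rewrite /grid_angle /z; field; exact: lt0r_neq0.
  set cz := cos _; set cy := cos _.
  rewrite (_ : _ - _ = - ((fcoef n - dft L n) * cz) + fcoef n * (cz - cy)); last by ring.
  apply: (le_trans (ler_normD _ _)); rewrite normrN !normrM /E mulrDl; apply: lerD.
    by apply: (le_trans _ (hB n L L0)); rewrite ler_piMr // cos_max.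
  rewrite -mulrA; apply: ler_pM => //; first exact: fcoef_le.
  have q0 : 0 <= 2 * pi * n%:R :> R by rewrite !mulr_ge0 // ltW.
  apply: (@le_trans _ _ (2 * pi * n%:R * `|z - y|)).
    apply: (lipschitz_of_bound (is_derive_cosax (2 * pi * n%:R)) (_ : forall w, 0 <= w <= 1 -> _)) => // w _.
    by rewrite normrN normrM (ger0_norm q0) ler_piMr ?sin_max.
  by rewrite ler_wpM2l // distrC.
have EE : (B1 + (B * 1%:R + 2 * \sum_(1 <= n < K.+1) E n)) / L%:R <= (B1 + (B * 1%:R + 2 * \sum_(1 <= n < K.+1) E n)) / 1 / M%:R.
  rewrite divr1 ler_wpM2l //; last by rewrite lef_pV2 ?posrE // ler_nat /L leqW // -addnn leq_addl.
  rewrite addr_ge0 // addr_ge0 ?mulr_ge0 // sumr_ge0 // => n _.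
  by rewrite /E addr_ge0 // !mulr_ge0 // ltW.
have -> : h y - fourier_sum K y = (h y - h z) + (h z - S) + (S - fourier_sum K y) by ring.
apply: (le_trans (ler_normD _ _)); apply: (le_trans (lerD (ler_normD _ _) (lexx _))).
apply: le_trans (lerD (lexx _) EE); rewrite mulrDl; lra.
Qed.

(** Bessel's inequality on the grid, where only the values of h in [0, 1] enter, followed by L
    tending to infinity. *)
Lemma fcoef_bessel A K : 0 <= A -> (forall x, 0 <= x <= 1 -> `|h x| <= A) ->
  2 * \sum_(1 <= n < K.+1) fcoef n ^+ 2 <= A ^+ 2.
Proof.
move=> A0 hA; have [B B0 hB] := dft_cvg.
apply: (@le_of_le_div _ _ (2 * \sum_(1 <= n < K.+1) 2 * A * (B * n.+1%:R)) (K.+1).*2) => L KL.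
have L0 : (0 < L)%N by lia.
have LR : 0 < L%:R :> R by rewrite ltr0n.
have b1 : 2 * \sum_(1 <= n < K.+1) dft L n ^+ 2 <= A ^+ 2.
  have := @bessel R L (index_iota 1 K.+1) (fun n j => cos (grid_angle R L n j))
    (fun j => h (j%:R / L%:R)) (L%:R / 2) (iota_uniq _ _).
  have L2 : 0 < L%:R / 2 :> R by rewrite divr_gt0.
  move=> /(_ L2) H0.
  have H : forall n m, n \in index_iota 1 K.+1 -> m \in index_iota 1 K.+1 ->
    \sum_(0 <= j < L) cos (grid_angle R L n j) * cos (grid_angle R L m j) = (if n == m then L%:R / 2 else 0).
    move=> n m; rewrite !mem_index_iota => /andP[n1 nK] /andP[m1 mK].
    have := @grid_ortho R L L0 n m 0 0; rewrite subrr cos0 mulr1 => <- //; try lia.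
    by apply: eq_bigr => j _; rewrite !addr0.
  have {H0 H}H := H0 H.
  have : L%:R / 2 * \sum_(0 <= j < L) h (j%:R / L%:R) ^+ 2 <= L%:R / 2 * (L%:R * A ^+ 2).
    rewrite ler_pM2l ?divr_gt0 //.
    apply: (@le_trans _ _ (\sum_(0 <= j < L) A ^+ 2)); last by rewrite sumr_const_nat subn0 -[_ *+ L]mulr_natl.
    rewrite big_nat_cond [leRHS]big_nat_cond; apply: ler_sum => j /andP[/andP[_ jL] _].
    rewrite -real_normK ?num_real // ler_pXn2r ?nnegrE //.
    by apply: hA; rewrite divr_ge0 //= ler_pdivrMr // mul1r ler_nat ltnW.
  move=> H'; have := le_trans H H'.
  rewrite (eq_bigr (fun n => L%:R ^+ 2 * dft L n ^+ 2)); last first.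
    by move=> n _; rewrite -exprMn /dft mulVKf ?lt0r_neq0.
  rewrite -mulr_sumr => H2; rewrite -(@ler_pM2l _ (L%:R ^+ 2 / 2)) ?divr_gt0 ?exprn_gt0 //.
  by lra.
apply: (le_trans _ (lerD b1 (lexx _))).
rewrite -[2 * _ / _]mulrA -mulrDr ler_pM2l // mulr_suml -big_split /=; apply: ler_sum => n _.
have h3 := hB n L L0; have h1' := fcoef_le n hA; have h2' := dft_le n L0 hA.
have -> : fcoef n ^+ 2 = dft L n ^+ 2 + (fcoef n + dft L n) * (fcoef n - dft L n) by ring.
rewrite lerD2l; apply: (le_trans (ler_norm _)); rewrite normrM -[leRHS]mulrA.
apply: ler_pM => //; apply: (le_trans (ler_normD _ _)).
by rewrite mulr_natl mulr2n lerD.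
Qed.

End FourierInversion.

Section Orthogonality.
Variable R : realType.

Lemma is_derive_sinax (a x : R) : is_derive x 1 (fun z => sin (a * z)) (a * cos (a * x)).
Proof.
have da : is_derive x (1 : R) ( *%R a) a.
  by apply: (is_derive_eq (is_deriveZ a (is_derive_id x 1))); rewrite /GRing.scale /= mulr1.
have dc := is_derive_sin (a * x).
have := @is_derive1_comp R sin ( *%R a) x _ _ dc da.
by rewrite mulrC.
Qed.

Lemma int01_cos (k : nat) : int01 (fun x : R => cos (2 * pi * k%:R * x)) = (k == 0)%N%:R.
Proof.
have [->|k0] := eqVneq k 0%N.
  rewrite -[RHS](@int01_cst R 1%:R); congr int01; apply: funext => x.
  by rewrite mulr0 mul0r cos0.
pose a : R := 2 * pi * k%:R.
have a0 : a != 0 by rewrite /a !mulf_neq0 ?pnatr_eq0 // lt0r_neq0 // pi_gt0.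
have cc : continuous (fun x : R => a * cos (a * x)).
  by move=> x; apply: cvgM; [exact: cvg_cst|exact: cont_cosax].
have c0 : continuous (fun _ : R => 0 : R) by move=> x; exact: cvg_cst.
have := @int01_by_parts R (fun=> 1) (fun=> 0) (fun x => sin (a * x)) (fun x => a * cos (a * x))
  (fun x => @is_derive_cst R R R 1 x 1) (is_derive_sinax a) c0 cc.
under [in LHS]eq_fun do rewrite mul1r.
rewrite int01Z; last exact: cont_cosax.
under [X in _ - int01 X]eq_fun do rewrite mul0r.
rewrite int01_cst subr0 !mul1r mulr0 sin0 subr0 mulr1.
have -> : sin a = 0.
  rewrite /a (_ : 2 * pi * k%:R = 0 + (pi *+ 2) *+ k); last by rewrite add0r -[(_ *+ _) *+ _]mulr_natr -[pi *+ 2]mulr_natl.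
  by elim: {k0 a a0 cc} k => [|k IH]; rewrite ?mulr0n ?addr0 ?sin0 // mulrSr addrA sinD2pi.
by move/eqP; rewrite mulf_eq0 (negPf a0) /= => /eqP.
Qed.

Lemma int01_cos_cos (k l : nat) : (0 < l)%N ->
  int01 (fun x : R => cos (2 * pi * k%:R * x) * cos (2 * pi * l%:R * x)) = (k == l)%:R / 2.
Proof.
move=> l0.
pose c (n : nat) (x : R) := cos (2 * pi * n%:R * x).
have cc n : continuous (c n) by exact: cont_cosax.
have ccZ n : continuous (fun x => 2^-1 * c n x).
  by move=> x; apply: cvgM; [exact: cvg_cst|exact: cc].
pose m := if (k <= l)%N then (l - k)%N else (k - l)%N.
have -> : (fun x : R => cos (2 * pi * k%:R * x) * cos (2 * pi * l%:R * x))
   = (fun x => 2^-1 * c (k + l)%N x + 2^-1 * c m x).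
  apply: funext => x; rewrite /c /m.
  set al := 2 * pi * k%:R * x; set be := 2 * pi * l%:R * x.
  have -> : 2 * pi * (k + l)%:R * x = al + be by rewrite natrD /al /be; ring.
  have -> : cos (2 * pi * (if (k <= l)%N then l - k else k - l)%N%:R * x) = cos (al - be).
    case: leqP => kl.
      rewrite -cosN; congr cos; rewrite natrB // /al /be; ring.
    by congr cos; rewrite natrB ?(ltnW kl) // /al /be; ring.
  by rewrite cosB cosD; field.
rewrite int01D ?int01Z // /c !int01_cos addn_eq0 eqn0Ngt [in X in _ && X]eqn0Ngt l0 andbF mulr0 add0r mulrC.
congr (_%:R / 2); rewrite /m; case: leqP => kl; first by rewrite subn_eq0 eqn_leq kl.
by rewrite subn_eq0 eqn_leq (ltnW kl) andbT.
Qed.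

End Orthogonality.

(** * Fourier coefficients of the form *)

Section SumLemmas.
Variable R : realType.

Lemma cont_sum (I : Type) (r : seq I) (P : pred I) (F : I -> R -> R) :
  (forall i, continuous (F i)) -> continuous (fun x => \sum_(i <- r | P i) F i x).
Proof.
move=> cF; elim: r => [|i r IH].
  by under eq_fun do rewrite big_nil; move=> x; exact: cvg_cst.
under eq_fun do rewrite big_cons.
by case: (P i) => // x; apply: cvgD; [exact: cF|exact: IH].
Qed.

Lemma contM (F G : R -> R) : continuous F -> continuous G -> continuous (fun x => F x * G x).
Proof. by move=> cF cG x; apply: cvgM; [exact: cF|exact: cG]. Qed.

Lemma contZ (a : R) (F : R -> R) : continuous F -> continuous (fun x => a * F x).
Proof. by move=> cF x; apply: cvgM; [exact: cvg_cst|exact: cF]. Qed.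

Lemma contD (F G : R -> R) : continuous F -> continuous G -> continuous (fun x => F x + G x).
Proof. by move=> cF cG x; apply: cvgD; [exact: cF|exact: cG]. Qed.

Lemma contN (F : R -> R) : continuous F -> continuous (fun x => - F x).
Proof. by move=> cF x; apply: cvgN; exact: cF. Qed.

Lemma cont_cst (a : R) : continuous (fun _ : R => a).
Proof. by move=> x; exact: cvg_cst. Qed.

Lemma is_derive_affine (a b x : R) : is_derive x (1 : R) (fun z : R => a * z + b) a.
Proof.
have d1 : is_derive x (1 : R) (fun z : R => a * z) a.
  by apply: (is_derive_eq (is_deriveZ a (is_derive_id x (1 : R)))); rewrite /GRing.scale /= mulr1.
by apply: (is_derive_eq (is_deriveD d1 (is_derive_cst b x (1 : R)))); rewrite addr0.
Qed.

Lemma cont_affine (F : R -> R) (a b : R) : continuous F -> continuous (fun x : R => F (a * x + b)).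
Proof.
move=> cF x; apply: (@continuous_comp _ _ _ (fun z : R => a * z + b) F x); last exact: cF.
exact: (@is_derive_continuous R _ (fun=> a) (is_derive_affine a b)).
Qed.

Lemma int01_sum (I : Type) (r : seq I) (P : pred I) (F : I -> R -> R) :
  (forall i, continuous (F i)) ->
  int01 (fun x => \sum_(i <- r | P i) F i x) = \sum_(i <- r | P i) int01 (F i).
Proof.
move=> cF; elim: r => [|i r IH].
  by under eq_fun do rewrite big_nil; rewrite big_nil int01_cst.
under eq_fun do rewrite big_cons; rewrite big_cons.
by case: (P i) => //; rewrite int01D ?IH //; exact: cont_sum.
Qed.

Lemma sum_cos_grid_mod (d k : nat) (al : R) : (0 < d)%N ->
  \sum_(0 <= b < d) cos (al + 2 * pi * k%:R * (b%:R / d%:R)) = if (d %| k)%N then d%:R * cos al else 0.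
Proof.
move=> d0; have dR : d%:R != 0 :> R by rewrite pnatr_eq0 -lt0n.
have E b : cos (al + 2 * pi * k%:R * (b%:R / d%:R)) = cos (grid_angle R d (k %% d) b + al).
  rewrite -[RHS](@cos2pik _ _ ((k %/ d * b)%N : int)); congr cos.
  by rewrite {1}(divn_eq k d) /grid_angle -pmulrn !natrD !natrM; field.
under eq_bigr do rewrite E.
rewrite /dvdn; have := ltn_pmod k d0; move: (k %% d)%N => r rd.
have [->|r0] := eqVneq r 0%N.
  rewrite (eq_bigr (fun=> cos al)); last by move=> b _; rewrite /grid_angle mul0r mulr0 mul0r add0r.
  by rewrite sumr_const_nat subn0 mulr_natl.
by apply: sum_cos_grid => //; rewrite lt0n r0.
Qed.

End SumLemmas.

Section FourierMore.
Variable R : realType.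
Variables h h1 h2 : R -> R.
Hypothesis hper : forall x, h (x + 1) = h x.
Hypothesis heven : forall x, h (- x) = h x.
Hypothesis dh : forall x : R, is_derive x 1 h (h1 x).
Hypothesis dh1 : forall x : R, is_derive x 1 h1 (h2 x).
Hypothesis ch2 : continuous h2.

Let ch : continuous h. Proof. exact: is_derive_continuous dh. Qed.
Let ch1 : continuous h1. Proof. exact: is_derive_continuous dh1. Qed.

Lemma derivative_periodic x : h1 (x + 1) = h1 x.
Proof.
have ds : is_derive x (1 : R) (fun z : R => z + 1) 1.
  by have := is_derive_affine 1 1 x; under eq_fun do rewrite mul1r.
have := @is_derive1_comp R h (fun z => z + 1) x _ _ (dh (x + 1)) ds.
rewrite mulr1 => d1.
have E : h \o (fun z => z + 1) = h by apply: funext => z /=; exact: hper.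
rewrite E in d1.
have -> : h1 (x + 1) = 'D_1 h x by apply/esym; apply: derive_val.
by apply: derive_val; exact: dh.
Qed.

Lemma fcoef_second n : int01 (fun x => h2 x * cos (2 * pi * n%:R * x)) =
  - (2 * pi * n%:R) ^+ 2 * fcoef h n.
Proof.
set a := 2 * pi * n%:R : R.
have s2 : sin a = 0.
  rewrite /a (_ : 2 * pi * n%:R = 0 + (pi *+ 2) *+ n); last by rewrite add0r -[(_ *+ _) *+ _]mulr_natr -[pi *+ 2]mulr_natl.
  by elim: n @a => [|k IH] a; rewrite ?mulr0n ?addr0 ?sin0 // mulrSr addrA sinD2pi.
have c2 : cos a = 1.
  by have := @cos2pik R 0 n; rewrite add0r -pmulrn -/a cos0.
have dw := is_derive_cosax a.
have cw' : continuous (fun x => - (a * sin (a * x))).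
  by apply: contN; apply: contZ; exact: is_derive_continuous (is_derive_sinax a).
have dw' (x : R) : is_derive x 1 (fun z => - (a * sin (a * z))) (- (a * (a * cos (a * x)))).
  have := is_deriveN (is_deriveZ a (is_derive_sinax a x)); exact.
have e1 := int01_by_parts dw dh1 cw' ch2.
have cw'' : continuous (fun x : R => - (a * (a * cos (a * x)))).
  by apply: contN; apply: contZ; apply: contZ; exact: cont_cosax.
have e2 := int01_by_parts dw' dh cw'' ch1.
have per : h1 1 = h1 0 by rewrite -[RHS]derivative_periodic add0r.
have -> : (fun x => h2 x * cos (a * x)) = (fun x => cos (a * x) * h2 x) by apply: funext => x; rewrite mulrC.
rewrite e1 e2 /fcoef -/a !mulr1 !mulr0 cos0 sin0 s2 c2 per.
have -> : (fun x => - (a * (a * cos (a * x))) * h x) = (fun x => - a ^+ 2 * (h x * cos (a * x))).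
  by apply: funext => x; ring.
by rewrite int01Z; [ring|apply: contM => //; exact: cont_cosax].
Qed.

Lemma int01_sqr_ge n : (0 < n)%N -> 2 * fcoef h n ^+ 2 <= int01 (fun x => h x ^+ 2).
Proof.
move=> n0; set c := fcoef h n.
pose w x : R := cos (2 * pi * n%:R * x).
have cw : continuous w by exact: cont_cosax.
have : 0 <= int01 (fun x => (h x * h x + - (4 * c) * (h x * w x)) + 4 * c ^+ 2 * (w x * w x)).
  rewrite -[leLHS](@int01_cst R 0); apply: le_int01.
  - by move=> x; exact: cvg_cst.
  - apply: contD; last by apply: contZ; exact: contM.
    by apply: contD; [exact: contM|apply: contZ; exact: contM].
  - by move=> x _; have := sqr_ge0 (h x - 2 * c * w x); lra.
have c1 : continuous (fun x => h x * h x) by exact: contM.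
have c2 : continuous (fun x => - (4 * c) * (h x * w x)) by apply: contZ; exact: contM.
have c3 : continuous (fun x => 4 * c ^+ 2 * (w x * w x)) by apply: contZ; exact: contM.
rewrite int01D //; last exact: contD.
rewrite int01D // int01Z; last exact: contM.
rewrite int01Z; last exact: contM.
rewrite (_ : int01 (fun x => w x * w x) = 2^-1); last by rewrite int01_cos_cos // eqxx mul1r.
rewrite -/(fcoef h n) -/c (_ : (fun x => h x ^+ 2) = (fun x => h x * h x)); last by apply: funext => x; rewrite expr2.
lra.
Qed.

(** These are the translates that occur in a Hecke operator. Summation over b keeps the frequencies
    dk and turns them into ak, so frequency n receives a contribution from k = n / a alone. The
    computation is made on Fourier partial sums, and the error $dC/K$ tends to zero. *)
Lemma fcoef_translates a d n : (0 < a)%N -> (0 < d)%N -> (0 < n)%N ->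
  fcoef (fun x => \sum_(0 <= b < d) h ((a%:R * x + b%:R) / d%:R)) n =
  if (a %| n)%N then d%:R * fcoef h (n %/ a * d) else 0.
Proof.
move=> a0 d0 n0.
have dR : d%:R != 0 :> R by rewrite pnatr_eq0 -lt0n.
have [C C0 hC] := fourier_inversion hper heven dh dh1 ch2.
pose g x := \sum_(0 <= b < d) h ((a%:R * x + b%:R) / d%:R).
pose w x : R := cos (2 * pi * n%:R * x).
pose X := if (a %| n)%N then d%:R * fcoef h (n %/ a * d) else 0.
have cw : continuous w by exact: cont_cosax.
have cg : continuous g.
  apply: cont_sum => b.
  have -> : (fun x => h ((a%:R * x + b%:R) / d%:R)) = (fun x => h ((a%:R / d%:R) * x + b%:R / d%:R)).
    by apply: funext => x; congr h; field.
  exact: cont_affine.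
suff : `|fcoef g n - X| <= 0 by rewrite normr_le0 subr_eq0 => /eqP.
apply: (@le_of_le_div _ _ _ (d%:R * C) (n * d)) => K nK; rewrite add0r.
have K0 : (0 < K)%N by apply: leq_trans nK; rewrite muln_gt0 n0.
pose s x := \sum_(0 <= b < d) fourier_sum h K ((a%:R * x + b%:R) / d%:R).
have sE x : s x = d%:R * fcoef h 0 + \sum_(1 <= k < K.+1) (2 * fcoef h k) *
    (if (d %| k)%N then d%:R * cos (2 * pi * (k %/ d * a)%:R * x) else 0).
  rewrite /s /fourier_sum big_split /= sumr_const_nat subn0 -[_ *+ d]mulr_natl; congr (_ + _).
  rewrite -mulr_sumr exchange_big mulr_sumr /=; apply: eq_bigr => k _.
  rewrite -mulr_sumr mulrA; congr (_ * _).
  rewrite (_ : (if _ then _ else _) = if (d %| k)%N then d%:R * cos (2 * pi * k%:R * (a%:R * x / d%:R)) else 0).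
    rewrite -sum_cos_grid_mod //; apply: eq_bigr => b _; congr cos; field => //.
  case: ifP => // /dvdnP[q ->]; rewrite mulnK // !natrM; congr (_ * cos _); field => //.
have ct k : continuous (fun x : R => if (d %| k)%N then d%:R * cos (2 * pi * (k %/ d * a)%:R * x) else 0).
  by case: (d %| k)%N; [apply: contZ; exact: cont_cosax|exact: cont_cst].
have cs : continuous s.
  rewrite (_ : s = (fun x => d%:R * fcoef h 0 + \sum_(1 <= k < K.+1) (2 * fcoef h k) *
    (if (d %| k)%N then d%:R * cos (2 * pi * (k %/ d * a)%:R * x) else 0))); last by apply: funext => x; rewrite sE.
  apply: contD; first exact: cont_cst.
  by apply: cont_sum => k; apply: contZ; exact: ct.
have gs x : `|g x - s x| <= d%:R * C / K%:R.
  rewrite /g /s -sumrB; apply: (le_trans (ler_norm_sum _ _ _)).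
  apply: (@le_trans _ _ (\sum_(0 <= b < d) C / K%:R)); first by apply: ler_sum => b _; exact: hC.
  by rewrite sumr_const_nat subn0 -[_ *+ d]mulr_natl mulrA.
have -> : X = int01 (fun x => s x * w x).
  have -> : (fun x => s x * w x) = (fun x => d%:R * fcoef h 0 * w x + \sum_(1 <= k < K.+1) (2 * fcoef h k) *
     ((if (d %| k)%N then d%:R * cos (2 * pi * (k %/ d * a)%:R * x) else 0) * w x)).
    by apply: funext => x; rewrite sE mulrDl mulr_suml; congr (_ + _); apply: eq_bigr => k _; rewrite mulrA.
  have ct' k : continuous (fun x => (if (d %| k)%N then d%:R * cos (2 * pi * (k %/ d * a)%:R * x) else 0) * w x) by exact: contM.
  rewrite int01D; last 2 first.
  - by apply: contZ.
  - by apply: cont_sum => k; apply: contZ; exact: ct'.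
  rewrite int01Z // /w int01_cos (negPf (lt0n_neq0 n0)) mulr0 add0r -/w int01_sum; last by move=> k; apply: contZ; exact: ct'.
  have term k : int01 (fun x => 2 * fcoef h k * ((if (d %| k)%N then d%:R * cos (2 * pi * (k %/ d * a)%:R * x) else 0) * w x))
     = if (d %| k)%N && (k %/ d * a == n)%N then d%:R * fcoef h k else 0.
    rewrite int01Z; last exact: ct'.
    case: (d %| k)%N => /=; last first.
      by under eq_fun do rewrite mul0r; rewrite int01_cst mulr0.
    under eq_fun do rewrite -mulrA; rewrite int01Z; last by apply: contM => //; exact: cont_cosax.
    by rewrite int01_cos_cos //; case: eqP => _ /=; field.
  under eq_bigr do rewrite term.
  rewrite /X; case: ifP => [/dvdnP[q nE]|an]; last first.
    rewrite big1 // => k _; case: ifP => // /andP[_ /eqP E]; move: an; rewrite -E dvdn_mull //.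
  have q0 : (0 < q)%N by case: q nE n0 => //; rewrite mul0n => ->.
  have qd : (q * d <= n * d)%N by rewrite nE leq_mul // leq_pmulr.
  have qdm : (q * d)%N \in index_iota 1 K.+1.
    by rewrite mem_index_iota muln_gt0 q0 d0 ltnS (leq_trans qd).
  rewrite nE mulnK // (bigD1_seq (q * d)%N) ?iota_uniq //=.
  rewrite dvdn_mull // mulnK // eqxx /= big1_seq ?addr0 // => k /andP[kq _].
  case: ifP => // /andP[/dvdnP[r kE]]; rewrite kE mulnK // eqn_pmul2r // => /eqP rq.
  by move: kq; rewrite kE rq eqxx.
rewrite /fcoef -/g.
have -> : int01 (fun x => g x * cos (2 * pi * n%:R * x)) - int01 (fun x => s x * w x)
   = int01 (fun x => (g x - s x) * w x).
  have -> : (fun x => (g x - s x) * w x) = (fun x => g x * w x + (-1) * (s x * w x)).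
    by apply: funext => x; ring.
  by rewrite int01D ?int01Z ?mulN1r //; try apply: contZ; exact: contM.
apply: int01_bound => [|x _].
  by apply: contM => //; apply: contD => //; exact: contN.
rewrite normrM; apply: (le_trans _ (gs x)); by rewrite ler_piMr // cos_max.
Qed.

End FourierMore.

Section RealCoordinates.
Variable R : realType.

Lemma is_derive_slice_x (g : R * R -> R) x y : derivable g (x, y) (1, 0) ->
  is_derive x (1 : R) (fun u => g (u, y)) (d_x g (x, y)).
Proof.
move=> dg.
have E : (fun h : R => h^-1 *: (((fun u => g (u, y)) \o shift x) (h *: (1 : R)) - g (x, y)))
  = (fun h : R => h^-1 *: ((g \o shift (x, y)) (h *: ((1, 0) : R * R)) - g (x, y))).
  apply: funext => h; congr (_ *: (_ - _)); rewrite /=.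
  have -> : h *: ((1, 0) : R * R) + (x, y) = (h *: (1 : R) + x, h *: (0 : R) + y) by [].
  by rewrite scaler0 add0r.
by apply: DeriveDef; rewrite /derivable /derive E.
Qed.

Lemma is_derive_slice_y (g : R * R -> R) x y : derivable g (x, y) (0, 1) ->
  is_derive y (1 : R) (fun u => g (x, u)) (d_y g (x, y)).
Proof.
move=> dg.
have E : (fun h : R => h^-1 *: (((fun u => g (x, u)) \o shift y) (h *: (1 : R)) - g (x, y)))
  = (fun h : R => h^-1 *: ((g \o shift (x, y)) (h *: ((0, 1) : R * R)) - g (x, y))).
  apply: funext => h; congr (_ *: (_ - _)); rewrite /=.
  have -> : h *: ((0, 1) : R * R) + (x, y) = (h *: (0 : R) + x, h *: (1 : R) + y) by [].
  by rewrite scaler0 add0r.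
by apply: DeriveDef; rewrite /derivable /derive E.
Qed.

Lemma cont_slice_x (g : R * R -> R) (x y : R) : {for (x, y), continuous g} ->
  {for x, continuous (fun u => g (u, y))}.
Proof.
move=> cg; apply: (@continuous_comp _ _ _ (fun u : R => (u, y)) g); last exact: cg.
by apply: (@cvg_pair _ _ _ _ (nbhs x) (nbhs y) _ _ _ (fun u : R => u) (fun=> y)); [exact: cvg_id|exact: cvg_cst].
Qed.

Lemma bounded_rectangle (g : R * R -> R) a b c d :
  (forall x y, a <= x <= b -> c <= y <= d -> {for (x, y), continuous g}) ->
  exists2 B, 0 <= B & forall x y, a <= x <= b -> c <= y <= d -> `|g (x, y)| <= B.
Proof.
move=> cg.
have cK := compact_setX (@segment_compact R a b) (@segment_compact R c d).
have cw : {within `[a, b] `*` `[c, d], continuous g}.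
  apply: continuous_in_subspaceT => -[x y]; rewrite inE /= !in_itv /= => -[xab ycd]; exact: cg.
have /compact_bounded[M [Mr HM]] := continuous_compact cw cK.
exists (`|M| + 1) => [|x y xab ycd]; first by rewrite addr_ge0.
apply: (HM (`|M| + 1)); first by rewrite ltr_pwDr // ler_norm.
by exists (x, y) => //=; rewrite !in_itv.
Qed.

(** Differentiation under the integral sign. The dominating constant is local: on the heights
    between y/2 and 2y, [gy] is bounded by compactness. *)
Lemma is_derive_int01 (g gy : R * R -> R) (w : R -> R) (y : R) : continuous w -> 0 < y ->
  (forall x v : R, 0 < v -> is_derive v (1 : R) (fun u => g (x, u)) (gy (x, v))) ->
  (forall v : R, 0 < v -> continuous (fun x => g (x, v))) ->
  (forall x v : R, 0 < v -> {for (x, v), continuous gy}) ->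
  is_derive y (1 : R) (fun v => int01 (fun x => g (x, v) * w x)) (int01 (fun x => gy (x, y) * w x)).
Proof.
move=> cw y0 dg cg cgy.
pose mu := @lebesgue_measure R.
pose F (v x : R) := g (x, v) * w x.
have [W W0 hW] := bounded_segment 0 1 cw.
have [B B0 hB] : exists2 B, 0 <= B & forall x v, 0 <= x <= 1 -> y / 2 <= v <= 2 * y -> `|gy (x, v)| <= B.
  apply: bounded_rectangle => x v _ /andP[yv _]; apply: cgy.
  by apply: lt_le_trans yv; rewrite divr_gt0.
have dF (v x : R) : 0 < v -> is_derive v (1 : R) (F ^~ x) (gy (x, v) * w x).
  move=> v0; have := is_deriveM (dg x v v0) (is_derive_cst (w x) v (1 : R)).
  by move=> h; apply: (is_derive_eq h); rewrite scaler0 add0r /GRing.scale /= mulrC.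
have pos (v : R) : `]y / 2, 2 * y[%classic v -> 0 < v.
  rewrite /= in_itv /= => /andP[yv _]; by apply: lt_trans yv; rewrite divr_gt0.
have Iy : `]y / 2, 2 * y[%classic y by rewrite /= in_itv /=; apply/andP; split; lra.
have intF (v : R) : `]y / 2, 2 * y[%classic v -> mu.-integrable `[0%R, 1%R] (EFin \o F v).
  by move=> /pos v0; apply: cont_integrable; apply: contM => //; exact: cg.
have derF (v x : R) : `]y / 2, 2 * y[%classic v -> `[0%R, 1%R]%classic x -> derivable (F ^~ x) v 1.
  by move=> /pos v0 _; case: (dF v x v0).
have E (v x : R) : 0 < v -> partial1of2 F v x = gy (x, v) * w x.
  by move=> v0; rewrite /partial1of2 derive1E; apply: derive_val; exact: dF.
have intG : mu.-integrable `[0%R, 1%R] (EFin \o (fun _ : R => B * W)).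
  by apply: cont_integrable; exact: cont_cst.
have ub (v x : R) : `]y / 2, 2 * y[%classic v -> `[0%R, 1%R]%classic x -> `|partial1of2 F v x| <= B * W.
  move=> Iv; rewrite /= in_itv /= => x01; rewrite E; last exact: pos.
  rewrite normrM; apply: ler_pM => //; last exact: hW.
  by apply: hB => //; move: Iv; rewrite /= in_itv /= => /andP[a b]; apply/andP; split; exact: ltW.
have G0 (x : R) : 0 <= B * W by rewrite mulr_ge0.
have mI : measurable (`[0%R, 1%R]%classic : set R) by [].
apply: DeriveDef.
  exact: (@derivable_under_integral R _ _ mu F _ mI y _ _ Iy intF derF _ G0 intG ub).
have := @differentiation_under_integral R _ _ mu F _ mI y _ _ Iy intF derF _ G0 intG ub.
rewrite derive1E => ->; congr fine; apply: eq_integral => x _; by rewrite E.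
Qed.

End RealCoordinates.

Lemma int01_lin3 (R : realType) (F1 F2 F3 : R -> R) (a b c : R) :
  continuous F1 -> continuous F2 -> continuous F3 ->
  int01 (fun x => a * F1 x + b * F2 x + c * F3 x) = a * int01 F1 + b * int01 F2 + c * int01 F3.
Proof.
move=> c1 c2 c3.
have z1 : continuous (fun x => a * F1 x) by exact: contZ.
have z2 : continuous (fun x => b * F2 x) by exact: contZ.
have z3 : continuous (fun x => c * F3 x) by exact: contZ.
by rewrite (int01D (contD z1 z2) z3) (int01D z1 z2) (int01Z _ c1) (int01Z _ c2) (int01Z _ c3).
Qed.

(** * Slices of the form and the equation of its coefficients *)

Section Form.
Variable R : realType.
Variables (phi : R[i] -> R) (t : R).
Hypothesis hphi : even_hecke_maass_cusp_form phi t.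

Let f : R * R -> R := in_coords phi.
Let hx y : R -> R := fun x => f (x, y).
Let hx1 y : R -> R := fun x => d_x f (x, y).
Let hx2 y : R -> R := fun x => d_x (d_x f) (x, y).

Let C1f (x y : R) (y0 : 0 < y) :
  [/\ derivable f (x, y) (1, 0), derivable f (x, y) (0, 1),
      {for (x, y), continuous (d_x f)} & {for (x, y), continuous (d_y f)}].
Proof. have [h _ _] := ehm_C2 hphi; exact: (h (x, y) y0). Qed.

Let C1fx (x y : R) (y0 : 0 < y) :
  [/\ derivable (d_x f) (x, y) (1, 0), derivable (d_x f) (x, y) (0, 1),
      {for (x, y), continuous (d_x (d_x f))} & {for (x, y), continuous (d_y (d_x f))}].
Proof. have [_ h _] := ehm_C2 hphi; exact: (h (x, y) y0). Qed.

Let C1fy (x y : R) (y0 : 0 < y) :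
  [/\ derivable (d_y f) (x, y) (1, 0), derivable (d_y f) (x, y) (0, 1),
      {for (x, y), continuous (d_x (d_y f))} & {for (x, y), continuous (d_y (d_y f))}].
Proof. have [_ _ h] := ehm_C2 hphi; exact: (h (x, y) y0). Qed.

Lemma slice_derive (y : R) : 0 < y -> forall x : R, is_derive x 1 (hx y) (hx1 y x).
Proof. move=> y0 x; have [h _ _ _] := C1f x y0; exact: (is_derive_slice_x h). Qed.

Lemma slice_derive2 (y : R) : 0 < y -> forall x : R, is_derive x 1 (hx1 y) (hx2 y x).
Proof. move=> y0 x; have [h _ _ _] := C1fx x y0; exact: (is_derive_slice_x h). Qed.

Lemma slice_cont2 (y : R) : 0 < y -> continuous (hx2 y).
Proof. move=> y0 x; have [_ _ h _] := C1fx x y0; exact: (cont_slice_x h). Qed.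

Let mat2 (a b c d : int) : 'M[int]_2 :=
  \matrix_(i, j) if i == 0 then (if j == 0 then a else b) else (if j == 0 then c else d).

Lemma det_mat2 a b c d : \det (mat2 a b c d) = a * d - b * c.
Proof.
rewrite (expand_det_row _ 0) !big_ord_recl big_ord0 addr0 /cofactor !det_mx11 !mxE /=.
by rewrite !addn0 expr0 mul1r expr1 mulN1r mulrN.
Qed.

Lemma mobius_mat2 a b c d (z : R[i]) :
  mobius (mat2 a b c d) z = (a%:~R * z + b%:~R) / (c%:~R * z + d%:~R).
Proof. by rewrite /mobius !mxE /=. Qed.

Lemma form_periodic (x y : R) : 0 < y -> f (x + 1, y) = f (x, y).
Proof.
move=> y0; rewrite /f /in_coords /=.
have := ehm_invariant hphi (g := mat2 1 1 0 1) (z := (x +i* y)%C); rewrite det_mat2 mobius_mat2.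
move=> /(_ (eqP (eqxx _)) y0) <-; congr phi.
rewrite mul1r mul0r add0r divr1; apply/eqP; rewrite eq_complex /=; by rewrite addr0 !eqxx.
Qed.

Lemma form_inversion (x y : R) : 0 < y ->
  f (- x / (x ^+ 2 + y ^+ 2), y / (x ^+ 2 + y ^+ 2)) = f (x, y).
Proof.
move=> y0; rewrite /f /in_coords /=.
have := ehm_invariant hphi (g := mat2 0 (-1) 1 0) (z := (x +i* y)%C); rewrite det_mat2 mobius_mat2.
move=> /(_ (eqP (eqxx _)) y0) <-; congr phi.
rewrite mul0r add0r mul1r addr0 mulrN1z mulN1r; apply/eqP; rewrite eq_complex /=.
by rewrite mulNr opprK !eqxx.
Qed.

Lemma form_even (x y : R) : 0 < y -> f (- x, y) = f (x, y).
Proof.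
move=> y0; rewrite /f /in_coords /= -[RHS](ehm_even hphi) //; congr phi.
by apply/eqP; rewrite eq_complex /= opprK !eqxx.
Qed.

Let per y (y0 : 0 < y) x : hx y (x + 1) = hx y x. Proof. exact: form_periodic. Qed.
Let ev y (y0 : 0 < y) x : hx y (- x) = hx y x. Proof. exact: form_even. Qed.

Definition coef n y := fcoef (hx y) n.

Lemma coef0 y : 0 < y -> coef 0 y = 0.
Proof.
move=> y0; have := ehm_cuspidal hphi y0; rewrite /coef /fcoef /int01 => E.
rewrite -[RHS]E; congr fine; apply: eq_integral => x _.
by rewrite mulr0 mul0r cos0 mulr1.
Qed.

Lemma slice_fourier y : 0 < y -> exists2 C, 0 <= C & forall K x, (0 < K)%N ->
  `|f (x, y) - 2 * \sum_(1 <= n < K.+1) coef n y * cos (2 * pi * n%:R * x)| <= C / K%:R.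
Proof.
move=> y0; have [C C0 hC] := fourier_inversion (per y0) (ev y0) (slice_derive y0) (slice_derive2 y0) (slice_cont2 y0).
exists C => // K x K0; have := hC K x K0; rewrite /fourier_sum -/(coef 0 y) coef0 // add0r.
exact.
Qed.

Definition coef' n y := int01 (fun x => d_y f (x, y) * cos (2 * pi * n%:R * x)).
Definition coef'' n y := int01 (fun x => d_y (d_y f) (x, y) * cos (2 * pi * n%:R * x)).

Lemma coef_derive n (y : R) : 0 < y -> is_derive y 1 (coef n) (coef' n y).
Proof.
move=> y0; apply: (@is_derive_int01 R f (d_y f) _ y (@cont_cosax R (2 * pi * n%:R)) y0).
- move=> x v v0; have [_ h _ _] := C1f x v0; exact: (is_derive_slice_y h).
- move=> v v0; exact: (is_derive_continuous (slice_derive v0)).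
- move=> x v v0; have [_ _ _ h] := C1f x v0; exact: h.
Qed.

Lemma coef_derive2 n (y : R) : 0 < y -> is_derive y 1 (coef' n) (coef'' n y).
Proof.
move=> y0; apply: (@is_derive_int01 R (d_y f) (d_y (d_y f)) _ y (@cont_cosax R (2 * pi * n%:R)) y0).
- move=> x v v0; have [_ h _ _] := C1fy x v0; exact: (is_derive_slice_y h).
- move=> v v0 x; have [_ _ _ h] := C1f x v0; exact: (cont_slice_x h).
- move=> x v v0; have [_ _ _ h] := C1fy x v0; exact: h.
Qed.

(** The eigenvalue equation is integrated against the cosine; two integrations by parts turn
    $\partial_x^2$ into $-(2\pi n)^2$, without boundary terms by periodicity. *)
Lemma coef_ode n (y : R) : 0 < y ->
  y ^+ 2 * coef'' n y + (4^-1 + t ^+ 2 - (2 * pi * n%:R * y) ^+ 2) * coef n y = 0.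
Proof.
move=> y0; pose w x : R := cos (2 * pi * n%:R * x).
have cw : continuous w by exact: cont_cosax.
have c0 : continuous (fun x => f (x, y)) by exact: is_derive_continuous (slice_derive y0).
have c2 := slice_cont2 y0.
have cy : continuous (fun x => d_y (d_y f) (x, y)).
  move=> x; have [_ _ _ h] := C1fy x y0; exact: (cont_slice_x h).
have Z : int01 (fun x => (y ^+ 2 * (hx2 y x * w x) + y ^+ 2 * (d_y (d_y f) (x, y) * w x))
   + (4^-1 + t ^+ 2) * (f (x, y) * w x)) = 0.
  rewrite -[RHS](@int01_cst R 0); congr int01; apply: funext => x.
  have := ehm_laplace hphi (p := (x, y)) y0; rewrite /= -/f => E.
  transitivity ((y ^+ 2 * (d_x (d_x f) (x, y) + d_y (d_y f) (x, y)) + (4^-1 + t ^+ 2) * f (x, y)) * w x).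
    by rewrite /hx2; ring.
  by rewrite E mul0r.
have m1 : continuous (fun x => hx2 y x * w x) by exact: (contM c2 cw).
have m2 : continuous (fun x => d_y (d_y f) (x, y) * w x) by exact: (contM cy cw).
have m3 : continuous (fun x => f (x, y) * w x) by exact: (contM c0 cw).
have E : y ^+ 2 * int01 (fun x => hx2 y x * w x) + y ^+ 2 * coef'' n y + (4^-1 + t ^+ 2) * coef n y = 0.
  by rewrite -[RHS]Z; apply/esym; exact: (int01_lin3 (y ^+ 2) (y ^+ 2) (4^-1 + t ^+ 2) m1 m2 m3).
have F := fcoef_second (per y0) (slice_derive y0) (slice_derive2 y0) (slice_cont2 y0) n.
rewrite F -/(coef n y) in E.
rewrite -[RHS]E; ring.
Qed.

(** The regularity hypotheses speak of continuity of partial derivatives. The eigenvalue equation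
    expresses f through its second derivatives, which are jointly continuous, because
    $\frac14+t^2\ne0$. *)
Lemma form_continuous x y : 0 < y -> {for (x, y), continuous f}.
Proof.
move=> y0.
have t0 := ehm_spectral_gt0 hphi.
have k0 : 4^-1 + t ^+ 2 != 0 by rewrite lt0r_neq0 // addr_gt0 // exprn_gt0.
pose g (p : R * R) := - (p.2 ^+ 2 * (d_x (d_x f) p + d_y (d_y f) p)) / (4^-1 + t ^+ 2).
have E p : 0 < p.2 -> f p = g p.
  move=> p0; have := ehm_laplace hphi p0; rewrite -/f => L.
  by rewrite /g; apply: (mulIf k0); rewrite divfK //; move: L; lra.
have cg : {for (x, y), continuous g}.
  have cs : {for (x, y), continuous (fun p : R * R => p.2)} by exact: cvg_snd.
  apply: cvgM; last exact: cvg_cst.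
  apply: cvgN; apply: cvgM.
    by apply: cvgM.
  have [_ _ h1 _] := C1fx x y0; have [_ _ _ h2] := C1fy x y0.
  apply: cvgD; [exact: h1|exact: h2].
rewrite /prop_for /continuous_at E //.
apply: cvg_trans cg; apply: near_eq_cvg.
have : nbhs (x, y) [set p : R * R | 0 < p.2].
  exists (setT, [set v : R | 0 < v]); last by move=> [a b] [].
  by split; [exact: filterT|apply: open_nbhs_nbhs; split; [exact: open_gt|]].
by apply: filterS => p p0; rewrite E.
Qed.

End Form.

(** * The Bessel equation *)

Section Calculus.
Variable R : realType.
Implicit Types (f g : R -> R) (x a b : R).

Lemma der_eq f x a b : is_derive x 1 f a -> a = b -> is_derive x 1 f b.
Proof. by move=> h <-. Qed.

Lemma derC a x : is_derive x 1 (fun _ : R => a) 0.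
Proof. exact: is_derive_cst. Qed.

Lemma derI x : is_derive x 1 (fun z : R => z) 1.
Proof. exact: is_derive_id. Qed.

Lemma derD f g x a b : is_derive x 1 f a -> is_derive x 1 g b ->
  is_derive x 1 (fun z => f z + g z) (a + b).
Proof. by move=> hf hg; exact: is_deriveD. Qed.

Lemma derN f x a : is_derive x 1 f a -> is_derive x 1 (fun z => - f z) (- a).
Proof. by move=> hf; exact: is_deriveN. Qed.

Lemma derM f g x a b : is_derive x 1 f a -> is_derive x 1 g b ->
  is_derive x 1 (fun z => f z * g z) (a * g x + f x * b).
Proof.
move=> hf hg; apply: (der_eq (is_deriveM hf hg)).
by rewrite /GRing.scale /= addrC [g x * a]mulrC.
Qed.

Lemma derZ f x a b : is_derive x 1 f a -> is_derive x 1 (fun z => b * f z) (b * a).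
Proof. by move=> hf; apply: (der_eq (derM (derC b x) hf)); rewrite mul0r add0r. Qed.

Lemma derX f x a : is_derive x 1 f a -> is_derive x 1 (fun z => f z ^+ 2) (2 * f x * a).
Proof.
move=> hf; have -> : (fun z => f z ^+ 2) = (fun z => f z * f z) by apply: funext => z; rewrite expr2.
by apply: (der_eq (derM hf hf)); ring.
Qed.

Lemma der_comp f g x a b : is_derive x 1 f a -> is_derive (f x) 1 g b ->
  is_derive x 1 (fun z => g (f z)) (a * b).
Proof. by move=> hf hg; have := @is_derive1_comp R g f x _ _ hg hf; rewrite mulrC. Qed.

Lemma derE f x a : is_derive x 1 f a -> is_derive x 1 (fun z => expR (f z)) (a * expR (f x)).
Proof. by move=> hf; apply: (der_comp hf); exact: is_derive_expR. Qed.

Lemma mvt_ex f f' a b : (forall x, a <= x <= b -> is_derive x 1 f (f' x)) -> a <= b ->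
  exists2 c, a <= c <= b & f b - f a = f' c * (b - a).
Proof.
move=> df; rewrite le_eqVlt => /predU1P[<-|ab].
  by exists a; rewrite ?lexx // !subrr mulr0.
have [||c] := @MVT R f f' a b ab.
- by move=> x; rewrite in_itv /= => /andP[ax xb]; apply: df; rewrite !ltW.
- apply: derivable_within_continuous => x; rewrite in_itv /= => xab.
  by case: (df x xab).
- by rewrite in_itv /= => /andP[ac cb] e; exists c => //; rewrite !ltW.
Qed.

Lemma ge0_der_le f f' a b : (forall x, a <= x <= b -> is_derive x 1 f (f' x)) ->
  (forall x, a <= x <= b -> 0 <= f' x) -> a <= b -> f a <= f b.
Proof.
move=> df f0 ab; have [c cab e] := mvt_ex df ab.
by rewrite -subr_ge0 e mulr_ge0 ?f0 ?subr_ge0.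
Qed.

Lemma le0_der_ge f f' a b : (forall x, a <= x <= b -> is_derive x 1 f (f' x)) ->
  (forall x, a <= x <= b -> f' x <= 0) -> a <= b -> f b <= f a.
Proof.
move=> df f0 ab; have [c cab e] := mvt_ex df ab.
by rewrite -subr_le0 e mulr_le0_ge0 ?f0 ?subr_ge0.
Qed.

Lemma der_dist_le f f' B a b : (forall x, a <= x <= b -> is_derive x 1 f (f' x)) ->
  (forall x, a <= x <= b -> `|f' x| <= B) -> a <= b -> `|f b - f a| <= B * (b - a).
Proof.
move=> df f0 ab; have [c cab e] := mvt_ex df ab.
by rewrite e normrM [`|b - a|]ger0_norm ?subr_ge0 // ler_wpM2r ?subr_ge0 // f0.
Qed.

Lemma norm_le_sqr x a : 0 <= a -> x ^+ 2 <= a ^+ 2 -> `|x| <= a.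
Proof. by move=> a0 h; rewrite -(@ler_pXn2r _ 2) ?nnegrE // real_normK ?num_real. Qed.

Lemma der_ln x : 0 < x -> is_derive x (1 : R) (@ln R) x^-1.
Proof. exact: is_derive1_ln. Qed.

End Calculus.

(** * The Bessel equation at and beyond the turning point *)

Section BesselODE.
Variable R : realType.
Variables (t : R) (K K1 : R -> R).
Hypothesis t2 : 2 <= t.
(** In the variable $s=\log y$ the normalized Bessel equation reads $K''=-QK$ with $Q=t^2-(2\pi
    e^s)^2$, so that the turning point is at $2\pi e^s=t$. The hypothesis [Kgrowth] is what singles
    out the decaying solution. *)
Definition freq2 (t s : R) := t ^+ 2 - (2 * pi * expR s) ^+ 2.
Local Notation Q := (freq2 t).
Hypothesis dK : forall s : R, is_derive s 1 K (K1 s).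
Hypothesis dK1 : forall s : R, is_derive s 1 K1 (- (Q s * K s)).
Hypothesis Kgrowth : forall s1 d, 0 < d -> exists2 s, s1 <= s & K s ^+ 2 < d * expR s.

Let derKK (s : R) : is_derive s 1 (fun z => K z * K1 z) (K1 s ^+ 2 - Q s * K s ^+ 2).
Proof. by apply: (der_eq (derM (dK s) (dK1 s))); ring. Qed.

Lemma freq2_le0 s s' : Q s <= 0 -> s <= s' -> Q s' <= 0.
Proof.
rewrite /freq2 !subr_le0 => h ss; apply: (le_trans h).
have p0 := pi_gt0 R; have e0 := expR_gt0 s; have e1 := expR_gt0 s'.
rewrite ler_pXn2r ?nnegrE //; try by rewrite !mulr_ge0 // ltW.
by rewrite ler_pM2l ?mulr_gt0 // ler_expR.
Qed.

(* [(K K')' = K'^2 - Q K^2 >= 0] past the turning point, and [K K' > 0] there would force exponential growth. *)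
Lemma tail_decreasing s : Q s <= 0 -> K s * K1 s <= 0.
Proof.
move=> Qs; rewrite leNgt; apply/negP => G0.
have T2 := t2; have t0 : 0 < t by lra.
have p0 := pi_gt0 R; have p2 := pi_ge2 R.
pose G z := K z * K1 z; have G0' : 0 < G s by [].
have Gmono a b : s <= a -> a <= b -> G a <= G b.
  move=> sa ab; apply: (ge0_der_le (fun x _ => derKK x)) => // x /andP[ax _].
  have Qx : Q x <= 0 by apply: (freq2_le0 Qs); lra.
  by have := sqr_ge0 (K1 x); have := sqr_ge0 (K x); nra.
pose s2 := Num.max s (ln t).
have ss2 : s <= s2 by rewrite le_max lexx.
have Q1 x : s2 <= x -> Q x <= -1.
  move=> sx; have : t <= expR x.
    rewrite -[t]lnK ?posrE // ler_expR; apply: le_trans sx; by rewrite le_max lexx orbT.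
  move=> tx; rewrite /freq2 exprMn.
  have : t ^+ 2 <= expR x ^+ 2 by rewrite ler_pXn2r ?nnegrE ?expR_ge0 // ltW.
  have : 4 <= pi ^+ 2 :> R by nra.
  have : 4 <= t ^+ 2 by nra.
  by rewrite !exprMn; nra.
pose g := G s.
have dF x : is_derive x (1 : R) (fun z => G z * expR (- (2 * z)))
    ((K1 x ^+ 2 - Q x * K x ^+ 2 - 2 * G x) * expR (- (2 * x))).
  by apply: (der_eq (derM (derKK x) (derE (derN (derZ 2 (derI x)))))); rewrite /G; ring.
have Gexp x : s2 <= x -> g * expR (2 * (x - s2)) <= G x.
  move=> sx.
  have : G s2 * expR (- (2 * s2)) <= G x * expR (- (2 * x)).
    apply: (ge0_der_le (fun z _ => dF z)) => // z /andP[sz _].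
    rewrite mulr_ge0 ?expR_ge0 // /G.
    have := Q1 _ sz; have := sqr_ge0 (K1 z - K z); have := sqr_ge0 (K z); nra.
  have e0 := expR_gt0 (2 * x).
  rewrite /g; move: (G s) (G s2) (G x) (Gmono s s2 (lexx _) ss2) => g1 u v gu.
  rewrite -(ler_pM2r e0) -!mulrA -!expRD addNr expR0 mulr1.
  move=> h; apply: le_trans h.
  rewrite (_ : - (2 * s2) + 2 * x = 2 * (x - s2)); last by ring.
  by rewrite ler_pM2r ?expR_gt0.
have dK2 x : is_derive x (1 : R) (fun z => K z ^+ 2 - g * expR (2 * (z - s2))) (2 * G x - 2 * g * expR (2 * (x - s2))).
  apply: (der_eq (derD (derX (dK x)) (derN (derZ g (derE (derZ 2 (derD (derI x) (derC (- s2) x)))))))).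
  by rewrite /G; ring.
have K2 x : s2 <= x -> g * (expR (2 * (x - s2)) - 1) <= K x ^+ 2.
  move=> sx.
  have : K s2 ^+ 2 - g * expR (2 * (s2 - s2)) <= K x ^+ 2 - g * expR (2 * (x - s2)).
    apply: (ge0_der_le (fun z _ => dK2 z)) => // z /andP[sz _].
    by have := Gexp z sz; lra.
  by rewrite subrr mulr0 expR0; have := sqr_ge0 (K s2); lra.
have g0 : 0 < g by [].
pose d := g * expR (- s2) / 2.
have d0 : 0 < d by apply: mulr_gt0; [apply: mulr_gt0 => //; exact: expR_gt0|].
have [x sx] := Kgrowth (s2 + 1) d0.
have sx2 : s2 <= x by lra.
have h := K2 x sx2; rewrite ltNge => /negP; apply; apply: (le_trans _ h).
have -> : d * expR x = g * (expR (x - s2) / 2) by rewrite /d [x - s2]addrC expRD; ring.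
rewrite ler_pM2l // expRM_natl.
set E := expR (x - s2).
have : 2 <= E by apply: le_trans (expR_ge1Dx _); lra.
by move=> E2; nra.
Qed.

Lemma K_sqr_decreasing s s' : Q s <= 0 -> s <= s' -> K s' ^+ 2 <= K s ^+ 2.
Proof.
move=> Qs ss; apply: (le0_der_ge (fun x _ => derX (dK x))) => // x /andP[sx _].
by rewrite -mulrA; have := tail_decreasing (freq2_le0 Qs sx); lra.
Qed.

Lemma freq2_past s : t <= expR s -> (2 * pi) ^+ 2 * expR s ^+ 2 - expR s ^+ 2 <= - Q s <= (2 * pi) ^+ 2 * expR s ^+ 2.
Proof.
move=> ts; rewrite /freq2 exprMn opprB; have T2 := t2.
have : t ^+ 2 <= expR s ^+ 2 by rewrite ler_pXn2r ?nnegrE ?expR_ge0 //; lra.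
have := sqr_ge0 t; lra.
Qed.

Lemma freq2_past_le0 s : t <= expR s -> Q s <= 0.
Proof.
move=> ts; have /andP[h _] := freq2_past ts; have p2 := pi_ge2 R.
have := expR_gt0 s; set E := expR s in h *; move=> E0; have : 0 <= E ^+ 2 * ((2 * pi) ^+ 2 - 1) by apply: mulr_ge0; nra.
nra.
Qed.

(** If $G=KK'+e^sK^2$ were positive at s, then $G'\ge e^xG$ would force it to grow like $\exp(e^x)$,
    against the bound $e^xK(s)^2$. The rate $e^s$ lies well below the true one, which leaves room in
    the inequalities. *)
Lemma K_fast s : t <= expR s -> K s * K1 s <= - (expR s * K s ^+ 2).
Proof.
move=> ts; rewrite -subr_le0 opprK leNgt; apply/negP => G0.
have p0 := pi_gt0 R; have p2 := pi_ge2 R.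
have tx x : s <= x -> t <= expR x by move=> sx; rewrite (le_trans ts) // ler_expR.
pose G z := K z * K1 z + expR z * K z ^+ 2.
have dG x : is_derive x (1 : R) G (K1 x ^+ 2 - Q x * K x ^+ 2 + expR x * K x ^+ 2 + 2 * expR x * (K x * K1 x)).
  by apply: (der_eq (derD (derKK x) (derM (derE (derI x)) (derX (dK x))))); ring.
have dF x : is_derive x (1 : R) (fun z => G z * expR (- expR z))
   ((K1 x ^+ 2 - Q x * K x ^+ 2 + expR x * K x ^+ 2 + 2 * expR x * (K x * K1 x) - expR x * G x) * expR (- expR x)).
  by apply: (der_eq (derM (dG x) (derE (derN (derE (derI x)))))); ring.
have Gexp x : s <= x -> G s * expR (expR x - expR s) <= G x.
  move=> sx.
  have : G s * expR (- expR s) <= G x * expR (- expR x).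
    apply: (ge0_der_le (fun z _ => dF z)) => // z /andP[sz _].
    rewrite mulr_ge0 ?expR_ge0 // /G.
    have /andP[h _] := freq2_past (tx z sz).
    have e0 := expR_gt0 z; set E := expR z in h e0 *.
    have P16 : 16 <= (2 * pi) ^+ 2 :> R by nra.
    have h2 : 15 * E ^+ 2 <= - Q z.
      apply: le_trans h; have : 0 <= E ^+ 2 * ((2 * pi) ^+ 2 - 16) by rewrite mulr_ge0 ?sqr_ge0 ?subr_ge0.
      lra.
    have := sqr_ge0 (2 * K1 z + E * K z); have K20 := sqr_ge0 (K z).
    have : 15 * E ^+ 2 * K z ^+ 2 <= - Q z * K z ^+ 2 by rewrite ler_wpM2r.
    have : 0 <= E * K z ^+ 2 by apply: mulr_ge0 => //; exact: ltW.
    have : 0 <= E ^+ 2 * K z ^+ 2 by apply: mulr_ge0 => //; exact: sqr_ge0.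
    nra.
  have e0 := expR_gt0 (expR x).
  rewrite -(ler_pM2r e0) -!mulrA -!expRD addNr expR0 mulr1 => h; apply: le_trans h.
  by rewrite [- _ + _]addrC.
(* but [K^2] is nonincreasing *)
have Gle x : s <= x -> G x <= expR x * K s ^+ 2.
  move=> sx; rewrite /G; have := tail_decreasing (freq2_past_le0 (tx x sx)).
  have : expR x * K x ^+ 2 <= expR x * K s ^+ 2.
    by rewrite ler_pM2l ?expR_gt0 //; apply: K_sqr_decreasing => //; exact: freq2_past_le0.
  lra.
have key x : s <= x -> G s * (1 + (expR x - expR s) / 2) ^+ 2 <= expR x * K s ^+ 2.
  move=> sx; apply: le_trans (Gle x sx); apply: le_trans (Gexp x sx).
  have d0 : 0 <= (expR x - expR s) / 2 by rewrite divr_ge0 // subr_ge0 ler_expR.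
  rewrite ler_pM2l // (_ : expR (expR x - expR s) = expR ((expR x - expR s) / 2) ^+ 2).
    rewrite ler_pXn2r ?nnegrE ?expR_ge0 ?expR_ge1Dx //; lra.
  by rewrite -expRM_natl; congr expR; field.
pose g := G s; have g0 : 0 < g by [].
pose E0 := expR s; have E00 : 0 < E0 by exact: expR_gt0.
(* The value of $e^x$ at which the quadratic lower bound of [key] overtakes the linear upper
   bound. *)
pose M := 2 * E0 + 16 * K s ^+ 2 / g + 1.
have kg : 0 <= K s ^+ 2 / g by rewrite divr_ge0 ?sqr_ge0 // ltW.
have M0 : 0 < M by rewrite /M; nra.
have sM : s <= ln M by rewrite -ler_expR lnK ?posrE // -/E0 /M; nra.
have := key _ sM; rewrite lnK ?posrE // -/g -/E0.
have : M * K s ^+ 2 = g * (M * (K s ^+ 2 / g)) by field; rewrite lt0r_neq0.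
move=> ->; rewrite ler_pM2l //.
have := kg; rewrite /M; set k := K s ^+ 2 / g => k0.
have -> : 16 * K s ^+ 2 / g = 16 * k by rewrite /k mulrA.
nra.
Qed.

Lemma K_decay s s' : t <= expR s -> s <= s' -> `|K s'| <= `|K s| * expR (expR s - expR s').
Proof.
move=> ts ss.
have dF x : is_derive x (1 : R) (fun z => K z ^+ 2 * expR (2 * expR z))
    (2 * (K x * K1 x + expR x * K x ^+ 2) * expR (2 * expR x)).
  by apply: (der_eq (derM (derX (dK x)) (derE (derZ 2 (derE (derI x)))))); ring.
have h : K s' ^+ 2 * expR (2 * expR s') <= K s ^+ 2 * expR (2 * expR s).
  apply: (le0_der_ge (fun x _ => dF x)) => // x /andP[sx _].
  have tx : t <= expR x by rewrite (le_trans ts) // ler_expR.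
  rewrite pmulr_lle0 ?expR_gt0 // pmulr_rle0 //; have := K_fast tx; lra.
rewrite -(@ler_pXn2r _ 2) ?nnegrE ?mulr_ge0 ?expR_ge0 // exprMn !real_normK ?num_real //.
rewrite -(ler_pM2r (expR_gt0 (2 * expR s'))); apply: (le_trans h).
rewrite -[leRHS]mulrA -[in leRHS]expRM_natl -expRD; rewrite le_eqVlt; apply/orP; left; apply/eqP; congr (_ * expR _).
by rewrite -mulr_natl; ring.
Qed.

(** If $G=K'^2-(4\pi e^s)^2K^2$ were positive at s, it would stay at least as large, so $|K'|$ would
    be bounded below by a positive constant. Over a long enough interval K would then move by more
    than $2|K(s)|$, although $|K|$ does not increase. *)
Lemma K1_bound s : t <= expR s -> K1 s ^+ 2 <= (4 * pi * expR s) ^+ 2 * K s ^+ 2.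
Proof.
move=> ts; rewrite leNgt; apply/negP => G0.
have p0 := pi_gt0 R; have p2 := pi_ge2 R.
have tx x : s <= x -> t <= expR x by move=> sx; rewrite (le_trans ts) // ler_expR.
pose G z := K1 z ^+ 2 - (4 * pi) ^+ 2 * (expR z ^+ 2 * K z ^+ 2).
have dG x : is_derive x (1 : R) G (2 * (- (K x * K1 x)) * ((4 * pi) ^+ 2 * expR x ^+ 2 + Q x)
    - 2 * (4 * pi) ^+ 2 * expR x ^+ 2 * K x ^+ 2).
  apply: (der_eq (derD (derX (dK1 x)) (derN (derZ ((4 * pi) ^+ 2) (derM (derX (derE (derI x))) (derX (dK x))))))).
  ring.
have Gmono x : s <= x -> G s <= G x.
  move=> sx; apply: (ge0_der_le (fun z _ => dG z)) => // z /andP[sz _].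
  have tz := tx z sz; have /andP[_ h] := freq2_past tz.
  have F := K_fast tz; have e2 : 2 <= expR z by exact: (le_trans t2).
  set E := expR z in e2 h F *; set k := K z ^+ 2 in F *; have k0 : 0 <= k by exact: sqr_ge0.
  set u := - (K z * K1 z); have u1 : E * k <= u by rewrite /u; lra.
  have h3 : 3 * (2 * pi) ^+ 2 * E ^+ 2 <= (4 * pi) ^+ 2 * E ^+ 2 + Q z by nra.
  have P0 : 0 <= (2 * pi) ^+ 2 :> R by exact: sqr_ge0.
  apply: (@le_trans _ _ (2 * (E * k) * (3 * (2 * pi) ^+ 2 * E ^+ 2) - 2 * (4 * pi) ^+ 2 * E ^+ 2 * k)).
    have -> : 2 * (E * k) * (3 * (2 * pi) ^+ 2 * E ^+ 2) - 2 * (4 * pi) ^+ 2 * E ^+ 2 * k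
      = (2 * pi) ^+ 2 * (E ^+ 2 * k) * (6 * E - 8) by ring.
    have e8 : 0 <= 6 * E - 8 by lra.
    by apply: mulr_ge0 => //; apply: mulr_ge0 => //; apply: mulr_ge0 => //; exact: sqr_ge0.
  rewrite lerD2r; apply: ler_pM => //.
  - by apply: mulr_ge0 => //; apply: mulr_ge0 => //; lra.
  - by apply: mulr_ge0; [apply: mulr_ge0|exact: sqr_ge0].
  - lra.
have g0 : 0 < G s by rewrite /G subr_gt0 mulrA -exprMn.
pose r := Num.sqrt (G s); have r0 : 0 < r by rewrite sqrtr_gt0.
have big x : s <= x -> r <= `|K1 x|.
  move=> sx; rewrite -(@ler_pXn2r _ 2) ?nnegrE ?sqrtr_ge0 // sqr_sqrtr ?(ltW g0) // real_normK ?num_real //.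
  apply: (le_trans (Gmono x sx)); rewrite /G lerBlDr lerDl mulr_ge0 ?sqr_ge0 // mulr_ge0 ?sqr_ge0 //.
pose x := s + (2 * `|K s| / r + 1).
have d0 : 0 <= 2 * `|K s| / r by rewrite divr_ge0 ?mulr_ge0 // ltW.
have sx : s <= x by rewrite /x; lra.
have [c /andP[sc _] E] := mvt_ex (fun z _ => dK z) sx.
have : r * (x - s) <= `|K x - K s|.
  by rewrite E normrM [`|x - s|]ger0_norm ?subr_ge0 // ler_wpM2r ?subr_ge0 // big.
have : `|K x| <= `|K s|.
  rewrite -(@ler_pXn2r _ 2) ?nnegrE // !real_normK ?num_real //.
  by apply: K_sqr_decreasing => //; exact: freq2_past_le0.
have -> : r * (x - s) = 2 * `|K s| + r by rewrite /x; field; rewrite lt0r_neq0.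
have := ler_normB (K x) (K s); lra.
Qed.

(** By [K1_bound], $K^2\exp(8\pi e^s)$ is nondecreasing. The upper bound for the zeros needs a
    coefficient that is not too small, and this is where K is kept from vanishing fast. *)
Lemma K_decay_lower s s' : t <= expR s -> s <= s' ->
  `|K s| * expR (4 * pi * (expR s - expR s')) <= `|K s'|.
Proof.
move=> ts ss; have p0 := pi_gt0 R.
pose a : R := 4 * pi.
have dF x : is_derive x (1 : R) (fun z => K z ^+ 2 * expR (2 * a * expR z))
    (2 * (K x * K1 x + a * expR x * K x ^+ 2) * expR (2 * a * expR x)).
  by apply: (der_eq (derM (derX (dK x)) (derE (derZ (2 * a) (derE (derI x)))))); ring.
have h : K s ^+ 2 * expR (2 * a * expR s) <= K s' ^+ 2 * expR (2 * a * expR s').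
  apply: (ge0_der_le (fun x _ => dF x)) => // x /andP[sx _].
  have tx : t <= expR x by rewrite (le_trans ts) // ler_expR.
  rewrite pmulr_lge0 ?expR_gt0 // pmulr_rge0 //.
  have b := K1_bound tx; rewrite -/a in b.
  have e0 := expR_gt0 x; have aE : 0 <= a * expR x by rewrite !mulr_ge0 // ltW.
  have : `|K1 x| <= a * expR x * `|K x|.
    apply: norm_le_sqr; first by rewrite mulr_ge0.
    by rewrite exprMn real_normK ?num_real.
  move=> b2; have : `|K x * K1 x| <= a * expR x * K x ^+ 2.
    rewrite normrM -[K x ^+ 2]real_normK ?num_real //.
    by have : `|K x| * `|K1 x| <= `|K x| * (a * expR x * `|K x|) by [apply: ler_wpM2l]; lra.
  by rewrite ler_norml => /andP[+ _]; lra.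
rewrite -(@ler_pXn2r _ 2) ?nnegrE ?mulr_ge0 ?expR_ge0 // exprMn !real_normK ?num_real //.
rewrite -(ler_pM2r (expR_gt0 (2 * a * expR s'))); apply: (le_trans _ h).
rewrite -[leLHS]mulrA -[in leLHS]expRM_natl -expRD; rewrite le_eqVlt; apply/orP; left; apply/eqP; congr (_ * expR _).
by rewrite /a -mulr_natl; ring.
Qed.

Definition energy s := K1 s ^+ 2 + t ^+ 2 * K s ^+ 2.

(** The derivative of the energy is $2(2\pi e^s)^2KK'$, and $2t|KK'|$ is at most the energy; so the
    energy at s is controlled by the energy at any later point. *)
Lemma energy_growth s s' : s <= s' ->
  energy s <= energy s' * expR (2 * pi ^+ 2 / t * (expR s' ^+ 2 - expR s ^+ 2)).
Proof.
move=> ss; have p0 := pi_gt0 R; have T2 := t2; have t0 : 0 < t by lra.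
pose a : R := 2 * pi ^+ 2 / t.
have dF x : is_derive x (1 : R) (fun z => energy z * expR (a * expR z ^+ 2))
    ((2 * (2 * pi * expR x) ^+ 2 * (K x * K1 x) + 2 * a * expR x ^+ 2 * energy x) * expR (a * expR x ^+ 2)).
  apply: (der_eq (derM (derD (derX (dK1 x)) (derZ (t ^+ 2) (derX (dK x)))) (derE (derZ a (derX (derE (derI x))))))).
  by rewrite /energy /freq2; ring.
have : energy s * expR (a * expR s ^+ 2) <= energy s' * expR (a * expR s' ^+ 2).
  apply: (ge0_der_le (fun x _ => dF x)) => // x _.
  rewrite mulr_ge0 ?expR_ge0 //.
  rewrite (_ : _ + _ = 4 * pi ^+ 2 / t * expR x ^+ 2 * (energy x + 2 * t * (K x * K1 x))); last first.
    by rewrite /a; field; rewrite lt0r_neq0.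
  have f0 : 0 <= 4 * pi ^+ 2 / t * expR x ^+ 2.
    by apply: mulr_ge0; [apply: mulr_ge0; [apply: mulr_ge0 => //; exact: sqr_ge0|rewrite invr_ge0 ltW]|exact: sqr_ge0].
  apply: mulr_ge0 => //.
  have -> : energy x + 2 * t * (K x * K1 x) = (K1 x + t * K x) ^+ 2 by rewrite /energy; ring.
  exact: sqr_ge0.
move=> h; rewrite -(ler_pM2r (expR_gt0 (a * expR s ^+ 2))); apply: (le_trans h).
by rewrite -[leRHS]mulrA -expRD le_eqVlt; apply/orP; left; apply/eqP; congr (_ * expR _); rewrite /a; ring.
Qed.

Lemma energy_ge0 s : 0 <= energy s.
Proof. by apply: addr_ge0; [exact: sqr_ge0|apply: mulr_ge0; exact: sqr_ge0]. Qed.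

(** Compares the oscillating range with the point $y=t$ past the turning point, where [K1_bound]
    expresses the energy through K alone. The price is an exponential in t. *)
Lemma K_le_at_t s : expR s <= t ->
  energy s <= (300 * t ^+ 2) * expR (2 * pi ^+ 2 * t) * K (ln t) ^+ 2.
Proof.
move=> st; have T2 := t2; have t0 : 0 < t by lra.
have p0 := pi_gt0 R.
have sl : s <= ln t by rewrite -ler_expR lnK ?posrE.
have := energy_growth sl; rewrite lnK ?posrE // => h; apply: (le_trans h).
have b : K1 (ln t) ^+ 2 <= (4 * pi * t) ^+ 2 * K (ln t) ^+ 2.
  by have := @K1_bound (ln t); rewrite lnK ?posrE //; apply.
have p4 : pi <= 4 :> R by have := @pihalf_lt2 R; lra.
have b2 : energy (ln t) <= 300 * t ^+ 2 * K (ln t) ^+ 2.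
  rewrite /energy; have := sqr_ge0 (K (ln t)); have := sqr_ge0 t.
  set k := K _ ^+ 2 in b *; move=> u0 k0; apply: (le_trans (lerD b (lexx _))).
  have -> : (4 * pi * t) ^+ 2 * k = 16 * pi ^+ 2 * (t ^+ 2 * k) by ring.
  have : pi ^+ 2 <= 16 :> R by nra.
  have : 0 <= t ^+ 2 * k by rewrite mulr_ge0.
  nra.
rewrite [leRHS]mulrAC; apply: ler_pM; rewrite ?energy_ge0 ?expR_ge0 //.
rewrite ler_expR; have -> : 2 * pi ^+ 2 / t * (t ^+ 2 - expR s ^+ 2) = 2 * pi ^+ 2 * t - 2 * pi ^+ 2 / t * expR s ^+ 2.
  by field; rewrite lt0r_neq0.
rewrite lerBlDr lerDl; apply: mulr_ge0; last exact: sqr_ge0.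
by apply: divr_ge0; [apply: mulr_ge0 => //; exact: sqr_ge0|exact: ltW].
Qed.

End BesselODE.

(** * The phase of the oscillating solution *)

Section Phase.
Variable R : realType.
Implicit Types (t X : R).

(** An antiderivative of $\sqrt{t^2-X^2}/X$: the Liouville-Green phase of the Bessel equation in the
    variable $X=2\pi e^s$. *)
Definition phase t X : R :=
  Num.sqrt (t ^+ 2 - X ^+ 2) - t * ln (t + Num.sqrt (t ^+ 2 - X ^+ 2)) + t * ln X.

Lemma sqr_gap t X : 0 < X -> X < t -> 0 < t ^+ 2 - X ^+ 2.
Proof. by move=> X0 Xt; rewrite subr_gt0 ltr_pXn2r ?nnegrE // ltW //; apply: lt_trans Xt. Qed.

Lemma der_gap t X : 0 < X -> X < t ->
  is_derive X (1 : R) (fun x => Num.sqrt (t ^+ 2 - x ^+ 2)) (- (X / Num.sqrt (t ^+ 2 - X ^+ 2))).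
Proof.
move=> X0 Xt; have q0 := sqr_gap X0 Xt.
have d1 : is_derive X (1 : R) (fun x => t ^+ 2 - x ^+ 2) (0 - 2 * X * 1).
  exact: (derD (derC _ X) (derN (derX (derI X)))).
apply: (der_eq (der_comp d1 (is_derive1_sqrt q0))).
by field; rewrite lt0r_neq0 // sqrtr_gt0.
Qed.

Lemma der_phase t X : 0 < X -> X < t ->
  is_derive X (1 : R) (phase t) (Num.sqrt (t ^+ 2 - X ^+ 2) / X).
Proof.
move=> X0 Xt; have q0 := sqr_gap X0 Xt.
have dw := der_gap X0 Xt.
set w := Num.sqrt (t ^+ 2 - X ^+ 2) in dw *.
have w0 : 0 < w by rewrite sqrtr_gt0.
have w2 : w ^+ 2 = t ^+ 2 - X ^+ 2 by rewrite sqr_sqrtr // ltW.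
have tw : 0 < t + w by lra.
have d2 := derD (derC t X) dw.
have d3 := der_comp d2 (der_ln (x := t + w) tw).
have d4 := derD (derD dw (derN (derZ t d3))) (derZ t (der_ln X0)).
apply: (der_eq d4).
have E : (w * (t + w)) != 0 by rewrite mulf_neq0 // lt0r_neq0.
have X00 := lt0r_neq0 X0.
apply/eqP; rewrite -subr_eq0; apply/eqP.
have -> : - (X / w) - t * ((0 - X / w) * (t + w)^-1) + t * X^-1 - w / X
  = (t ^+ 2 - X ^+ 2 - w ^+ 2) / (X * (t + w)).
  by field; rewrite !lt0r_neq0.
by rewrite w2 subrr mul0r.
Qed.

Lemma polar (a b : R) : exists al, a = Num.sqrt (a ^+ 2 + b ^+ 2) * cos al /\ b = Num.sqrt (a ^+ 2 + b ^+ 2) * sin al.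
Proof.
set r2 := a ^+ 2 + b ^+ 2; set r := Num.sqrt r2.
have r20 : 0 <= r2 by rewrite addr_ge0 ?sqr_ge0.
have rr : r ^+ 2 = r2 by rewrite sqr_sqrtr.
have [r0|r0] := eqVneq r 0.
  exists 0; rewrite r0 !mul0r; move: rr; rewrite r0 expr0n /= /r2 => h.
  have := sqr_ge0 a; have := sqr_ge0 b => hb ha.
  by split; apply/eqP; rewrite -sqrf_eq0; apply/eqP; lra.
have rp : 0 < r by rewrite lt_neqAle eq_sym r0 sqrtr_ge0.
have c1 : -1 <= a / r <= 1.
  rewrite -ler_norml normrM normfV (gtr0_norm rp) ler_pdivrMr // mul1r.
  apply: norm_le_sqr; first exact: ltW.
  by rewrite rr lerDl sqr_ge0.
have [_ ca] := acos_def c1; have sa := sin_acos c1.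
have sE : Num.sqrt (1 - (a / r) ^+ 2) = `|b| / r.
  have -> : 1 - (a / r) ^+ 2 = (b / r) ^+ 2.
    have -> : 1 = r2 / r ^+ 2 :> R by rewrite -rr divff // expf_neq0.
    by rewrite /r2; field.
  by rewrite sqrtr_sqr normrM normfV (gtr0_norm rp).
rewrite sE in sa.
have [b0|b0] := leP 0 b.
  exists (acos (a / r)); rewrite ca sa ger0_norm //; split; field => //.
exists (- acos (a / r)); rewrite cosN sinN ca sa ltr0_norm //; split; field => //.
Qed.

End Phase.

Section Oscillation.
Variable R : realType.
Variables (t : R) (K K1 : R -> R).
Hypothesis t2 : 2 <= t.
Local Notation Q := (freq2 t).
Hypothesis dK : forall s : R, is_derive s 1 K (K1 s).
Hypothesis dK1 : forall s : R, is_derive s 1 K1 (- (Q s * K s)).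
Let X (s : R) := 2 * pi * expR s.

Let X0 s : 0 < X s.
Proof. by rewrite mulr_gt0 ?expR_gt0 // mulr_gt0 // pi_gt0. Qed.

Let dX (s : R) : is_derive s 1 X (X s).
Proof. by apply: (der_eq (derZ (2 * pi) (derE (derI s)))); rewrite mul1r. Qed.

Let w s := Num.sqrt (Q s).

Let X_le s s' : s <= s' -> X s <= X s'.
Proof. by move=> ss; rewrite ler_pM2l ?ler_expR // mulr_gt0 // pi_gt0. Qed.

(* Rotating [(K, K'/sqrt Q)] by the phase removes the oscillation: the rotated vector has derivative [O(Q'/Q)]. *)
Lemma oscillation s1 : 2 * (2 * pi * expR s1) <= t ->
  exists r al, [/\ 0 <= r, r ^+ 2 = K s1 ^+ 2 + K1 s1 ^+ 2 / Q s1 &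
    forall s, s <= s1 -> `|K s - r * cos (phase t (2 * pi * expR s) - al)| <= 6 * r * (2 * pi * expR s1 / t) ^+ 2].
Proof.
move=> Xt; have T2 := t2; have t0 : 0 < t by lra.
pose th s := phase t (X s).
have lt s : s <= s1 -> X s < t.
  by move=> ss; have := X_le ss; have := X0 s1; rewrite /X in Xt *; lra.
have Q34 s : s <= s1 -> 3 * t ^+ 2 <= 4 * Q s.
  move=> ss; rewrite /freq2 -/(X s).
  have : X s ^+ 2 <= (t / 2) ^+ 2.
    rewrite ler_pXn2r ?nnegrE //; [|by rewrite ltW|by lra].
    by have := X_le ss; rewrite /X in Xt *; lra.
  by lra.
have Q0 s : s <= s1 -> 0 < Q s.
  by move=> ss; have := Q34 s ss; have : 0 < t ^+ 2 by [rewrite exprn_gt0]; lra.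
have w0 s : s <= s1 -> 0 < w s by move=> ss; rewrite sqrtr_gt0 Q0.
have w2 s : s <= s1 -> w s ^+ 2 = Q s by move=> ss; rewrite sqr_sqrtr // ltW // Q0.
have dth s : s <= s1 -> is_derive s (1 : R) th (w s).
  move=> ss; apply: (der_eq (der_comp (dX s) (der_phase (X0 s) (lt s ss)))).
  by rewrite mulrC divfK // lt0r_neq0 // X0.
have dw s : s <= s1 -> is_derive s (1 : R) w (- (X s ^+ 2 / w s)).
  move=> ss; apply: (der_eq (der_comp (dX s) (der_gap (X0 s) (lt s ss)))).
  by rewrite -/(freq2 t s) -/(w s); ring.
pose W s := K1 s / w s.
have dW s : s <= s1 -> is_derive s (1 : R) W (- (w s * K s) + X s ^+ 2 / Q s * W s).
  move=> ss; have wn := lt0r_neq0 (w0 s ss).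
  have dV := is_deriveV wn (dw s ss).
  apply: (der_eq (derM (dK1 s) dV)).
  rewrite -(w2 s ss) /W /GRing.scale /=; field => //.
pose P s := K s * cos (th s) - W s * sin (th s).
pose S s := K s * sin (th s) + W s * cos (th s).
have dP s : s <= s1 -> is_derive s (1 : R) P (- (X s ^+ 2 / Q s * W s * sin (th s))).
  move=> ss; have wn := lt0r_neq0 (w0 s ss).
  have dc := der_comp (dth s ss) (is_derive_cos (th s)).
  have ds := der_comp (dth s ss) (is_derive_sin (th s)).
  apply: (der_eq (derD (derM (dK s) dc) (derN (derM (dW s ss) ds)))).
  have -> : K1 s = w s * W s by rewrite /W mulrC divfK.
  ring.
have dS s : s <= s1 -> is_derive s (1 : R) S (X s ^+ 2 / Q s * W s * cos (th s)).
  move=> ss; have wn := lt0r_neq0 (w0 s ss).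
  have dc := der_comp (dth s ss) (is_derive_cos (th s)).
  have ds := der_comp (dth s ss) (is_derive_sin (th s)).
  apply: (der_eq (derD (derM (dK s) ds) (derM (dW s ss) dc))).
  have -> : K1 s = w s * W s by rewrite /W mulrC divfK.
  ring.
pose rho2 s := P s ^+ 2 + S s ^+ 2.
have rho2E s : rho2 s = K s ^+ 2 + W s ^+ 2.
  by rewrite /rho2 /P /S; have := cos2Dsin2 (th s) => e; rewrite -[RHS]mulr1 -e; ring.
have PSK s : K s = P s * cos (th s) + S s * sin (th s).
  by rewrite /P /S; have := cos2Dsin2 (th s) => e; rewrite -[LHS]mulr1 -e; ring.
have XQ s : s <= s1 -> X s ^+ 2 / Q s <= 4 / 3 * X s ^+ 2 / t ^+ 2.
  move=> ss; rewrite ler_pdivrMr ?Q0 // mulrAC ler_pdivlMr ?exprn_gt0 //.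
  by have := Q34 s ss; have := sqr_ge0 (X s); nra.
have XQ0 s : s <= s1 -> 0 <= X s ^+ 2 / Q s.
  by move=> ss; apply: divr_ge0; [exact: sqr_ge0|rewrite ltW ?Q0].
(* [rho2] cannot grow by more than a constant factor as [s] decreases *)
have rho_le s : s <= s1 -> rho2 s <= 4 * rho2 s1.
  move=> ss.
  pose b := 4 / 3 / t ^+ 2.
  have b0 : 0 < b by rewrite divr_gt0 ?exprn_gt0 // divr_gt0.
  pose F z := rho2 z * expR (b * X z ^+ 2).
  pose F' x := (2 * P x * (- (X x ^+ 2 / Q x * W x * sin (th x))) + 2 * S x * (X x ^+ 2 / Q x * W x * cos (th x))
      + 2 * b * X x ^+ 2 * rho2 x) * expR (b * X x ^+ 2).
  have dF x : x <= s1 -> is_derive x (1 : R) F (F' x).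
    move=> xs; apply: (der_eq (derM (derD (derX (dP x xs)) (derX (dS x xs))) (derE (derZ b (derX (dX x)))))).
    by rewrite /F' /rho2; ring.
  have dF2 x : s <= x <= s1 -> is_derive x (1 : R) F (F' x) by move=> /andP[_]; exact: dF.
  have : F s <= F s1.
    apply: (ge0_der_le dF2 _ ss) => x /andP[_ xs]; rewrite /F'.
    rewrite mulr_ge0 ?expR_ge0 //.
    have -> : 2 * P x * - (X x ^+ 2 / Q x * W x * sin (th x)) + 2 * S x * (X x ^+ 2 / Q x * W x * cos (th x))
      = 2 * (X x ^+ 2 / Q x) * W x ^+ 2.
      by rewrite /P /S; have := cos2Dsin2 (th x) => e; rewrite -[RHS]mulr1 -e; ring.
    rewrite addr_ge0 //.
      by apply: mulr_ge0; [apply: mulr_ge0 => //; exact: XQ0|exact: sqr_ge0].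
    rewrite rho2E; apply: mulr_ge0; last by rewrite addr_ge0 ?sqr_ge0.
    by apply: mulr_ge0; [apply: mulr_ge0 => //; exact: ltW|exact: sqr_ge0].
  rewrite /F => h; apply: (@le_trans _ _ (rho2 s * expR (b * X s ^+ 2))).
    rewrite ler_peMr // ?rho2E ?addr_ge0 ?sqr_ge0 //.
    apply: le_trans (expR_ge1Dx _); rewrite lerDl; apply: mulr_ge0; [exact: ltW|exact: sqr_ge0].
  apply: (le_trans h); rewrite mulrC ler_wpM2r // ?rho2E ?addr_ge0 ?sqr_ge0 //.
  have bx : b * X s1 ^+ 2 <= 1 / 2.
    have : X s1 ^+ 2 <= (t / 2) ^+ 2.
      by rewrite ler_pXn2r ?nnegrE //; [rewrite /X in Xt *; lra|rewrite ltW|lra].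
    move=> hx; have : b * X s1 ^+ 2 <= b * (t / 2) ^+ 2 by rewrite ler_pM2l.
    move=> h2; apply: (le_trans h2); rewrite /b (_ : _ * _ = 1 / 3); first by lra.
    by field; rewrite lt0r_neq0.
  have : expR (b * X s1 ^+ 2) * (1 - 1 / 2) <= 1.
    rewrite -[leRHS](_ : expR (b * X s1 ^+ 2) * expR (- (b * X s1 ^+ 2)) = 1); last by rewrite -expRD subrr expR0.
    rewrite ler_pM2l ?expR_gt0 //; apply: le_trans (expR_ge1Dx _); lra.
  by lra.
pose r := Num.sqrt (rho2 s1).
have r0 : 0 <= r by exact: sqrtr_ge0.
have r2 : r ^+ 2 = rho2 s1 by rewrite sqr_sqrtr // rho2E addr_ge0 ?sqr_ge0.
have W_le s : s <= s1 -> `|W s| <= 2 * r.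
  move=> ss; apply: norm_le_sqr; first by rewrite mulr_ge0.
  rewrite [leRHS]exprMn r2; apply: le_trans (_ : rho2 s <= _); first by rewrite rho2E lerDr sqr_ge0.
  by have := rho_le s ss; lra.
(* both components move by at most [(4/3) r X^2/t^2] *)
pose b := 4 / 3 * r / t ^+ 2.
have b0 : 0 <= b by rewrite divr_ge0 ?sqr_ge0 // mulr_ge0 // divr_ge0.
have small (g g' : R -> R) : (forall s, s <= s1 -> is_derive s (1 : R) g (g' s)) ->
    (forall s, s <= s1 -> `|g' s| <= X s ^+ 2 / Q s * `|W s|) ->
    forall s, s <= s1 -> `|g s - g s1| <= b * X s1 ^+ 2.
  move=> dg g'l s ss.
  have g'2 x : x <= s1 -> `|g' x| <= 2 * b * X x ^+ 2.
    move=> xs; apply: (le_trans (g'l x xs)).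
    have -> : 2 * b * X x ^+ 2 = (4 / 3 * X x ^+ 2 / t ^+ 2) * (2 * r).
      by rewrite /b; field; rewrite lt0r_neq0.
    by apply: ler_pM => //; [exact: XQ0|exact: XQ|exact: W_le].
  have dX2 (x : R) : is_derive x 1 (fun z => b * X z ^+ 2) (2 * b * X x ^+ 2).
    by apply: (der_eq (derZ b (derX (dX x)))); ring.
  have u1 : g s1 - b * X s1 ^+ 2 <= g s - b * X s ^+ 2.
    have d1 x : s <= x <= s1 -> is_derive x (1 : R) (fun z => g z - b * X z ^+ 2) (g' x - 2 * b * X x ^+ 2).
      by move=> /andP[_ xs]; exact: (derD (dg x xs) (derN (dX2 x))).
    apply: (le0_der_ge d1 _ ss) => x /andP[_ xs].
    by have := g'2 x xs; rewrite ler_norml => /andP[_]; lra.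
  have u2 : g s + b * X s ^+ 2 <= g s1 + b * X s1 ^+ 2.
    have d1 x : s <= x <= s1 -> is_derive x (1 : R) (fun z => g z + b * X z ^+ 2) (g' x + 2 * b * X x ^+ 2).
      by move=> /andP[_ xs]; exact: (derD (dg x xs) (dX2 x)).
    apply: (ge0_der_le d1 _ ss) => x /andP[_ xs].
    by have := g'2 x xs; rewrite ler_norml => /andP[+ _]; lra.
  have : 0 <= b * X s ^+ 2 by rewrite mulr_ge0 ?sqr_ge0.
  by rewrite ler_norml => ?; apply/andP; split; lra.
have [al [Pe Se]] := polar (P s1) (S s1).
rewrite -/(rho2 s1) -/r in Pe Se.
exists r, al; split => //.
  by rewrite r2 rho2E /W expr_div_n w2.
move=> s ss.
have hP := small _ _ dP _ s ss; have hS := small _ _ dS _ s ss.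
have tri (u v z : R) : 0 <= u -> `|z| <= 1 -> `|u * v * z| <= u * `|v|.
  by move=> u0 z1; rewrite !normrM (ger0_norm u0) ler_piMr // mulr_ge0.
have {}hP : `|P s - P s1| <= b * X s1 ^+ 2.
  apply: hP => x xs; rewrite normrN; apply: tri; [exact: XQ0|exact: sin_max].
have {}hS : `|S s - S s1| <= b * X s1 ^+ 2.
  apply: hS => x xs; apply: tri; [exact: XQ0|exact: cos_max].
rewrite -/(X s) -/(th s) -/(X s1).
have -> : K s - r * cos (th s - al) = (P s - P s1) * cos (th s) + (S s - S s1) * sin (th s).
  rewrite cosB (PSK s) Pe Se; move: (P s) (S s) => p q; ring.
apply: (le_trans (ler_normD _ _)); rewrite !normrM.
have c1 : `|P s - P s1| * `|cos (th s)| <= b * X s1 ^+ 2 by apply: (le_trans _ hP); rewrite ler_piMr ?cos_max.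
have c2 : `|S s - S s1| * `|sin (th s)| <= b * X s1 ^+ 2 by apply: (le_trans _ hS); rewrite ler_piMr ?sin_max.
apply: (le_trans (lerD c1 c2)).
have -> : b * X s1 ^+ 2 = 4 / 3 * r * (X s1 / t) ^+ 2 by rewrite /b; field; rewrite lt0r_neq0.
have := sqr_ge0 (X s1 / t); set u := _ ^+ 2 => u0; have : 0 <= r * u by rewrite mulr_ge0.
lra.
Qed.

Hypothesis Kgrowth : forall s1 d, 0 < d -> exists2 s, s1 <= s & K s ^+ 2 < d * expR s.

(** Up to the turning point the energy $K'^2+QK^2$ does not increase, so $|K'|\le tr$ and K grows at
    most linearly over a range of length at most t. Beyond the turning point $|K|$ does not
    increase. *)
Lemma K_sup s1 r : 0 <= s1 -> 2 * (2 * pi * expR s1) <= t -> 0 <= r ->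
  r ^+ 2 = K s1 ^+ 2 + K1 s1 ^+ 2 / Q s1 -> forall s, s1 <= s -> `|K s| <= r * (1 + t ^+ 2).
Proof.
move=> s10 Xt r0 r2 s ss.
have T2 := t2; have t0 : 0 < t by lra.
pose E z := K1 z ^+ 2 + Q z * K z ^+ 2.
have dQ (z : R) : is_derive z 1 Q (- (2 * X z ^+ 2)).
  by apply: (der_eq (derD (derC (t ^+ 2) z) (derN (derX (dX z))))); ring.
have dE (z : R) : is_derive z 1 E (- (2 * X z ^+ 2 * K z ^+ 2)).
  by apply: (der_eq (derD (derX (dK1 z)) (derM (dQ z) (derX (dK z))))); ring.
have XX : X s1 ^+ 2 <= (t / 2) ^+ 2.
  by rewrite ler_pXn2r ?nnegrE //; [rewrite /X in Xt *; lra|rewrite ltW|lra].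
have Q1 : 0 < Q s1.
  rewrite /freq2 -/(X s1); have : 0 < t ^+ 2 by rewrite exprn_gt0.
  by lra.
have E1 : E s1 <= (t * r) ^+ 2.
  rewrite exprMn r2 /E (_ : _ + _ = Q s1 * (K s1 ^+ 2 + K1 s1 ^+ 2 / Q s1)); last by field; rewrite lt0r_neq0.
  apply: ler_wpM2r; first by rewrite -r2 sqr_ge0.
  by rewrite /freq2 lerBlDr lerDl sqr_ge0.
have Ks1 : `|K s1| <= r.
  apply: norm_le_sqr => //; rewrite r2 lerDl; apply: divr_ge0; [exact: sqr_ge0|exact: ltW].
pose sT := ln (t / (2 * pi)).
have pp : 0 < 2 * pi :> R by rewrite mulr_gt0 // pi_gt0.
have XT : X sT = t by rewrite /X /sT lnK ?posrE ?divr_gt0 // mulrC divfK // lt0r_neq0.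
have sT_t : sT <= t.
  rewrite /sT; apply: (@le_trans _ _ (ln t)); last first.
    by have := expR_ge1Dx (ln t); rewrite lnK ?posrE //; lra.
  rewrite ler_ln ?posrE ?divr_gt0 // ler_pdivrMr // ler_peMr ?(ltW t0) //.
  by have := pi_ge2 R; lra.
have low z : s1 <= z -> z <= sT -> `|K z| <= r * (1 + t ^+ 2).
  move=> sz zT.
  have K1b x : s1 <= x <= z -> `|K1 x| <= t * r.
    move=> /andP[sx xz]; apply: norm_le_sqr; first by rewrite mulr_ge0 // ltW.
    apply: le_trans E1; apply: (@le_trans _ _ (E x)).
      rewrite lerDl mulr_ge0 ?sqr_ge0 // /freq2 subr_ge0 -/(X x).
      by rewrite ler_pXn2r ?nnegrE ?(ltW t0) ?(ltW (X0 _)) // -XT; apply: X_le; lra.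
    apply: (le0_der_ge (fun y _ => dE y)) => // y _.
    by rewrite oppr_le0 mulr_ge0 ?sqr_ge0 // mulr_ge0 ?sqr_ge0.
  have := der_dist_le (fun x _ => dK x) K1b sz.
  have -> : K z = (K z - K s1) + K s1 by rewrite subrK.
  move=> h; apply: (le_trans (ler_normD _ _)).
  rewrite subrK in h *.
  have : t * r * (z - s1) <= t * r * t by rewrite ler_wpM2l ?mulr_ge0 ?(ltW t0) //; lra.
  by move: h Ks1; lra.
have s1T : s1 <= sT.
  rewrite -ler_expR -(ler_pM2l pp) -/(X s1) -/(X sT) XT.
  by rewrite /X in Xt *; have := X0 s1; rewrite /X; lra.
have [sT'|Ts] := leP s sT; first exact: low.
apply: le_trans (low sT s1T (lexx _)).
apply: norm_le_sqr => //; rewrite real_normK ?num_real //.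
apply: (K_sqr_decreasing t2 dK dK1 Kgrowth) => //; last exact: ltW.
by rewrite /freq2 -/(X sT) XT subrr.
Qed.

End Oscillation.

Lemma sum_dual_divisors (R : realType) (n : nat) (F : nat -> R) : (0 < n)%N ->
  \sum_(d <- divisors n) F (n %/ d)%N = \sum_(d <- divisors n) F d.
Proof.
move=> n0; rewrite -(big_map (fun d => n %/ d)%N xpredT F); apply: perm_big.
have dd d : (d %| n)%N -> (n %/ (n %/ d) = d)%N.
  move=> /dvdnP[q nE]; have q0 : (0 < q)%N by move: n0; rewrite nE muln_gt0 => /andP[].
  have d0 : (0 < d)%N by move: n0; rewrite nE muln_gt0 => /andP[].
  by rewrite {2}nE mulnK // nE mulKn.
have dv d : (d %| n)%N -> (n %/ d %| n)%N.
  by move=> dn; rewrite -{2}(divnK dn) dvdn_mulr.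
apply: uniq_perm; rewrite ?divisors_uniq //.
  rewrite map_inj_in_uniq ?divisors_uniq // => a b; rewrite -!dvdn_divisors // => an bn e.
  by rewrite -(dd a an) e dd.
move=> d; apply/mapP/idP => [[e]|]; rewrite -!dvdn_divisors //.
  by move=> en ->; exact: dv.
by move=> dn; exists (n %/ d)%N; rewrite -?dvdn_divisors ?dv ?dd.
Qed.

Lemma sum_common_divisors (R : realType) (n k : nat) (F : nat -> R) : (0 < n)%N ->
  \sum_(d <- divisors n) (if (d %| k)%N then F d else 0) = \sum_(d <- divisors (gcdn n k)) F d.
Proof.
move=> n0; rewrite -big_mkcond -big_filter; apply: perm_big.
have g0 : (0 < gcdn n k)%N by rewrite gcdn_gt0 n0.
apply: uniq_perm; rewrite ?filter_uniq ?divisors_uniq // => d.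
by rewrite mem_filter -!dvdn_divisors // dvdn_gcd andbC.
Qed.

(** * Hecke eigenvalues *)

Section Hecke.
Variable R : realType.
Variables (phi : R[i] -> R) (t : R).
Hypothesis hphi : even_hecke_maass_cusp_form phi t.
Let f : R * R -> R := in_coords phi.
Notation coef := (coef phi).

Lemma hecke_coords n x y : hecke n phi (x +i* y)%C = (Num.sqrt n%:R)^-1 *
  \sum_(d <- divisors n) \sum_(0 <= b < d) f (((n %/ d)%:R * x + b%:R) / d%:R, (n %/ d)%:R * y / d%:R).
Proof.
rewrite /hecke; congr (_ * _); apply: eq_bigr => d _; apply: eq_bigr => b _.
rewrite /f /in_coords /=; congr phi.
have nC k : (k%:R : R[i]) = (k%:R)%:C%C by rewrite rmorph_nat.
rewrite !nC -fmorphV /=; apply/eqP; rewrite eq_complex /=.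
by rewrite !mul0r !mulr0 !subr0 !addr0 !add0r !eqxx.
Qed.

(** The eigenvalue is chosen from the existential hypothesis; the value 0 at n = 0 is a default. *)
Definition lam (n : nat) : R :=
  if pselect (0 < n)%N is left n0 then projT1 (cid (ehm_hecke hphi n0)) else 0.

Lemma lamP n x y : (0 < n)%N -> 0 < y -> hecke n phi (x +i* y)%C = lam n * f (x, y).
Proof.
move=> n0 y0; rewrite /lam; case: pselect => // n0'.
by case: (cid _) => l /= hl; rewrite hl.
Qed.

Lemma coef_hecke n k y : (0 < n)%N -> (0 < k)%N -> 0 < y ->
  lam n * coef k y = (Num.sqrt n%:R)^-1 * \sum_(d <- divisors n)
    (if (n %/ d %| k)%N then d%:R * coef (k %/ (n %/ d) * d) ((n %/ d)%:R * y / d%:R) else 0).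
Proof.
move=> n0 k0 y0.
pose G d x : R := if d \in divisors n then
  \sum_(0 <= b < d) f (((n %/ d)%:R * x + b%:R) / d%:R, (n %/ d)%:R * y / d%:R) else 0.
have dpos d : d \in divisors n -> (0 < d)%N /\ (0 < n %/ d)%N.
  rewrite -dvdn_divisors // => dn; have d0 := dvdn_gt0 n0 dn; split => //.
  by rewrite divn_gt0 // dvdn_leq.
have ypos d : d \in divisors n -> 0 < (n %/ d)%:R * y / d%:R.
  by move=> /dpos[d0 a0]; rewrite divr_gt0 ?mulr_gt0 ?ltr0n.
pose w x : R := cos (2 * pi * k%:R * x).
have cw : continuous w by exact: cont_cosax.
have cf v : 0 < v -> continuous (fun x => f (x, v)).
  by move=> v0; exact: (is_derive_continuous (slice_derive hphi v0)).
have cG d : continuous (G d).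
  rewrite /G; case: (boolP (d \in divisors n)) => dn; last exact: cont_cst.
  apply: cont_sum => b; have [d0 a0] := dpos d dn.
  have dR : d%:R != 0 :> R by rewrite pnatr_eq0 -lt0n.
  have -> : (fun x => f (((n %/ d)%:R * x + b%:R) / d%:R, (n %/ d)%:R * y / d%:R))
    = (fun x => (fun u => f (u, (n %/ d)%:R * y / d%:R)) (((n %/ d)%:R / d%:R) * x + b%:R / d%:R)).
    by apply: funext => x /=; congr (f (_, _)); field.
  by apply: (@cont_affine R (fun u => f (u, (n %/ d)%:R * y / d%:R))); apply: cf; exact: ypos.
have E : int01 (fun x => lam n * (f (x, y) * w x)) =
         int01 (fun x => (Num.sqrt n%:R)^-1 * \sum_(d <- divisors n) (G d x * w x)).
  congr int01; apply: funext => x; rewrite mulrA -lamP // hecke_coords -mulrA mulr_suml.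
  congr (_ * _); rewrite big_seq [RHS]big_seq; apply: eq_bigr => d dn; by rewrite /G dn.
have m1 : continuous (fun x => f (x, y) * w x) by apply: contM => //; exact: cf.
have mG d : continuous (fun x => G d x * w x) by exact: contM.
have mS := @cont_sum R nat (divisors n) xpredT (fun d x => G d x * w x) mG.
rewrite (int01Z _ m1) (int01Z _ mS) (int01_sum _ _ mG) in E.
rewrite /coef /fcoef -/f E; congr (_ * _); rewrite big_seq [RHS]big_seq; apply: eq_bigr => d dn.
have [d0 a0] := dpos d dn; have y'0 := ypos d dn.
have := @fcoef_translates R (fun x => f (x, (n %/ d)%:R * y / d%:R)) _ _
  (fun x => form_periodic hphi x y'0) (fun x => form_even hphi x y'0)
  (slice_derive hphi y'0) (slice_derive2 hphi y'0) (slice_cont2 hphi y'0) (n %/ d)%N d k a0 d0 k0.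
by rewrite /fcoef => <-; congr int01; apply: funext => x; rewrite /G dn.
Qed.

(** The frequency 1 of the Hecke operator is compared on both sides: a divisor d contributes only
    when n / d divides 1, that is, for d = n. *)
Lemma coef_lam n y : (0 < n)%N -> 0 < y -> coef n y = lam n / Num.sqrt n%:R * coef 1 (n%:R * y).
Proof.
move=> n0 y0; have nR : 0 < n%:R :> R by rewrite ltr0n.
have ny : 0 < n%:R * y by rewrite mulr_gt0.
have := coef_hecke n0 (ltn0Sn 0) ny.
have nn : n \in divisors n by rewrite -dvdn_divisors.
rewrite (bigD1_seq n) ?divisors_uniq //= divnn n0 dvdn1 eqxx divn1 mul1n mul1r.
rewrite big1_seq; last first.
  move=> d /andP[dn]; rewrite -dvdn_divisors // => dd; case: ifP => //.
  rewrite dvdn1 => /eqP e; case/negP: dn; apply/eqP.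
  by rewrite -[LHS]mul1n -e divnK.
rewrite addr0 mulrAC divff ?lt0r_neq0 // mul1r => h.
have s0 : 0 < Num.sqrt n%:R :> R by rewrite sqrtr_gt0.
rewrite mulrAC h mulrAC -expr2.
by rewrite exprVn sqr_sqrtr ?ler0n // mulKf // lt0r_neq0.
Qed.

Lemma form_zero_of_coef : (forall y, 0 < y -> coef 1 y = 0) -> forall x y, 0 < y -> f (x, y) = 0.
Proof.
move=> c0 x y y0; have [C C0 hC] := slice_fourier hphi y0.
suff : `|f (x, y)| <= 0 by rewrite normr_le0 => /eqP.
apply: (@le_of_le_div _ _ _ C 1) => K K0; rewrite add0r.
have := hC K x K0; rewrite big_nat_cond big1 ?mulr0 ?subr0 // => n /andP[/andP[n0 _] _].
by rewrite coef_lam // c0 ?mulr0 ?mul0r // mulr_gt0 ?ltr0n.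
Qed.

(** If the first coefficient vanished at all heights, so would all the others, hence the form,
    against its unit norm. *)
Lemma coef1_neq0 : exists2 y, 0 < y & coef 1 y != 0.
Proof.
apply: contrapT => h.
have f0 : forall x y, 0 < y -> f (x, y) = 0.
  apply: form_zero_of_coef => v v0; apply/eqP; apply/negPn/negP => c; by apply: h; exists v.
have := ehm_normalized hphi; rewrite /L2_normalized => E.
have : (\int[(lebesgue_measure \x lebesgue_measure)%E]_(p in @fundamental_domain R)
     (in_coords phi p ^+ 2 / p.2 ^+ 2)%R%:E = 0)%E.
  apply: integral0_eq => -[x y] [/= y0 _ _].
  by rewrite -/(f (x, y)) f0 // expr0n mul0r.
by rewrite E => /eqP; rewrite eqe oner_eq0.
Qed.

(** The frequency n of the Hecke operator of index m is evaluated at the height y / n, where y is a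
    height at which the first coefficient is not zero. Every term of the Hecke sum then involves the
    first coefficient at the same y, which can be cancelled. *)
Lemma hecke_relation m n : (0 < m)%N -> (0 < n)%N ->
  lam m * lam n = \sum_(d <- divisors (gcdn m n)) lam (m * n %/ d ^ 2).
Proof.
move=> m0 n0; have [y y0 cy] := coef1_neq0.
have nR : 0 < n%:R :> R by rewrite ltr0n.
have mR : 0 < m%:R :> R by rewrite ltr0n.
have v0 : 0 < y / n%:R by rewrite divr_gt0.
have ny : n%:R * (y / n%:R) = y by field; exact: lt0r_neq0.
have E1 : coef n (y / n%:R) = lam n / Num.sqrt n%:R * coef 1 y by rewrite coef_lam // ny.
have sm : 0 < Num.sqrt m%:R :> R by rewrite sqrtr_gt0.
have sn : 0 < Num.sqrt n%:R :> R by rewrite sqrtr_gt0.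
have := coef_hecke m0 n0 v0; rewrite E1.
pose F a := Num.sqrt m%:R / Num.sqrt n%:R * coef 1 y * lam (m * n %/ a ^ 2).
rewrite big_seq (eq_bigr (fun d => (fun a => if (a %| n)%N then F a else 0) (m %/ d)%N)) -?big_seq; last first.
  move=> d; rewrite -dvdn_divisors // => dm; case: ifP => // an; rewrite /F.
  have d0 := dvdn_gt0 m0 dm.
  have a0 : (0 < m %/ d)%N by rewrite divn_gt0 // dvdn_leq.
  have md : m = (m %/ d * d)%N by rewrite divnK.
  have na : n = (n %/ (m %/ d) * (m %/ d))%N by rewrite divnK.
  move: (m %/ d)%N an a0 md na => a an a0 md na.
  have q0 : (0 < n %/ a)%N by rewrite divn_gt0 // dvdn_leq.
  move: (n %/ a)%N na q0 => q na q0.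
  have -> : (m * n %/ a ^ 2 = q * d)%N.
    have -> : (m * n = q * d * a ^ 2)%N by rewrite md na; ring.
    by rewrite mulnK // expn_gt0 a0.
  have N0 : (0 < q * d)%N by rewrite muln_gt0 q0.
  have aR : 0 < a%:R :> R by rewrite ltr0n.
  have dR : 0 < d%:R :> R by rewrite ltr0n.
  have qR : 0 < q%:R :> R by rewrite ltr0n.
  have u0 : 0 < a%:R * (y / n%:R) / d%:R by rewrite divr_gt0 // mulr_gt0.
  rewrite coef_lam //.
  have -> : (q * d)%:R * (a%:R * (y / n%:R) / d%:R) = y.
    by rewrite na !natrM; field; rewrite !lt0r_neq0.
  have -> : Num.sqrt m%:R = Num.sqrt a%:R * Num.sqrt d%:R :> R by rewrite md natrM sqrtrM ?ler0n.
  have -> : Num.sqrt n%:R = Num.sqrt q%:R * Num.sqrt a%:R :> R by rewrite na natrM sqrtrM ?ler0n.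
  have -> : Num.sqrt (q * d)%:R = Num.sqrt q%:R * Num.sqrt d%:R :> R by rewrite natrM sqrtrM ?ler0n.
  have dd : d%:R = Num.sqrt d%:R ^+ 2 :> R by rewrite sqr_sqrtr ?ler0n.
  rewrite {1}dd; field; by rewrite !lt0r_neq0 ?sqrtr_gt0.
rewrite (sum_dual_divisors (fun a => if (a %| n)%N then F a else 0) m0) (sum_common_divisors n F m0) /F -mulr_sumr => E.
have k0 : coef 1 y / Num.sqrt n%:R != 0 by rewrite mulf_neq0 // invr_neq0 // lt0r_neq0.
apply: (mulIf k0); move: E; set S := \sum_(_ <- _) _ => E.
transitivity (lam m * (lam n / Num.sqrt n%:R * coef 1 y)); first by ring.
by rewrite E; field; rewrite !lt0r_neq0.
Qed.

End Hecke.

(** * The Bessel factor in logarithmic coordinates *)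

Section RadialODE.
Variable R : realType.
Variables (phi : R[i] -> R) (t : R).
Hypothesis hphi : even_hecke_maass_cusp_form phi t.
Notation coef := (coef phi).

(** The factor $e^{-s/2}$ removes the first-order term that the substitution $y=e^s$ creates, so
    that $a_1(y)=\sqrt y\,K(\log y)$ with $K''=-QK$. *)
Definition radial (s : R) : R := coef 1 (expR s) * expR (- (s / 2)).
Definition radial' (s : R) : R := expR (s / 2) * coef' phi 1 (expR s) - radial s / 2.

Let half (s : R) : is_derive s 1 (fun z : R => z / 2) (2^-1).
Proof. by apply: (der_eq (derM (derI s) (derC 2^-1 s))); rewrite mulr0 addr0 mul1r. Qed.

Lemma radial_derive (s : R) : is_derive s 1 radial (radial' s).
Proof.
have dc := der_comp (derE (derI s)) (coef_derive hphi 1 (expR_gt0 s)).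
apply: (der_eq (derM dc (derE (derN (half s))))).
rewrite /radial' /radial expRN (_ : expR s = expR (s / 2) ^+ 2); last first.
  by rewrite -expRM_natl; congr expR; field.
by have := lt0r_neq0 (expR_gt0 (s / 2)) => u0; field.
Qed.

Lemma radial_derive2 (s : R) : is_derive s 1 radial' (- (freq2 t s * radial s)).
Proof.
have dc := der_comp (derE (derI s)) (coef_derive2 hphi 1 (expR_gt0 s)).
have h2 : is_derive s (1 : R) (fun z => radial z / 2) (radial' s / 2).
  by apply: (der_eq (derM (radial_derive s) (derC 2^-1 s))); rewrite mulr0 addr0.
apply: (der_eq (derD (derM (derE (half s)) dc) (derN h2))).
have := coef_ode hphi 1 (expR_gt0 s); rewrite mulr1 -/(freq2 t s).
rewrite /radial' /radial expRN /freq2.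
have e2 : expR s = expR (s / 2) ^+ 2 by rewrite -expRM_natl; congr expR; field.
move: (coef' _ _ _) (coef'' _ _ _) (coef _ _) => c1 c2 c; rewrite e2.
set u := expR (s / 2); have u0 : u != 0 by exact: lt0r_neq0 (expR_gt0 _).
move: (pi : R) => p ode.
apply: (mulfI u0); apply/eqP; rewrite -subr_eq0; apply/eqP.
rewrite -[RHS]ode; field => //.
Qed.

Lemma coef1_radial y : 0 < y -> coef 1 y = Num.sqrt y * radial (ln y).
Proof.
move=> y0; rewrite /radial lnK ?posrE // mulrCA.
have s0 : 0 < Num.sqrt y by rewrite sqrtr_gt0.
have -> : expR (- (ln y / 2)) = (Num.sqrt y)^-1.
  rewrite expRN; congr _^-1.
  apply/eqP; rewrite -(@eqrXn2 _ 2) ?expR_ge0 ?sqrtr_ge0 //.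
  by rewrite -expRM_natl mulrC divfK // lnK ?posrE // sqr_sqrtr // ltW.
by rewrite divff ?mulr1 // lt0r_neq0.
Qed.

Lemma coef_radial n y : (0 < n)%N -> 0 < y ->
  coef n y = lam hphi n * (Num.sqrt y * radial (ln (n%:R * y))).
Proof.
move=> n0 y0; have nR : 0 < n%:R :> R by rewrite ltr0n.
rewrite (coef_lam hphi) // coef1_radial ?mulr_gt0 // sqrtrM ?ler0n //.
by field; rewrite lt0r_neq0 // sqrtr_gt0.
Qed.

Lemma radial_neq0 : exists s, radial s != 0.
Proof.
have [y y0 cy] := coef1_neq0 hphi; exists (ln y); rewrite /radial lnK ?posrE //.
by rewrite mulf_neq0 // lt0r_neq0 // expR_gt0.
Qed.

End RadialODE.

Section HalfPeriod.
Variable R : realType.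
Notation mu := (@lebesgue_measure R).

(** Needed because the rectangle placed inside the fundamental domain below has width 1/2 only;
    evenness and periodicity make it see half of a full period. *)
Lemma int_half (h : R -> R) : continuous h -> (forall x, h (x + 1) = h x) -> (forall x, h (- x) = h x) ->
  (\int[mu]_(x in `[0%R, 2^-1]) h x)%R = int01 h / 2.
Proof.
move=> ch hp he; have ih a b := cont_integrable a b ch.
have E := @Rintegral_itvB R h (BLeft 0) (BRight 1) 2^-1 (ih 0 1).
have h1 : (BLeft (0 : R) <= BRight (2^-1 : R))%O by rewrite bnd_simp.
have h2 : (BRight (2^-1 : R) <= BRight (1 : R))%O by rewrite bnd_simp; lra.
have {}E := E h1 h2.
have i3 : mu.-integrable `]2^-1, 1] (EFin \o h).
  by apply: (integrableS _ _ _ (ih 2^-1 1)) => //; apply: subset_itv; rewrite bnd_simp.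
rewrite Rintegral_itv_obnd_cbnd // in E.
have h01 : (0 <= 2^-1 :> R) && (2^-1 <= 1 :> R) by apply/andP; split; lra.
have S := @Rintegration_by_substitution_onem R h 2^-1 h01 (continuous_subspaceT ch).
have o : unstable.onem 2^-1 = 2^-1 :> R by rewrite /unstable.onem; lra.
rewrite o in S.
have hs x : h (unstable.onem x) = h x by rewrite /unstable.onem addrC hp he.
have S2 : (\int[mu]_(x in `[2^-1, 1%R]) h (unstable.onem x) = \int[mu]_(x in `[2^-1, 1%R]) h x)%R.
  by apply: eq_Rintegral => x _; rewrite hs.
rewrite S2 in S.
by rewrite -S /int01 in E *; lra.
Qed.

End HalfPeriod.

(** * The unit norm excludes the growing Bessel solution *)

Section NoGrowth.
Variable R : realType.
Variables (phi : R[i] -> R) (t : R).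
Hypothesis hphi : even_hecke_maass_cusp_form phi t.
Let f : R * R -> R := in_coords phi.
Notation coef := (coef phi).
Notation mu := (@lebesgue_measure R).
Let U : set (R * R) := [set p | 0 < p.2].

Let mU : measurable U.
Proof.
have -> : U = setT `&` snd @^-1` `]0%R, +oo[%classic.
  by rewrite setTI; apply/seteqP; split => p /=; rewrite in_itv /= andbT.
by apply: measurable_snd => //; exact: measurable_itv.
Qed.

Let m_fst (h : R -> R) : continuous h -> measurable_fun U (fun p : R * R => h p.1).
Proof.
move=> ch; apply: (measurableT_comp (continuous_measurable_fun ch)).
by apply: measurable_funTS; exact: measurable_fst.
Qed.

Let m_snd (h : R -> R) : (forall y, 0 < y -> derivable h y 1) -> measurable_fun U (fun p : R * R => h p.2).
Proof.
move=> dh; pose h0 := h \_ `]0%R, +oo[%classic.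
have mh0 : measurable_fun setT h0.
  apply/(measurable_restrict _ (measurable_itv _) measurableT); rewrite setTI.
  apply: subspace_continuous_measurable_fun; first exact: measurable_itv.
  by apply: derivable_within_continuous => y; rewrite in_itv /= andbT; exact: dh.
have m : measurable_fun U (fun p : R * R => h0 p.2).
  by apply: (measurableT_comp mh0); apply: measurable_funTS; exact: measurable_snd.
apply: eq_measurable_fun m => p; rewrite inE /U /= => p0.
by rewrite /h0 /patch ifT // inE /= in_itv /= andbT.
Qed.

(** Joint measurability comes from the Fourier series: its partial sums are finite sums of products
    of functions of one variable. *)
Lemma form_measurable : measurable_fun U f.
Proof.
apply/measurable_EFinP.
pose P K (p : R * R) := 2 * \sum_(1 <= n < K.+1) coef n p.2 * cos (2 * pi * n%:R * p.1).
apply: (@emeasurable_fun_cvg _ _ _ U (fun K p => (P K p)%:E)).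
  move=> K; apply/measurable_EFinP; apply: measurable_funM; first exact: measurable_cst.
  apply: measurable_sum => n; apply: measurable_funM; last exact: (m_fst (@cont_cosax R (2 * pi * n%:R))).
  by apply: m_snd => y y0; case: (coef_derive hphi n y0).
move=> [x y] y0; apply: cvg_EFin; first exact: nearW.
have [C C0 hC] := slice_fourier hphi (y0 : 0 < y).
apply/cvgrPdist_le => /= e e0.
pose m := Num.bound (C / e).
have ce : 0 <= C / e by rewrite divr_ge0 // ltW.
exists m.+1 => // K /= mK; have K0 : (0 < K)%N by apply: leq_trans mK.
apply: (le_trans (hC K x K0)); rewrite ler_pdivrMr ?ltr0n // mulrC -ler_pdivrMr //.
apply: le_trans (ltW (archi_boundP ce)) _; rewrite ler_nat; exact: ltnW.
Qed.

Let g (p : R * R) : \bar R := (f p ^+ 2 / p.2 ^+ 2)%R%:E.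

Let mg : measurable_fun U g.
Proof.
apply/measurable_EFinP; apply: measurable_funM.
  by apply: measurable_funX; exact: form_measurable.
apply: (m_snd (h := fun y => (y ^+ 2)^-1)) => y y0.
have y20 : y ^+ 2 != 0 by rewrite expf_neq0 // lt0r_neq0.
by have := @is_deriveV R (fun z => z ^+ 2) y _ 1 y20 (derX (derI y)); case.
Qed.

Let mFD : measurable (@fundamental_domain R).
Proof.
pose q (p : R * R) := p.1 ^+ 2 + p.2 ^+ 2.
have mq : measurable_fun setT q.
  by apply: measurable_funD; apply: measurable_funX; [exact: measurable_fst|exact: measurable_snd].
have -> : @fundamental_domain R = (U `&` (setT `&` fst @^-1` `[- 2^-1, 2^-1]%classic)) `&` (setT `&` q @^-1` `[1%R, +oo[%classic).
  rewrite !setTI; apply/seteqP; split => p; rewrite /fundamental_domain /= !in_itv /= andbT ler_norml.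
    by case=> a b c; split.
  by case=> [[a b] c]; split.
apply: measurableI; first apply: measurableI => //.
  by apply: measurable_fst => //; exact: measurable_itv.
by apply: mq => //; exact: measurable_itv.
Qed.

(** Otherwise $\int_0^{1/2}\phi^2y^{-2}dx\ge a_1(y)^2/y^2\ge d$ at every height from Y1 on, and the
    rectangle of height 2/d above Y1 would alone carry a mass of at least 2, against the unit
    norm. *)
Lemma coef1_not_growing Y1 d : 1 <= Y1 -> 0 < d ->
  exists2 y, Y1 <= y & coef 1 y ^+ 2 < d * y ^+ 2.
Proof.
move=> Y11 d0; apply: contrapT => H.
have {}H y : Y1 <= y -> d * y ^+ 2 <= coef 1 y ^+ 2.
  by move=> yy; rewrite leNgt; apply/negP => c; apply: H; exists y.
pose N := 2 / d; have N0 : 0 < N by rewrite divr_gt0.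
pose Y2 := Y1 + N.
pose Q : set (R * R) := `[0%R, 2^-1]%classic `*` `[Y1, Y2]%classic.
have mQ : measurable Q by apply: measurableX; exact: measurable_itv.
have QU : Q `<=` U by move=> p [_] /=; rewrite in_itv /= => /andP[a _]; rewrite /U /=; lra.
have QF : Q `<=` @fundamental_domain R.
  move=> [x y] [] /=; rewrite !in_itv /= => /andP[x0 x1] /andP[a _]; split => //=; first by lra.
    by rewrite ger0_norm.
  have : 1 <= y ^+ 2 by rewrite expr2; nra.
  have := sqr_ge0 x; lra.
have g0 p : (0%R <= g p)%E.
  by rewrite lee_fin divr_ge0 // sqr_ge0.
have mgF : measurable_fun (@fundamental_domain R) g.
  by apply: measurable_funS mg => // p [].
have := ge0_subset_integral (lebesgue_measure \x lebesgue_measure)%E mQ mFD mgF (fun p _ => g0 p) QF.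
have := ehm_normalized hphi; rewrite /L2_normalized -/f => ->.
rewrite integral_mkcond; set G := g \_ Q.
have mG : measurable_fun setT G.
  apply/(measurable_restrict _ mQ measurableT); rewrite setTI.
  exact: measurable_funS mg.
have G0 p : (0%R <= G p)%E by rewrite /G /patch; case: ifP.
have F2 := @fubini_tonelli2 _ _ _ _ _ mu mu G mG G0.
rewrite F2.
have low : (\int[mu]_y ((cst d%:E) \_ `[Y1, Y2]) y <= \int[mu]_y fubini_G mu G y)%E.
  apply: ge0_le_integral => //.
  - by move=> y _; rewrite /patch; case: ifP => // _; rewrite lee_fin ltW.
  - apply/(measurable_restrict _ (measurable_itv _) measurableT); exact: measurable_cst.
  - exact: measurable_fun_fubini_tonelli_G.
  move=> y _; rewrite {1}/patch; case: ifPn => [|_]; last first.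
    by apply: integral_ge0 => x _; exact: G0.
  rewrite inE /= in_itv /= => yI; have y1 : Y1 <= y by case/andP: yI.
  have y0 : 0 < y by lra.
  have -> : fubini_G mu G y = (\int[mu]_(x in `[0%R, 2^-1%R]) (f (x, y) ^+ 2 / y ^+ 2)%R%:E)%E.
    rewrite [RHS]integral_mkcond; apply: eq_integral => x _; rewrite /G /patch.
    have -> : ((x, y) \in Q) = (x \in `[0%R, 2^-1]%classic).
      apply/idP/idP; rewrite !inE /Q /=; first by case.
      by move=> xx; split => //=; rewrite in_itv.
    by [].
  have cf : continuous (fun x => f (x, y)) by exact: (is_derive_continuous (slice_derive hphi y0)).
  have cf2 : continuous (fun x => f (x, y) ^+ 2 / y ^+ 2).
    have -> : (fun x => f (x, y) ^+ 2 / y ^+ 2) = (fun x => (y ^+ 2)^-1 * (f (x, y) * f (x, y))).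
      by apply: funext => x; rewrite mulrC expr2.
    by apply: contZ; exact: contM.
  have I := cont_integrable 0 2^-1 cf2.
  have Fn : (\int[mu]_(x in `[0%R, 2^-1%R]) (f (x, y) ^+ 2 / y ^+ 2)%R%:E)%E \is a fin_num by exact: (integrable_fin_num _ I).
  rewrite -(fineK Fn) lee_fin.
  change (d <= (\int[mu]_(x in `[0%R, 2^-1]) (f (x, y) ^+ 2 / y ^+ 2))%R).
  rewrite int_half //; last 2 first.
  - by move=> x; rewrite /f (form_periodic hphi).
  - by move=> x; rewrite /f (form_even hphi).
  have c2 : continuous (fun x => f (x, y) ^+ 2).
    have -> : (fun x => f (x, y) ^+ 2) = (fun x => f (x, y) * f (x, y)) by apply: funext => x; rewrite expr2.
    exact: contM.
  have -> : (fun x => f (x, y) ^+ 2 / y ^+ 2) = (fun x => (y ^+ 2)^-1 * f (x, y) ^+ 2) by apply: funext => x; rewrite mulrC.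
  rewrite int01Z //.
  have B := int01_sqr_ge (slice_derive hphi y0) (ltn0Sn 0).
  have {}H := H y y1; have y20 : 0 < y ^+ 2 by rewrite exprn_gt0.
  rewrite -/(coef 1 y) -/f in B; move: B; set u := int01 _ => B.
  have -> : y ^- 2 * u / 2 = u / 2 / y ^+ 2 by ring.
  by rewrite ler_pdivlMr //; lra.
move/(le_trans low); rewrite -integral_mkcond integral_cst //.
move=> h; have muE : mu `[Y1, Y2]%classic = N%:E.
  by rewrite lebesgue_measure_itv /= lte_fin /Y2 ltrDl N0 -EFinB addrAC subrr add0r.
have : (d%:E * mu `[Y1, Y2]%classic <= 1)%E by exact: h.
rewrite muE -EFinM lee_fin /N mulrC divfK ?lt0r_neq0 //; lra.
Qed.

Lemma radial_not_growing s1 d : 0 < d -> exists2 s, s1 <= s & radial phi s ^+ 2 < d * expR s.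
Proof.
move=> d0; pose Y1 := Num.max 1 (expR s1).
have Y11 : 1 <= Y1 by rewrite le_max lexx.
have [y yY hy] := coef1_not_growing Y11 d0.
have y0 : 0 < y by lra.
exists (ln y).
  rewrite -ler_expR lnK ?posrE //; apply: le_trans yY; by rewrite le_max lexx orbT.
rewrite lnK ?posrE //; move: hy; rewrite coef1_radial // exprMn sqr_sqrtr ?ltW // [y ^+ 2]expr2.
by rewrite (mulrCA d y y) ltr_pM2l.
Qed.

End NoGrowth.

(** * Boundedness of the form and a trivial bound for the eigenvalues *)

Section Boundedness.
Variable R : realType.
Variables (phi : R[i] -> R) (t : R).
Hypothesis hphi : even_hecke_maass_cusp_form phi t.
Hypothesis t2 : 2 <= t.
Let f : R * R -> R := in_coords phi.
Notation coef := (coef phi).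
Notation K := (radial phi).

(* Translating to [|x| <= 1/2] and inverting at least doubles a height below 1/2. *)
Lemma reduction (x y : R) : 0 < y -> exists x' y', 2^-1 <= y' /\ f (x, y) = f (x', y').
Proof.
move=> y0.
suff H k : forall x y, 0 < y -> 2^-1 <= (2 ^ k)%:R * y -> exists x' y', 2^-1 <= y' /\ f (x, y) = f (x', y').
  pose k := Num.bound (y^-1).
  have yi : 0 <= y^-1 by rewrite invr_ge0 ltW.
  apply: (H k x y y0); rewrite -ler_pdivrMr //.
  have := archi_boundP yi; rewrite -/k => h.
  have : k%:R <= (2 ^ k)%:R :> R by rewrite ler_nat ltnW // ltn_expl.
  lra.
elim: k => [|k IH] {}x {}y {}y0.
  by rewrite expn0 mul1r => h; exists x, y.
rewrite expnS natrM => h.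
have [y2|y2] := leP 2^-1 y; first by exists x, y.
pose m := Num.floor (x + 2^-1); pose x0 := x - m%:~R.
have fx : f (x, y) = f (x0, y).
  have := @hperZ R (fun u => f (u, y)) (fun u => form_periodic hphi u y0) x0 m.
  by rewrite /x0 subrK.
have h1 : x0 <= 2^-1.
  have := lt_succ_floor (x + 2^-1); rewrite intrD -/m /x0 => /ltW; lra.
have h2 : - 2^-1 <= x0.
  have := floor_le (x + 2^-1); rewrite -/m /x0; lra.
have n2 : x0 ^+ 2 + y ^+ 2 <= 2^-1 by nra.
have n0 : 0 < x0 ^+ 2 + y ^+ 2 by have := sqr_ge0 x0; nra.
rewrite fx /f -(form_inversion hphi x0 y0) -/f; apply: IH; first by rewrite divr_gt0.
apply: (le_trans h); rewrite mulrAC mulrC ler_wpM2l // ?mulr_ge0 //.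
by rewrite ler_pdivlMr //; nra.
Qed.

(** Up to the height 2t this is compactness. Above it, the coefficients are compared with those at
    the height t, which are bounded by B0; the decay of K leaves at most $4B_0/n^2$, which is
    summable. *)
Lemma form_bounded_high : exists2 A, 0 <= A & forall x y, 2^-1 <= y -> `|f (x, y)| <= A.
Proof.
have T2 := t2; have t0 : 0 < t by lra.
have [B0 B00 hB0] : exists2 B, 0 <= B & forall x, 0 <= x <= 1 -> `|f (x, t)| <= B.
  by apply: bounded_segment; exact: (is_derive_continuous (slice_derive hphi t0)).
have [B1 B10 hB1] : exists2 B, 0 <= B & forall x y, 0 <= x <= 1 -> 2^-1 <= y <= 2 * t -> `|f (x, y)| <= B.
  apply: bounded_rectangle => x y _ /andP[yl _]; apply: (form_continuous hphi); lra.
exists (B1 + 16 * B0) => [|x y yl]; first by rewrite addr_ge0 // mulr_ge0.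
have y0 : 0 < y by lra.
have [yt|yt] := leP y (2 * t).
  pose m := Num.floor x.
  have -> : f (x, y) = f (x - m%:~R, y).
    by rewrite -[in LHS](subrK m%:~R x); apply: (@hperZ R (fun u => f (u, y)) (fun u => form_periodic hphi u y0)).
  apply: (@le_trans _ _ B1); last by rewrite lerDl mulr_ge0.
  apply: hB1; last by apply/andP.
  have := floor_le x; have := lt_succ_floor x; rewrite intrD -/m => a b; clear -a b; apply/andP; split; lra.
have cn n : (0 < n)%N -> `|coef n y| <= 4 * B0 * (n%:R ^+ 2)^-1.
  move=> n0; have nR : 0 < n%:R :> R by rewrite ltr0n.
  have n1 : 1 <= n%:R :> R by rewrite ler1n.
  have cB : `|coef n t| <= B0 by apply: (fcoef_le (slice_derive hphi t0)).
  have nt0 : 0 < n%:R * t by rewrite mulr_gt0.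
  have ny0 : 0 < n%:R * y by rewrite mulr_gt0.
  have e1 : t <= expR (ln (n%:R * t)) by rewrite lnK ?posrE // ler_peMl // ltW.
  have e2 : ln (n%:R * t) <= ln (n%:R * y) by rewrite ler_ln ?posrE // ler_pM2l //; lra.
  have D := K_decay t2 (radial_derive hphi) (radial_derive2 hphi) (radial_not_growing hphi) e1 e2.
  rewrite !lnK ?posrE // in D.
  have st : 0 < Num.sqrt t by rewrite sqrtr_gt0.
  have sy : 0 < Num.sqrt y by rewrite sqrtr_gt0.
  have cE v : 0 < v -> `|coef n v| = `|lam hphi n| * (Num.sqrt v * `|K (ln (n%:R * v))|).
    by move=> v0; rewrite (coef_radial hphi) // !normrM (ger0_norm (sqrtr_ge0 v)).
  have r1 : Num.sqrt y <= y / t * Num.sqrt t.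
    have -> : y = t * (y / t) by rewrite mulrC divfK // lt0r_neq0.
    have yt0 : 0 < y / t by rewrite divr_gt0.
    rewrite sqrtrM ?(ltW t0) // mulrC [t * _]mulrC mulfK ?lt0r_neq0 // ler_pM2r //.
    have yt1 : 1 <= y / t by rewrite ler_pdivlMr // mul1r; lra.
    rewrite -(@ler_pXn2r _ 2) ?nnegrE ?sqrtr_ge0 ?(ltW yt0) // sqr_sqrtr ?(ltW yt0) //.
    by rewrite expr2 ler_peMl // ltW.
  have r2 : y / t * expR (n%:R * t - n%:R * y) <= 4 * (n%:R ^+ 2)^-1.
    have yt1 : y / t <= 1 + (y - t) / 2.
      rewrite ler_pdivrMr //; nra.
    have ex1 : y / t <= expR ((y - t) / 2) by apply: (le_trans yt1); exact: expR_ge1Dx.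
    apply: (@le_trans _ _ (expR ((y - t) / 2) * expR (n%:R * t - n%:R * y))).
      by rewrite ler_wpM2r ?expR_ge0.
    rewrite -expRD.
    apply: (@le_trans _ _ (expR (- n%:R))).
      by rewrite ler_expR; nra.
    rewrite expRN -[4 * _]invrK invfM invrK lef_pV2 ?posrE ?expR_gt0 //; last by rewrite mulr_gt0 ?exprn_gt0.
    have -> : expR n%:R = expR (n%:R / 2) ^+ 2 :> R by rewrite -expRM_natl; congr expR; field.
    have := expR_ge1Dx (n%:R / 2 : R); set E := expR _ => hE.
    by nra.
  rewrite cE //.
  apply: (@le_trans _ _ (`|coef n t| * (4 * (n%:R ^+ 2)^-1))); last first.
    rewrite mulrA ler_wpM2r ?invr_ge0 ?sqr_ge0 //; lra.
  rewrite cE // -mulrA ler_wpM2l //.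
  apply: (@le_trans _ _ (Num.sqrt t * `|K (ln (n%:R * t))| * (y / t * expR (n%:R * t - n%:R * y)))); last first.
    by rewrite ler_wpM2l // mulr_ge0 ?sqrtr_ge0.
  apply: (@le_trans _ _ (y / t * Num.sqrt t * (`|K (ln (n%:R * t))| * expR (n%:R * t - n%:R * y)))).
    by apply: ler_pM => //; exact: sqrtr_ge0.
  by rewrite le_eqVlt; apply/orP; left; apply/eqP; ring.
have [C C0 hC] := slice_fourier hphi y0.
apply: (@le_of_le_div _ _ _ C 1) => k k0.
have := hC k x k0; rewrite -/f => h.
rewrite -[f (x, y)](subrK (2 * \sum_(1 <= n < k.+1) coef n y * cos (2 * pi * n%:R * x))) addrC.
apply: (le_trans (ler_normD _ _)); apply: lerD => //.
rewrite normrM ger0_norm //.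
have : `|\sum_(1 <= n < k.+1) coef n y * cos (2 * pi * n%:R * x)| <= 4 * B0 * 2.
  apply: (le_trans (ler_norm_sum _ _ _)).
  apply: (@le_trans _ _ (\sum_(1 <= n < k.+1) 4 * B0 * (n%:R ^+ 2)^-1)).
    rewrite big_nat_cond [leRHS]big_nat_cond; apply: ler_sum => n /andP[/andP[n0 _] _].
    by rewrite normrM; apply: (le_trans _ (cn n n0)); rewrite ler_piMr // cos_max.
  rewrite -mulr_sumr ler_wpM2l // ?mulr_ge0 //.
  rewrite big_nat_recl //= expr1n invr1 (_ : 2 = 1 + 1) // lerD2l.
  have H := @sum_inv_sqr R 1 k (ltn0Sn 0); rewrite big_add1 /= in H.
  by apply: (le_trans H); rewrite invr1.
lra.
Qed.

(** A is the supremum over heights at least 1/2, which bounds the form everywhere by [reduction].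
    Its minimality is recorded because later estimates improve a bound on the high part into a bound
    on A. *)
Lemma form_sup : exists2 A, 0 < A & (forall x y, 0 < y -> `|f (x, y)| <= A) /\
  (forall B, (forall x y, 2^-1 <= y -> `|f (x, y)| <= B) -> A <= B).
Proof.
have [A0 A00 hA0] := form_bounded_high.
pose S : set R := [set z | exists x y, 2^-1 <= y /\ z = `|f (x, y)|].
have hub : ubound S A0 by move=> _ [x [y [yl ->]]]; exact: hA0.
have Sne : S !=set0 by exists `|f (0, 2^-1)|, 0, 2^-1.
have hS : has_sup S by split => //; exists A0.
have ub x y : 0 < y -> `|f (x, y)| <= sup S.
  move=> y0; have [x' [y' [yl ->]]] := reduction x y0.
  by apply: sup_upper_bound => //; exists x', y'.
exists (sup S); last first.
  split=> // B hB; apply: ge_sup => // _ [x [y [yl ->]]]; exact: hB.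
rewrite lt_neqAle; apply/andP; split; last first.
  exact: le_trans (normr_ge0 _) (ub 0 1 ltr01).
apply/eqP => E; have [y y0 /eqP cy] := coef1_neq0 hphi; apply: cy.
apply/eqP; rewrite -normr_le0 E; apply: (fcoef_le (slice_derive hphi y0)) => x _; exact: ub.
Qed.

(** The Hecke operator sums at most $n^2$ values of the form, so $|\lambda(n)\phi|\le n^2A$
    everywhere; as A is the least bound, it can be divided out. *)
Lemma lam_le_sqr n : (0 < n)%N -> `|lam hphi n| <= n%:R ^+ 2.
Proof.
move=> n0; have nR : 1 <= n%:R :> R by rewrite ler1n.
have [A A0 [hA hmin]] := form_sup.
have key x y : 0 < y -> `|lam hphi n| * `|f (x, y)| <= n%:R ^+ 2 * A.
  move=> y0; rewrite -normrM -/f -(lamP hphi) // hecke_coords normrM.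
  have s1 : 1 <= Num.sqrt n%:R :> R.
    have : Num.sqrt (1 : R) <= Num.sqrt n%:R by rewrite ler_wsqrtr.
    by rewrite sqrtr1.
  have s0 : 0 < (Num.sqrt n%:R)^-1 :> R by rewrite invr_gt0; lra.
  rewrite (gtr0_norm s0).
  apply: (@le_trans _ _ (1 * `|\sum_(d <- divisors n) \sum_(0 <= b < d) f (((n %/ d)%:R * x + b%:R) / d%:R, (n %/ d)%:R * y / d%:R)|)).
    by rewrite ler_wpM2r // invf_le1 //; lra.
  rewrite mul1r; apply: (le_trans (ler_norm_sum _ _ _)).
  apply: (@le_trans _ _ (\sum_(d <- divisors n) n%:R * A)).
    rewrite big_seq [leRHS]big_seq; apply: ler_sum => d; rewrite -dvdn_divisors // => dn.
    have d0 := dvdn_gt0 n0 dn.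
    have y'0 : 0 < (n %/ d)%:R * y / d%:R by rewrite divr_gt0 ?mulr_gt0 ?ltr0n // divn_gt0 // dvdn_leq.
    apply: (le_trans (ler_norm_sum _ _ _)).
    apply: (@le_trans _ _ (\sum_(0 <= b < d) A)); first by apply: ler_sum => b _; exact: hA.
    by rewrite sumr_const_nat subn0 -[_ *+ d]mulr_natl ler_wpM2r ?(ltW A0) // ler_nat dvdn_leq.
  rewrite big_const_seq count_predT iter_addr_0 -[_ *+ _]mulr_natl expr2 -mulrA ler_wpM2r //.
    by rewrite mulr_ge0 // ltW.
  rewrite ler_nat; apply: leq_trans (_ : size (iota 1 n) <= n)%N; last by rewrite size_iota.
  apply: uniq_leq_size; first exact: divisors_uniq.
  by move=> d; rewrite -dvdn_divisors // mem_iota => dn; rewrite (dvdn_gt0 n0 dn) add1n ltnS dvdn_leq.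
rewrite -(ler_pM2r A0).
have [l0|l0] := eqVneq (lam hphi n) 0.
  by rewrite l0 normr0 mul0r mulr_ge0 ?sqr_ge0 // ltW.
have lp : 0 < `|lam hphi n| by rewrite normr_gt0.
rewrite mulrC -ler_pdivlMr //; apply: hmin => x y yl.
rewrite ler_pdivlMr // mulrC; apply: key; lra.
Qed.

End Boundedness.

(** * Test polynomials *)

Section Smoothing.
Variable R : realType.
Implicit Types (x y : R).

(** What 2L averages over a grid of L points do to the frequency n: about $\exp(-\pi^2n^2/L)$ for
    small n/L, close to 1 as long as n is small against $\sqrt L$ and negligible far beyond $\sqrt
    L$. *)
Definition smooth_factor (L n : nat) : R := cos (pi * n%:R / L%:R) ^+ L.*2.

Lemma sin2_le_sqr x : 0 <= x -> sin x ^+ 2 <= x ^+ 2.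
Proof.
move=> x0; have := @der_dist_le R sin cos 1 0 x (fun z _ => is_derive_sin z) (fun z _ => cos_max z) x0.
rewrite sin0 !subr0 mul1r => h.
by rewrite -(@real_normK _ (sin x)) ?num_real // ler_pXn2r ?nnegrE.
Qed.

Lemma smooth_factorE L n : smooth_factor L n = (1 - sin (pi * n%:R / L%:R) ^+ 2) ^+ L.
Proof. by rewrite /smooth_factor -mul2n exprM cos2sin2. Qed.

Lemma smooth_factor_ge0 L n : 0 <= smooth_factor L n.
Proof. by rewrite smooth_factorE -cos2sin2 exprn_ge0 // sqr_ge0. Qed.

Lemma smooth_factor_le1 L n : smooth_factor L n <= 1.
Proof.
have s0 := sqr_ge0 (sin (pi * n%:R / L%:R) : R); have c0 := sqr_ge0 (cos (pi * n%:R / L%:R) : R).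
by rewrite smooth_factorE exprn_ile1 -?cos2sin2 //; have := cos2Dsin2 (pi * n%:R / L%:R : R); lra.
Qed.

Lemma bernoulli x n : 0 <= x <= 1 -> 1 - n%:R * x <= (1 - x) ^+ n.
Proof.
move=> /andP[x0 x1]; elim: n => [|n IH]; first by rewrite mul0r subr0 expr0.
have nx : 0 <= n%:R * x by rewrite mulr_ge0.
rewrite exprSr; have [h|h] := leP (1 - n%:R * x) 0.
  apply: (@le_trans _ _ 0); first by rewrite -natr1; lra.
  by rewrite mulr_ge0 ?exprn_ge0 ?subr_ge0.
apply: (@le_trans _ _ ((1 - n%:R * x) * (1 - x))); first by rewrite -natr1; nra.
by rewrite ler_wpM2r ?subr_ge0.
Qed.

Lemma smooth_factor_ge L n : (64 * n ^ 2 <= L)%N -> 3 / 4 <= smooth_factor L n.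
Proof.
move=> nL; have [->|L0] := posnP L.
  by rewrite /smooth_factor expr0; lra.
have LR : 0 < L%:R :> R by rewrite ltr0n.
have p0 := pi_gt0 R; have p4 : pi <= 4 :> R by have := @pihalf_lt2 R; lra.
rewrite smooth_factorE; set x := pi * n%:R / L%:R.
have x0 : 0 <= x by rewrite divr_ge0 // mulr_ge0 // ltW.
have nL' : 64 * n%:R ^+ 2 <= L%:R :> R by rewrite -natrX -(natrM _ 64) ler_nat.
have s1 := sin2_le_sqr x0.
apply: (@le_trans _ _ (1 - L%:R * sin x ^+ 2)); last first.
  apply: bernoulli; rewrite sqr_ge0 /=; have := sqr_ge0 (cos x); have := cos2Dsin2 x; lra.
have : L%:R * sin x ^+ 2 <= L%:R * x ^+ 2 by rewrite ler_pM2l.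
have : L%:R * x ^+ 2 <= 1 / 4.
  have -> : L%:R * x ^+ 2 = pi ^+ 2 * n%:R ^+ 2 / L%:R by rewrite /x; field; rewrite lt0r_neq0.
  rewrite ler_pdivrMr //.
  have : pi ^+ 2 <= 16 :> R by nra.
  have := sqr_ge0 (n%:R : R); set N := n%:R ^+ 2 in nL' *; nra.
lra.
Qed.

Lemma smooth_factor_small L n : (n.*2 <= L)%N -> smooth_factor L n <= expR (- (n%:R ^+ 2 / L%:R)).
Proof.
move=> nL; have [L0|L0] := posnP L.
  by rewrite L0 invr0 mulr0 oppr0 expR0 smooth_factor_le1.
have LR : 0 < L%:R :> R by rewrite ltr0n.
have p0 := pi_gt0 R; have p2 := pi_ge2 R.
rewrite smooth_factorE; set x := pi * n%:R / L%:R.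
have nL0 : 0 <= n%:R / L%:R :> R by rewrite divr_ge0.
have x0 : 0 <= x by rewrite divr_ge0 // mulr_ge0 // ltW.
have nL' : 2 * n%:R <= L%:R :> R by rewrite -(natrM _ 2) ler_nat mul2n.
have xE : x = pi * (n%:R / L%:R) by rewrite /x mulrA.
have n2 : n%:R / L%:R <= 2^-1 :> R by rewrite ler_pdivrMr //; lra.
have xh : x <= pi / 2 by rewrite xE ler_pM2l.
have s1 : n%:R / L%:R <= sin x.
  apply: (@le_trans _ _ (x / 2)); last by apply: sin_ge_half; rewrite x0.
  by rewrite xE; nra.
have s2 : (n%:R / L%:R) ^+ 2 <= sin x ^+ 2.
  by rewrite ler_pXn2r ?nnegrE // (le_trans nL0).
apply: (@le_trans _ _ (expR (- (n%:R / L%:R) ^+ 2) ^+ L)).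
  have c0 : 0 <= 1 - sin x ^+ 2 by rewrite -cos2sin2 sqr_ge0.
  rewrite ler_pXn2r ?nnegrE ?expR_ge0 //.
  by apply: le_trans (expR_ge1Dx _); lra.
rewrite -expRM_natl ler_expR le_eqVlt; apply/orP; left; apply/eqP; field.
by rewrite lt0r_neq0.
Qed.

Variable L : nat.
Hypothesis L0 : (0 < L)%N.
Let LR : 0 < L%:R :> R. Proof. by rewrite ltr0n. Qed.

Definition trig_poly (b : nat -> R) j := \sum_(1 <= n < L | (4 * n <= L)%N) b n * cos (grid_angle R L n j).
Definition grid_norm (u : nat -> R) := L%:R^-1 * \sum_(0 <= j < L) `|u j|.

Lemma grid_norm_ge0 u : 0 <= grid_norm u.
Proof. by rewrite mulr_ge0 ?invr_ge0 // sumr_ge0. Qed.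

Lemma cos_cos_ortho n k : (0 < n)%N -> (n.*2 < L)%N -> (0 < k)%N -> (k.*2 < L)%N ->
  \sum_(0 <= j < L) cos (grid_angle R L n j) * cos (grid_angle R L k j) = if n == k then L%:R / 2 else 0.
Proof.
move=> n0 nL k0 kL; have := @grid_ortho R L L0 n k 0 0 n0 nL k0 kL; rewrite subrr cos0 mulr1 => <-.
by apply: eq_bigr => j _; rewrite !addr0.
Qed.

Lemma trig_poly_pairing b (k : nat) : (0 < k)%N -> (4 * k <= L)%N ->
  \sum_(0 <= j < L) trig_poly b j * cos (grid_angle R L k j) = L%:R / 2 * b k.
Proof.
move=> k0 kL; rewrite /trig_poly.
under eq_bigr do rewrite mulr_suml.
rewrite exchange_big /=.
have k2 : (k.*2 < L)%N by rewrite -muln2; lia.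
have E n : (n \in index_iota 1 L) && (4 * n <= L)%N ->
    \sum_(0 <= j < L) b n * cos (grid_angle R L n j) * cos (grid_angle R L k j) = if n == k then L%:R / 2 * b k else 0.
  rewrite mem_index_iota => /andP[/andP[n1 nL] n4].
  have n2 : (n.*2 < L)%N by rewrite -muln2; lia.
  under eq_bigr do rewrite -mulrA.
  rewrite -mulr_sumr cos_cos_ortho //; case: eqP => [->|_]; first by rewrite mulrC.
  by rewrite mulr0.
rewrite big_seq_cond (eq_bigr _ E) -big_seq_cond -big_mkcondr /=.
have kI : k \in index_iota 1 L by rewrite mem_index_iota k0; lia.
rewrite (big_rem k) //= eqxx kL /= big1_seq ?addr0 // => n /andP[/andP[_ /eqP ->]].
by rewrite mem_rem_uniqF // iota_uniq.
Qed.

(* Duality: a bounded test polynomial bounds the grid norm from below. *)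
Lemma trig_poly_duality (I J : eqType) (r : seq I) (s : seq J) (c : I -> J -> R) (nn : I -> J -> nat) b X :
  (forall i k, i \in r -> k \in s -> (0 < nn i k)%N /\ (4 * nn i k <= L)%N) ->
  (forall j, `|\sum_(i <- r) \sum_(k <- s) c i k * cos (grid_angle R L (nn i k) j)| <= X) ->
  `|\sum_(i <- r) \sum_(k <- s) c i k * b (nn i k)| <= 2 * X * grid_norm (trig_poly b).
Proof.
move=> hn hX.
pose g j := \sum_(i <- r) \sum_(k <- s) c i k * cos (grid_angle R L (nn i k) j).
have E : \sum_(0 <= j < L) trig_poly b j * g j = L%:R / 2 * \sum_(i <- r) \sum_(k <- s) c i k * b (nn i k).
  rewrite /g; under eq_bigr do rewrite mulr_sumr.
  rewrite exchange_big /= mulr_sumr big_seq [RHS]big_seq; apply: eq_bigr => i ir.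
  under eq_bigr do rewrite mulr_sumr.
  rewrite exchange_big /= mulr_sumr big_seq [RHS]big_seq; apply: eq_bigr => k ks.
  have [n0 n4] := hn i k ir ks.
  under eq_bigr do rewrite mulrCA.
  by rewrite -mulr_sumr trig_poly_pairing // mulrCA.
have -> : \sum_(i <- r) \sum_(k <- s) c i k * b (nn i k) = 2 / L%:R * \sum_(0 <= j < L) trig_poly b j * g j.
  by rewrite E; field; rewrite lt0r_neq0.
rewrite normrM ger0_norm ?divr_ge0 // /grid_norm.
have -> : 2 * X * (L%:R^-1 * \sum_(0 <= j < L) `|trig_poly b j|) = 2 / L%:R * (X * \sum_(0 <= j < L) `|trig_poly b j|) by ring.
rewrite ler_wpM2l ?divr_ge0 //; apply: (le_trans (ler_norm_sum _ _ _)).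
rewrite mulr_sumr; apply: ler_sum => j _; rewrite normrM mulrC ler_wpM2r //; exact: hX.
Qed.

End Smoothing.

(** * Primes at which an eigenvalue is bounded below *)

Section PrimeSupply.
Variable R : realType.

Lemma many_primes z h : (0 < z)%N -> (z.*2 <= 2 ^ h)%N -> (z <= h * size (primes_upto z.*2))%N.
Proof.
move=> z0 zh; have := chebyshev_lower z0; rewrite -mul2n mul2n => c.
rewrite -(leq_exp2l _ _ (ltnSn 1)); apply: (leq_trans c).
rewrite expnM; case: (size _) => [|k]; first by rewrite !expn0.
by rewrite leq_exp2r.
Qed.

Definition primes_between y z := [seq p <- primes_upto z | (y < p)%N].

Lemma primes_between_size y z : (size (primes_upto z) - y <= size (primes_between y z))%N.
Proof.
rewrite leq_subLR -(count_predC (fun p => (y < p)%N) (primes_upto z)) -size_filter -/(primes_between y z).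
rewrite addnC leq_add2r -size_filter -(size_iota 1 y).
apply: uniq_leq_size; first by rewrite filter_uniq // filter_uniq // iota_uniq.
move=> p; rewrite !mem_filter mem_iota /= -leqNgt mem_iota => /andP[py /andP[pp /andP[p1 _]]].
by move: py; rewrite size_iota => py; rewrite p1 add1n ltnS.
Qed.

Lemma mem_primes_between y z p : (p \in primes_between y z) = [&& prime p, (y < p)%N & (p <= z)%N].
Proof.
rewrite !mem_filter mem_iota add1n ltnS andbA andbC -!andbA andbC -!andbA.
by case: (boolP (prime p)) => [pp|]; rewrite ?andbF //= ?prime_gt0 //= ?andbT ?(prime_gt0 pp) //= andbC ?andbT //.
Qed.

Variable lam : nat -> R.
Hypothesis hecke_rel : forall m n, (0 < m)%N -> (0 < n)%N ->
  lam m * lam n = \sum_(d <- divisors (gcdn m n)) lam (m * n %/ d ^ 2).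
Hypothesis lam1 : lam 1 = 1.

Lemma lam_coprime m n : (0 < m)%N -> (0 < n)%N -> coprime m n -> lam (m * n) = lam m * lam n.
Proof.
by move=> m0 n0 /eqP cmn; rewrite hecke_rel // cmn /= big_seq1 exp1n divn1.
Qed.

Lemma lam_prime_sqr p : prime p -> lam p ^+ 2 = lam (p ^ 2) + 1.
Proof.
move=> pp; have p0 := prime_gt0 pp; rewrite expr2 hecke_rel // gcdnn.
rewrite (perm_big [:: 1%N; p]) /=; last first.
  apply: uniq_perm; rewrite ?divisors_uniq //= ?inE ?andbT; first by rewrite neq_ltn prime_gt1.
  move=> d; rewrite -dvdn_divisors // !inE; have /primeP[_ H] := pp.
  by apply/idP/orP => [/H/orP//|[/eqP->|/eqP->]]; rewrite ?dvd1n.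
by rewrite big_cons big_seq1 exp1n divn1 -mulnn divnn muln_gt0 p0 lam1.
Qed.

Definition good_power k p := 1 / 2 <= `|lam (p ^ k)|.

Lemma good_power_exists p : prime p -> good_power 1 p \/ good_power 2 p.
Proof.
move=> pp; have E := lam_prime_sqr pp; rewrite /good_power expn1.
have [h|h] := leP (1 / 2) `|lam p|; [by left|right].
have : lam p ^+ 2 < 1 / 4.
  by rewrite -real_normK ?num_real //; have := normr_ge0 (lam p); nra.
by move=> h2; rewrite ler0_norm; lra.
Qed.

(** Each prime is good for the exponent 1 or for the exponent 2, so one of the two exponents serves
    at least half of the primes. *)
Lemma good_primes y z : exists k U, [/\ k = 1%N \/ k = 2%N, uniq U,
  forall p, p \in U -> [/\ prime p, (y < p)%N, (p <= z)%N & good_power k p] &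
  (size (primes_between y z) <= (size U).*2)%N].
Proof.
pose P := primes_between y z.
have uP : uniq P by rewrite filter_uniq // filter_uniq // iota_uniq.
pose U k := [seq p <- P | `[< good_power k p >]].
have hU k p : p \in U k -> [/\ prime p, (y < p)%N, (p <= z)%N & good_power k p].
  by rewrite mem_filter mem_primes_between => /andP[/asboolP g /and3P[]].
have : (size P <= size (U 1) + size (U 2))%N.
  rewrite -(count_predC (fun p => `[< good_power 1 p >]) P) [size (U 1)]size_filter leq_add2l.
  rewrite -!size_filter; apply: uniq_leq_size; first by rewrite filter_uniq.
  move=> p; rewrite !mem_filter /= => /andP[/asboolP n1 pP]; rewrite pP andbT; apply/asboolP.
  by move: pP => /and3P[_ pp _]; case: (good_power_exists pp).
have [h|h] := leqP (size (U 2)) (size (U 1)) => hs.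
  exists 1%N, (U 1); split; [by left|exact: filter_uniq|exact: hU|].
  by rewrite -addnn (leq_trans hs) // leq_add2l.
exists 2%N, (U 2); split; [by right|exact: filter_uniq|exact: hU|].
by rewrite -addnn (leq_trans hs) // leq_add2r ltnW.
Qed.

End PrimeSupply.

(** * Second differences of a difference of phases *)

Section PhaseKernel.
Variable R : realType.
Variables (t : R) (k : nat).
Hypothesis t0 : 0 < t.
Hypothesis k12 : k = 1%N \/ k = 2%N.

Lemma der_pow (x : R) n : is_derive x (1 : R) (fun z => z ^+ n) (n%:R * x ^+ n.-1).
Proof.
elim: n => [|n IH].
  rewrite mul0r; have -> : (fun z : R => z ^+ 0) = (fun=> 1) by apply: funext => z; rewrite expr0.
  exact: derC.
have -> : (fun z : R => z ^+ n.+1) = (fun z => z * z ^+ n) by apply: funext => z; rewrite exprS.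
apply: (der_eq (derM (derI x) IH)); case: n {IH} => [|n]; first by rewrite !expr0; ring.
by rewrite /= -!natr1 !exprS; ring.
Qed.

Definition phase_pow (A x : R) := phase t (A * x ^+ k).
Definition gap_pow (A x : R) := Num.sqrt (t ^+ 2 - (A * x ^+ k) ^+ 2).

Lemma der_phase_pow A x : 0 < A -> 0 < x -> A * x ^+ k < t ->
  is_derive x (1 : R) (phase_pow A) (k%:R / x * gap_pow A x).
Proof.
move=> A0 x0 At; have X0 : 0 < A * x ^+ k by rewrite mulr_gt0 // exprn_gt0.
apply: (der_eq (der_comp (derZ A (der_pow x k)) (der_phase X0 At))).
rewrite /gap_pow; set w := Num.sqrt _.
have kE : x ^+ k = x * x ^+ k.-1 by case: k12 => ->; rewrite ?expr1 ?expr0 ?mulr1 //.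
have xk0 : 0 < x ^+ k.-1 by rewrite exprn_gt0.
rewrite kE; field; by rewrite !lt0r_neq0.
Qed.

Variables (A A' : R).
Hypothesis A'0 : 0 < A'.
Hypothesis AA' : A' < A.
Let A0 : 0 < A. Proof. exact: lt_trans AA'. Qed.

Definition phase_gap (x : R) := phase_pow A' x - phase_pow A x.
Definition phase_slope (x : R) := k%:R / x * (gap_pow A' x - gap_pow A x).

Lemma pow_le x y : 0 < x -> x <= y -> A * x ^+ k <= A * y ^+ k.
Proof. by move=> x0 xy; rewrite ler_pM2l // lerXn2r ?nnegrE // ltW // (lt_le_trans x0). Qed.

Lemma der_phase_gap x : 0 < x -> 2 * (A * x ^+ k) <= t -> is_derive x (1 : R) phase_gap (phase_slope x).
Proof.
move=> x0 At; have xk : 0 < x ^+ k by rewrite exprn_gt0.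
have h1 : A * x ^+ k < t by have : 0 < A * x ^+ k by [rewrite mulr_gt0]; lra.
have h2 : A' * x ^+ k < t by apply: le_lt_trans h1; rewrite ler_pM2r // ltW.
apply: (der_eq (derD (der_phase_pow A'0 x0 h2) (derN (der_phase_pow A0 x0 h1)))).
by rewrite /phase_slope; ring.
Qed.

Lemma gap_pow_bounds x : 0 < x -> 2 * (A * x ^+ k) <= t ->
  [/\ t / 2 <= gap_pow A x, gap_pow A x <= t, t / 2 <= gap_pow A' x & gap_pow A' x <= t].
Proof.
move=> x0 At; have T0 := t0; have xk : 0 < x ^+ k by rewrite exprn_gt0.
have gen B : 0 < B -> B <= A -> t / 2 <= gap_pow B x /\ gap_pow B x <= t.
  move=> B0 BA; have b0 : 0 <= B * x ^+ k by rewrite mulr_ge0 ?ltW.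
  have b1 : 2 * (B * x ^+ k) <= t by apply: le_trans At; rewrite ler_pM2l // ler_pM2r.
  have : 0 <= t ^+ 2 - (B * x ^+ k) ^+ 2 by nra.
  move=> q0; rewrite /gap_pow; split.
    rewrite -(@ler_pXn2r _ 2) ?nnegrE ?sqrtr_ge0 //; last by lra.
    by rewrite sqr_sqrtr //; nra.
  rewrite -(@ler_pXn2r _ 2) ?nnegrE ?sqrtr_ge0 //; last by lra.
  by rewrite sqr_sqrtr // lerBlDr lerDl sqr_ge0.
have [a1 a2] := gen A A0 (lexx _); have [b1 b2] := gen A' A'0 (ltW AA').
by split.
Qed.

(** Multiplication by the conjugate removes the cancellation between the two square roots; sign,
    size and growth of the slope can then be read off. *)
Lemma phase_slopeE x : 0 < x -> 2 * (A * x ^+ k) <= t ->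
  phase_slope x = k%:R * (A ^+ 2 - A' ^+ 2) * x ^+ (2 * k).-1 / (gap_pow A x + gap_pow A' x).
Proof.
move=> x0 At; have [a1 a2 b1 b2] := gap_pow_bounds x0 At.
have xk : 0 < x ^+ k by rewrite exprn_gt0.
have q B : 0 < B -> B <= A -> gap_pow B x ^+ 2 = t ^+ 2 - B ^+ 2 * x ^+ (2 * k).
  move=> B0 BA; rewrite sqr_sqrtr; first by rewrite exprMn -exprM mulnC.
  have b0 : 0 <= B * x ^+ k by rewrite mulr_ge0 ?ltW.
  have b1' : 2 * (B * x ^+ k) <= t by apply: le_trans At; rewrite ler_pM2l // ler_pM2r.
  by nra.
have T0 := t0; have s0 : gap_pow A x + gap_pow A' x != 0 by rewrite lt0r_neq0 //; lra.
have E : (gap_pow A' x - gap_pow A x) * (gap_pow A x + gap_pow A' x) = (A ^+ 2 - A' ^+ 2) * x ^+ (2 * k).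
  have := q A A0 (lexx _); have := q A' A'0 (ltW AA') => q1 q2.
  transitivity (gap_pow A' x ^+ 2 - gap_pow A x ^+ 2); first by ring.
  by rewrite q1 q2; ring.
apply: (mulIf s0); rewrite divfK //.
have -> : phase_slope x * (gap_pow A x + gap_pow A' x) = k%:R / x * ((gap_pow A' x - gap_pow A x) * (gap_pow A x + gap_pow A' x)).
  by rewrite /phase_slope; ring.
rewrite E.
have -> : x ^+ (2 * k) = x * x ^+ (2 * k).-1 by case: k12 => ->; rewrite -exprS.
by field; rewrite lt0r_neq0.
Qed.

Let d2 : 0 < A ^+ 2 - A' ^+ 2.
Proof. by rewrite subr_gt0 ltr_pXn2r ?nnegrE ?ltW. Qed.

Let kR : 0 < k%:R :> R.
Proof. by case: k12 => ->. Qed.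

Lemma phase_slope_ge0 x : 0 < x -> 2 * (A * x ^+ k) <= t -> 0 <= phase_slope x.
Proof.
move=> x0 At; rewrite phase_slopeE //; have [a1 a2 b1 b2] := gap_pow_bounds x0 At; have T0 := t0.
apply: divr_ge0; last by lra.
by rewrite mulr_ge0 ?exprn_ge0 ?(ltW x0) // mulr_ge0 ?ltW.
Qed.

Lemma phase_slope_le x z : 0 < x -> x <= z -> 2 * (A * z ^+ k) <= t ->
  phase_slope x <= k%:R * (A ^+ 2 - A' ^+ 2) * z ^+ (2 * k).-1 / t.
Proof.
move=> x0 xz zt.
have At : 2 * (A * x ^+ k) <= t by apply: le_trans zt; rewrite ler_pM2l //; exact: pow_le.
rewrite phase_slopeE //; have [a1 a2 b1 b2] := gap_pow_bounds x0 At.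
apply: ler_pM.
- by rewrite mulr_ge0 ?exprn_ge0 ?(ltW x0) // mulr_ge0 ?ltW.
- by have T0 := t0; rewrite invr_ge0; lra.
- rewrite ler_pM2l ?mulr_gt0 // lerXn2r ?nnegrE //; [exact: ltW|lra].
- by have T0 := t0; rewrite lef_pV2 ?posrE //; lra.
Qed.

(** In the quotient of [phase_slopeE] the numerator increases with x and the denominator does not,
    so the increment of the power in the numerator alone gives the lower bound. *)
Lemma phase_slope_step a x : 0 < a -> a <= x -> 2 * (A * (x + 1) ^+ k) <= t ->
  k%:R * (2 * k).-1%:R * (A ^+ 2 - A' ^+ 2) * a ^+ (2 * k).-2 / (2 * t)
    <= phase_slope (x + 1) - phase_slope x.
Proof.
move=> a0 ax At1; have x0 : 0 < x by exact: lt_le_trans ax.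
have x10 : 0 < x + 1 by lra.
have At : 2 * (A * x ^+ k) <= t by apply: le_trans At1; rewrite ler_pM2l //; apply: pow_le => //; lra.
have [c1 c2 e1 e2] := gap_pow_bounds x0 At; have [c3 c4 e3 e4] := gap_pow_bounds x10 At1.
rewrite !phase_slopeE //.
set s := gap_pow A x + gap_pow A' x; set s1 := gap_pow A (x + 1) + gap_pow A' (x + 1).
have T0 := t0; have s0 : 0 < s by rewrite /s; lra.
have s10 : 0 < s1 by rewrite /s1; lra.
have mono B : 0 < B -> B <= A -> gap_pow B (x + 1) <= gap_pow B x.
  move=> B0 BA; rewrite /gap_pow ler_wsqrtr // lerD2l lerN2.
  have x0' : 0 <= x by exact: ltW.
  have x1' : 0 <= x + 1 by exact: ltW.
  have xk : x ^+ k <= (x + 1) ^+ k by rewrite lerXn2r ?nnegrE //; lra.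
  rewrite lerXn2r ?nnegrE ?mulr_ge0 ?exprn_ge0 ?(ltW B0) //.
  by rewrite ler_pM2l.
have ss : s1 <= s by apply: lerD; [exact: mono|apply: mono => //; exact: ltW].
have s2t : s <= 2 * t by rewrite /s; lra.
set c := k%:R * (A ^+ 2 - A' ^+ 2); have c0 : 0 < c by rewrite mulr_gt0.
apply: (@le_trans _ _ (c * ((x + 1) ^+ (2 * k).-1 - x ^+ (2 * k).-1) / s)); last first.
  rewrite mulrBr mulrBl lerD2r ler_pM2l ?mulr_gt0 ?exprn_gt0 //.
  by rewrite lef_pV2 ?posrE.
have p : (2 * k).-1%:R * a ^+ (2 * k).-2 <= (x + 1) ^+ (2 * k).-1 - x ^+ (2 * k).-1.
  case: k12 => -> /=; first by rewrite expr0 !expr1; lra.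
  by rewrite -!natr1 mulr0n; nra.
have p0 : 0 <= (2 * k).-1%:R * a ^+ (2 * k).-2 by rewrite mulr_ge0 ?exprn_ge0 // ltW.
have -> : k%:R * (2 * k).-1%:R * (A ^+ 2 - A' ^+ 2) * a ^+ (2 * k).-2 = c * ((2 * k).-1%:R * a ^+ (2 * k).-2).
  by rewrite /c; ring.
apply: ler_pM.
- by rewrite mulr_ge0 // ltW.
- by rewrite invr_ge0; lra.
- by rewrite ler_pM2l.
- by rewrite lef_pV2 ?posrE //; lra.
Qed.

Definition curvature a := k%:R * (2 * k).-1%:R * (A ^+ 2 - A' ^+ 2) * a ^+ (2 * k).-2 / (2 * t).

(** The van der Corput bound for $e(\theta_{A'}-\theta_A)$ plus an arbitrary linear phase. The
    linear part disappears from the second differences, so the estimate is uniform in the grid point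
    at which a test polynomial is evaluated. *)
Lemma phase_kernel (a b : nat) (e c d : R) : (0 < a)%N -> (a <= b)%N -> 0 < e ->
  2 * (A * (b.+1%:R) ^+ k) <= t -> e * curvature a%:R <= 1 ->
  `|\sum_(a <= n < b) cos (e * phase_gap n%:R + c * n%:R + d)| <=
    (e * (k%:R * (A ^+ 2 - A' ^+ 2) * b.+1%:R ^+ (2 * k).-1 / t) + 3) * (12 / Num.sqrt (e * curvature a%:R)).
Proof.
move=> a0 ab e0 At l1.
have aR : 0 < a%:R :> R by rewrite ltr0n.
have inA (x : R) : 0 < x -> x <= b.+1%:R -> 2 * (A * x ^+ k) <= t.
  by move=> x0 xb; apply: le_trans At; rewrite ler_pM2l //; exact: pow_le.
pose G (n : nat) := e * phase_gap n%:R + c * n%:R + d.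
have diff (n : nat) : (a <= n)%N -> (n < b.+1)%N ->
    exists2 x, n%:R <= x <= n.+1%:R & phase_gap n.+1%:R - phase_gap n%:R = phase_slope x.
  move=> an nb; have nR : 0 < n%:R :> R by rewrite ltr0n (leq_trans a0).
  have nn : n%:R <= n.+1%:R :> R by rewrite ler_nat.
  have dd (x : R) : n%:R <= x <= n.+1%:R -> is_derive x (1 : R) phase_gap (phase_slope x).
    move=> /andP[nx xn]; apply: der_phase_gap; first by lra.
    apply: inA; first by lra.
    by apply: (le_trans xn); rewrite ler_nat.
  have [x xI E] := mvt_ex dd nn; exists x => //; rewrite E -natr1; ring.
have curv0 : 0 < curvature a%:R.
  rewrite /curvature divr_gt0 ?mulr_gt0 ?exprn_gt0 //.
  by case: k12 => -> /=; rewrite ltr0n.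
apply: (@van_der_corput R G (e * curvature a%:R) _ a b).
- by rewrite mulr_gt0.
- move=> n an nb; have nR : 0 < n%:R :> R by rewrite ltr0n (leq_trans a0).
  have -> : G n.+2 - G n.+1 - (G n.+1 - G n) = e * ((phase_gap n.+2%:R - phase_gap n.+1%:R) - (phase_gap n.+1%:R - phase_gap n%:R)).
    by rewrite /G -[n.+2%:R]natr1 -[n.+1%:R]natr1; ring.
  rewrite ler_pM2l //.
  pose E x := phase_gap (x + 1) - phase_gap x.
  have nn : n%:R <= n.+1%:R :> R by rewrite ler_nat.
  have dE (x : R) : n%:R <= x <= n.+1%:R -> is_derive x (1 : R) E (phase_slope (x + 1) - phase_slope x).
    move=> /andP[nx xn]; have x0 : 0 < x by lra.
    have b1 : x + 1 <= b.+1%:R.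
      have : n.+2%:R <= b.+1%:R :> R by rewrite ler_nat leqW.
      by rewrite -[n.+2%:R]natr1; lra.
    have s1 : is_derive x (1 : R) (fun z => z + 1) (1 + 0) by exact: (derD (derI x) (derC 1 x)).
    have d1 := der_phase_gap (_ : 0 < x + 1) (inA (x + 1) _ b1).
    have d2' := der_phase_gap x0 (inA x x0 _).
    apply: (der_eq (derD (der_comp s1 (d1 _ _)) (derN (d2' _)))); try lra.
  have [x /andP[nx xn] E1] := mvt_ex dE nn.
  have -> : (phase_gap n.+2%:R - phase_gap n.+1%:R) - (phase_gap n.+1%:R - phase_gap n%:R) = E n.+1%:R - E n%:R.
    by rewrite /E !natr1.
  rewrite E1 -[n.+1%:R]natr1 addrAC subrr add0r mulr1.
  apply: phase_slope_step => //.
    by apply: le_trans nx; rewrite ler_nat.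
  apply: inA; first by lra.
  have : n.+2%:R <= b.+1%:R :> R by rewrite ler_nat leqW.
  by rewrite -[n.+2%:R]natr1; lra.
- move=> n /andP[an nb].
  have -> : G n.+1 - G n - (G a.+1 - G a) = e * ((phase_gap n.+1%:R - phase_gap n%:R) - (phase_gap a.+1%:R - phase_gap a%:R)).
    by rewrite /G -[n.+1%:R]natr1 -[a.+1%:R]natr1; ring.
  rewrite ler_pM2l //.
  have [x /andP[nx xn] ->] := diff n an (leqW nb).
  have [y /andP[ay ya] ->] := diff a (leqnn a) (ab : (a < b.+1)%N).
  have nR : a%:R <= n%:R :> R by rewrite ler_nat.
  have nb' : n.+1%:R <= b.+1%:R :> R by rewrite ler_nat leqW.
  have ab' : a.+1%:R <= b.+1%:R :> R by rewrite ler_nat.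
  have y0 : 0 <= phase_slope y by apply: phase_slope_ge0; [|apply: inA]; lra.
  have := @phase_slope_le x b.+1%:R; rewrite -!mulrA => h.
  have {}h := h _ _ At; apply: le_trans (h _ _); lra.
- by rewrite mulr_ge0 ?divr_ge0 ?mulr_ge0 ?exprn_ge0 ?(ltW t0) ?(ltW e0) ?(ltW kR) ?(ltW d2).
Qed.

End PhaseKernel.

(** * Bilinear sums of oscillating phases *)

Section Bilinear.
Variable R : realType.
Variables (t : R) (k : nat) (kp : R).
Hypothesis t0 : 0 < t.
Hypothesis k12 : k = 1%N \/ k = 2%N.
Hypothesis kp0 : 0 < kp.

(* The sum over the support of [be] is completed to all v in [a, b): the added
   terms are nonnegative once the square modulus has been taken. *)
Lemma bilinear_weighted (U : seq nat) (al be : nat -> R) (F : nat -> nat -> R) a b :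
  (forall u, `|al u| <= 1) ->
  (\sum_(a <= v < b) \sum_(u <- U) be v * al u * cos (F u v)) ^+ 2
  <= (\sum_(a <= v < b) be v ^+ 2) *
     \sum_(u <- U) \sum_(u' <- U) `|\sum_(a <= v < b) cos (F u v - F u' v)|.
Proof.
move=> al1.
pose c v := \sum_(u <- U) al u * cos (F u v).
pose s v := \sum_(u <- U) al u * sin (F u v).
rewrite (eq_bigr (fun v => be v * c v)); last first.
  by move=> v _; rewrite /c mulr_sumr; apply: eq_bigr => u _; rewrite mulrA.
apply: (le_trans (cauchy_schwarz_sum _ _ _ _)).
apply: ler_wpM2l; first by apply: sumr_ge0 => v _; exact: sqr_ge0.
apply: (@le_trans _ _ (\sum_(a <= v < b) (c v ^+ 2 + s v ^+ 2))).
  by apply: ler_sum => v _; rewrite lerDl sqr_ge0.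
have -> : \sum_(a <= v < b) (c v ^+ 2 + s v ^+ 2)
   = \sum_(u <- U) \sum_(u' <- U) al u * al u' * \sum_(a <= v < b) cos (F u v - F u' v).
  rewrite (eq_bigr (fun v => \sum_(u <- U) \sum_(u' <- U)
      al u * al u' * cos (F u v - F u' v))); last first.
    move=> v _; rewrite !expr2 /c /s !mulr_suml -big_split /=.
    apply: eq_bigr => u _; rewrite !mulr_sumr -big_split /=.
    by apply: eq_bigr => u' _; rewrite cosB; ring.
  rewrite exchange_big /=; apply: eq_bigr => u _.
  rewrite exchange_big /=; apply: eq_bigr => u' _.
  by rewrite mulr_sumr.
apply: ler_sum => u _; apply: ler_sum => u' _.
apply: (le_trans (ler_norm _)); rewrite normrM ler_piMl // normrM.
by rewrite mulr_ile1 // al1.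
Qed.

Lemma near_count (U : seq nat) u H : uniq U ->
  (count (fun u' => (u' <= u + H) && (u <= u' + H))%N U <= 2 * H + 1)%N.
Proof.
move=> uU; rewrite -size_filter -[leqRHS](size_iota (u - H)).
apply: uniq_leq_size; first exact: filter_uniq.
move=> x; rewrite mem_filter mem_iota => /andP[/andP[h1 h2] _]; apply/andP; split; lia.
Qed.

(** Pairs u, u' at distance at most H are estimated trivially, and there are at most 2H + 1 of them
    for each u; all other pairs have the cancellation X. *)
Lemma bilinear_phase (U : seq nat) (al be : nat -> R) (a b H : nat) (e al0 th X : R) :
  uniq U -> (forall u, `|al u| <= 1) -> 0 <= X ->
  (forall u u' c d, u \in U -> u' \in U -> (u' + H < u)%N ->
     `|\sum_(a <= v < b) cos (e * phase_gap t k (kp * u%:R) (kp * u'%:R) v%:R + c * v%:R + d)| <= X) ->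
  (\sum_(a <= v < b) \sum_(u <- U) be v * al u *
      cos (e * (phase_pow t k (kp * u%:R) v%:R - al0) + th * u%:R * v%:R)) ^+ 2
  <= (\sum_(a <= v < b) be v ^+ 2) *
     ((size U)%:R * ((2 * H + 1)%:R * (b - a)%:R) + (size U)%:R ^+ 2 * X).
Proof.
move=> uU al1 X0 hX; apply: (le_trans (bilinear_weighted _ _ _ _ _ al1)).
apply: ler_wpM2l; first by apply: sumr_ge0 => v _; exact: sqr_ge0.
pose near u u' := ((u' <= u + H) && (u <= u' + H))%N.
have pair u u' : u \in U -> u' \in U -> (u' + H < u)%N ->
    `|\sum_(a <= v < b) cos (e * (phase_pow t k (kp * u%:R) v%:R - al0) + th * u%:R * v%:R
       - (e * (phase_pow t k (kp * u'%:R) v%:R - al0) + th * u'%:R * v%:R))| <= X.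
  move=> uI u'I uu; apply: le_trans (hX u u' (th * (u'%:R - u%:R)) 0 uI u'I uu).
  rewrite le_eqVlt; apply/orP; left; apply/eqP; congr `|_|; apply: eq_bigr => v _.
  by rewrite -[LHS]cosN; congr cos; rewrite /phase_gap; ring.
apply: (@le_trans _ _ (\sum_(u <- U) \sum_(u' <- U) ((if near u u' then (b - a)%:R else 0) + X))).
  rewrite big_seq [leRHS]big_seq; apply: ler_sum => u uI.
  rewrite big_seq [leRHS]big_seq; apply: ler_sum => u' u'I.
  rewrite /near; case: ifP => [_|/negbT]; last rewrite negb_and -!ltnNge => /orP[] h.
  - apply: (@le_trans _ _ (b - a)%:R); last by rewrite lerDl.
    apply: (le_trans (ler_norm_sum _ _ _)).
    apply: (@le_trans _ _ (\sum_(a <= v < b) 1)); last by rewrite sumr_const_nat.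
    by apply: ler_sum => v _; exact: cos_max.
  - rewrite add0r; apply: le_trans (pair u' u u'I uI h).
    rewrite le_eqVlt; apply/orP; left; apply/eqP; congr `|_|; apply: eq_bigr => v _.
    by rewrite -[LHS]cosN; congr cos; ring.
  - by rewrite add0r; exact: pair.
apply: (@le_trans _ _ (\sum_(u <- U) ((2 * H + 1)%:R * (b - a)%:R + (size U)%:R * X))); last first.
  by rewrite big_const_seq count_predT iter_addr_0 -[leLHS]mulr_natl mulrDr lerD2l expr2 mulrA.
apply: ler_sum => u _; rewrite big_split /= big_const_seq count_predT iter_addr_0 -[X *+ _]mulr_natl lerD2r.
rewrite -big_mkcond /= big_const_seq iter_addr_0 -[leLHS]mulr_natl ler_wpM2r // ler_nat.
exact: near_count.
Qed.

(** q1 and q2 bracket the square root q of [kp ^+ 2 * (u%:R ^+ 2 - u'%:R ^+ 2) / t]. The curvature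
    at a is $(qa^{k-1})^2$ up to a factor between 1/2 and 3, so the square root in the van der
    Corput bound is replaced by explicit monomials. *)
Lemma phase_kernel_le (u u' a b : nat) (e q1 q2 c d : R) : (0 < a)%N -> (a <= b)%N -> 1 <= e <= 2 ->
  (0 < u')%N -> (u' < u)%N ->
  2 * (kp * u%:R * b.+1%:R ^+ k) <= t -> 0 < q1 -> 0 <= q2 ->
  q1 ^+ 2 <= kp ^+ 2 * (u%:R ^+ 2 - u'%:R ^+ 2) / t <= q2 ^+ 2 ->
  12 * (q2 * a%:R ^+ k.-1) ^+ 2 <= 1 ->
  `|\sum_(a <= v < b) cos (e * phase_gap t k (kp * u%:R) (kp * u'%:R) v%:R + c * v%:R + d)|
   <= 96 * q2 * b.+1%:R ^+ (2 * k).-1 / a%:R ^+ k.-1 + 72 / (q1 * a%:R ^+ k.-1).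
Proof.
move=> a0 ab /andP[e1 e2] u'0 uu ut q10 q20 /andP[Q1 Q2] small.
have aR : 0 < a%:R :> R by rewrite ltr0n.
set D := kp ^+ 2 * _ / t in Q1 Q2.
have D0 : 0 < D by apply: lt_le_trans Q1; rewrite exprn_gt0.
pose q := Num.sqrt D; have q0 : 0 < q by rewrite sqrtr_gt0.
have qq : q ^+ 2 = D by rewrite sqr_sqrtr // ltW.
have q1q : q1 <= q by rewrite -(@ler_pXn2r _ 2) ?nnegrE ?qq // ltW.
have qq2 : q <= q2 by rewrite -(@ler_pXn2r _ 2) ?nnegrE ?qq // ltW.
pose B : R := a%:R ^+ k.-1; have B0 : 0 < B by rewrite exprn_gt0.
have AA : kp * u'%:R < kp * u%:R by rewrite ltr_pM2l // ltr_nat.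
have A'0 : 0 < kp * u'%:R by rewrite mulr_gt0 // ltr0n.
have cE : curvature t k (kp * u%:R) (kp * u'%:R) a%:R = k%:R * (2 * k).-1%:R / 2 * (q * B) ^+ 2.
  rewrite exprMn qq /curvature /D /B -exprM.
  have -> : (k.-1 * 2 = (2 * k).-2)%N by case: k12 => ->.
  by field; rewrite lt0r_neq0.
have kk : (1 / 2 : R) <= k%:R * (2 * k).-1%:R / 2 <= (3 : R).
  by have [k1|k2] := k12; [rewrite k1 (_ : (2 * 1).-1 = 1%N) //|rewrite k2 (_ : (2 * 2).-1 = 3%N) //]; lra_from t0 k12 kp0.
move: kk cE; set kq := k%:R * _ / 2 => /andP[kk1 kk3] cE.
have qB0 : 0 < q * B by rewrite mulr_gt0.
have qB2 : (q * B) ^+ 2 <= (q2 * B) ^+ 2.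
  by rewrite ler_pXn2r ?nnegrE ?mulr_ge0 // ?ler_pM2r // ltW.
have ec1 : e * curvature t k (kp * u%:R) (kp * u'%:R) a%:R <= 1.
  rewrite cE; move: qB2 small; rewrite -/B => h1 h2.
  have s0 : 0 < (q * B) ^+ 2 by rewrite exprn_gt0.
  have : kq * (q * B) ^+ 2 <= 3 * (q * B) ^+ 2 by rewrite ler_pM2r.
  have : 0 < kq * (q * B) ^+ 2 by rewrite mulr_gt0 //; lra.
  by set S := kq * _; nra_from t0 k12 kp0 h1 h2 s0 e1 e2.
have pk := @phase_kernel R t k t0 k12 _ _ A'0 AA a b e c d a0 ab (lt_le_trans ltr01 e1) ut ec1.
apply: (le_trans pk).
have s1 : q * B / 2 <= Num.sqrt (e * curvature t k (kp * u%:R) (kp * u'%:R) a%:R).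
  rewrite -(ger0_norm (ltW (divr_gt0 qB0 (@ltr0n R 2)))) -sqrtr_sqr ler_wsqrtr // cE.
  have s0 : 0 < (q * B) ^+ 2 by rewrite exprn_gt0.
  have -> : (q * B / 2) ^+ 2 = (q * B) ^+ 2 / 4 by field.
  have : 1 / 2 * (q * B) ^+ 2 <= kq * (q * B) ^+ 2 by rewrite ler_pM2r.
  by set S := kq * _; nra_from t0 k12 kp0 e1 s0.
have s2 : 12 / Num.sqrt (e * curvature t k (kp * u%:R) (kp * u'%:R) a%:R) <= 24 / (q * B).
  have -> : 24 / (q * B) = 12 / (q * B / 2) by field; rewrite !lt0r_neq0.
  by rewrite ler_pM2l // lef_pV2 ?posrE ?divr_gt0 //; apply: lt_le_trans s1; rewrite divr_gt0.
pose M : R := b.+1%:R ^+ (2 * k).-1; have M0 : 0 < M by rewrite exprn_gt0 // ltr0n.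
have s3 : e * (k%:R * ((kp * u%:R) ^+ 2 - (kp * u'%:R) ^+ 2) * M / t) <= 4 * q ^+ 2 * M.
  have -> : k%:R * ((kp * u%:R) ^+ 2 - (kp * u'%:R) ^+ 2) * M / t = k%:R * (q ^+ 2 * M).
    by rewrite qq /D; field; rewrite lt0r_neq0.
  have qM : 0 < q ^+ 2 * M by rewrite mulr_gt0 // exprn_gt0.
  have : k%:R * (q ^+ 2 * M) <= 2 * (q ^+ 2 * M) by rewrite ler_pM2r // ler_nat; case: k12 => ->.
  have : 0 <= k%:R * (q ^+ 2 * M) by rewrite mulr_ge0 // ltW.
  by rewrite -(mulrA 4); set S := k%:R * _; set S' := q ^+ 2 * M; nra_from t0 k12 kp0 e1 e2.
apply: (@le_trans _ _ ((4 * q ^+ 2 * M + 3) * (24 / (q * B)))).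
  apply: ler_pM => //; last by rewrite -/M; lra.
  - rewrite addr_ge0 // mulr_ge0 //; first by lra.
    apply: divr_ge0; last exact: ltW.
    apply: mulr_ge0; last exact: ltW.
    apply: mulr_ge0 => //; rewrite subr_ge0 ler_pXn2r ?nnegrE //; apply: ltW => //.
    exact: lt_trans AA.
have -> : (4 * q ^+ 2 * M + 3) * (24 / (q * B)) = 96 * q * M / B + 72 / (q * B).
  by field; rewrite !lt0r_neq0.
apply: lerD.
  by rewrite ler_pM2r ?invr_gt0 // ler_pM2r // ler_pM2l.
by rewrite ler_pM2l // lef_pV2 ?posrE ?mulr_gt0 // ler_pM2r.
Qed.

End Bilinear.

Ltac mlia := match goal with H : is_true (20 <= ?m)%N |- _ => clear -H; lia end.

(** * Bilinear bounds in the ranges used by the tests *)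

Section LargeBase.
Variable R : realType.
Variables (lam : nat -> R) (w m : nat) (t kp : R).
Local Notation W := (w%:R : R).

(** All sizes are powers of an integer base w with $t\approx w^{24m}$, so that comparing sizes means
    comparing exponents, and constants are absorbed by one power of w. [lb_exp] and [lb_tau] let w
    also absorb logarithms and divisor functions; kp stands for $2\pi Y$. *)
Record large_base : Prop := LargeBase {
  lb_hecke : forall a b, (0 < a)%N -> (0 < b)%N ->
    lam a * lam b = \sum_(d <- divisors (gcdn a b)) lam (a * b %/ d ^ 2);
  lb_lam1 : lam 1 = 1;
  lb_m : (20 <= m)%N;
  lb_w : (10 ^ 6 <= w)%N;
  lb_exp : (2 * w ^ (24 * m) <= 2 ^ w)%N;
  lb_tau : forall n, (0 < n <= w ^ (24 * m))%N -> (tau n <= w)%N;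
  lb_kp0 : 0 < kp;
  lb_kp1 : 10 ^+ 6 * kp <= W;
  lb_kp2 : 10 ^+ 6 <= kp * W;
  lb_t1 : W ^+ (24 * m) <= t;
  lb_t2 : t <= 2 * W ^+ (24 * m) }.

Hypothesis lb : large_base.

Lemma w_ge : 10 ^+ 6 <= W.
Proof. by rewrite -natrX ler_nat (lb_w lb). Qed.

Lemma w_gt0 : 0 < W.
Proof. by apply: lt_le_trans w_ge; rewrite exprn_gt0. Qed.

Lemma wX_gt0 a : 0 < W ^+ a.
Proof. by rewrite exprn_gt0 // w_gt0. Qed.

Lemma le_wX a b : (a <= b)%N -> W ^+ a <= W ^+ b.
Proof. by move=> ab; rewrite ler_weXn2l //; apply: le_trans w_ge; rewrite exprn_ege1 //; lra. Qed.

Lemma le_wX_gap a b c : c <= 10 ^+ 6 -> (a < b)%N -> c * W ^+ a <= W ^+ b.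
Proof.
move=> c6 ab; apply: le_trans (le_wX ab); rewrite exprS ler_pM2r ?wX_gt0 //.
exact: le_trans w_ge.
Qed.

Lemma lb_t0 : 0 < t.
Proof. exact: lt_le_trans (wX_gt0 _) (lb_t1 lb). Qed.

(** Chebyshev's bound gives at least $w^{e-1}$ primes up to $2w^e$. Dropping those up to $w^{e-2}$
    and then half of the rest, to fix the exponent k, leaves at least $w^{e-2}$. *)
Lemma prime_supply e : (2 <= e)%N -> (e <= 24 * m)%N ->
  exists k U, [/\ k = 1%N \/ k = 2%N, uniq U,
    forall p, p \in U -> [/\ prime p, (w ^ (e - 2) < p)%N, (p <= 2 * w ^ e)%N & good_power lam k p] &
    (w ^ (e - 2) <= size U)%N].
Proof.
move=> e2 em; have [k [U [k12 uU hU sU]]] := good_primes (lb_hecke lb) (lb_lam1 lb) (w ^ (e - 2)) (2 * w ^ e).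
exists k, U; split => //.
have w6 := lb_w lb; have w0 : (0 < w)%N by apply: leq_trans w6.
have wx0 a : (0 < w ^ a)%N by rewrite expn_gt0 w0.
have h2 : ((w ^ e).*2 <= 2 ^ w)%N.
  by rewrite -mul2n; apply: leq_trans (lb_exp lb); rewrite leq_mul2l leq_pexp2l.
have := many_primes (wx0 e) h2; rewrite -mul2n.
have -> : (w ^ e = w * (w * w ^ (e - 2)))%N by rewrite -!expnS; congr (_ ^ _)%N; lia.
rewrite leq_pmul2l // => h3.
have := primes_between_size (w ^ (e - 2)) (2 * (w * (w * w ^ (e - 2)))).
move: sU; have -> : (w ^ e = w * (w * w ^ (e - 2)))%N by rewrite -!expnS; congr (_ ^ _)%N; lia.
have : (3 * w ^ (e - 2) <= w * w ^ (e - 2))%N by rewrite leq_mul2r; apply/orP; right; apply: leq_trans w6.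
rewrite -mul2n; lia.
Qed.

Lemma size_supply (U : seq nat) e : uniq U -> (forall p, p \in U -> (0 < p <= 2 * w ^ e)%N) ->
  (size U)%:R <= 2 * W ^+ e.
Proof.
move=> uU hU; rewrite -natrX -(natrM _ 2) ler_nat -[leqRHS](size_iota 1).
by apply: uniq_leq_size => // p /hU /andP[p0 pe]; rewrite mem_iota p0 add1n ltnS.
Qed.

Lemma wX_ge b : (0 < b)%N -> 10 ^+ 6 <= W ^+ b.
Proof. by move=> b0; have := le_wX_gap (lexx _) b0; rewrite expr0 mulr1. Qed.

Lemma kp_inv_le : kp^-1 <= W / 10 ^+ 6.
Proof.
by rewrite ler_pdivlMr ?exprn_gt0 // mulrC ler_pdivrMr ?(lb_kp0 lb) // mulrC (lb_kp2 lb).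
Qed.

(** v runs over all integers up to $N=w^{16m+1}$. Here H = 0: all distinct pairs of the family have
    so much cancellation that $|U|X\le N$, and the diagonal prevails. *)
Lemma bilinear_long (U : seq nat) (al be : nat -> R) (e al0 th : R) :
  uniq U -> (forall u, `|al u| <= 1) -> 1 <= e <= 2 ->
  (forall u, u \in U -> (w ^ (4 * m - 4) < u <= 4 * w ^ (8 * m - 4))%N) ->
  (size U)%:R <= 2 * W ^+ (4 * m - 2) ->
  (\sum_(1 <= v < (w ^ (16 * m + 1)).+1) \sum_(u <- U) be v * al u *
      cos (e * (phase_pow t 1 (kp * u%:R) v%:R - al0) + th * u%:R * v%:R)) ^+ 2
  <= (\sum_(1 <= v < (w ^ (16 * m + 1)).+1) be v ^+ 2) * (2 * (size U)%:R * W ^+ (16 * m + 1)).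
Proof.
move=> uU al1 e12 hU sU; set N := (w ^ (16 * m + 1))%N.
have m20 := lb_m lb; have t0 := lb_t0; have k0 := lb_kp0 lb; have k1 := lb_kp1 lb; have k2 := lb_kp2 lb.
have t1 := lb_t1 lb; have t2 := lb_t2 lb; have w6 := w_ge; have w0 := w_gt0.
have NR : N%:R = W ^+ (16 * m + 1) :> R by rewrite natrX.
pose q1 := kp / (2 * W ^+ (10 * m + 2)); pose q2 := 4 * kp / W ^+ (4 * m + 4).
have q10 : 0 < q1 by rewrite divr_gt0 // mulr_gt0 // wX_gt0.
have q20 : 0 < q2 by rewrite divr_gt0 ?wX_gt0 // mulr_gt0.
pose X := 96 * q2 * (N.+2)%:R + 72 / q1.
have X0 : 0 <= X by rewrite addr_ge0 ?mulr_ge0 ?invr_ge0 // ltW.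
have N2 : (N.+2)%:R <= 2 * W ^+ (16 * m + 1) :> R.
  have : 10 ^+ 6 <= W ^+ (16 * m + 1) by apply: wX_ge; rewrite addn1.
  by rewrite -[N.+2%:R]natr1 -[N.+1%:R]natr1 NR; lra_from lb.
have kpi := kp_inv_le.
have Uq2 : (size U)%:R * q2 <= 1 / 1000.
  have -> : (size U)%:R * q2 = (size U)%:R * (4 * kp) / W ^+ (4 * m + 4) by rewrite /q2 mulrA.
  rewrite ler_pdivrMr ?wX_gt0 //.
  have h : (size U)%:R * (4 * kp) <= 2 * W ^+ (4 * m - 2) * (4 * kp) by rewrite ler_wpM2r // mulr_ge0 // ltW.
  apply: (le_trans h).
  have h2 : W ^+ (4 * m - 2) * (10 ^+ 6 * kp) <= W ^+ (4 * m - 2) * W by rewrite ler_wpM2l // ltW // wX_gt0.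
  have h3 : W ^+ (4 * m - 2) * W <= W ^+ (4 * m + 4) by rewrite -exprSr; apply: le_wX; mlia.
  have := wX_gt0 (4 * m + 4); lra.
have Uq1 : (size U)%:R / q1 <= W ^+ (16 * m + 1) / 1000.
  have -> : (size U)%:R / q1 = (size U)%:R * (2 * W ^+ (10 * m + 2) * kp^-1).
    by rewrite /q1; field; rewrite !lt0r_neq0 ?wX_gt0.
  apply: (@le_trans _ _ (2 * W ^+ (4 * m - 2) * (2 * W ^+ (10 * m + 2) * (W / 10 ^+ 6)))).
    apply: ler_pM => //.
      by rewrite !mulr_ge0 ?invr_ge0 // ltW ?wX_gt0.
    by rewrite ler_pM2l // mulr_gt0 // wX_gt0.
  have -> : 2 * W ^+ (4 * m - 2) * (2 * W ^+ (10 * m + 2) * (W / 10 ^+ 6))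
     = (4 / 10 ^+ 6) * W ^+ (14 * m + 1).
    rewrite (_ : 14 * m + 1 = (4 * m - 2) + (10 * m + 2) + 1)%N; last by mlia.
    by rewrite !exprD expr1; ring.
  have : W ^+ (14 * m + 1) <= W ^+ (16 * m + 1) by apply: le_wX; mlia.
  have := wX_gt0 (14 * m + 1); lra_from lb.
apply: (le_trans (@bilinear_phase R t 1 kp t0 (or_introl erefl) k0 U al be 1 N.+1 0 e al0 th X uU al1 X0 _)); last first.
  apply: ler_wpM2l; first by apply: sumr_ge0 => v _; exact: sqr_ge0.
  rewrite muln0 add0n mul1r subSS subn0 NR.
  have S0 : 0 <= (size U)%:R :> R by [].
  suff : (size U)%:R * X <= W ^+ (16 * m + 1).
    by move=> h; have : (size U)%:R * ((size U)%:R * X) <= (size U)%:R * W ^+ (16 * m + 1); [rewrite ler_wpM2l|lra_from lb].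
  have -> : (size U)%:R * X = 96 * ((size U)%:R * q2) * N.+2%:R + 72 * ((size U)%:R / q1) by rewrite /X; ring.
  have : (size U)%:R * q2 * N.+2%:R <= 1 / 1000 * (2 * W ^+ (16 * m + 1)).
    by apply: ler_pM => //; rewrite mulr_ge0 // ltW.
  have := wX_gt0 (16 * m + 1); lra_from lb Uq1.
move=> u u' c d uI u'I; rewrite addn0 => uu.
have /andP[lu ul] := hU u uI; have /andP[lu' ul'] := hU u' u'I.
have luR : W ^+ (4 * m - 4) <= u%:R by rewrite -natrX ler_nat ltnW.
have ulR : u%:R <= 4 * W ^+ (8 * m - 4) by rewrite -natrX -(natrM _ 4) ler_nat.
have u'0 : (0 < u')%N by apply: leq_ltn_trans lu'.
have uuR : u'%:R + 1 <= u%:R :> R by rewrite natr1 ler_nat.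
have u'R : 0 <= u'%:R :> R by [].
apply: (le_trans (@phase_kernel_le R t 1 kp t0 (or_introl erefl) k0 u u' 1 N.+1 e q1 q2 c d _ _ e12 u'0 uu _ q10 (ltW q20) _ _)).
- by [].
- by [].
- rewrite expr1.
  have h : kp * u%:R * N.+2%:R <= kp * (4 * W ^+ (8 * m - 4)) * (2 * W ^+ (16 * m + 1)).
    by apply: ler_pM => //; [rewrite mulr_ge0 // ltW|rewrite ler_pM2l].
  have E : kp * (4 * W ^+ (8 * m - 4)) * (2 * W ^+ (16 * m + 1)) = 8 * kp * W ^+ (24 * m - 3).
    rewrite (_ : 24 * m - 3 = (8 * m - 4) + (16 * m + 1))%N; last by mlia.
    by rewrite !exprD; ring.
  have h2 : 10 ^+ 6 * kp * W ^+ (24 * m - 3) <= W * W ^+ (24 * m - 3) by rewrite ler_pM2r // wX_gt0.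
  have h3 : W * W ^+ (24 * m - 3) <= W ^+ (24 * m) by rewrite -exprS; apply: le_wX; mlia.
  have := wX_gt0 (24 * m - 3) => p0; have : 0 < kp * W ^+ (24 * m - 3) by rewrite mulr_gt0.
  lra_from lb h E h2 h3 t1.
- apply/andP; split.
    rewrite ler_pdivlMr //.
    have : q1 ^+ 2 * t <= q1 ^+ 2 * (2 * W ^+ (24 * m)) by rewrite ler_wpM2l // sqr_ge0.
    have -> : q1 ^+ 2 * (2 * W ^+ (24 * m)) = kp ^+ 2 * W ^+ (4 * m - 4) / 2.
      rewrite /q1 (_ : 24 * m = (10 * m + 2) + (10 * m + 2) + (4 * m - 4))%N; last by mlia.
      by rewrite !exprD; field; rewrite !lt0r_neq0 ?wX_gt0.
    move=> h; apply: (le_trans h).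
    have : kp ^+ 2 * W ^+ (4 * m - 4) <= kp ^+ 2 * (u%:R ^+ 2 - u'%:R ^+ 2).
      by rewrite ler_pM2l ?exprn_gt0 //; nra_from lb uuR luR u'R.
    have : 0 < kp ^+ 2 * W ^+ (4 * m - 4) by rewrite mulr_gt0 ?exprn_gt0 // wX_gt0.
    lra_from lb.
  rewrite ler_pdivrMr //.
  have : q2 ^+ 2 * W ^+ (24 * m) <= q2 ^+ 2 * t by rewrite ler_wpM2l // sqr_ge0.
  have -> : q2 ^+ 2 * W ^+ (24 * m) = kp ^+ 2 * (4 * W ^+ (8 * m - 4)) ^+ 2.
    rewrite /q2 (_ : 24 * m = (4 * m + 4) + (4 * m + 4) + ((8 * m - 4) + (8 * m - 4)))%N; last by mlia.
    by rewrite !exprD; field; rewrite !lt0r_neq0 ?wX_gt0.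
  apply: le_trans; rewrite ler_pM2l ?exprn_gt0 //.
  have := wX_gt0 (8 * m - 4); nra_from lb ulR u'R uuR.
- rewrite expr1n mulr1.
  have : q2 <= 1 / 1000.
    rewrite /q2 ler_pdivrMr ?wX_gt0 //.
    have : W ^+ 1 <= W ^+ (4 * m + 4) by apply: le_wX; mlia.
    rewrite expr1; lra_from lb k1 k0.
  nra_from lb q20.
- by rewrite /= !expr1n !expr1 divr1 mulr1.
Qed.

(** Both variables have the same size, and for close u, u' the difference $u^2-u'^2$ is too small
    for the second derivative test. These pairs are discarded. *)
Lemma bilinear_primes (U : seq nat) (al be : nat -> R) (e al0 th : R) :
  uniq U -> (forall u, `|al u| <= 1) -> 1 <= e <= 2 ->
  (forall u, u \in U -> (w ^ (8 * m - 10) < u <= 2 * w ^ (8 * m - 8))%N) ->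
  W ^+ (8 * m - 10) <= (size U)%:R ->
  (\sum_(1 <= v < (2 * w ^ (8 * m - 8)).+1) \sum_(u <- U) be v * al u *
      cos (e * (phase_pow t 1 (kp * u%:R) v%:R - al0) + th * u%:R * v%:R)) ^+ 2
  <= (\sum_(1 <= v < (2 * w ^ (8 * m - 8)).+1) be v ^+ 2) * ((size U)%:R ^+ 3 / 1000).
Proof.
move=> uU al1 e12 hU sU; set N := (2 * w ^ (8 * m - 8))%N.
have m20 := lb_m lb; have t0 := lb_t0; have k0 := lb_kp0 lb; have k1 := lb_kp1 lb.
have t1 := lb_t1 lb; have t2 := lb_t2 lb; have w6 := w_ge; have w0 := w_gt0; have kpi := kp_inv_le.
have NR : N%:R = 2 * W ^+ (8 * m - 8) :> R by rewrite natrM natrX.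
(* With $u^2-u'^2\ge W^{34}W^{8m-10}$, the term $1/q_1$ stays below $|U|$, whereas the discarded
   pairs, about $W^{34}$ for each u, remain negligible against $|U|^2$. *)
pose H := (w ^ 34)%N; have HR : H%:R = W ^+ 34 :> R by rewrite natrX.
pose q1 := kp / (2 * W ^+ (8 * m - 12)); pose q2 := 2 * kp / W ^+ (4 * m + 8).
have q10 : 0 < q1 by rewrite divr_gt0 // mulr_gt0 // wX_gt0.
have q20 : 0 < q2 by rewrite divr_gt0 ?wX_gt0 // mulr_gt0.
pose X := 96 * q2 * (N.+2)%:R + 72 / q1.
have X0 : 0 <= X by rewrite addr_ge0 ?mulr_ge0 ?invr_ge0 // ltW.
have p8 : 10 ^+ 6 <= W ^+ (8 * m - 8) by apply: wX_ge; mlia.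
have N2 : (N.+2)%:R <= 4 * W ^+ (8 * m - 8) :> R.
  by rewrite -[N.+2%:R]natr1 -[N.+1%:R]natr1 NR; lra_from lb p8.
have Xle : X <= W ^+ (8 * m - 10) / 2000.
  have h1 : q2 * N.+2%:R <= W ^+ (8 * m - 10) / 10 ^+ 6.
    apply: (@le_trans _ _ (q2 * (4 * W ^+ (8 * m - 8)))); first by rewrite ler_pM2l.
    have -> : q2 * (4 * W ^+ (8 * m - 8)) = 8 * kp * W ^+ (4 * m - 16).
      rewrite /q2 (_ : 8 * m - 8 = (4 * m - 16) + (4 * m + 8))%N; last by mlia.
      by rewrite [_ ^+ (_ + (_ + _))]exprD; field; rewrite lt0r_neq0 ?wX_gt0.
    have h2 : 10 ^+ 6 * kp * W ^+ (4 * m - 16) <= W * W ^+ (4 * m - 16) by rewrite ler_pM2r // wX_gt0.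
    have h3 : 10 ^+ 6 * W ^+ (4 * m - 15) <= W ^+ (8 * m - 10) by apply: le_wX_gap => //; mlia.
    move: h2; rewrite -exprS (_ : (4 * m - 16).+1 = 4 * m - 15)%N; last by mlia.
    have := wX_gt0 (8 * m - 10); have : 0 < kp * W ^+ (4 * m - 16) by rewrite mulr_gt0 // wX_gt0.
    lra_from lb h3.
  have h2 : q1^-1 <= W ^+ (8 * m - 10) / 10 ^+ 6.
    have -> : q1^-1 = 2 * W ^+ (8 * m - 12) * kp^-1 by rewrite /q1; field; rewrite !lt0r_neq0 ?wX_gt0.
    have h3 : 2 * W ^+ (8 * m - 12) * kp^-1 <= 2 * W ^+ (8 * m - 12) * (W / 10 ^+ 6).
      by rewrite ler_wpM2l // mulr_ge0 // ltW ?wX_gt0.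
    have h4 : 10 ^+ 6 * W ^+ (8 * m - 12).+1 <= W ^+ (8 * m - 10) by apply: le_wX_gap => //; mlia.
    move: h4; rewrite [W ^+ _.+1]exprS; have := wX_gt0 (8 * m - 10); lra_from lb h3.
  rewrite /X; have := wX_gt0 (8 * m - 10); lra_from lb h1 h2.
have lo0 := wX_gt0 (8 * m - 10).
apply: (le_trans (@bilinear_phase R t 1 kp t0 (or_introl erefl) k0 U al be 1 N.+1 H e al0 th X uU al1 X0 _)); last first.
  apply: ler_wpM2l; first by apply: sumr_ge0 => v _; exact: sqr_ge0.
  rewrite subSS subn0 NR natrD natrM HR; set S := (size U)%:R in sU *.
  have S0 : 0 < S by apply: lt_le_trans sU.
  have SS : W ^+ (16 * m - 20) <= S ^+ 2.
    rewrite (_ : 16 * m - 20 = (8 * m - 10) * 2)%N; last by mlia.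
    by rewrite exprM ler_pXn2r ?nnegrE // ltW.
  have h1 : (2 * W ^+ 34 + 1) * (2 * W ^+ (8 * m - 8)) <= S ^+ 2 / 2000.
    have h3 : 1 <= W ^+ 34 by apply: le_trans (wX_ge (ltn0Sn 33)); rewrite exprn_ege1 //; lra_from lb.
    have h4 : W ^+ 34 * W ^+ (8 * m - 8) <= W ^+ (8 * m + 26) by rewrite -exprD; apply: le_wX; mlia.
    have h5 : 10 ^+ 6 * W ^+ (8 * m + 26) <= W ^+ (16 * m - 20) by apply: le_wX_gap => //; mlia.
    have h6 := wX_gt0 (8 * m + 26); have h7 := wX_gt0 (8 * m - 8).
    have h8 : W ^+ (8 * m - 8) * 1 <= W ^+ (8 * m - 8) * W ^+ 34 by rewrite ler_pM2l.
    lra_from lb SS h4 h5 h6 h7 h8.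
  have h2 : S * ((2 * W ^+ 34 + 1) * (2 * W ^+ (8 * m - 8))) <= S * (S ^+ 2 / 2000) by rewrite ler_pM2l.
  have h3 : S ^+ 2 * X <= S ^+ 2 * (S / 2000).
    by rewrite ler_pM2l ?exprn_gt0 //; apply: (le_trans Xle); lra_from lb sU.
  rewrite exprS; lra_from lb h2 h3.
move=> u u' c d uI u'I uu.
have /andP[lu ul] := hU u uI; have /andP[lu' ul'] := hU u' u'I.
have luR : W ^+ (8 * m - 10) <= u%:R by rewrite -natrX ler_nat ltnW.
have ulR : u%:R <= 2 * W ^+ (8 * m - 8) by rewrite -natrX -(natrM _ 2) ler_nat.
have u'0 : (0 < u')%N by apply: leq_ltn_trans lu'.
have uu1 : (u' < u)%N by apply: leq_ltn_trans uu; rewrite leq_addr.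
have uuR : u'%:R + W ^+ 34 <= u%:R :> R by rewrite -HR -natrD ler_nat ltnW.
have u'R : 0 <= u'%:R :> R by [].
have h34 := wX_gt0 34.
apply: (le_trans (@phase_kernel_le R t 1 kp t0 (or_introl erefl) k0 u u' 1 N.+1 e q1 q2 c d _ _ e12 u'0 uu1 _ q10 (ltW q20) _ _)).
- by [].
- by [].
- rewrite expr1.
  have h : kp * u%:R * N.+2%:R <= kp * (2 * W ^+ (8 * m - 8)) * (4 * W ^+ (8 * m - 8)).
    by apply: ler_pM => //; [rewrite mulr_ge0 // ltW|rewrite ler_pM2l].
  have E : kp * (2 * W ^+ (8 * m - 8)) * (4 * W ^+ (8 * m - 8)) = 8 * kp * W ^+ (16 * m - 16).
    rewrite (_ : 16 * m - 16 = (8 * m - 8) + (8 * m - 8))%N; last by mlia.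
    by rewrite [_ ^+ (_ + _)]exprD; ring.
  have h2 : 10 ^+ 6 * kp * W ^+ (16 * m - 16) <= W * W ^+ (16 * m - 16) by rewrite ler_pM2r // wX_gt0.
  have h3 : W * W ^+ (16 * m - 16) <= W ^+ (24 * m) by rewrite -exprS; apply: le_wX; mlia.
  have := wX_gt0 (16 * m - 16) => p0; have : 0 < kp * W ^+ (16 * m - 16) by rewrite mulr_gt0.
  lra_from lb h E h2 h3 t1.
- apply/andP; split.
    rewrite ler_pdivlMr //.
    have : q1 ^+ 2 * t <= q1 ^+ 2 * (2 * W ^+ (24 * m)) by rewrite ler_wpM2l // sqr_ge0.
    have -> : q1 ^+ 2 * (2 * W ^+ (24 * m)) = kp ^+ 2 * (W ^+ 34 * W ^+ (8 * m - 10)) / 2.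
      rewrite /q1 -exprD (_ : 24 * m = (8 * m - 12) + (8 * m - 12) + (34 + (8 * m - 10)))%N; last by mlia.
      by rewrite [_ ^+ (_ + _ + (_ + _))]exprD [_ ^+ (8 * m - 12 + _)]exprD; field; rewrite !lt0r_neq0 ?wX_gt0.
    move=> h; apply: (le_trans h).
    have : kp ^+ 2 * (W ^+ 34 * W ^+ (8 * m - 10)) <= kp ^+ 2 * (u%:R ^+ 2 - u'%:R ^+ 2).
      rewrite ler_pM2l ?exprn_gt0 //.
      have : W ^+ 34 * W ^+ (8 * m - 10) <= W ^+ 34 * u%:R by rewrite ler_pM2l.
      nra_from lb uuR u'R h34.
    have : 0 < kp ^+ 2 * (W ^+ 34 * W ^+ (8 * m - 10)) by rewrite mulr_gt0 ?exprn_gt0 // mulr_gt0 // wX_gt0.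
    lra_from lb.
  rewrite ler_pdivrMr //.
  have : q2 ^+ 2 * W ^+ (24 * m) <= q2 ^+ 2 * t by rewrite ler_wpM2l // sqr_ge0.
  have -> : q2 ^+ 2 * W ^+ (24 * m) = kp ^+ 2 * (2 * W ^+ (8 * m - 8)) ^+ 2.
    rewrite /q2 (_ : 24 * m = (4 * m + 8) + (4 * m + 8) + ((8 * m - 8) + (8 * m - 8)))%N; last by mlia.
    by rewrite [_ ^+ (_ + _ + (_ + _))]exprD [_ ^+ (_ + (4 * m + 8))]exprD [_ ^+ (8 * m - 8 + _)]exprD; field; rewrite !lt0r_neq0 ?wX_gt0.
  apply: le_trans; rewrite ler_pM2l ?exprn_gt0 //.
  have := wX_gt0 (8 * m - 8); nra_from lb ulR u'R uuR h34.
- rewrite expr1n mulr1.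
  have : q2 <= 1 / 1000.
    rewrite /q2 ler_pdivrMr ?wX_gt0 //.
    have : W ^+ 1 <= W ^+ (4 * m + 8) by apply: le_wX; mlia.
    rewrite expr1; lra_from lb k1 k0.
  nra_from lb q20.
- by rewrite /= !expr1n !expr1 divr1 mulr1.
Qed.

(** Frequencies $uv^2$ with very few u. The lower end of v matters because the curvature grows with
    v. Again H = 0, and the diagonal prevails. *)
Lemma bilinear_square (U : seq nat) (al be : nat -> R) (al0 : R) :
  uniq U -> (forall u, `|al u| <= 1) ->
  (forall u, u \in U -> (0 < u <= 4 * w ^ 10)%N) ->
  (\sum_(w ^ (8 * m - 10) <= v < (2 * w ^ (8 * m - 8)).+1) \sum_(u <- U) be v * al u *
      cos (2 * (phase_pow t 2 (kp * u%:R) v%:R - al0) + 0 * u%:R * v%:R)) ^+ 2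
  <= (\sum_(w ^ (8 * m - 10) <= v < (2 * w ^ (8 * m - 8)).+1) be v ^+ 2) * (3 * (size U)%:R * W ^+ (8 * m - 8)).
Proof.
move=> uU al1 hU; set N := (2 * w ^ (8 * m - 8))%N; set a := (w ^ (8 * m - 10))%N.
have m20 := lb_m lb; have t0 := lb_t0; have k0 := lb_kp0 lb; have k1 := lb_kp1 lb.
have t1 := lb_t1 lb; have t2 := lb_t2 lb; have w6 := w_ge; have w0 := w_gt0; have kpi := kp_inv_le.
have NR : N%:R = 2 * W ^+ (8 * m - 8) :> R by rewrite natrM natrX.
have aR : a%:R = W ^+ (8 * m - 10) :> R by rewrite natrX.
have a0 : (0 < a)%N by rewrite -(ltr_nat R) aR wX_gt0.
have aN : (a <= N.+1)%N.
  apply: leqW; rewrite -(ler_nat R) aR NR; have : W ^+ (8 * m - 10) <= W ^+ (8 * m - 8) by apply: le_wX; mlia.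
  by have := wX_gt0 (8 * m - 8); lra_from lb.
pose q1 := kp / (2 * W ^+ (12 * m)); pose q2 := 4 * kp * W ^+ 10 / W ^+ (12 * m).
have q10 : 0 < q1 by rewrite divr_gt0 // mulr_gt0 // wX_gt0.
have q20 : 0 < q2 by rewrite divr_gt0 ?wX_gt0 // mulr_gt0 ?wX_gt0 // mulr_gt0.
pose X := 96 * q2 * (N.+2)%:R ^+ 3 / a%:R + 72 / (q1 * a%:R).
have X0 : 0 <= X by rewrite addr_ge0 // ?divr_ge0 ?mulr_ge0 // ?exprn_ge0 // ltW.
have p8 : 10 ^+ 6 <= W ^+ (8 * m - 8) by apply: wX_ge; mlia.
have N2 : (N.+2)%:R <= 4 * W ^+ (8 * m - 8) :> R.
  by rewrite -[N.+2%:R]natr1 -[N.+1%:R]natr1 NR; lra_from lb p8.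
have lo0 := wX_gt0 (8 * m - 10).
have Xle : X <= W ^+ (4 * m + 12).
  have h1 : q2 * N.+2%:R ^+ 3 / a%:R <= W ^+ (4 * m + 12) / 10 ^+ 3.
    apply: (@le_trans _ _ (q2 * (4 * W ^+ (8 * m - 8)) ^+ 3 / a%:R)).
      rewrite aR ler_pM2r ?invr_gt0 // ler_pM2l // ler_pXn2r ?nnegrE // mulr_ge0 // ltW // wX_gt0.
    have -> : q2 * (4 * W ^+ (8 * m - 8)) ^+ 3 / a%:R = 256 * kp * W ^+ (4 * m - 4).
      rewrite aR /q2 exprMn -exprM.
      have E : W ^+ 10 * W ^+ ((8 * m - 8) * 3) = W ^+ (4 * m - 4) * (W ^+ (12 * m) * W ^+ (8 * m - 10)).
        by rewrite -!exprD; congr (_ ^+ _); mlia.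
      have -> : 4 * kp * W ^+ 10 / W ^+ (12 * m) * (4 ^+ 3 * W ^+ ((8 * m - 8) * 3)) / W ^+ (8 * m - 10)
        = 256 * kp * (W ^+ 10 * W ^+ ((8 * m - 8) * 3)) / (W ^+ (12 * m) * W ^+ (8 * m - 10)).
        by field; rewrite !lt0r_neq0 ?wX_gt0.
      by rewrite E; field; rewrite !lt0r_neq0 ?wX_gt0.
    have h2 : 10 ^+ 6 * kp * W ^+ (4 * m - 4) <= W * W ^+ (4 * m - 4) by rewrite ler_pM2r // wX_gt0.
    have h3 : W * W ^+ (4 * m - 4) <= W ^+ (4 * m + 12) by rewrite -exprS; apply: le_wX; mlia.
    have := wX_gt0 (4 * m + 12); have : 0 < kp * W ^+ (4 * m - 4) by rewrite mulr_gt0 // wX_gt0.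
    lra_from lb h2 h3.
  have h2 : (q1 * a%:R)^-1 <= W ^+ (4 * m + 12) / 10 ^+ 3.
    have -> : (q1 * a%:R)^-1 = 2 * W ^+ (4 * m + 10) * kp^-1.
      rewrite aR /q1 (_ : 12 * m = (4 * m + 10) + (8 * m - 10))%N; last by mlia.
      by rewrite [_ ^+ (_ + (_ - _))]exprD; field; rewrite !lt0r_neq0 ?wX_gt0.
    have h3 : 2 * W ^+ (4 * m + 10) * kp^-1 <= 2 * W ^+ (4 * m + 10) * (W / 10 ^+ 6).
      by rewrite ler_wpM2l // mulr_ge0 // ltW ?wX_gt0.
    have h4 : W ^+ (4 * m + 10).+1 <= W ^+ (4 * m + 12) by apply: le_wX; mlia.
    move: h4; rewrite exprS; have := wX_gt0 (4 * m + 12); lra_from lb h3.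
  have := wX_gt0 (4 * m + 12).
  have -> : X = 96 * (q2 * N.+2%:R ^+ 3 / a%:R) + 72 * (q1 * a%:R)^-1 by rewrite /X; ring.
  lra_from lb h1 h2.
have sU : (size U)%:R <= 4 * W ^+ 10 :> R.
  rewrite -natrX -(natrM _ 4) ler_nat -[leqRHS](size_iota 1).
  by apply: uniq_leq_size => // p /hU /andP[p0 pe]; rewrite mem_iota p0 add1n ltnS.
have := @bilinear_phase R t 2 kp t0 (or_intror erefl) k0 U al be a N.+1 0 2 al0 0 X uU al1 X0.
move=> B; apply: (le_trans (B _)); last first.
  apply: ler_wpM2l; first by apply: sumr_ge0 => v _; exact: sqr_ge0.
  rewrite muln0 add0n mul1r; set S := (size U)%:R in sU *.
  have S0 : 0 <= S by rewrite /S.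
  have ba : (N.+1 - a)%:R <= 2 * W ^+ (8 * m - 8) :> R by rewrite -NR ler_nat; clear -a0; lia.
  have h1 : S * (N.+1 - a)%:R <= S * (2 * W ^+ (8 * m - 8)) by rewrite ler_wpM2l.
  have h2 : S * X <= W ^+ (8 * m - 8).
    apply: (@le_trans _ _ (4 * W ^+ 10 * W ^+ (4 * m + 12))); first by apply: ler_pM.
    rewrite -mulrA -exprD; apply: le_wX_gap; last by mlia.
    by lra.
  have h3 : S * (S * X) <= S * W ^+ (8 * m - 8) by rewrite ler_wpM2l.
  rewrite expr2; lra_from lb h1 h3.
move=> u u' c d uI u'I; rewrite addn0 => uu.
have /andP[u0 ul] := hU u uI; have /andP[u'0 ul'] := hU u' u'I.
have ulR : u%:R <= 4 * W ^+ 10 by rewrite -natrX -(natrM _ 4) ler_nat.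
have uuR : u'%:R + 1 <= u%:R :> R by rewrite natr1 ler_nat.
have u'R : 0 <= u'%:R :> R by [].
have h10 := wX_gt0 10.
have e12 : (1 : R) <= (2 : R) <= (2 : R) by rewrite lexx andbT ler1n.
apply: (le_trans (@phase_kernel_le R t 2 kp t0 (or_intror erefl) k0 u u' a N.+1 2 q1 q2 c d a0 aN e12 u'0 uu _ q10 (ltW q20) _ _)).
- have h : kp * u%:R * N.+2%:R ^+ 2 <= kp * (4 * W ^+ 10) * (4 * W ^+ (8 * m - 8)) ^+ 2.
    apply: ler_pM => //; [by rewrite mulr_ge0 // ltW|by rewrite ler_pM2l|].
    by rewrite ler_pXn2r ?nnegrE // mulr_ge0 // ltW // wX_gt0.
  have E : kp * (4 * W ^+ 10) * (4 * W ^+ (8 * m - 8)) ^+ 2 = 64 * kp * W ^+ (16 * m - 6).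
    rewrite (_ : 16 * m - 6 = 10 + ((8 * m - 8) + (8 * m - 8)))%N; last by mlia.
    by rewrite [_ ^+ (10 + _)]exprD [_ ^+ (_ + _)]exprD; ring.
  have h2 : 10 ^+ 6 * kp * W ^+ (16 * m - 6) <= W * W ^+ (16 * m - 6) by rewrite ler_pM2r // wX_gt0.
  have h3 : W * W ^+ (16 * m - 6) <= W ^+ (24 * m) by rewrite -exprS; apply: le_wX; mlia.
  have := wX_gt0 (16 * m - 6) => p0; have : 0 < kp * W ^+ (16 * m - 6) by rewrite mulr_gt0.
  lra_from lb h E h2 h3 t1.
- have tE : W ^+ (24 * m) = W ^+ (12 * m) ^+ 2 by rewrite -exprM; congr (_ ^+ _); mlia.
  have p12 := wX_gt0 (12 * m).
  apply/andP; split.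
    rewrite ler_pdivlMr //.
    have : q1 ^+ 2 * t <= q1 ^+ 2 * (2 * W ^+ (24 * m)) by rewrite ler_wpM2l // sqr_ge0.
    have -> : q1 ^+ 2 * (2 * W ^+ (24 * m)) = kp ^+ 2 / 2 by rewrite /q1 tE; field; rewrite !lt0r_neq0.
    move=> h; apply: (le_trans h).
    have : kp ^+ 2 * 1 <= kp ^+ 2 * (u%:R ^+ 2 - u'%:R ^+ 2) by rewrite ler_pM2l ?exprn_gt0 //; nra_from lb uuR u'R.
    have : 0 < kp ^+ 2 by rewrite exprn_gt0.
    lra_from lb.
  rewrite ler_pdivrMr //.
  have : q2 ^+ 2 * W ^+ (24 * m) <= q2 ^+ 2 * t by rewrite ler_wpM2l // sqr_ge0.
  have -> : q2 ^+ 2 * W ^+ (24 * m) = kp ^+ 2 * (4 * W ^+ 10) ^+ 2 by rewrite /q2 tE; field; rewrite !lt0r_neq0.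
  by apply: le_trans; rewrite ler_pM2l ?exprn_gt0 //; nra_from lb ulR u'R uuR h10.
- have : q2 * a%:R <= 1 / 1000.
    rewrite aR /q2 mulrAC ler_pdivrMr ?wX_gt0 //.
    have -> : 4 * kp * W ^+ 10 * W ^+ (8 * m - 10) = 4 * kp * W ^+ (8 * m).
      by rewrite -mulrA -exprD (_ : 10 + (8 * m - 10) = 8 * m)%N //; mlia.
    have h2 : 10 ^+ 6 * kp * W ^+ (8 * m) <= W * W ^+ (8 * m) by rewrite ler_pM2r // wX_gt0.
    have h3 : W * W ^+ (8 * m) <= W ^+ (12 * m) by rewrite -exprS; apply: le_wX; mlia.
    have := wX_gt0 (12 * m); lra_from lb h2 h3 k0.
  have : 0 <= q2 * a%:R by rewrite mulr_ge0 // ltW.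
  by rewrite expr1; nra_from lb.
- by rewrite /= !expr1.
Qed.

End LargeBase.

Section SeqSums.
Variable R : realType.
Implicit Types (F : nat -> R).

Lemma cos_double (y : R) : cos (2 * y) = 2 * cos y ^+ 2 - 1.
Proof. by rewrite mulr_natl cos_mulr2n mulr_natl. Qed.

Lemma norm_prod_le (b i c q mu X : R) : `|i| <= 1 -> `|c| <= 1 -> 0 <= mu <= 1 -> `|q| <= X ->
  `|b * i * c * (q * mu)| <= `|b| * X.
Proof.
move=> i1 c1 /andP[mu0 mu1] qX; rewrite !normrM (ger0_norm mu0) -!mulrA ler_wpM2l //.
rewrite -[leRHS]mul1r; apply: ler_pM; rewrite ?mulr_ge0 // -[leRHS]mul1r; apply: ler_pM; rewrite ?mulr_ge0 //.
by rewrite -[leRHS]mulr1; apply: ler_pM.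
Qed.

Lemma smoothed_le (c p mu : R) : 0 <= c -> c - 1 / 100 <= p -> 3 / 4 <= mu -> mu <= 1 ->
  3 / 8 * c - 1 / 100 <= 1 / 2 * (p * mu).
Proof. by move=> c0 cp mu1 mu2; have [h|h] := leP 0 p; nra. Qed.

Lemma eq_ler (a b : R) : a = b -> a <= b.
Proof. by move=> ->. Qed.

Lemma sum_const_seq (s : seq nat) (c : R) : \sum_(n <- s) c = (size s)%:R * c.
Proof. by rewrite big_const_seq count_predT iter_addr_0 -[LHS]mulr_natl. Qed.

Lemma sum_le_sub (s r : seq nat) F : uniq s -> uniq r -> {subset s <= r} -> (forall n, 0 <= F n) ->
  \sum_(n <- s) F n <= \sum_(n <- r) F n.
Proof.
move=> us ur sr F0; rewrite [leRHS](bigID (mem s)) /= -[leLHS]addr0 lerD ?sumr_ge0 //.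
rewrite -[in leRHS]big_filter; apply: eq_ler; apply: perm_big; apply: uniq_perm => //; first exact: filter_uniq.
by move=> n; rewrite mem_filter; case: (boolP (n \in s)) => // /sr ->.
Qed.

Lemma sum_indicator (s : seq nat) a b F : uniq s -> (forall n, n \in s -> (a <= n < b)%N) ->
  \sum_(a <= n < b) (if n \in s then F n else 0) = \sum_(n <- s) F n.
Proof.
move=> us hs; rewrite -big_mkcond /= -big_filter; apply: perm_big; apply: uniq_perm => //.
  by rewrite filter_uniq // iota_uniq.
by move=> n; rewrite mem_filter mem_index_iota; case: (boolP (n \in s)) => // /hs ->.
Qed.

Lemma count_divisors (U : seq nat) v : (0 < v)%N -> uniq U -> (count (fun p => p %| v)%N U <= tau v)%N.
Proof.
move=> v0 uU; rewrite -size_filter; apply: uniq_leq_size; first exact: filter_uniq.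
by move=> p; rewrite mem_filter -dvdn_divisors // => /andP[].
Qed.

End SeqSums.

(** * The test for a large mass *)

Section TestPolynomials.
Variable R : realType.
Variables (lam kap : nat -> R) (w m : nat) (t kp al0 : R).
Local Notation W := (w%:R : R).
Hypothesis lb : large_base lam w m t kp.
Hypothesis kap_osc : forall n, (0 < n)%N -> 25 * (kp * n%:R) <= t ->
  `|kap n - cos (phase t (kp * n%:R) - al0)| <= 1 / 100.

Let psi (n : nat) := phase t (kp * n%:R) - al0.
Let x n := (lam n * kap n) ^+ 2.
Let beta L n := lam n * kap n * smooth_factor R L n.
Definition mass := \sum_(1 <= n < (w ^ (16 * m + 1)).+1) x n.

Let lam_hecke := lb_hecke lb.

Lemma x_ge0 n : 0 <= x n. Proof. exact: sqr_ge0. Qed.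

Lemma mass_ge0 : 0 <= mass.
Proof. by apply: sumr_ge0 => n _; exact: x_ge0. Qed.

Lemma kap_cos n : (0 < n)%N -> 25 * (kp * n%:R) <= t ->
  [/\ `|kap n| <= 101 / 100, cos (psi n) ^+ 2 - 1 / 100 <= cos (psi n) * kap n
    & cos (psi n) ^+ 2 - 2 / 100 <= kap n ^+ 2].
Proof.
move=> n0 nt; have := kap_osc n0 nt; rewrite -/(psi n) => h.
have := cos_max (psi n); move: h; rewrite !ler_norml; set c := cos _; set k := kap n.
move=> /andP[h1 h2] /andP[c1 c2]; split; first by apply/andP; split; lra.
  nra.
have : (k - c) ^+ 2 >= 0 by exact: sqr_ge0.
have : `|c| * `|k - c| <= 1 / 100.
  by rewrite -[leRHS]mul1r; apply: ler_pM => //; rewrite ler_norml; apply/andP; split; lra.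
rewrite -normrM ler_norml => /andP[]; nra.
Qed.

Lemma osc_range n a : (a < 24 * m)%N -> n%:R <= 16 * W ^+ a -> 25 * (kp * n%:R) <= t \/ (24 * m <= a.+1)%N.
Proof.
move=> am na; have [h|h] := leqP (24 * m) a.+1; [by right|left].
have k0 := lb_kp0 lb; have k1 := lb_kp1 lb.
apply: le_trans (lb_t1 lb); apply: (@le_trans _ _ (W ^+ a.+2)); last exact: (le_wX lb).
have : kp * n%:R <= kp * (16 * W ^+ a) by rewrite ler_pM2l.
have : 10 ^+ 6 * kp * W ^+ a <= W * W ^+ a by rewrite ler_pM2r // (wX_gt0 lb).
have h6 : W * W ^+ a <= W ^+ a.+2 by rewrite -exprS; exact: (le_wX lb).
have := wX_gt0 lb a => p0; have : 0 < kp * W ^+ a by rewrite mulr_gt0.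
lra.
Qed.

Lemma osc_of_le n a : (a.+2 <= 24 * m)%N -> n%:R <= 16 * W ^+ a -> 25 * (kp * n%:R) <= t.
Proof. by move=> am na; case: (osc_range (ltnW am) na) => //; rewrite leqNgt am. Qed.

(** A weight bounded by 1 that cancels the eigenvalue at u in a pairing, up to the factor 1/2; the
    default 0 covers small eigenvalues. *)
Definition inv_weight u : R := if 1 / 2 <= `|lam u| then (2 * lam u)^-1 else 0.

Lemma inv_weight_le1 u : `|inv_weight u| <= 1.
Proof.
rewrite /inv_weight; case: ifP => [h|_]; last by rewrite normr0.
have u0 : 0 < `|lam u| by apply: lt_le_trans h; lra.
by rewrite normfV normrM ger0_norm // invf_le1 ?mulr_gt0 //; lra.
Qed.

Lemma inv_weightE u : 1 / 2 <= `|lam u| -> inv_weight u * lam u = 1 / 2.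
Proof.
move=> h; rewrite /inv_weight h; have u0 : lam u != 0.
  by rewrite -normr_gt0; apply: lt_le_trans h; lra.
by field.
Qed.

Lemma phase_pow_psi k u v : phase_pow t k (kp * u%:R) v%:R - al0 = psi (u * v ^ k).
Proof. by rewrite /phase_pow /psi natrM natrX mulrA. Qed.

(** The family consists of primes or of squares of primes. An element shares a factor with v only if
    its prime divides v, which leaves at most $\tau(v)\le w$ exceptions. *)
Lemma prime_power_family e : (2 <= e)%N -> (e <= 24 * m)%N ->
  exists U, [/\ uniq U, (w ^ (e - 2) <= size U)%N, (size U)%:R <= 2 * W ^+ e,
    forall u, u \in U -> [/\ (w ^ (e - 2) < u)%N, (u <= 4 * w ^ (2 * e))%N & 1 / 2 <= `|lam u|] &
    forall v, (0 < v <= w ^ (24 * m))%N -> (count (fun u => ~~ coprime u v) U <= w)%N].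
Proof.
move=> e2 em; have [k [U0 [k12 uU hU sU]]] := prime_supply lb e2 em.
have k0 : (0 < k)%N by case: k12 => ->.
have inj : {in U0 &, injective (fun p => p ^ k)%N}.
  by move=> p q _ _ /eqP; rewrite eqn_exp2r // => /eqP.
have w0 : (0 < w)%N by apply: leq_trans (lb_w lb).
exists [seq (p ^ k)%N | p <- U0]; split.
- by rewrite map_inj_in_uniq.
- by rewrite size_map.
- rewrite size_map; have hp p : p \in U0 -> (0 < p <= 2 * w ^ e)%N by move=> /hU[pp _ pe _]; rewrite prime_gt0.
  exact: (size_supply R uU hp).
- move=> u /mapP[p /hU[pp pl pe pg] ->]; split => //.
    by apply: (leq_trans pl); rewrite -{1}(expn1 p) leq_pexp2l // prime_gt0.
  have p1 := prime_gt0 pp.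
  apply: (@leq_trans (p ^ 2)); first by case: k12 => ->; rewrite ?leqnn // leq_pexp2l.
  apply: (@leq_trans ((2 * w ^ e) ^ 2)); first by rewrite leq_exp2r.
  by rewrite expnMn -expnM (mulnC e).
- move=> v /andP[v0 vw]; rewrite count_map.
  have vI : (0 < v <= w ^ (24 * m))%N by rewrite v0.
  apply: leq_trans (lb_tau lb vI).
  apply: leq_trans (count_divisors v0 uU).
  rewrite -!size_filter; apply: uniq_leq_size; first exact: filter_uniq.
  move=> p; rewrite !mem_filter /= => /andP[nc pU]; rewrite pU andbT.
  by have [pp _ _ _] := hU p pU; move: nc; rewrite coprime_pexpl // prime_coprime // negbK.
Qed.

(** The test coefficients are $\lambda(v)\kappa(v)^2\cos\psi(uv)/(2\lambda(u))$. For coprime u, v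
    the pairing with $\lambda(uv)\kappa(uv)$ is about $\frac12x(v)\cos^2\psi(uv)$, and
    $\cos^2\psi=\frac12(1+\cos2\psi)$ has a positive mean, since the doubled phase also has a
    bilinear bound. With $S=|U|$, the pairing is at least $SD/8$ and the sup norm at most
    $G=(4SDN)^{1/2}$, so the norm is at least $(SD/1024N)^{1/2}$. *)
Lemma test_long L : (forall n, (0 < n <= w ^ (24 * m - 2))%N -> `|lam n * kap n| <= W ^+ m) ->
  W ^+ (16 * m + 1) * W ^+ 6 <= mass * W ^+ (2 * m) ->
  (64 * (w ^ (24 * m - 2)) ^ 2 <= L)%N ->
  W ^+ m <= grid_norm L (trig_poly L (beta L)).
Proof.
move=> small big hL; have m20 := lb_m lb.
have e2 : (2 <= 4 * m - 2)%N by mlia.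
have em : (4 * m - 2 <= 24 * m)%N by mlia.
have [U [uU sUl sUh hU cU]] := prime_power_family e2 em.
have D0 := mass_ge0; set D := mass in big D0 *.
set N := (w ^ (16 * m + 1))%N; have NR : N%:R = W ^+ (16 * m + 1) by rewrite natrX.
set S : R := (size U)%:R.
have Sl : W ^+ (4 * m - 4) <= S by rewrite -natrX ler_nat (_ : 4 * m - 4 = 4 * m - 2 - 2)%N //; mlia.
have S0 : 0 < S by apply: lt_le_trans Sl; exact: (wX_gt0 lb).
have w0 := w_gt0 lb; have w6 := w_ge lb.
have hU' u : u \in U -> (w ^ (4 * m - 4) < u <= 4 * w ^ (8 * m - 4))%N.
  move=> /hU [h1 h2 _]; rewrite (_ : 4 * m - 4 = 4 * m - 2 - 2)%N; last by mlia.
  by rewrite (_ : 8 * m - 4 = 2 * (4 * m - 2))%N ?h1 ?h2 //; mlia.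
have vN v : (0 < v <= N)%N -> 25 * (kp * v%:R) <= t.
  move=> /andP[_ vN]; apply: (@osc_of_le _ (16 * m + 1)); first by mlia.
  have : v%:R <= N%:R :> R by rewrite ler_nat.
  by rewrite NR; have := wX_gt0 lb (16 * m + 1); lra.
have Nle : (N <= w ^ (24 * m - 2))%N.
  by rewrite leq_pexp2l; [|rewrite -(ltr_nat R)|mlia].
have uv u v : u \in U -> (0 < v <= N)%N ->
    [/\ (0 < u * v)%N, (u * v <= w ^ (24 * m - 2))%N & 25 * (kp * (u * v)%:R) <= t].
  move=> /hU' /andP[lu ul] /andP[v0 vN'].
  have h : (u * v)%:R <= 4 * W ^+ (24 * m - 3).
    rewrite natrM (_ : 24 * m - 3 = (8 * m - 4) + (16 * m + 1))%N; last by mlia.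
    rewrite [_ ^+ (_ + (_ + _))]exprD mulrA -NR; apply: ler_pM => //; last by rewrite ler_nat.
    by rewrite -natrX -(natrM _ 4) ler_nat.
  have u0 : (0 < u)%N by apply: leq_ltn_trans lu.
  split; first by rewrite muln_gt0 u0.
    rewrite -(ler_nat R) natrX; apply: (le_trans h); apply: (le_wX_gap lb); last by mlia.
    by lra.
  apply: (@osc_of_le _ (24 * m - 3)); first by mlia.
  by apply: (le_trans h); have := wX_gt0 lb (24 * m - 3); lra.
pose be v := lam v * kap v ^+ 2.
have be2 : \sum_(1 <= v < N.+1) be v ^+ 2 <= 2 * D.
  rewrite /D /mass mulr_sumr big_nat_cond [leRHS]big_nat_cond; apply: ler_sum => v /andP[/andP[v0 v1] _].
  have vI : (0 < v <= N)%N by rewrite v0.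
  have [k1 _ _] := kap_cos v0 (vN v vI).
  have -> : be v ^+ 2 = x v * kap v ^+ 2 by rewrite /be /x; ring.
  rewrite mulrC ler_wpM2r ?x_ge0 // -real_normK ?num_real //.
  by have := normr_ge0 (kap v); nra.
pose G := Num.sqrt (4 * D * S * N%:R).
have G0 : 0 <= G by exact: sqrtr_ge0.
have bil al be' e th : (forall u, `|al u| <= 1) -> 1 <= e <= (2 : R) ->
    (\sum_(1 <= v < N.+1) \sum_(u <- U) be' v * al u * cos (e * psi (u * v) + th * u%:R * v%:R)) ^+ 2
    <= (\sum_(1 <= v < N.+1) be' v ^+ 2) * (2 * S * N%:R).
  move=> al1 e12; rewrite NR; apply: le_trans (bilinear_long lb be' al0 th uU al1 e12 hU' sUh).
  apply: eq_ler; congr (_ ^+ 2); apply: eq_bigr => v _; apply: eq_bigr => u _.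
  by rewrite phase_pow_psi expn1.
have L0 : (0 < L)%N by apply: leq_trans hL; rewrite muln_gt0 /= sqrn_gt0 expn_gt0 -(ltr_nat R) w0.
have LR : 0 < L%:R :> R by rewrite ltr0n.
have sup j : `|\sum_(1 <= v < N.+1) \sum_(u <- U) be v * inv_weight u * cos (psi (u * v)) * cos (grid_angle R L (u * v) j)| <= G.
  (* The product of the two cosines is half the sum of two bilinear sums with the linear twists
     $\pm2\pi j/L$, which the bound absorbs. *)
  pose A th := \sum_(1 <= v < N.+1) \sum_(u <- U) be v * inv_weight u * cos (1 * psi (u * v) + th * u%:R * v%:R).
  have e12 : (1 : R) <= (1 : R) <= (2 : R) by rewrite lexx /=; lra.
  have Ale th : `|A th| <= G.
    rewrite -(@ler_pXn2r _ 2) ?nnegrE // real_normK ?num_real //.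
    apply: (le_trans (bil _ _ _ _ inv_weight_le1 e12)); rewrite sqr_sqrtr; last by rewrite !mulr_ge0 // ltW.
    have -> : 4 * D * S * N%:R = 2 * D * (2 * S * N%:R) by ring.
    by rewrite ler_wpM2r // !mulr_ge0 // ltW.
  have -> : \sum_(1 <= v < N.+1) \sum_(u <- U) be v * inv_weight u * cos (psi (u * v)) * cos (grid_angle R L (u * v) j)
    = (A (2 * pi * j%:R / L%:R) + A (- (2 * pi * j%:R / L%:R))) / 2.
    rewrite /A -big_split /= mulr_suml; apply: eq_bigr => v _.
    rewrite -big_split /= mulr_suml; apply: eq_bigr => u _.
    rewrite (_ : 1 * psi (u * v) + - (2 * pi * j%:R / L%:R) * u%:R * v%:R = psi (u * v) - grid_angle R L (u * v) j); last first.
      by rewrite /grid_angle natrM; field; rewrite lt0r_neq0.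
    rewrite (_ : 1 * psi (u * v) + 2 * pi * j%:R / L%:R * u%:R * v%:R = psi (u * v) + grid_angle R L (u * v) j); last first.
      by rewrite /grid_angle natrM; field; rewrite lt0r_neq0.
    by rewrite cosB cosD; field.
  have := Ale (2 * pi * j%:R / L%:R); have := Ale (- (2 * pi * j%:R / L%:R)).
  by rewrite !ler_norml => /andP[a1 a2] /andP[b1 b2]; apply/andP; split; lra_from lb kap_osc a1 a2 b1 b2.
have W2 : 1 <= W ^+ (2 * m) by rewrite exprn_ege1 // ler1n -(ltr_nat R).
have hSD : W ^+ (2 * m + 2) * N%:R <= S * D.
  have h1 : W ^+ (4 * m - 4) * D <= S * D by rewrite ler_wpM2r.
  apply: le_trans h1; have b2 := ler_wpM2l (ltW (wX_gt0 lb (2 * m - 4))) big.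
  have E1 : W ^+ (2 * m + 2) = W ^+ (2 * m - 4) * W ^+ 6 by rewrite -exprD; congr (_ ^+ _); mlia.
  have E2 : W ^+ (4 * m - 4) = W ^+ (2 * m - 4) * W ^+ (2 * m) by rewrite -exprD; congr (_ ^+ _); mlia.
  by rewrite E1 E2 NR; lra_from lb kap_osc b2.
have c2 : `|\sum_(1 <= v < N.+1) \sum_(u <- U) x v * cos (2 * psi (u * v))| <= S * D / 100.
  have SD0 : 0 <= S * D by rewrite mulr_ge0 // ltW.
  rewrite -(@ler_pXn2r _ 2) ?nnegrE // ?real_normK ?num_real //; last by lra_from lb kap_osc SD0.
  have e12 : (1 : R) <= (2 : R) <= (2 : R) by rewrite lexx andbT ler1n.
  have n1 : forall u : nat, `|1 : R| <= 1 by move=> _; rewrite normr1.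
  have E : \sum_(1 <= v < N.+1) \sum_(u <- U) x v * cos (2 * psi (u * v))
     = \sum_(1 <= v < N.+1) \sum_(u <- U) x v * 1 * cos (2 * psi (u * v) + 0 * u%:R * v%:R).
    by apply: eq_bigr => v _; apply: eq_bigr => u _; rewrite mulr1 !mul0r addr0.
  rewrite E; apply: (le_trans (bil (fun=> 1) x 2 0 n1 e12)).
  (* This is where the absence of a single large coefficient enters: it bounds the fourth powers by
     $W^{2m}$ times the mass. *)
  have h : \sum_(1 <= v < N.+1) x v ^+ 2 <= W ^+ (2 * m) * D.
    rewrite /D /mass mulr_sumr big_nat_cond [leRHS]big_nat_cond; apply: ler_sum => v /andP[/andP[v0 v1] _].
    rewrite expr2 ler_wpM2r ?x_ge0 // /x -real_normK ?num_real // mulnC exprM.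
    rewrite ler_pXn2r ?nnegrE ?exprn_ge0 ?(ltW w0) //.
    by apply: small; rewrite v0 (leq_trans _ Nle).
  apply: (@le_trans _ _ (W ^+ (2 * m) * D * (2 * S * N%:R))); first by rewrite ler_wpM2r // !mulr_ge0 // ltW.
  have -> : W ^+ (2 * m) * D * (2 * S * N%:R) = (S * D) * (2 * (W ^+ (2 * m) * N%:R)) by ring.
  have -> : (S * D / 100) ^+ 2 = (S * D) * (S * D / 10000) by field.
  rewrite ler_wpM2l //.
  have h2 : 10 ^+ 6 * W ^+ (2 * m) <= W ^+ (2 * m + 2) by apply: (le_wX_gap lb) => //; mlia.
  have h3 : 10 ^+ 6 * W ^+ (2 * m) * N%:R <= W ^+ (2 * m + 2) * N%:R by rewrite ler_wpM2r.
  have h4 : 0 <= W ^+ (2 * m) * N%:R by rewrite mulr_ge0 // ltW // (wX_gt0 lb).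
  by clear -hSD h3 h4; lra.
have mu n : (n <= w ^ (24 * m - 2))%N -> 3 / 4 <= smooth_factor R L n.
  move=> nw; apply: smooth_factor_ge; apply: leq_trans hL.
  by rewrite leq_mul2l /= leq_exp2r.
have DE : \sum_(1 <= i < N.+1) x i = D by [].
have main : S * D / 8 <= \sum_(1 <= v < N.+1) \sum_(u <- U) be v * inv_weight u * cos (psi (u * v)) * beta L (u * v).
  (* For a pair with a common factor the sign of the pairing is unknown; [pen] covers both its
     absolute value and the missing main term. At most w elements u are concerned for each v. *)
  pose pen v := 2 * x v * W ^+ (2 * m) + 1.
  have pen0 v : 0 <= pen v.
    apply: addr_ge0 => //; apply: mulr_ge0; last exact: ltW (wX_gt0 lb _).
    by apply: mulr_ge0 => //; exact: x_ge0.
  have pt v u : (0 < v <= N)%N -> u \in U ->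
      x v * (3 / 16 - 1 / 100) + 3 / 16 * (x v * cos (2 * psi (u * v))) - (if ~~ coprime u v then pen v else 0)
      <= be v * inv_weight u * cos (psi (u * v)) * beta L (u * v).
    move=> vI uI; have [uv0 uvw uvt] := uv u v uI vI; have /andP[v0 _] := vI.
    have [k1 k2 _] := kap_cos uv0 uvt; have [kv _ _] := kap_cos v0 (vN v vI).
    have mu1 := smooth_factor_le1 R L (u * v); have mu2 := mu _ uvw.
    have xv0 := x_ge0 v; have c1 := cos_max (psi (u * v)).
    have u0 : (0 < u)%N by have [h _ _] := hU u uI; exact: leq_ltn_trans h.
    have c2' : cos (2 * psi (u * v)) = 2 * cos (psi (u * v)) ^+ 2 - 1.
      exact: cos_double.
    rewrite c2'; have [_ _ lu] := hU u uI.
    have ck : (3 / 8) * (cos (psi (u * v)) ^+ 2) - 1 / 100 <= 1 / 2 * (cos (psi (u * v)) * kap (u * v)%N * smooth_factor R L (u * v)).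
      by apply: smoothed_le k2 mu2 mu1; exact: sqr_ge0.
    case: (boolP (coprime u v)) => [cp|_] /=.
      have -> : be v * inv_weight u * cos (psi (u * v)) * beta L (u * v) =
         x v * (1 / 2 * (cos (psi (u * v)) * kap (u * v)%N * smooth_factor R L (u * v))).
        rewrite /beta (lam_coprime lam_hecke u0 v0 cp) -(inv_weightE lu) /be /x; ring.
      by rewrite subr0; have := ler_wpM2l xv0 ck; lra_from lb kap_osc.
    have sm := small (u * v)%N; rewrite uv0 uvw in sm; have {}sm := sm isT.
    have b1 : `|be v * inv_weight u * cos (psi (u * v)) * beta L (u * v)| <= x v * W ^+ (2 * m) + 1.
      have e1 : `|be v| * W ^+ m <= x v * W ^+ (2 * m) + 1.
        have -> : `|be v| = `|lam v * kap v| * `|kap v| by rewrite /be -normrM; congr `|_|; ring.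
        have -> : x v * W ^+ (2 * m) = (`|lam v * kap v| * W ^+ m) ^+ 2.
          by rewrite exprMn real_normK ?num_real // -exprM (mulnC m).
        have n0 : 0 <= `|lam v * kap v| * W ^+ m by rewrite mulr_ge0 // ltW // (wX_gt0 lb).
        have : `|lam v * kap v| * W ^+ m * `|kap v| <= `|lam v * kap v| * W ^+ m * (101 / 100) by rewrite ler_wpM2l.
        by set q := `|lam v * kap v| * W ^+ m in n0 *; rewrite mulrAC -/q; nra_from lb kap_osc kv n0.
      apply: le_trans e1; apply: norm_prod_le; rewrite ?inv_weight_le1 // smooth_factor_ge0 //.
    move: b1; rewrite ler_norml => /andP[b1 _]; rewrite /pen.
    have : x v * cos (psi (u * v)) ^+ 2 <= x v * 1.
      by rewrite ler_wpM2l // -real_normK ?num_real // expr_le1.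
    have : x v * 1 <= x v * W ^+ (2 * m) by rewrite ler_wpM2l.
    lra_from lb kap_osc b1 xv0.
  have penS : \sum_(1 <= v < N.+1) \sum_(u <- U) (if ~~ coprime u v then pen v else 0) <= S * D / 100.
    apply: (@le_trans _ _ (\sum_(1 <= v < N.+1) W * pen v)).
      rewrite big_nat_cond [leRHS]big_nat_cond; apply: ler_sum => v /andP[/andP[v0 v1] _].
      rewrite -big_mkcond /= big_const_seq iter_addr_0 -[leLHS]mulr_natl ler_wpM2r // ler_nat.
      apply: cU; rewrite v0 /=; apply: (@leq_trans N) => //; apply: (leq_trans Nle).
      by rewrite leq_pexp2l; [|rewrite -(ltr_nat R)|mlia].
    rewrite -mulr_sumr big_split /= -mulr_suml -mulr_sumr DE sumr_const_nat subSS subn0.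
    have h1 : 10 ^+ 6 * W ^+ (2 * m).+1 <= S by apply: le_trans Sl; apply: (le_wX_gap lb) => //; mlia.
    have h2 : 10 ^+ 6 * W ^+ (2 * m).+1 * D <= S * D by rewrite ler_wpM2r.
    have h3 : 10 ^+ 6 * W ^+ 1 * N%:R <= W ^+ (2 * m + 2) * N%:R.
      by rewrite ler_wpM2r //; apply: (le_wX_gap lb) => //; mlia.
    rewrite [W ^+ _.+1]exprS in h2; rewrite expr1 in h3.
    have : 0 <= W * N%:R by rewrite mulr_ge0 // ltW.
    have : 0 <= W * W ^+ (2 * m) * D by rewrite !mulr_ge0 // ltW // (wX_gt0 lb).
    lra_from lb kap_osc h1 h2 h3 hSD.
  apply: (@le_trans _ _ (\sum_(1 <= v < N.+1) \sum_(u <- U)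
     (x v * (3 / 16 - 1 / 100) + 3 / 16 * (x v * cos (2 * psi (u * v))) - (if ~~ coprime u v then pen v else 0)))); last first.
    rewrite big_nat_cond [leRHS]big_nat_cond; apply: ler_sum => v /andP[/andP[v0 v1] _].
    rewrite big_seq [leRHS]big_seq; apply: ler_sum => u uI; apply: pt => //; by rewrite v0.
  have E v : \sum_(u <- U) (x v * (3 / 16 - 1 / 100) + 3 / 16 * (x v * cos (2 * psi (u * v))) - (if ~~ coprime u v then pen v else 0))
    = S * (3 / 16 - 1 / 100) * x v + 3 / 16 * \sum_(u <- U) x v * cos (2 * psi (u * v)) - \sum_(u <- U) (if ~~ coprime u v then pen v else 0).
    by rewrite sumrB big_split /= big_const_seq count_predT iter_addr_0 -mulr_sumr -[_ *+ size U]mulr_natl -/S; ring.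
  rewrite (eq_bigr _ (fun v _ => E v)) sumrB big_split /= -!mulr_sumr DE.
  move: c2; rewrite ler_norml => /andP[c2 _].
  have SD0 : 0 <= S * D by rewrite mulr_ge0 // ltW.
  lra_from lb kap_osc SD0 c2 penS.
have SD0 : 0 < S * D.
  by apply: lt_le_trans hSD; rewrite NR mulr_gt0 // (wX_gt0 lb).
have gn0 := grid_norm_ge0 L (trig_poly L (beta L)); set gn := grid_norm _ _ in gn0 *.
have dual : S * D / 8 <= 2 * G * gn.
  apply: (le_trans main); apply: (le_trans (ler_norm _)).
  apply: (@trig_poly_duality R L L0 nat nat (index_iota 1 N.+1) U
    (fun v u => be v * inv_weight u * cos (psi (u * v))) (fun v u => u * v)%N (beta L) G) => //.
  move=> v u; rewrite mem_index_iota => vI uI; have [uv0 uvw _] := uv u v uI vI; split => //.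
  apply: leq_trans hL; apply: (@leq_trans (64 * (w ^ (24 * m - 2)))).
    by apply: leq_mul.
  by rewrite leq_mul2l /= -mulnn leq_pmulr // expn_gt0 -(ltr_nat R) w0.
have G2 : G ^+ 2 = 4 * (S * D) * N%:R by rewrite sqr_sqrtr; [ring|rewrite !mulr_ge0 // ltW].
have key : (S * D) ^+ 2 / 64 <= 16 * (S * D) * N%:R * gn ^+ 2.
  have : (S * D / 8) ^+ 2 <= (2 * G * gn) ^+ 2.
    have p1 : 0 <= S * D / 8 by apply: divr_ge0 => //; exact: ltW.
    have p2 : 0 <= 2 * G * gn by apply: mulr_ge0 => //; exact: mulr_ge0.
    by rewrite ler_pXn2r ?nnegrE.
  have -> : (2 * G * gn) ^+ 2 = 16 * (S * D) * N%:R * gn ^+ 2 by rewrite !exprMn G2; ring.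
  have -> : (S * D / 8) ^+ 2 = (S * D) ^+ 2 / 64 by field.
  by [].
have N0 : 0 < N%:R :> R by rewrite NR (wX_gt0 lb).
have key2 : S * D <= 1024 * N%:R * gn ^+ 2.
  by rewrite -(ler_pM2l SD0); move: key; rewrite expr2; lra_from lb kap_osc.
have key3 : W ^+ (2 * m + 2) <= 1024 * gn ^+ 2.
  rewrite -(ler_pM2r N0); apply: (le_trans hSD); apply: (le_trans key2); lra_from lb kap_osc.
rewrite -(@ler_pXn2r _ 2) ?nnegrE ?exprn_ge0 ?(ltW w0) // -exprM (mulnC m).
have h2 : 10 ^+ 6 * W ^+ (2 * m) <= W ^+ (2 * m + 2) by apply: (le_wX_gap lb) => //; mlia.
have := wX_gt0 lb (2 * m); lra_from lb kap_osc key3 h2.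
Qed.

End TestPolynomials.

(** * Fourth moments over squares *)

Section FourthMoment.
Variable R : realType.

Lemma grid_cos_corr L d d' : (d.*2 < L)%N -> (d'.*2 < L)%N ->
  `|\sum_(0 <= j < L) cos (grid_angle R L d j) * cos (grid_angle R L d' j)| <= if d == d' then L%:R else 0.
Proof.
move=> dL d'L; have L0 : (0 < L)%N by apply: leq_ltn_trans dL.
case: eqVneq => [_|nd].
  apply: (le_trans (ler_norm_sum _ _ _)).
  apply: (@le_trans _ _ (\sum_(0 <= j < L) 1)); last by rewrite sumr_const_nat subn0.
  by apply: ler_sum => j _; rewrite normrM mulr_ile1 // cos_max.
have E j : cos (grid_angle R L d j) * cos (grid_angle R L d' j)
   = (cos (grid_angle R L (d + d') j + 0) + cos (grid_angle R L ((d - d') + (d' - d)) j + 0)) / 2.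
  rewrite (grid_angleD R L0) !addr0.
  have -> : cos (grid_angle R L ((d - d') + (d' - d)) j) = cos (grid_angle R L d j - grid_angle R L d' j).
    have [h|h] := leqP d d'.
      rewrite (_ : d - d' = 0)%N; last by apply/eqP.
      by rewrite add0n (grid_angleB R L0 _ h) -[RHS]cosN; congr cos; ring.
    rewrite (_ : d' - d = 0)%N; last by apply/eqP; exact: ltnW.
    by rewrite addn0 (grid_angleB R L0 _ (ltnW h)).
  by rewrite cosB cosD; field.
rewrite (eq_bigr _ (fun j _ => E j)) -mulr_suml big_split /= !(sum_cos_grid L0) ?addr0 ?mul0r ?normr0 //.
  by move: dL d'L nd; rewrite -!muln2 neq_ltn; lia.
by move: dL d'L nd; rewrite -!muln2 neq_ltn; lia.
Qed.

(** The absolute value of $p^2-q^2$: one of the two truncated differences is zero. *)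
Definition sqr_dist (p q : nat) := ((p ^ 2 - q ^ 2) + (q ^ 2 - p ^ 2))%N.

(** As $p^2-q^2=(p-q)(p+q)$, the divisor p - q of d determines the pair; the factor 2 accounts for
    the order. *)
Lemma sqr_dist_fibre (Q : seq nat) (d T : nat) : uniq Q -> (0 < d)%N -> (tau d <= T)%N ->
  \sum_(p <- Q) \sum_(q <- Q) (if sqr_dist p q == d then 1 else 0) <= 2 * T%:R :> R.
Proof.
move=> uQ d0 dT.
pose S := [seq pq <- [seq (p, q) | p <- Q, q <- Q] | (pq.2 < pq.1)%N && (pq.1 ^ 2 - pq.2 ^ 2 == d)%N].
have uS : uniq S by rewrite filter_uniq // allpairs_uniq // => -[a b] [a' b'] _ _ [-> ->].
have SE : \sum_(p <- Q) \sum_(q <- Q) (if (q < p)%N && (p ^ 2 - q ^ 2 == d)%N then 1 else 0) = (size S)%:R :> R.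
  rewrite size_filter -sum1_count natr_sum [RHS]big_mkcond [RHS]big_allpairs /=.
  by apply: eq_bigr => p _; apply: eq_bigr => q _; case: ifP.
have ST : (size S <= T)%N.
  apply: leq_trans dT; rewrite -(size_map (fun pq : nat * nat => pq.1 - pq.2)%N).
  apply: uniq_leq_size.
    rewrite map_inj_in_uniq // => -[a b] [a' b']; rewrite !mem_filter /= => /andP[/andP[ab /eqP h] _] /andP[/andP[ab' /eqP h'] _] e.
    have s : ((a - b) * (a + b) = (a - b) * (a' + b'))%N by rewrite {2}e -!subn_sqr h h'.
    move/eqP: s; rewrite eqn_pmul2l ?subn_gt0 // => /eqP s.
    by clear -e s ab ab'; congr pair; lia.
  move=> k /mapP[[a b]]; rewrite mem_filter /= => /andP[/andP[ab /eqP h] _] ->.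
  by rewrite -dvdn_divisors // -h subn_sqr dvdn_mulr.
have SR : (size S)%:R <= T%:R :> R by rewrite ler_nat.
apply: (@le_trans _ _ (\sum_(p <- Q) \sum_(q <- Q) ((if (q < p)%N && (p ^ 2 - q ^ 2 == d)%N then 1 else 0)
    + (if (p < q)%N && (q ^ 2 - p ^ 2 == d)%N then 1 else 0)))).
  apply: ler_sum => p _; apply: ler_sum => q _.
  have pos (b : bool) : 0 <= (if b then 1 else 0) :> R by case: b.
  rewrite /sqr_dist; case: (ltngtP p q) => /= [pq|qp|->].
  - by rewrite (_ : p ^ 2 - q ^ 2 = 0)%N ?add0n ?add0r //; apply/eqP; rewrite subn_eq0 leq_exp2r // ltnW.
  - by rewrite (_ : q ^ 2 - p ^ 2 = 0)%N ?addn0 ?addr0 //; apply/eqP; rewrite subn_eq0 leq_exp2r // ltnW.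
  - by rewrite subnn addn0 eq_sym -leqn0 leqNgt d0 /= addr0.
under eq_bigr do rewrite big_split /=.
rewrite big_split /= SE [X in _ + X]exchange_big /= SE; lra.
Qed.

(** The cosine sum is completed to a square modulus, which is a cosine sum over the differences
    $u|p^2-q^2|$. In its square only equal differences correlate: a nonzero one has at most 2T
    representations, and zero only the diagonal ones. *)
Lemma fourth_moment L (Q : seq nat) (c : nat -> R) (u T : nat) : (0 < L)%N -> (0 < u)%N -> uniq Q ->
  (forall q, `|c q| <= 1) -> (forall q, q \in Q -> ((u * q ^ 2).*2 < L)%N) ->
  (forall q, q \in Q -> forall d, (0 < d <= q ^ 2)%N -> (tau d <= T)%N) ->
  \sum_(0 <= j < L) (\sum_(q <- Q) c q * cos (grid_angle R L (u * q ^ 2) j)) ^+ 4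
    <= L%:R * ((size Q)%:R ^+ 2 * (1 + 2 * T%:R)).
Proof.
move=> L0 u0 uQ c1 qL qT.
pose C q j := cos (grid_angle R L (u * q ^ 2) j); pose Sn q j := sin (grid_angle R L (u * q ^ 2) j).
pose G j := \sum_(p <- Q) \sum_(q <- Q) c p * c q * cos (grid_angle R L (u * sqr_dist p q) j).
have dist p q j : cos (grid_angle R L (u * sqr_dist p q) j) = C p j * C q j + Sn p j * Sn q j.
  rewrite /C /Sn -cosB /sqr_dist.
  have [h|h] := leqP (p ^ 2) (q ^ 2).
    rewrite (_ : p ^ 2 - q ^ 2 = 0)%N; last by apply/eqP.
    by rewrite add0n mulnBr (grid_angleB R L0) ?leq_mul2l ?h ?orbT // -[RHS]cosN; congr cos; ring.
  rewrite (_ : q ^ 2 - p ^ 2 = 0)%N; last by apply/eqP; exact: ltnW.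
  by rewrite addn0 mulnBr (grid_angleB R L0) ?leq_mul2l ?(ltnW h) ?orbT.
have GE j : G j = (\sum_(q <- Q) c q * C q j) ^+ 2 + (\sum_(q <- Q) c q * Sn q j) ^+ 2.
  rewrite /G !expr2 !mulr_suml -big_split /=; apply: eq_bigr => p _.
  by rewrite !mulr_sumr -big_split /=; apply: eq_bigr => q _; rewrite dist; ring.
apply: (@le_trans _ _ (\sum_(0 <= j < L) G j ^+ 2)).
  apply: ler_sum => j _; rewrite (exprM _ 2 2) GE.
  have := sqr_ge0 (\sum_(q <- Q) c q * C q j); have := sqr_ge0 (\sum_(q <- Q) c q * Sn q j).
  by rewrite -/(C _ _); set a := _ ^+ 2; set b := (\sum_(q <- Q) c q * C q j) ^+ 2; nra.
have E : \sum_(0 <= j < L) G j ^+ 2 = \sum_(p <- Q) \sum_(q <- Q) \sum_(p' <- Q) \sum_(q' <- Q)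
   c p * c q * (c p' * c q') * \sum_(0 <= j < L) cos (grid_angle R L (u * sqr_dist p q) j) * cos (grid_angle R L (u * sqr_dist p' q') j).
  under eq_bigr do rewrite expr2 {1}/G mulr_suml.
  rewrite exchange_big /=; apply: eq_bigr => p _.
  under eq_bigr do rewrite mulr_suml.
  rewrite exchange_big /=; apply: eq_bigr => q _.
  under eq_bigr do rewrite mulr_sumr.
  rewrite exchange_big /=; apply: eq_bigr => p' _.
  under eq_bigr do rewrite mulr_sumr.
  rewrite exchange_big /=; apply: eq_bigr => q' _.
  by rewrite mulr_sumr; apply: eq_bigr => j _; ring.
have dL p q : p \in Q -> q \in Q -> ((u * sqr_dist p q).*2 < L)%N.
  move=> pQ qQ; have := qL p pQ; have := qL q qQ; rewrite -!muln2 /sqr_dist.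
  have [h|h] := leqP (p ^ 2) (q ^ 2).
    rewrite (_ : p ^ 2 - q ^ 2 = 0)%N; last by apply/eqP.
    by rewrite add0n => + _; apply: leq_ltn_trans; rewrite leq_mul2r leq_mul2l leq_subr orbT.
  rewrite (_ : q ^ 2 - p ^ 2 = 0)%N; last by apply/eqP; exact: ltnW.
  by rewrite addn0 => _; apply: leq_ltn_trans; rewrite leq_mul2r leq_mul2l leq_subr orbT.
rewrite E; set S : R := (size Q)%:R.
apply: (@le_trans _ _ (\sum_(p <- Q) \sum_(q <- Q) L%:R * (2 * T%:R + (if p == q then S else 0)))); last first.
  under eq_bigr do rewrite -mulr_sumr.
  rewrite -mulr_sumr ler_wpM2l //.
  apply: (@le_trans _ _ (\sum_(p <- Q) (S * (2 * T%:R) + S))); last first.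
    by rewrite big_const_seq count_predT iter_addr_0 -[leLHS]mulr_natl -/S; rewrite expr2; lra.
  rewrite big_seq [leRHS]big_seq; apply: ler_sum => p pQ.
  rewrite big_split /= sum_const_seq lerD2l.
  by rewrite -big_mkcond (big_rem p) //= eqxx big1_seq ?addr0 // => q /andP[/eqP <-]; rewrite mem_rem_uniqF.
rewrite big_seq [leRHS]big_seq; apply: ler_sum => p pQ.
rewrite big_seq [leRHS]big_seq; apply: ler_sum => q qQ.
apply: (@le_trans _ _ (\sum_(p' <- Q) \sum_(q' <- Q) L%:R * (if sqr_dist p' q' == sqr_dist p q then 1 else 0))).
  rewrite big_seq [leRHS]big_seq; apply: ler_sum => p' p'Q.
  rewrite big_seq [leRHS]big_seq; apply: ler_sum => q' q'Q.
  apply: (le_trans (ler_norm _)); rewrite normrM.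
  have := grid_cos_corr (dL p q pQ qQ) (dL p' q' p'Q q'Q).
  rewrite eqn_pmul2l // eq_sym => h.
  rewrite (_ : L%:R * (if _ then 1 else 0) = if sqr_dist p' q' == sqr_dist p q then L%:R else 0); last first.
    by case: ifP; rewrite ?mulr1 ?mulr0.
  apply: le_trans h; rewrite ler_piMl // !normrM.
  by rewrite !mulr_ile1 ?mulr_ge0.
under eq_bigr do rewrite -mulr_sumr.
rewrite -mulr_sumr ler_wpM2l //.
have [d0|d0] := posnP (sqr_dist p q); last first.
  have dT : (tau (sqr_dist p q) <= T)%N.
    have [h|h] := leqP (p ^ 2) (q ^ 2).
      apply: (qT q qQ); rewrite d0 /sqr_dist (_ : p ^ 2 - q ^ 2 = 0)%N; last by apply/eqP.
      by rewrite add0n leq_subr.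
    apply: (qT p pQ); rewrite d0 /sqr_dist (_ : q ^ 2 - p ^ 2 = 0)%N; last by apply/eqP; exact: ltnW.
    by rewrite addn0 leq_subr.
  by apply: (le_trans (sqr_dist_fibre uQ d0 dT)); rewrite lerDl; case: ifP.
have eqd a b : sqr_dist a b = 0%N -> a = b.
  move/eqP; rewrite addn_eq0 !subn_eq0 -eqn_leq eqn_exp2r // => /eqP //.
rewrite d0 (eqd _ _ d0) eqxx.
apply: (@le_trans _ _ (\sum_(p' <- Q) 1)).
  rewrite big_seq [leRHS]big_seq; apply: ler_sum => p' p'Q.
  rewrite -big_mkcond (big_rem p') //= /sqr_dist !subnn eqxx big1_seq ?addr0 // => q' /andP[/eqP/eqd <-].
  by rewrite mem_rem_uniqF.
by rewrite big_const_seq count_predT iter_addr_0 -/S lerDr mulr_ge0.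
Qed.

End FourthMoment.

(** * The tests for a small mass *)

Section ShortTests.
Variable R : realType.
Variables (lam kap : nat -> R) (w m : nat) (t kp al0 : R).
Local Notation W := (w%:R : R).
Hypothesis lb : large_base lam w m t kp.
Hypothesis kap_osc : forall n, (0 < n)%N -> 25 * (kp * n%:R) <= t ->
  `|kap n - cos (phase t (kp * n%:R) - al0)| <= 1 / 100.

Let psi (n : nat) := phase t (kp * n%:R) - al0.
Let x n := (lam n * kap n) ^+ 2.
Let beta L n := lam n * kap n * smooth_factor R L n.
Local Notation D := (mass lam kap w m).

Variable Q : seq nat.
Hypothesis uQ : uniq Q.
Hypothesis Qp : forall q, q \in Q -> [/\ prime q, (w ^ (8 * m - 10) < q)%N & (q <= 2 * w ^ (8 * m - 8))%N].
Hypothesis sQ : (w ^ (8 * m - 10) <= size Q)%N.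
Local Notation S := ((size Q)%:R : R).

Let w0 : 0 < W. Proof. exact: (w_gt0 lb). Qed.
Let wn0 : (0 < w)%N. Proof. by rewrite -(ltr_nat R). Qed.
Let SW : W ^+ (8 * m - 10) <= S.
Proof. by rewrite -natrX ler_nat. Qed.
Let S0 : 0 < S. Proof. by apply: lt_le_trans SW; exact: (wX_gt0 lb). Qed.
Let q0 q : q \in Q -> (0 < q)%N. Proof. by move=> /Qp[/prime_gt0]. Qed.

(** An integer n is a product of two elements of Q in at most $\tau(n)\le w$ ways. *)
Lemma sum_products (F : nat -> R) : (forall n, 0 <= F n) ->
  \sum_(v <- Q) \sum_(u <- Q) F (u * v)%N <= W * \sum_(1 <= n < (w ^ (16 * m + 1)).+1) F n.
Proof.
move=> F0; set N := (w ^ (16 * m + 1))%N; have m20 := lb_m lb.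
have qq u v : u \in Q -> v \in Q -> (0 < u * v <= N)%N.
  move=> uI vI; rewrite muln_gt0 !q0 //=; have [_ _ hu] := Qp uI; have [_ _ hv] := Qp vI.
  apply: (leq_trans (leq_mul hu hv)); rewrite -(ler_nat R) !natrM !natrX.
  have -> : 2 * W ^+ (8 * m - 8) * (2 * W ^+ (8 * m - 8)) = 4 * W ^+ (16 * m - 16).
    by rewrite (_ : 16 * m - 16 = (8 * m - 8) + (8 * m - 8))%N; [rewrite exprD; ring|mlia].
  by apply: (le_wX_gap lb); [lra|mlia].
apply: (@le_trans _ _ (\sum_(v <- Q) \sum_(1 <= n < N.+1) if (v %| n)%N then F n else 0)).
  rewrite big_seq [leRHS]big_seq; apply: ler_sum => v vI; rewrite -big_mkcond /=.
  rewrite -(big_map (fun u => u * v)%N predT F) -[leRHS]big_filter; apply: sum_le_sub => //.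
  - rewrite map_inj_in_uniq // => a b _ _ /eqP; rewrite eqn_pmul2r ?q0 // => /eqP //.
  - by rewrite filter_uniq // iota_uniq.
  - move=> n /mapP[u uI ->]; rewrite mem_filter dvdn_mull //= mem_index_iota; exact: qq.
rewrite exchange_big /= mulr_sumr big_nat_cond [leRHS]big_nat_cond; apply: ler_sum => n /andP[/andP[n0 n1] _].
rewrite -big_mkcond /= big_const_seq iter_addr_0 -[leLHS]mulr_natl ler_wpM2r // ler_nat.
apply: (leq_trans (count_divisors n0 uQ)); apply: (lb_tau lb); rewrite n0 /=.
by apply: (@leq_trans N); rewrite // leq_pexp2l //; mlia.
Qed.

(* The eigenvalues at products of two such primes are bounded below by
   multiplicativity, so the mass would be too large. *)
Lemma no_large_primes : (forall q, q \in Q -> 1 / 2 <= `|lam q|) ->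
  D * W ^+ (2 * m) < W ^+ (16 * m + 1) * W ^+ 6 -> False.
Proof.
move=> Ql small; have m20 := lb_m lb; set N := (w ^ (16 * m + 1))%N.
have qq u v : u \in Q -> v \in Q -> 25 * (kp * (u * v)%:R) <= t.
  move=> uI vI; apply: (osc_of_le lb (a := 16 * m - 16)); first by mlia.
  have [_ _ hu] := Qp uI; have [_ _ hv] := Qp vI.
  apply: (@le_trans _ _ ((2 * w ^ (8 * m - 8)) * (2 * w ^ (8 * m - 8)))%N%:R).
    by rewrite ler_nat; exact: leq_mul.
  rewrite !natrM !natrX.
  have -> : 2 * W ^+ (8 * m - 8) * (2 * W ^+ (8 * m - 8)) = 4 * W ^+ (16 * m - 16).
    by rewrite (_ : 16 * m - 16 = (8 * m - 8) + (8 * m - 8))%N; [rewrite exprD; ring|mlia].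
  by have := wX_gt0 lb (16 * m - 16); lra.
have c2 : `|\sum_(v <- Q) \sum_(u <- Q) cos (2 * psi (u * v))| <= S ^+ 2 / 30.
  rewrite -(@ler_pXn2r _ 2) ?nnegrE ?divr_ge0 ?exprn_ge0 ?normr_ge0 // real_normK ?num_real //.
  have e12 : (1 : R) <= (2 : R) <= (2 : R) by rewrite lexx andbT; lra.
  have n1 : forall u : nat, `|1 : R| <= 1 by move=> _; rewrite normr1.
  have Qr u : u \in Q -> (w ^ (8 * m - 10) < u <= 2 * w ^ (8 * m - 8))%N by move=> /Qp[_ -> ->].
  have Qi n : n \in Q -> (1 <= n < (2 * w ^ (8 * m - 8)).+1)%N by move=> nQ; rewrite q0 //= ltnS; have /andP[] := Qr n nQ.
  have := bilinear_primes lb (fun v => if v \in Q then 1 else 0) al0 0 uQ n1 e12 Qr SW.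
  rewrite -(sum_indicator (fun v => \sum_(u <- Q) cos (2 * psi (u * v))) uQ Qi).
  have -> : \sum_(1 <= v < (2 * w ^ (8 * m - 8)).+1) (if v \in Q then 1 else 0 : R) ^+ 2 = S.
    under eq_bigr do rewrite (fun_if (fun z => z ^+ 2)) expr1n expr0n /=.
    by rewrite (sum_indicator (fun=> 1) uQ Qi) sum_const_seq mulr1.
  have -> : (S ^+ 2 / 30) ^+ 2 = S * (S ^+ 3 / 900) by field.
  move=> h; apply: le_trans (le_trans h _).
    apply: eq_ler; congr (_ ^+ 2); apply: eq_bigr => v _; case: ifP => _.
      by apply: eq_bigr => u _; rewrite mulr1 mul1r phase_pow_psi expn1 !mul0r addr0.
    by rewrite big1 // => u _; rewrite !mul0r.
  clear n1; have z : (1000 : R)^-1 <= 900^-1 by rewrite lef_pV2 ?posrE; lra.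
  apply: ler_wpM2l; first exact: ltW.
  by apply: ler_wpM2l; [exact: exprn_ge0|exact: z].
have pt u v : u \in Q -> v \in Q -> 1 / 32 * (1 + cos (2 * psi (u * v))) - 1 / 800 - (if u == v then 1 else 0) <= x (u * v)%N.
  move=> uI vI; have uv0 : (0 < u * v)%N by rewrite muln_gt0 !q0.
  have [_ _ k3] := kap_cos kap_osc uv0 (qq u v uI vI); rewrite -/(psi _) in k3.
  have cm := cos_max (psi (u * v)); have := sqr_ge0 (cos (psi (u * v))).
  have c1 : cos (psi (u * v)) ^+ 2 <= 1 by rewrite -real_normK ?num_real // expr_le1.
  rewrite cos_double; case: eqVneq => [_|nuv].
    by have := sqr_ge0 (lam (u * v) * kap (u * v)%N); rewrite /x; lra.
  have cp : coprime u v.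
    have [pu _ _] := Qp uI; have [pv _ _] := Qp vI.
    by rewrite prime_coprime // dvdn_prime2.
  have -> : x (u * v)%N = (lam u ^+ 2 * lam v ^+ 2) * kap (u * v)%N ^+ 2.
    by rewrite /x (lam_coprime (lb_hecke lb) (q0 uI) (q0 vI) cp); ring.
  have l2 z : z \in Q -> 1 / 4 <= lam z ^+ 2.
    by move=> /Ql h; rewrite -real_normK ?num_real //; have := normr_ge0 (lam z); nra.
  have l4 : 1 / 16 <= lam u ^+ 2 * lam v ^+ 2.
    rewrite (_ : 1 / 16 = 1 / 4 * (1 / 4)); last by field.
    by apply: ler_pM; rewrite ?l2 // divr_ge0.
  have : 1 / 16 * kap (u * v)%N ^+ 2 <= lam u ^+ 2 * lam v ^+ 2 * kap (u * v)%N ^+ 2 by rewrite ler_wpM2r // sqr_ge0.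
  lra.
have tot : S ^+ 2 / 50 - S <= W * D.
  apply: le_trans (sum_products (fun n => sqr_ge0 (lam n * kap n))).
  apply: (@le_trans _ _ (\sum_(v <- Q) \sum_(u <- Q) (1 / 32 * (1 + cos (2 * psi (u * v))) - 1 / 800 - (if u == v then 1 else 0)))); last first.
    rewrite big_seq [leRHS]big_seq; apply: ler_sum => v vI.
    by rewrite big_seq [leRHS]big_seq; apply: ler_sum => u uI; exact: pt.
  have E v : v \in Q -> \sum_(u <- Q) (1 / 32 * (1 + cos (2 * psi (u * v))) - 1 / 800 - (if u == v then 1 else 0))
     = S * (1 / 32 - 1 / 800) - 1 + 1 / 32 * \sum_(u <- Q) cos (2 * psi (u * v)).
    move=> vI; have E1 : \sum_(u <- Q) (if u == v then 1 else 0) = 1 :> R.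
      rewrite -big_mkcond (big_rem v) //= eqxx big1_seq ?addr0 // => u /andP[/eqP ->].
      by rewrite mem_rem_uniqF.
    rewrite sumrB E1.
    by rewrite sumrB -mulr_sumr big_split /= !sum_const_seq; ring.
  rewrite big_seq (eq_bigr _ E) -big_seq big_split /= sum_const_seq -mulr_sumr.
  move: c2; rewrite ler_norml => /andP[c2 _]; have := mulr_gt0 S0 S0; rewrite expr2 in c2 *; lra.
have big : W ^+ (16 * m - 20) <= S ^+ 2.
  rewrite (_ : 16 * m - 20 = (8 * m - 10) * 2)%N; last by mlia.
  by rewrite exprM; apply: lerXn2r; rewrite ?nnegrE // ltW // (wX_gt0 lb).
have SS : 100 * S <= S ^+ 2.
  rewrite expr2 ler_pM2r //; apply: le_trans SW; apply: (@le_trans _ _ (10 ^+ 6)); first by lra.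
  by apply: (wX_ge lb); mlia.
have WD : W ^+ (16 * m - 20) <= 100 * (W * D) by lra.
have : W ^+ (16 * m - 20) * W ^+ (2 * m) <= 100 * W * (D * W ^+ (2 * m)).
  by have := ler_wpM2r (ltW (wX_gt0 lb (2 * m))) WD; lra.
have : 100 * W * (D * W ^+ (2 * m)) < 100 * W * (W ^+ (16 * m + 1) * W ^+ 6) by rewrite ltr_pM2l // mulr_gt0.
have e1 : W ^+ (16 * m - 20) * W ^+ (2 * m) = W ^+ (18 * m - 20) by rewrite -exprD; congr (_ ^+ _); mlia.
have e2 : 100 * W * (W ^+ (16 * m + 1) * W ^+ 6) = 100 * W ^+ (16 * m + 8).
  by rewrite -exprD -mulrA -exprS; congr (_ * _ ^+ _); mlia.
rewrite e1 e2 => h1 h2.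
have c6 : (100 : R) <= 10 ^+ 6 by lra.
have ab : (16 * m + 8 < 18 * m - 20)%N by mlia.
by have := lt_le_trans (le_lt_trans h2 h1) (le_wX_gap lb c6 ab); rewrite ltxx.
Qed.

Lemma trig_poly_parseval L b : (0 < L)%N ->
  \sum_(0 <= j < L) trig_poly L b j ^+ 2 = L%:R / 2 * \sum_(1 <= n < L | (4 * n <= L)%N) b n ^+ 2 :> R.
Proof.
move=> L0; under eq_bigr do rewrite expr2 {2}/trig_poly mulr_sumr.
rewrite exchange_big /= mulr_sumr big_nat_cond [RHS]big_nat_cond; apply: eq_bigr => n /andP[/andP[n0 nL] n4].
under eq_bigr do rewrite mulrCA.
by rewrite -mulr_sumr trig_poly_pairing //; ring.
Qed.

(* The test polynomial has a small fourth moment, so it can be truncated. *)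
Lemma truncated_pairing L (P g : nat -> R) (X Y T : R) : (0 < L)%N -> 0 < T -> 0 <= Y ->
  L%:R * X <= \sum_(0 <= j < L) P j * g j ->
  (\sum_(0 <= j < L) P j ^+ 2) * (\sum_(0 <= j < L) g j ^+ 4) <= (L%:R * Y) ^+ 2 ->
  X <= T * grid_norm L P + Y / T.
Proof.
move=> L0 T0 Y0 pX pY; have LR : 0 < L%:R :> R by rewrite ltr0n.
have h : \sum_(0 <= j < L) `|P j| * g j ^+ 2 <= L%:R * Y.
  have s0 : 0 <= \sum_(0 <= j < L) `|P j| * g j ^+ 2 by apply: sumr_ge0 => j _; rewrite mulr_ge0 // sqr_ge0.
  rewrite -(@ler_pXn2r _ 2) ?nnegrE ?mulr_ge0 //.
  apply: le_trans pY; apply: (le_trans (cauchy_schwarz_sum _ _ _ _)).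
  apply: eq_ler; congr (_ * _); apply: eq_bigr => j _; first by rewrite real_normK ?num_real.
  by rewrite -exprM.
rewrite -(ler_pM2l LR); apply: (le_trans pX).
apply: (@le_trans _ _ (\sum_(0 <= j < L) (T * `|P j| + (`|P j| * g j ^+ 2) / T))).
  apply: ler_sum => j _; apply: (le_trans (ler_norm _)); rewrite normrM.
  have E : T * `|P j| + `|P j| * g j ^+ 2 / T = `|P j| * (T + g j ^+ 2 / T) by ring.
  rewrite E ler_wpM2l // -(ler_pM2r T0) mulrDl divfK ?lt0r_neq0 //.
  by rewrite -[g j ^+ 2]real_normK ?num_real //; have := sqr_ge0 (T - `|g j|); have := normr_ge0 (g j); nra.
rewrite big_split /= -mulr_sumr -mulr_suml mulrDr lerD //.
  by rewrite /grid_norm mulrCA mulVKf ?lt0r_neq0.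
by rewrite mulrA ler_pM2r ?invr_gt0.
Qed.

(** The test polynomial has the frequencies $uq^2$ for one well-chosen u. The small mass bounds the
    $L^2$ norm of the polynomial to be tested, and the fourth moment of the test is about $|Q|^2$,
    so the pairing survives truncation at a height of about $W^{7m}$ while being itself at least
    $|Q|/32$. *)
Lemma test_short L : (forall q, q \in Q -> 1 / 2 <= `|lam (q ^ 2)|) ->
  D * W ^+ (2 * m) < W ^+ (16 * m + 1) * W ^+ 6 ->
  (64 * (w ^ (16 * m)) ^ 2 <= L)%N ->
  \sum_(1 <= n < L | (4 * n <= L)%N) beta L n ^+ 2 <= D + 1 ->
  W ^+ m <= W ^+ 16 * grid_norm L (trig_poly L (beta L)).
Proof.
move=> Ql small hL mL; have m20 := lb_m lb; have w6 := w_ge lb.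
have L0 : (0 < L)%N by apply: leq_trans hL; rewrite muln_gt0 /= sqrn_gt0 expn_gt0 wn0.
have LR : 0 < L%:R :> R by rewrite ltr0n.
(* With e = 5 there are at least $w^3$ values of u, enough to average over, and all are at most
   $4w^{10}$, so that $uq^2$ stays below $w^{16m}$. *)
have e5 : (5 <= 24 * m)%N by mlia.
have [U [uU sUl _ hU _]] := @prime_power_family _ _ _ _ _ _ lb 5 isT e5.
have {}hU u : u \in U -> [/\ (0 < u)%N, (u <= 4 * w ^ 10)%N & 1 / 2 <= `|lam u|].
  by move=> /hU[h1 h2 h3]; split => //; apply: leq_ltn_trans h1.
pose V : R := (size U)%:R; have VW : W ^+ 3 <= V by rewrite -natrX ler_nat.
have V0 : 0 < V by apply: lt_le_trans VW; exact: (wX_gt0 lb).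
have Qi n : n \in Q -> (w ^ (8 * m - 10) <= n < (2 * w ^ (8 * m - 8)).+1)%N.
  by move=> /Qp[_ h1 h2]; rewrite ltnS h2 ltnW.
have c2 : `|\sum_(v <- Q) \sum_(u <- U) cos (2 * psi (u * v ^ 2))| <= S * V / 8.
  have SV0 : 0 <= S * V / 8 by rewrite divr_ge0 // mulr_ge0 // ltW.
  rewrite -(@ler_pXn2r _ 2) ?nnegrE // real_normK ?num_real //.
  have n1 (u : nat) : `|(fun=> 1 : R) u| <= 1 by rewrite normr1.
  have Ur u : u \in U -> (0 < u <= 4 * w ^ 10)%N by move=> /hU[-> ->].
  have h := bilinear_square lb (fun v => if v \in Q then 1 else 0) al0 uU n1 Ur; clear n1.
  rewrite -(sum_indicator (fun v => \sum_(u <- U) cos (2 * psi (u * v ^ 2))) uQ Qi).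
  have E1 : \sum_(w ^ (8 * m - 10) <= v < (2 * w ^ (8 * m - 8)).+1) (if v \in Q then 1 else 0 : R) ^+ 2 = S.
    under eq_bigr do rewrite (fun_if (fun z => z ^+ 2)) expr1n expr0n /=.
    by rewrite (sum_indicator (fun=> 1) uQ Qi) sum_const_seq mulr1.
  rewrite E1 in h; apply: le_trans (le_trans h _).
    apply: eq_ler; congr (_ ^+ 2); apply: eq_bigr => v _; case: ifP => _.
      by apply: eq_bigr => u _; rewrite mulr1 mul1r phase_pow_psi !mul0r addr0.
    by rewrite big1 // => u _; rewrite !mul0r.
  rewrite -/V.
  have SV : 10 ^+ 6 * W ^+ (8 * m - 8) <= S * V.
    have : W ^+ (8 * m - 10) * W ^+ 3 <= S * V by apply: ler_pM => //; rewrite ltW // (wX_gt0 lb).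
    apply: le_trans; rewrite -exprD; apply: (le_wX_gap lb) => //; mlia.
  have h3 : (S * V) * (3 * W ^+ (8 * m - 8)) <= (S * V) * (S * V / 64).
    apply: ler_wpM2l; first by rewrite mulr_ge0 // ltW.
    by have := wX_gt0 lb (8 * m - 8); lra.
  have -> : (S * V / 8) ^+ 2 = (S * V) * (S * V / 64) by field.
  by apply: le_trans h3; apply: eq_ler; ring.
(* The cancellation in $\cos2\psi$ holds only on average over u; an average of $\cos^2\psi$ near 1/2
   provides one u that can be fixed. *)
have [u uI hu] : exists2 u, u \in U & 3 / 8 * S <= \sum_(q <- Q) cos (psi (u * q ^ 2)) ^+ 2.
  apply: contrapT => no.
  have : \sum_(u <- U) \sum_(q <- Q) cos (psi (u * q ^ 2)) ^+ 2 <= V * (3 / 8 * S).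
    apply: (@le_trans _ _ (\sum_(u <- U) 3 / 8 * S)); last first.
      by rewrite sum_const_seq.
    rewrite big_seq [leRHS]big_seq; apply: ler_sum => u uI.
    by rewrite leNgt; apply/negP => h; apply: no; exists u => //; exact: ltW.
  have -> : \sum_(u <- U) \sum_(q <- Q) cos (psi (u * q ^ 2)) ^+ 2
     = S * V / 2 + 1 / 2 * \sum_(v <- Q) \sum_(u <- U) cos (2 * psi (u * v ^ 2)).
    rewrite exchange_big /=.
    have E v : \sum_(u <- U) cos (psi (u * v ^ 2)) ^+ 2 = V / 2 + 1 / 2 * \sum_(u <- U) cos (2 * psi (u * v ^ 2)).
      have E0 u : cos (psi (u * v ^ 2)) ^+ 2 = 1 / 2 + 1 / 2 * cos (2 * psi (u * v ^ 2)) by rewrite cos_double; field.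
      rewrite (eq_bigr _ (fun u _ => E0 u)) big_split /= sum_const_seq -mulr_sumr -/V; ring.
    rewrite (eq_bigr _ (fun v _ => E v)) big_split /= sum_const_seq -mulr_sumr; ring.
  move: c2; rewrite ler_norml => /andP[c2 _]; have : 0 < S * V by rewrite mulr_gt0.
  lra.
have [u0 uw lu] := hU u uI.
have uq q : q \in Q -> [/\ (0 < u * q ^ 2)%N, (u * q ^ 2 <= w ^ (16 * m))%N & 25 * (kp * (u * q ^ 2)%:R) <= t].
  move=> qI; have [_ _ hq] := Qp qI.
  have h : (u * q ^ 2)%:R <= 16 * W ^+ (16 * m - 6).
    apply: (@le_trans _ _ ((4 * w ^ 10) * (2 * w ^ (8 * m - 8)) ^ 2)%N%:R).
      by rewrite ler_nat leq_mul // leq_exp2r.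
    rewrite !(natrM, natrX) (_ : 16 * m - 6 = 10 + ((8 * m - 8) + (8 * m - 8)))%N; last by mlia.
    by rewrite [_ ^+ (10 + _)]exprD [_ ^+ (_ + (_ - _))]exprD; apply: eq_ler; ring.
  split; first by rewrite muln_gt0 u0 sqrn_gt0 q0.
    by rewrite -(ler_nat R) natrX; apply: (le_trans h); apply: (le_wX_gap lb); [lra|mlia].
  by apply: (osc_of_le lb _ h); mlia.
pose c q := inv_weight lam (q ^ 2) * inv_weight lam u * cos (psi (u * q ^ 2)).
have c1 q : `|c q| <= 1.
  by rewrite /c !normrM !mulr_ile1 ?mulr_ge0 ?inv_weight_le1 // ?cos_max // mulr_ile1 // inv_weight_le1.
have cb q : q \in Q -> 1 / 2 * (3 / 8 * cos (psi (u * q ^ 2)) ^+ 2 - 1 / 100) <= c q * beta L (u * q ^ 2).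
  move=> qI; have [n0 nw nt] := uq q qI; have [_ k2 _] := kap_cos kap_osc n0 nt.
  have [pq ql _] := Qp qI.
  have cp : coprime u (q ^ 2).
    rewrite coprime_sym coprime_pexpl // prime_coprime //; apply/negP => /(dvdn_leq u0).
    rewrite leqNgt => /negP; apply; apply: leq_ltn_trans ql; apply: (leq_trans uw).
    by rewrite -(ler_nat R) natrM !natrX; apply: (le_wX_gap lb); [lra|mlia].
  have E : c q * beta L (u * q ^ 2) = 1 / 2 * (1 / 2 * (cos (psi (u * q ^ 2)) * kap (u * q ^ 2)%N * smooth_factor R L (u * q ^ 2))).
    have qq0 : (0 < q ^ 2)%N by rewrite sqrn_gt0 q0.
    by rewrite /c /beta (lam_coprime (lb_hecke lb) u0 qq0 cp) -{1}(inv_weightE lu) -(inv_weightE (Ql q qI)); ring.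
  rewrite E; apply: ler_wpM2l; first by rewrite divr_ge0.
  apply: smoothed_le => //; first exact: sqr_ge0.
    by apply: smooth_factor_ge; apply: leq_trans hL; rewrite leq_mul2l /= leq_exp2r.
  exact: smooth_factor_le1.
pose P := trig_poly L (beta L); pose g j := \sum_(q <- Q) c q * cos (grid_angle R L (u * q ^ 2) j).
have uq4 q : q \in Q -> (4 * (u * q ^ 2) <= L)%N.
  move=> qI; have [_ nw _] := uq q qI; apply: leq_trans hL.
  apply: (@leq_trans (64 * w ^ (16 * m))); first exact: leq_mul.
  by rewrite leq_mul2l /= -mulnn leq_pmulr // expn_gt0 wn0.
have Pg : L%:R * (S / 32) <= \sum_(0 <= j < L) P j * g j.
  have E : \sum_(0 <= j < L) P j * g j = L%:R / 2 * \sum_(q <- Q) c q * beta L (u * q ^ 2).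
    under eq_bigr do rewrite mulr_sumr.
    rewrite exchange_big /= mulr_sumr big_seq [RHS]big_seq; apply: eq_bigr => q qI.
    under eq_bigr do rewrite mulrCA.
    have [n0 _ _] := uq q qI.
    by rewrite -mulr_sumr trig_poly_pairing ?uq4 //; ring.
  rewrite E -mulrA; apply: ler_wpM2l => //.
  have h : \sum_(q <- Q) 1 / 2 * (3 / 8 * cos (psi (u * q ^ 2)) ^+ 2 - 1 / 100) <= \sum_(q <- Q) c q * beta L (u * q ^ 2).
    by rewrite big_seq [leRHS]big_seq; apply: ler_sum.
  move: h; rewrite -mulr_sumr sumrB sum_const_seq -mulr_sumr.
  have := S0; lra_from lb kap_osc uQ Qp sQ hu.
have P2 : \sum_(0 <= j < L) P j ^+ 2 <= L%:R * W ^+ (14 * m + 7).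
  rewrite /P trig_poly_parseval // -mulrA; apply: ler_wpM2l => //.
  have Ds : D <= W ^+ (14 * m + 7).
    rewrite -(ler_pM2r (wX_gt0 lb (2 * m))) -exprD; apply: (le_trans (ltW small)).
    by rewrite -exprD; apply: (le_wX lb); mlia.
  have : 10 ^+ 6 <= W ^+ (14 * m + 7) by apply: (wX_ge lb); rewrite addnS.
  lra.
have g4 : \sum_(0 <= j < L) g j ^+ 4 <= L%:R * (S ^+ 2 * (1 + 2 * W)).
  apply: fourth_moment => //.
    by move=> q qI; have [n0 _ _] := uq q qI; apply: leq_trans (uq4 q qI); rewrite -mul2n ltn_pmul2r.
  move=> q qI d /andP[d0 dq]; apply: (lb_tau lb); rewrite d0 /=.
  have [_ nw _] := uq q qI; apply: (leq_trans dq); apply: (@leq_trans (w ^ (16 * m))).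
    by apply: leq_trans nw; rewrite leq_pmull.
  by rewrite leq_pexp2l //; mlia.
pose Y := S * W ^+ (7 * m + 5).
have Y0 : 0 < Y by rewrite mulr_gt0 ?(wX_gt0 lb) ?S0.
have PG : (\sum_(0 <= j < L) P j ^+ 2) * (\sum_(0 <= j < L) g j ^+ 4) <= (L%:R * Y) ^+ 2.
  apply: (@le_trans _ _ (L%:R * W ^+ (14 * m + 7) * (L%:R * (S ^+ 2 * (1 + 2 * W))))).
    apply: ler_pM => //; first by apply: sumr_ge0 => j _; exact: sqr_ge0.
    by apply: sumr_ge0 => j _; rewrite (exprM _ 2 2) sqr_ge0.
  have -> : L%:R * W ^+ (14 * m + 7) * (L%:R * (S ^+ 2 * (1 + 2 * W))) = (L%:R * S) ^+ 2 * (W ^+ (14 * m + 7) * (1 + 2 * W)) by ring.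
  have -> : (L%:R * Y) ^+ 2 = (L%:R * S) ^+ 2 * W ^+ (14 * m + 10).
    by rewrite /Y (_ : 14 * m + 10 = (7 * m + 5) * 2)%N ?exprM; [ring|mlia].
  apply: ler_wpM2l; first exact: sqr_ge0.
  have h1 : W ^+ (14 * m + 7) * W <= W ^+ (14 * m + 9) by rewrite -exprSr; apply: (le_wX lb); mlia.
  have h2 : W ^+ (14 * m + 7) <= W ^+ (14 * m + 9) by apply: (le_wX lb); mlia.
  have h3 : 10 ^+ 6 * W ^+ (14 * m + 9) <= W ^+ (14 * m + 10) by apply: (le_wX_gap lb) => //; mlia.
  have := wX_gt0 lb (14 * m + 9); lra.
(* Chosen so that the error Y / T of the truncation is half of the lower bound S / 32 for the
   pairing. *)
pose T := 64 * W ^+ (7 * m + 5); have T0 : 0 < T by rewrite mulr_gt0 // (wX_gt0 lb).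
have := truncated_pairing L0 T0 (ltW Y0) Pg PG.
have -> : Y / T = S / 64 by rewrite /Y /T; field; rewrite lt0r_neq0 // (wX_gt0 lb).
have gn0 := grid_norm_ge0 L P; rewrite -/P; set gn := grid_norm L P in gn0 *.
move=> h; have {}h : W ^+ (8 * m - 10) / 64 <= T * gn by have := SW; lra_from lb kap_osc uQ Qp sQ h.
rewrite -(ler_pM2r (wX_gt0 lb (7 * m + 5))) -exprD.
have e1 : 10 ^+ 6 * W ^+ (m + (7 * m + 5)) <= W ^+ 16 * W ^+ (8 * m - 10).
  by rewrite -exprD; apply: (le_wX_gap lb) => //; mlia.
have e2 : W ^+ 16 * (W ^+ (8 * m - 10) / 64) <= W ^+ 16 * (T * gn) by rewrite ler_pM2l // (wX_gt0 lb).
have := wX_gt0 lb (m + (7 * m + 5)); rewrite /T in e2; lra_from lb kap_osc uQ Qp sQ e1 e2.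
Qed.

End ShortTests.

(** * Combining the tests *)

Section TestNorm.
Variable R : realType.
Variables (lam kap : nat -> R) (w m : nat) (t kp al0 : R).
Local Notation W := (w%:R : R).
Hypothesis lb : large_base lam w m t kp.
Hypothesis kap_osc : forall n, (0 < n)%N -> 25 * (kp * n%:R) <= t ->
  `|kap n - cos (phase t (kp * n%:R) - al0)| <= 1 / 100.
Hypothesis kap_bd : forall n, (0 < n)%N -> `|kap n| <= 2 * (1 + t ^+ 2).
Hypothesis lam_bd : forall n, (0 < n)%N -> `|lam n| <= n%:R ^+ 2.

Let x n := (lam n * kap n) ^+ 2.
Let beta L n := lam n * kap n * smooth_factor R L n.

Lemma two_power_between X : (0 < X)%N -> exists J, (X <= 2 ^ J <= 2 * X)%N.
Proof.
move=> X0; have /andP[h1 h2] := trunc_log_bounds (ltnSn 1) X0.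
by exists (trunc_log 2 X).+1; rewrite ltnW //= expnS leq_mul2l.
Qed.

Lemma wX_le_exp c : W ^+ (24 * m * c) <= expR (c%:R * W).
Proof.
rewrite exprM expRM_natl; apply: lerXn2r; rewrite ?nnegrE ?expR_ge0 ?exprn_ge0 ?(ltW (w_gt0 lb)) //.
have h2 : 2 <= expR 1 :> R by have := expR_ge1Dx (1 : R); lra.
apply: (@le_trans _ _ (expR 1 ^+ w)); last by rewrite -expRM_natl mulr1.
apply: (@le_trans _ _ (2 ^+ w)); last by apply: lerXn2r; rewrite ?nnegrE ?expR_ge0.
rewrite -!natrX ler_nat; apply: leq_trans (lb_exp lb); exact: leq_pmull.
Qed.

(** For $n>w^{16m+1}$ and $L\le128w^{32m}$ the square of the smoothing factor is at most
    $\exp(-W^2/64)$, which outweighs every fixed power of w in the polynomial bounds for the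
    coefficients. *)
Lemma mass_tail L : (64 * (w ^ (16 * m)) ^ 2 <= L)%N -> (L <= 128 * (w ^ (16 * m)) ^ 2)%N ->
  \sum_(1 <= n < L | (4 * n <= L)%N) beta L n ^+ 2 <= mass lam kap w m + 1.
Proof.
move=> hL hL'; have m20 := lb_m lb; have w0 := w_gt0 lb; have w6 := w_ge lb.
have wn0 : (0 < w)%N by rewrite -(ltr_nat R).
have L0 : (0 < L)%N by apply: leq_trans hL; rewrite muln_gt0 /= sqrn_gt0 expn_gt0 wn0.
have LR : 0 < L%:R :> R by rewrite ltr0n.
have LW : L%:R <= 128 * W ^+ (32 * m).
  have : L%:R <= (128 * (w ^ (16 * m)) ^ 2)%N%:R :> R by rewrite ler_nat.
  by rewrite natrM !natrX -exprM (_ : 16 * m * 2 = 32 * m)%N //; mlia.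
set N := (w ^ (16 * m + 1))%N; have NR : N%:R = W ^+ (16 * m + 1) :> R by rewrite natrX.
pose K := 2 * (1 + t ^+ 2) : R.
have t0 := lb_t0 lb; have t2 := lb_t2 lb.
have K0 : 0 <= K by rewrite mulr_ge0 // addr_ge0 // sqr_ge0.
pose e := expR (- (W ^+ 2 / 64)) : R.
have e0 : 0 <= e by exact: expR_ge0.
have big n : (N < n < L)%N && (4 * n <= L)%N -> beta L n ^+ 2 <= L%:R ^+ 4 * K ^+ 2 * e.
  move=> /andP[/andP[nN nL] n4]; have n0 : (0 < n)%N by apply: leq_ltn_trans nN.
  have nR : n%:R <= L%:R :> R by rewrite ler_nat ltnW.
  have s : smooth_factor R L n ^+ 2 <= e.
    have n2 : (n.*2 <= L)%N by apply: leq_trans n4; rewrite -mul2n leq_mul2r orbT.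
    have := smooth_factor_small R n2; have := smooth_factor_ge0 R L n => s0 s1.
    apply: (@le_trans _ _ (expR (- (n%:R ^+ 2 / L%:R)) ^+ 2)); first by apply: lerXn2r; rewrite ?nnegrE ?expR_ge0.
    rewrite -expRM_natl ler_expR.
    have : W ^+ 2 / 128 <= n%:R ^+ 2 / L%:R.
      rewrite ler_pdivlMr //; apply: (@le_trans _ _ (W ^+ 2 / 128 * (128 * W ^+ (32 * m)))).
        by rewrite ler_wpM2l // divr_ge0 // sqr_ge0.
      have -> : W ^+ 2 / 128 * (128 * W ^+ (32 * m)) = N%:R ^+ 2.
        rewrite NR -exprM (_ : (16 * m + 1) * 2 = 2 + 32 * m)%N; last by mlia.
        by rewrite exprD; field.
      by apply: lerXn2r; rewrite ?nnegrE // ler_nat ltnW.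
    lra.
  have -> : beta L n ^+ 2 = (lam n) ^+ 2 * kap n ^+ 2 * smooth_factor R L n ^+ 2 by rewrite /beta; ring.
  have a1 : lam n ^+ 2 <= L%:R ^+ 4.
    rewrite -real_normK ?num_real // (exprM _ 2 2); apply: lerXn2r; rewrite ?nnegrE ?sqr_ge0 //.
    by apply: (le_trans (lam_bd n0)); apply: lerXn2r; rewrite ?nnegrE.
  have a2 : kap n ^+ 2 <= K ^+ 2.
    by rewrite -real_normK ?num_real //; apply: lerXn2r; rewrite ?nnegrE //; exact: kap_bd.
  exact: (ler_pM (mulr_ge0 (sqr_ge0 _) (sqr_ge0 _)) (sqr_ge0 _) (ler_pM (sqr_ge0 _) (sqr_ge0 _) a1 a2) s).
have T0 : 0 <= L%:R ^+ 4 * K ^+ 2 * e by apply: mulr_ge0 => //; apply: mulr_ge0; apply: exprn_ge0.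
have small : L%:R * (L%:R ^+ 4 * K ^+ 2 * e) <= 1.
  have LW' : L%:R <= W ^+ (33 * m) by apply: (le_trans LW); apply: (le_wX_gap lb); [lra|mlia].
  have KW : K <= W ^+ (49 * m).
    have h1 : t ^+ 2 <= (2 * W ^+ (24 * m)) ^+ 2 by apply: lerXn2r; rewrite ?nnegrE ?mulr_ge0 ?exprn_ge0 // ltW.
    have h2 : 10 ^+ 6 * W ^+ (48 * m) <= W ^+ (49 * m) by apply: (le_wX_gap lb) => //; mlia.
    have h3 : 10 ^+ 6 <= W ^+ (48 * m) by apply: (wX_ge lb); mlia.
    move: h1; rewrite exprMn -exprM (_ : 24 * m * 2 = 48 * m)%N; last by mlia.
    rewrite /K; lra.
  apply: (@le_trans _ _ (W ^+ (24 * m * 11) * e)); last first.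
    apply: (@le_trans _ _ (expR (11 * W) * e)); first by rewrite ler_wpM2r // wX_le_exp.
    rewrite /e -expRD -[leRHS]expR0 ler_expR.
    have : 64 * (11 * W) <= W * W by rewrite mulrA ler_pM2r //; lra.
    by rewrite expr2; lra.
  rewrite mulrA ler_wpM2r //.
  have -> : L%:R * (L%:R ^+ 4 * K ^+ 2) = L%:R ^+ 5 * K ^+ 2 by ring.
  apply: (@le_trans _ _ (W ^+ (33 * m) ^+ 5 * W ^+ (49 * m) ^+ 2)).
    by apply: ler_pM; rewrite ?exprn_ge0 //; apply: lerXn2r; rewrite ?nnegrE ?exprn_ge0 // ltW.
  by rewrite -!exprM -exprD; apply: (le_wX lb); mlia.
have pt n : (1 <= n < L)%N && (4 * n <= L)%N ->
    beta L n ^+ 2 <= (if (n < N.+1)%N then x n else 0) + L%:R ^+ 4 * K ^+ 2 * e.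
  move=> /andP[/andP[n0 nL] n4]; case: ltnP => nN.
    apply: (@le_trans _ _ (x n)); last by rewrite lerDl.
    rewrite /beta /x exprMn ler_piMr ?sqr_ge0 //.
    by rewrite expr_le1 ?smooth_factor_ge0 ?smooth_factor_le1.
  by rewrite add0r; apply: big; rewrite nN nL n4.
apply: (@le_trans _ _ (\sum_(1 <= n < L) ((if (n < N.+1)%N then x n else 0) + L%:R ^+ 4 * K ^+ 2 * e))).
  rewrite big_mkcond big_nat_cond [leRHS]big_nat_cond; apply: ler_sum => n /andP[nI _].
  case: ifP => n4; first by apply: pt; rewrite nI n4.
  by rewrite addr_ge0 //; case: ifP => // _; exact: sqr_ge0.
rewrite big_split /=; apply: lerD; last first.
  rewrite sumr_const_nat -[leLHS]mulr_natl; apply: le_trans small.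
  by rewrite ler_wpM2r // ler_nat leq_subr.
rewrite -big_mkcond -big_filter /mass; apply: sum_le_sub.
- by rewrite filter_uniq // iota_uniq.
- exact: iota_uniq.
- by move=> n; rewrite mem_filter !mem_index_iota => /andP[-> /andP[-> _]].
- by move=> n; exact: sqr_ge0.
Qed.

(** A coefficient above $W^m$ is detected by pairing with a single cosine. Otherwise a large mass is
    handled by [test_long], and a small one leaves primes that are good for the exponent 1, which is
    contradictory, or for the exponent 2, where [test_short] applies. *)
Lemma test_norm : exists J, [/\ (64 * (w ^ (16 * m)) ^ 2 <= 2 ^ J)%N, (2 ^ J <= 128 * (w ^ (24 * m - 2)) ^ 2)%N
  & W ^+ m <= W ^+ 16 * grid_norm (2 ^ J) (trig_poly (2 ^ J) (beta (2 ^ J)))].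
Proof.
have m20 := lb_m lb; have w0 := w_gt0 lb; have w6 := w_ge lb.
have wn0 : (0 < w)%N by rewrite -(ltr_nat R).
have X0 a : (0 < 64 * (w ^ a) ^ 2)%N by rewrite muln_gt0 /= sqrn_gt0 expn_gt0 wn0.
have mon : ((w ^ (16 * m)) ^ 2 <= (w ^ (24 * m - 2)) ^ 2)%N by rewrite leq_exp2r // leq_pexp2l //; mlia.
have W16 : 10 ^+ 6 <= W ^+ 16 by apply: (wX_ge lb).
(* On the grid of JA the smoothing is flat up to $w^{24m-2}$; on that of JB it is flat only up to
   $w^{16m}$ and cuts off past $w^{16m+1}$, so that the $L^2$ norm is bounded by the mass. *)
have [JA /andP[A1 A2]] := two_power_between (X0 (24 * m - 2)%N).
have [JB /andP[B1 B2]] := two_power_between (X0 (16 * m)%N).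
rewrite mulnA in A2; rewrite mulnA in B2.
have LA : (64 * (w ^ (16 * m)) ^ 2 <= 2 ^ JA)%N by apply: leq_trans A1; rewrite leq_mul2l.
have LB : (2 ^ JB <= 128 * (w ^ (24 * m - 2)) ^ 2)%N by apply: (leq_trans B2); rewrite leq_mul2l.
have P0 J : (0 < 2 ^ J)%N by rewrite expn_gt0.
have pos J : 0 <= grid_norm (2 ^ J) (trig_poly (2 ^ J) (beta (2 ^ J))) := grid_norm_ge0 _ _.
have [[n nI hn]|no] := pselect (exists2 n, (0 < n <= w ^ (24 * m - 2))%N & W ^+ m < `|lam n * kap n|).
  exists JA; split => //; have /andP[n0 nw] := nI.
  set L := (2 ^ JA)%N in A1 A2 *; set b := beta L; have LR : 0 < L%:R :> R by rewrite ltr0n P0.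
  have n4 : (4 * n <= L)%N.
    apply: leq_trans A1; apply: (@leq_trans (64 * w ^ (24 * m - 2))); first exact: leq_mul.
    by rewrite leq_mul2l /= -mulnn leq_pmulr // expn_gt0 wn0.
  have h1 : L%:R / 2 * `|b n| <= L%:R * grid_norm L (trig_poly L b).
    rewrite /grid_norm mulVKf ?lt0r_neq0 // -{1}(ger0_norm (ltW LR)) -[2]ger0_norm // -normfV -!normrM.
    rewrite -trig_poly_pairing ?P0 //; apply: (le_trans (ler_norm_sum _ _ _)); apply: ler_sum => j _.
    by rewrite normrM ler_piMr // cos_max.
  have mu : 3 / 4 <= smooth_factor R L n.
    by apply: smooth_factor_ge; apply: leq_trans A1; rewrite leq_mul2l /= leq_exp2r.
  have h2 : 3 / 4 * W ^+ m <= `|b n|.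
    rewrite /b /beta normrM (ger0_norm (smooth_factor_ge0 _ _ _)) mulrC.
    by apply: ler_pM => //; first [exact: ltW (wX_gt0 lb _)|exact: ltW|lra].
  have h3 : `|b n| <= 2 * grid_norm L (trig_poly L b).
    by rewrite -(ler_pM2l LR); move: h1; lra.
  have := pos JA; rewrite -/L -/b; set G := grid_norm _ _ in h3 *; move=> G0.
  have : 10 ^+ 6 * G <= W ^+ 16 * G by rewrite ler_wpM2r.
  lra.
have sm n : (0 < n <= w ^ (24 * m - 2))%N -> `|lam n * kap n| <= W ^+ m.
  by move=> nI; rewrite leNgt; apply/negP => h; apply: no; exists n.
have [big|small] := leP (W ^+ (16 * m + 1) * W ^+ 6) (mass lam kap w m * W ^+ (2 * m)).
  exists JA; split => //; apply: (le_trans (test_long lb kap_osc sm big A1)).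
  by rewrite ler_peMl ?pos //; apply: le_trans W16; rewrite exprn_ege1 //; lra.
have e2 : (2 <= 8 * m - 8)%N by mlia.
have em : (8 * m - 8 <= 24 * m)%N by mlia.
have [k [Q [k12 uQ hQ sQ]]] := prime_supply lb e2 em.
have E : (8 * m - 8 - 2 = 8 * m - 10)%N by mlia.
rewrite E in hQ sQ.
have Qp q : q \in Q -> [/\ prime q, (w ^ (8 * m - 10) < q)%N & (q <= 2 * w ^ (8 * m - 8))%N] by move=> /hQ[].
have Qg q : q \in Q -> 1 / 2 <= `|lam (q ^ k)| by move=> /hQ[].
case: k12 => kE; rewrite kE in Qg.
  by have := no_large_primes lb kap_osc uQ Qp sQ _ small; case => q /Qg; rewrite expn1.
exists JB; split => //; apply: (test_short lb kap_osc uQ Qp sQ Qg small B1).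
exact: mass_tail.
Qed.

End TestNorm.

(** * Sizes of the form and of its coefficients *)

Section Sizes.
Variable R : realType.
Variables (phi : R[i] -> R) (t : R).
Hypothesis hphi : even_hecke_maass_cusp_form phi t.
Hypothesis t1000 : 1000 <= t.
Local Notation f := (in_coords phi).
Local Notation K := (radial phi).
Local Notation lm := (lam hphi).

Let t2 : 2 <= t. Proof. by have h := t1000; lra. Qed.

Definition oscillates (r al : R) := [/\ 0 < r,
  forall s, 25 * (2 * pi * expR s) <= t -> `|K s - r * cos (phase t (2 * pi * expR s) - al)| <= r / 100
  & forall s, `|K s| <= 2 * r * (1 + t ^+ 2)].

(** The rotation estimate is used at the point where $2\pi e^s=t/25$: its error is $6r/625<r/100$.
    The amplitude is positive, since r = 0 would make K vanish identically. *)
Lemma radial_oscillates : exists r al, oscillates r al.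
Proof.
have T := t1000; have p0 := pi_gt0 R; have p4 : pi <= 4 :> R by have := @pihalf_lt2 R; lra.
have p50 : 0 < 50 * pi :> R by rewrite mulr_gt0.
have tp : 0 < t / (50 * pi) by rewrite divr_gt0 //; lra.
have gen (q : R) : 0 < q -> 2 * q * (t / (50 * q)) = t / 25 by move=> q0; field; rewrite lt0r_neq0.
pose s1 := ln (t / (50 * pi)).
have e1 : expR s1 = t / (50 * pi) by rewrite /s1 lnK ?posrE.
have X1 : 2 * pi * expR s1 = t / 25 by rewrite e1; exact: gen.
have Xt : 2 * (2 * pi * expR s1) <= t by rewrite X1; lra.
have s10 : 0 <= s1 by apply: ln_ge0; rewrite ler_pdivlMr //; lra.
have [r [al [r0 r2 os]]] := oscillation t2 (radial_derive hphi) (radial_derive2 hphi) Xt.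
have sup := K_sup t2 (radial_derive hphi) (radial_derive2 hphi) (radial_not_growing hphi) s10 Xt r0 r2.
have below s : s <= s1 -> `|K s| <= 2 * r.
  move=> ss; have := os s ss; rewrite X1.
  have -> : 6 * r * (t / 25 / t) ^+ 2 = r * (6 / 625) by field; rewrite lt0r_neq0 //; lra.
  have := cos_max (phase t (2 * pi * expR s) - al); rewrite !ler_norml; set c := cos _.
  by move=> /andP[c1 c2] /andP[h1 h2]; apply/andP; split; nra_from hphi t1000 r0 c1 c2 h1 h2.
have rp : 0 < r.
  rewrite lt_neqAle r0 andbT eq_sym; apply/eqP => rE; have [s] := radial_neq0 hphi.
  case/eqP; apply/eqP; rewrite -normr_le0; have [ss|ss] := leP s s1.
    by have := below s ss; rewrite rE mulr0.
  by have := sup s (ltW ss); rewrite rE mul0r.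
exists r, al; split => //.
  move=> s hs; have ss : s <= s1.
    rewrite -ler_expR e1 ler_pdivlMr //; lra.
  have := os s ss; rewrite X1.
  have -> : 6 * r * (t / 25 / t) ^+ 2 = r * (6 / 625) by field; rewrite lt0r_neq0 //; lra.
  move=> h; apply: (le_trans h); lra.
move=> s; have r2' : 0 <= r * t ^+ 2 by rewrite mulr_ge0 // sqr_ge0.
have [ss|ss] := leP s s1; first by apply: (le_trans (below s ss)); lra.
by apply: (le_trans (sup s (ltW ss))); lra.
Qed.

Variables (r al : R).
Hypothesis osc : oscillates r al.

(** Exponential decay turned into decay of any order p. For $z\le2t$ the factor on the right is at
    least 1, so the uniform bound suffices. *)
Lemma radial_poly p z : (0 < p)%N -> 0 < z -> `|K (ln z)| <= 2 * r * (1 + t ^+ 2) * (2 * p%:R * t / z) ^+ p.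
Proof.
move=> p0 z0; have [r0 _ sup] := osc; have T := t1000; have t0 : 0 < t by lra.
have pR : 1 <= p%:R :> R by rewrite ler1n.
have M0 : 0 <= 2 * r * (1 + t ^+ 2) by rewrite !mulr_ge0 ?addr_ge0 ?sqr_ge0 // ltW.
have [zt|zt] := leP z (2 * t).
  apply: (le_trans (sup _)); rewrite ler_peMr // exprn_ege1 // ler_pdivlMr // mul1r.
  by apply: (le_trans zt); rewrite ler_pM2r //; lra.
have e1 : t <= expR (ln t) by rewrite lnK ?posrE.
have e2 : ln t <= ln z by rewrite ler_ln ?posrE //; lra.
apply: (le_trans (K_decay t2 (radial_derive hphi) (radial_derive2 hphi) (radial_not_growing hphi) e1 e2)).
rewrite !lnK ?posrE //; apply: ler_pM => //.
apply: (@le_trans _ _ (expR (- (z / 2)))); first by rewrite ler_expR; lra.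
have h1 : (z / (2 * p%:R)) ^+ p <= expR (z / 2).
  have -> : expR (z / 2) = expR (z / (2 * p%:R)) ^+ p.
    by rewrite -expRM_natl; congr expR; field; rewrite lt0r_neq0 //; lra.
  apply: lerXn2r; rewrite ?nnegrE ?expR_ge0 ?divr_ge0 ?mulr_ge0 ?(ltW z0) //.
  by apply: le_trans (expR_ge1Dx _); lra.
have zp : 0 < z / (2 * p%:R) by rewrite divr_gt0 // mulr_gt0 //; lra.
rewrite expRN; apply: (@le_trans _ _ (((z / (2 * p%:R)) ^+ p)^-1)).
  by rewrite lef_pV2 ?posrE ?expR_gt0 ?exprn_gt0.
rewrite -exprVn; apply: lerXn2r; rewrite ?nnegrE.
- by rewrite invr_ge0 ltW.
- by rewrite divr_ge0 ?mulr_ge0 // ltW.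
rewrite invf_div ler_pM2r ?invr_gt0 // ler_peMr //; lra.
Qed.

Lemma coef_poly p n y : (0 < p)%N -> (0 < n)%N -> 0 < y ->
  `|coef phi n y| <= n%:R ^+ 2 * Num.sqrt y * (2 * r * (1 + t ^+ 2) * (2 * p%:R * t / (n%:R * y)) ^+ p).
Proof.
move=> p0 n0 y0; have nR : 0 < n%:R :> R by rewrite ltr0n.
rewrite (coef_radial hphi n0 y0) normrM normrM (ger0_norm (sqrtr_ge0 _)) -mulrA.
apply: ler_pM => //; first exact: (lam_le_sqr hphi t2 n0).
by rewrite ler_wpM2l ?sqrtr_ge0 //; apply: radial_poly; rewrite // mulr_gt0.
Qed.

Lemma sum_inv_sqr_le2 M : \sum_(1 <= n < M.+1) (n%:R ^+ 2)^-1 <= 2 :> R.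
Proof.
case: M => [|M]; first by rewrite big_geq.
rewrite big_ltn // expr1n invr1; have := @sum_inv_sqr R 1 M.+1 (ltn0Sn 0); rewrite invr1; lra.
Qed.

(** At heights at least 1/2, decay of order 5 against the trivial bound $|\lambda(n)|\le n^2$ leaves
    a convergent series; minimality of the supremum carries the bound to all heights. The bound is
    in terms of the amplitude r, which later cancels. *)
Lemma form_le x y : 0 < y -> `|f (x, y)| <= 10 ^+ 8 * r * t ^+ 7.
Proof.
have [r0 _ _] := osc; have T := t1000; have t0 : 0 < t by lra.
have [A A0 [hA small]] := form_sup hphi t2.
have AB : A <= 10 ^+ 8 * r * t ^+ 7.
  apply: small => {}x {}y y2; have y0 : 0 < y by lra.
  have [C C0 hC] := slice_fourier hphi y0.
  apply: (@le_of_le_div _ _ _ C 1) => M M0; have := hC M x M0.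
  set sm := 2 * _ => h.
  suff : `|sm| <= 10 ^+ 8 * r * t ^+ 7.
    by have := ler_normD (f (x, y) - sm) sm; rewrite subrK; lra.
  pose B := 10 ^+ 5 * 64 * r * (1 + t ^+ 2) * t ^+ 5.
  have B0 : 0 <= B by rewrite !mulr_ge0 ?addr_ge0 ?exprn_ge0 ?sqr_ge0 // ltW.
  have one n : (1 <= n < M.+1)%N -> `|coef phi n y * cos (2 * pi * n%:R * x)| <= B * (n%:R ^+ 2)^-1.
    move=> /andP[n0 _]; have nR : 1 <= n%:R :> R by rewrite ler1n.
    rewrite normrM; apply: (@le_trans _ _ `|coef phi n y|); first by rewrite ler_piMr // cos_max.
    apply: (le_trans (coef_poly (ltn0Sn 4) n0 y0)).
    have sy : Num.sqrt y <= 2 * y.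
      rewrite -(ger0_norm (_ : 0 <= 2 * y)) -?sqrtr_sqr ?ler_wsqrtr //; last by lra.
      by nra.
    have -> : n%:R ^+ 2 * Num.sqrt y * (2 * r * (1 + t ^+ 2) * (2 * 5%:R * t / (n%:R * y)) ^+ 5)
      = 2 * 10 ^+ 5 * r * (1 + t ^+ 2) * t ^+ 5 * (Num.sqrt y / y ^+ 5) * (n%:R ^+ 3)^-1.
      by field; rewrite !lt0r_neq0 //; lra.
    have -> : B * (n%:R ^+ 2)^-1 = 2 * 10 ^+ 5 * r * (1 + t ^+ 2) * t ^+ 5 * 32 * (n%:R ^+ 2)^-1 by rewrite /B; ring.
    apply: ler_pM.
    - by rewrite !mulr_ge0 ?invr_ge0 ?sqrtr_ge0 ?addr_ge0 ?exprn_ge0 ?sqr_ge0 // ltW.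
    - by rewrite invr_ge0 exprn_ge0.
    - apply: ler_wpM2l; first by rewrite !mulr_ge0 ?addr_ge0 ?exprn_ge0 ?sqr_ge0 // ltW.
      rewrite ler_pdivrMr ?exprn_gt0 //; apply: (le_trans sy).
      have y4 : (1 / 2) ^+ 4 <= y ^+ 4 by apply: lerXn2r; rewrite ?nnegrE; lra_from hphi osc y2.
      by rewrite exprSr mulrA ler_pM2r //; move: y4; rewrite !exprS expr0; lra_from hphi t1000 osc.
    - by rewrite lef_pV2 ?posrE ?exprn_gt0 ?ltr0n // ler_weXn2l.
  have : `|sm| <= 2 * (B * 2).
    rewrite /sm normrM ger0_norm // ler_pM2l //; apply: (le_trans (ler_norm_sum _ _ _)).
    apply: (@le_trans _ _ (\sum_(1 <= n < M.+1) B * (n%:R ^+ 2)^-1)).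
      rewrite big_nat_cond [leRHS]big_nat_cond; apply: ler_sum => n /andP[nI _]; exact: one.
    by rewrite -mulr_sumr ler_wpM2l // sum_inv_sqr_le2.
  move=> h2; apply: (le_trans h2).
  have q : 0 < r * t ^+ 5 by rewrite mulr_gt0 // exprn_gt0.
  have -> : 2 * (B * 2) = (256 * 10 ^+ 5 * (1 + t ^+ 2)) * (r * t ^+ 5) by rewrite /B; ring.
  have -> : 10 ^+ 8 * r * t ^+ 7 = (10 ^+ 8 * t ^+ 2) * (r * t ^+ 5) by ring.
  by rewrite ler_pM2r //; nra.
by move=> y0; apply: le_trans AB; exact: hA.
Qed.

(* The two heights are a quarter of an oscillation apart. *)
Lemma two_heights s : s <= 0 -> r ^+ 2 / 25 <= K s ^+ 2 + K (s + pi / (2 * t)) ^+ 2.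
Proof.
move=> s0; have [r0 os _] := osc; have T := t1000; have t0 : 0 < t by lra.
have p0 := pi_gt0 R; have p2 := pi_ge2 R; have p4 : pi <= 4 :> R by have := @pihalf_lt2 R; lra.
set h := pi / (2 * t); have h0 : 0 < h by rewrite divr_gt0 // mulr_gt0.
have hle : h <= 1 / 500 by rewrite ler_pdivrMr ?mulr_gt0 //; lra.
have eh : expR h <= 2.
  have := expR_ge1Dx (- h); rewrite expRN => k.
  by have e0 := expR_gt0 h; rewrite -(ler_pM2r (expR_gt0 h)) mulVf ?gt_eqF // in k; nra_from hphi t1000 osc e0 k hle.
have X z : z <= s + h -> 0 < 2 * pi * expR z <= 16.
  move=> zs; rewrite !mulr_gt0 ?expR_gt0 //=.
  have : expR z <= expR h by rewrite ler_expR; lra.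
  by have := expR_gt0 z; nra_from hphi t1000 osc eh p0 p4.
have a1 := os s; have a2 := os (s + h).
have ss : s <= s + h by rewrite lerDl ltW.
have b1 : 25 * (2 * pi * expR s) <= t by have /andP[_] := X s ss; lra_from hphi osc T.
have b2 : 25 * (2 * pi * expR (s + h)) <= t by have /andP[_] := X (s + h) (lexx _); lra_from hphi osc T.
move: (a1 b1) (a2 b2) => {}a1 {}a2.
pose ps z := phase t (2 * pi * expR z).
have dps z : s <= z <= s + h -> is_derive z (1 : R) ps (Num.sqrt (t ^+ 2 - (2 * pi * expR z) ^+ 2)).
  move=> /andP[_ zs]; have /andP[X0 X16] := X z zs.
  have Xt : 2 * pi * expR z < t by lra_from hphi osc T X16.
  apply: (der_eq (der_comp (derZ (2 * pi) (derE (derI z))) (der_phase X0 Xt))).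
  by rewrite mul1r mulrCA divff ?mulr1 // lt0r_neq0.
have [z zI zE] := mvt_ex dps ss.
have [X0 X16] : 0 < 2 * pi * expR z /\ 2 * pi * expR z <= 16 by move: zI => /andP[_ /X/andP[]].
set w := Num.sqrt _ in zE; have w0 : 0 <= w by exact: sqrtr_ge0.
have wt : w <= t.
  by rewrite -(@ler_pXn2r _ 2) ?nnegrE // ?(ltW t0) // sqr_sqrtr; [rewrite lerBlDr lerDl sqr_ge0|nra_from hphi osc T X0 X16].
have tw : 99 / 100 * t <= w.
  rewrite -(@ler_pXn2r _ 2) ?nnegrE //; last by lra_from hphi osc T.
  by rewrite sqr_sqrtr; nra_from hphi osc T X0 X16.
pose d := ps (s + h) - ps s.
have dE : d = pi / 2 * (w / t) by rewrite /d zE /h; field; rewrite lt0r_neq0.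
have wt1 : w / t <= 1 by rewrite ler_pdivrMr // mul1r.
have wt2 : 99 / 100 <= w / t by rewrite ler_pdivlMr.
have cd : cos d ^+ 2 <= (2 / 100) ^+ 2.
  have -> : cos d = sin (pi / 2 - d) by rewrite sinB sin_pihalf cos_pihalf; ring.
  have e0 : 0 <= pi / 2 - d by rewrite dE; nra_from hphi osc p0 wt1.
  apply: (le_trans (sin2_le_sqr e0)); apply: lerXn2r; rewrite ?nnegrE //.
  by rewrite dE; nra_from hphi osc p0 p4 wt1 wt2.
rewrite leNgt; apply/negP => small.
have k1 : `|K s| <= r / 5.
  by apply: norm_le_sqr; [lra_from hphi osc r0|have := sqr_ge0 (K (s + h)); rewrite -/h in small; lra_from hphi osc small].
have k2 : `|K (s + h)| <= r / 5.
  by apply: norm_le_sqr; [lra_from hphi osc r0|have := sqr_ge0 (K s); lra_from hphi osc small].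
pose u := ps s - al.
have c1 : `|cos u| <= 21 / 100.
  move: a1 k1; rewrite -/(ps s) -/u !ler_norml => /andP[x1 x2] /andP[x3 x4].
  by apply/andP; split; rewrite -(ler_pM2l r0); lra_from hphi osc r0 x1 x2 x3 x4.
have c2 : `|cos (u + d)| <= 21 / 100.
  have uE : u + d = ps (s + h) - al by rewrite /u /d; ring.
  move: a2 k2; rewrite uE -/(ps (s + h)) !ler_norml => /andP[x1 x2] /andP[x3 x4].
  by apply/andP; split; rewrite -(ler_pM2l r0); lra_from hphi osc r0 x1 x2 x3 x4.
have cd' : `|cos d| <= 2 / 100 by apply: norm_le_sqr; [by apply: divr_ge0|].
have E : sin u * sin d = cos u * cos d - cos (u + d) by rewrite cosD; ring.
have f1 : `|sin u * sin d| <= 1 / 4.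
  rewrite E; apply: (le_trans (ler_normB _ _)); rewrite normrM.
  have := normr_ge0 (cos u); have := normr_ge0 (cos d); nra_from hphi osc c1 c2 cd'.
have f2 : (sin u * sin d) ^+ 2 <= 1 / 16.
  by rewrite -real_normK ?num_real //; have := normr_ge0 (sin u * sin d); nra_from hphi osc f1.
have g1 : cos u ^+ 2 <= (21 / 100) ^+ 2 by rewrite -real_normK ?num_real //; apply: lerXn2r; rewrite ?nnegrE ?normr_ge0 //; exact: divr_ge0.
have su : sin u ^+ 2 >= 9 / 10 by have := cos2Dsin2 u; lra_from hphi osc g1.
have sd : sin d ^+ 2 >= 9 / 10 by have := cos2Dsin2 d; lra_from hphi osc cd.
by rewrite exprMn in f2; nra_from hphi osc f2 su sd.
Qed.

(** Bessel's inequality near the height 1/N, where all $n\le N$ lie in the oscillating range. A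
    second height guards against zeros of K: by [two_heights] one of the two values is not small. *)
Lemma sum_sqr_le N : (0 < N)%N -> \sum_(1 <= n < N.+1) lm n ^+ 2 <= 25 * 10 ^+ 16 * t ^+ 14 * N%:R.
Proof.
move=> N0; have [r0 _ _] := osc; have T := t1000; have t0 : 0 < t by lra.
have NR : 0 < N%:R :> R by rewrite ltr0n.
have p0 := pi_gt0 R; set h := pi / (2 * t); have h0 : 0 < h by rewrite divr_gt0 // mulr_gt0.
pose A := 10 ^+ 8 * r * t ^+ 7; have A0 : 0 <= A by rewrite !mulr_ge0 ?exprn_ge0 // ltW.
have bes y : 0 < y -> 2 * \sum_(1 <= n < N.+1) coef phi n y ^+ 2 <= A ^+ 2.
  move=> y0.
  have le x : 0 <= x <= 1 -> `|f (x, y)| <= A by move=> _; exact: form_le.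
  exact: (fcoef_bessel (slice_derive hphi y0) (slice_derive2 hphi y0) N A0 le).
pose y := N%:R^-1 : R; have y0 : 0 < y by rewrite invr_gt0.
pose y' := y * expR h; have y'0 : 0 < y' by rewrite mulr_gt0 ?expR_gt0.
have yy : y <= y' by rewrite ler_peMr ?(ltW y0) //; apply: (@le_trans _ _ (1 + h)); [lra|exact: expR_ge1Dx].
have one n : (1 <= n < N.+1)%N -> lm n ^+ 2 * (y * (r ^+ 2 / 25)) <= coef phi n y ^+ 2 + coef phi n y' ^+ 2.
  move=> /andP[n0 nN]; have nR : 0 < n%:R :> R by rewrite ltr0n.
  have ny : 0 < n%:R * y by rewrite mulr_gt0.
  have s0 : ln (n%:R * y) <= 0.
    by rewrite -ln1 ler_ln ?posrE // ler_pdivrMr // mul1r ler_nat.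
  have sE : ln (n%:R * y') = ln (n%:R * y) + h.
    by rewrite /y' mulrA lnM ?posrE ?expR_gt0 // expRK.
  rewrite (coef_radial hphi n0 y0) (coef_radial hphi n0 y'0) sE !(exprMn _ (lm n)) !(exprMn _ (Num.sqrt _)) !sqr_sqrtr ?(ltW y0) ?(ltW y'0) //.
  rewrite -mulrDr ler_wpM2l ?sqr_ge0 //.
  have := two_heights s0; rewrite -/h; set a := K _ ^+ 2; set b := K _ ^+ 2 => ab.
  have b0 : 0 <= b by exact: sqr_ge0.
  have : y * (r ^+ 2 / 25) <= y * (a + b) by rewrite ler_pM2l.
  have : y * b <= y' * b by rewrite ler_wpM2r.
  lra.
have sum : (\sum_(1 <= n < N.+1) lm n ^+ 2) * (y * (r ^+ 2 / 25)) <= A ^+ 2.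
  rewrite mulr_suml.
  apply: (@le_trans _ _ (\sum_(1 <= n < N.+1) (coef phi n y ^+ 2 + coef phi n y' ^+ 2))).
    rewrite big_nat_cond [leRHS]big_nat_cond; apply: ler_sum => n /andP[nI _]; exact: one.
  by rewrite big_split /=; have := bes y y0; have := bes y' y'0; lra.
have c0 : 0 < y * (r ^+ 2 / 25) by rewrite mulr_gt0 // divr_gt0 // exprn_gt0.
rewrite -(ler_pM2r c0); apply: (le_trans sum); rewrite /A /y.
rewrite le_eqVlt; apply/orP; left; apply/eqP; field.
by rewrite lt0r_neq0.
Qed.

Lemma square_sum_dyadic j : square_sum lm (2 ^ j) <= 50 * 10 ^+ 16 * t ^+ 14 * j.+1%:R.
Proof.
have T := t1000; have t0 : 0 < t by lra.
have t14 : 0 < t ^+ 14 by rewrite exprn_gt0.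
elim: j => [|j IH].
  have := sum_sqr_le (ltn0Sn 0); rewrite /square_sum expn0 !big_nat1 divr1 mulr1; lra.
have p0 : (0 < 2 ^ j)%N by rewrite expn_gt0.
have pp : (2 ^ j <= 2 ^ j.+1)%N by rewrite leq_exp2l.
have pR : 0 < (2 ^ j)%:R :> R by rewrite ltr0n.
rewrite /square_sum (@big_cat_nat _ _ _ (2 ^ j).+1) //= -/(square_sum lm (2 ^ j)).
have h : \sum_((2 ^ j).+1 <= n < (2 ^ j.+1).+1) lm n ^+ 2 / n%:R <= 50 * 10 ^+ 16 * t ^+ 14.
  apply: (@le_trans _ _ (\sum_((2 ^ j).+1 <= n < (2 ^ j.+1).+1) lm n ^+ 2 / (2 ^ j)%:R)).
    rewrite big_nat_cond [leRHS]big_nat_cond; apply: ler_sum => n /andP[/andP[n1 _] _].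
    have n0 : (0 < n)%N by apply: leq_ltn_trans n1.
    by rewrite ler_wpM2l ?sqr_ge0 // lef_pV2 ?posrE ?ltr0n // ler_nat ltnW.
  rewrite -mulr_suml ler_pdivrMr //.
  apply: (@le_trans _ _ (\sum_(1 <= n < (2 ^ j.+1).+1) lm n ^+ 2)).
    by rewrite [leRHS](@big_cat_nat _ _ _ (2 ^ j).+1) //= lerDr sumr_ge0 // => n _; exact: sqr_ge0.
  apply: (le_trans (sum_sqr_le _)); first by rewrite expn_gt0.
  by rewrite expnS natrM; lra.
rewrite -[j.+2%:R]natr1; lra.
Qed.

End Sizes.

Section Counting.
Variables (R : realType) (T : choiceType).

Lemma counting_ge (A : set T) (zs : seq T) : uniq zs -> (forall z, z \in zs -> A z) ->
  ((size zs)%:R%:E <= counting A :> \bar R)%E.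
Proof.
move=> uz zA; rewrite /counting; case: asboolP => [fA|_]; last by rewrite leey.
rewrite lee_fin ler_nat; apply: uniq_leq_size => // z /zA Az.
by rewrite in_fset_set // inE.
Qed.

End Counting.

(** * Zeros and sign changes *)

Section Averages.
Variable R : realType.

Lemma iter_average_dist m (u v : nat -> R) e : (forall j, `|u j - v j| <= e) ->
  forall j, `|iter m (@average R) u j - iter m (@average R) v j| <= e.
Proof.
move=> uv; elim: m => [//|m IH] j; rewrite !iterS /average.
have := IH j; have := IH j.+1; rewrite !ler_norml => /andP[a1 a2] /andP[b1 b2]; apply/andP; split; lra.
Qed.

Lemma iter_average_sum m (I : Type) (s : seq I) (c : I -> R) (F : I -> nat -> R) j :
  iter m (@average R) (fun j => \sum_(i <- s) c i * F i j) j = \sum_(i <- s) c i * iter m (@average R) (F i) j.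
Proof.
elim: m j => [//|m IH] j; rewrite iterS /average !IH -big_split /= mulr_suml.
by apply: eq_bigr => i _; rewrite -mulrDr -mulrA.
Qed.

End Averages.

Section KnownSigns.
Variable R : realType.
Variables (phi : R[i] -> R) (t Y : R).
Hypothesis hphi : even_hecke_maass_cusp_form phi t.
Hypothesis t1000 : 1000 <= t.
Hypothesis Y0 : 0 < Y.
Local Notation f := (in_coords phi).
Variable J : nat.
Local Notation L := (2 ^ J)%N.

Let L0 : (0 < L)%N. Proof. by rewrite expn_gt0. Qed.
Let LR : 0 < L%:R :> R. Proof. by rewrite ltr0n. Qed.

Let u (j : nat) : R := f (j%:R / L%:R, Y).

Lemma samples_periodic : periodicL L u.
Proof.
by move=> j; rewrite /u natrD mulrDl divff ?lt0r_neq0 // (form_periodic hphi).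
Qed.

(* Around the circle there are as many sign changes from + to - as from - to +,
   and the former have zeros in disjoint half-open intervals. *)
Lemma few_changes_zeros : exists zs : seq R, [/\ uniq zs,
  forall z, z \in zs -> 0 <= z < 1 /\ f (z, Y) = 0 & few_changes L u (4 * (size zs)%:R)].
Proof.
have cf : continuous (fun x => f (x, Y)) := is_derive_continuous (slice_derive hphi Y0).
have ivt j : 0 <= u j -> u j.+1 < 0 -> exists z, [/\ j%:R / L%:R <= z, z < j.+1%:R / L%:R & f (z, Y) = 0].
  move=> u0 u1; have jj : j%:R / L%:R <= j.+1%:R / L%:R :> R by rewrite ler_pM2r ?invr_gt0 // ler_nat.
  have cw : {within `[(j%:R / L%:R : R), j.+1%:R / L%:R], continuous (fun x => f (x, Y))}.
    by apply: continuous_subspaceT => x; exact: cf.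
  have mm : Num.min (f (j%:R / L%:R, Y)) (f (j.+1%:R / L%:R, Y)) <= 0 <= Num.max (f (j%:R / L%:R, Y)) (f (j.+1%:R / L%:R, Y)).
    by rewrite ge_min le_max -/(u j) -/(u j.+1) u0 (ltW u1) orbT.
  have [z] := IVT jj cw mm; rewrite in_itv /= => /andP[z1 z2] fz; exists z; split => //.
  rewrite lt_neqAle z2 andbT; apply/eqP => zE; move: u1; rewrite /u -zE fz ltxx //.
pose A := [seq j <- iota 0 L | (0 <= u j) && (u j.+1 < 0)].
pose root j := if pselect (0 <= u j /\ u j.+1 < 0) is left h then projT1 (cid (ivt j h.1 h.2)) else 0.
have rootP j : j \in A -> [/\ j%:R / L%:R <= root j, root j < j.+1%:R / L%:R & f (root j, Y) = 0].
  rewrite mem_filter => /andP[/andP[h1 h2] _]; rewrite /root; case: pselect => [h|[]//].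
  by case: (cid _).
have uA : uniq A by rewrite filter_uniq // iota_uniq.
exists [seq root j | j <- A]; split.
- rewrite map_inj_in_uniq // => i j iA jA E.
  have [i1 i2 _] := rootP i iA; have [j1 j2 _] := rootP j jA.
  have a1 := le_lt_trans i1 (eq_ind_r (fun z => z < _) j2 E); have a2 := le_lt_trans j1 (eq_ind (root i) (fun z => z < _) i2 _ E).
  rewrite !ltr_pM2r ?invr_gt0 // !ltr_nat in a1 a2.
  by apply/eqP; rewrite eqn_leq -ltnS a1 -ltnS a2.
- move=> z /mapP[j jA ->]; have [j1 j2 ->] := rootP j jA; split => //.
  rewrite (le_trans _ j1) /=; last by rewrite divr_ge0.
  apply: (lt_le_trans j2); rewrite ler_pdivrMr // mul1r ler_nat.
  by move: jA; rewrite mem_filter mem_iota add0n => /andP[_ /andP[_]].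
pose s j : R := if 0 <= u j then 1 else -1.
have ps : periodicL L s by move=> j; rewrite /s samples_periodic.
exists s; split => //.
- by move=> j; rewrite /s; case: ifP; [left|right].
- by move=> j; rewrite /s; case: (leP 0 (u j)) => h; rewrite ?mul1r // mulN1r oppr_ge0 ltW.
have E j : `|s j.+1 - s j| = (s j.+1 - s j) + 4 * (if (0 <= u j) && (u j.+1 < 0) then 1 else 0).
  rewrite /s; case: (leP 0 (u j)) => a; case: (leP 0 (u j.+1)) => b /=.
  - by rewrite subrr normr0; ring.
  - by rewrite ler0_norm; lra.
  - by rewrite ger0_norm; lra.
  - by rewrite subrr normr0; ring.
rewrite (eq_bigr _ (fun j _ => E j)) big_split /= -mulr_sumr sumrB.
have -> : \sum_(0 <= j < L) s j.+1 = \sum_(0 <= j < L) s j.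
  by rewrite -(periodic_shift L0 1 ps); apply: eq_bigr => j _; rewrite addn1.
rewrite subrr add0r size_map -big_mkcond -big_filter big_const_seq count_predT iter_addr_0.
by rewrite /A /index_iota subn0.
Qed.

Variables (r al : R).
Hypothesis osc : oscillates phi t r al.
Local Notation beta := (fun n => lam hphi n * (radial phi (ln (n%:R * Y)) / r) * smooth_factor R L n).

(** 2L averages, each moving the wave by half a step, move a wave of integer frequency by n full
    turns, so no phase shift remains. *)
Lemma smooth_coef n j : iter L.*2 (@average R) (fun j => cos (2 * pi * n%:R * (j%:R / L%:R))) j
  = smooth_factor R L n * cos (grid_angle R L n j).
Proof.
have E i : cos (2 * pi * n%:R * (i%:R / L%:R)) = cos (grid_angle R L n i + 0).
  by rewrite addr0 /grid_angle; congr cos; ring.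
rewrite (_ : (fun _ => _) = (fun i => cos (grid_angle R L n i + 0))); last by apply: funext => i; exact: E.
rewrite (iter_average_cos L0) addr0 -/(smooth_factor R L n); congr (_ * _).
rewrite -[RHS](@cos2pik R _ (n : int)); congr cos; congr (_ + _).
by rewrite -mul2n natrM -pmulrn; field; rewrite lt0r_neq0.
Qed.

Hypothesis tail : exists2 p, (4 < p)%N &
  4 * (1 + t ^+ 2) * (2 * p%:R * t / Y) ^+ 4 * (8 * p%:R * t / (L%:R * Y)) ^+ (p - 4) <= 1.

(** The averaged samples equal the polynomial with frequencies up to L/4, apart from the higher
    coefficients. For these, decay of order p is split: four powers compensate the trivial bound
    $n^2$ and give $\sum n^{-2}$, and the other p - 4 give the smallness in [tail]. *)
Lemma smoothed_samples j : `|iter L.*2 (@average R) u j - 2 * (Num.sqrt Y * r) * trig_poly L beta j| <= 2 * (Num.sqrt Y * r).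
Proof.
have [r0 _ _] := osc; have T := t1000; have t0 : 0 < t by lra.
have sY : 0 < Num.sqrt Y by rewrite sqrtr_gt0.
have [C C0 hC] := slice_fourier hphi Y0.
have [p p4 htail] := tail; have p0 : (0 < p)%N by apply: ltn_trans p4.
apply: (@le_of_le_div _ _ _ C L) => M LM; have M0 : (0 < M)%N by apply: leq_trans LM.
pose a n := coef phi n Y.
have d1 := iter_average_dist L.*2 (fun j => hC M (j%:R / L%:R) M0) j.
have E : iter L.*2 (@average R) (fun j => 2 * \sum_(1 <= n < M.+1) a n * cos (2 * pi * n%:R * (j%:R / L%:R))) j
   = \sum_(1 <= n < M.+1) 2 * a n * (smooth_factor R L n * cos (grid_angle R L n j)).
  rewrite (_ : (fun _ => _) = (fun j => \sum_(1 <= n < M.+1) (2 * a n) * cos (2 * pi * n%:R * (j%:R / L%:R)))); last first.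
    by apply: funext => i; rewrite mulr_sumr; apply: eq_bigr => n _; rewrite mulrA.
  by rewrite iter_average_sum; apply: eq_bigr => n _; rewrite smooth_coef.
rewrite E in d1.
pose B := 2 * (Num.sqrt Y * r); have B0 : 0 < B by rewrite !mulr_gt0.
have aE n : (0 < n)%N -> 2 * a n * smooth_factor R L n = B * beta n.
  move=> n0; rewrite /a (coef_radial hphi n0 Y0) /B; field; exact: lt0r_neq0.
have abd n : (0 < n)%N -> (L < 4 * n)%N -> `|2 * a n * (smooth_factor R L n * cos (grid_angle R L n j))| <= B / 2 * (n%:R ^+ 2)^-1.
  move=> n0 Ln; have nR : 0 < n%:R :> R by rewrite ltr0n.
  apply: (@le_trans _ _ (2 * `|a n|)).
    rewrite !normrM ger0_norm // ler_piMr ?mulr_ge0 // mulr_ile1 //; last exact: cos_max.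
    by rewrite ger0_norm ?smooth_factor_ge0 // smooth_factor_le1.
  have := coef_poly hphi t1000 osc p0 n0 Y0; rewrite -/(a n).
  set q := 2 * p%:R * t / Y in htail *.
  have q0 : 0 < q by rewrite divr_gt0 // !mulr_gt0 // ltr0n.
  have -> : 2 * p%:R * t / (n%:R * Y) = q / n%:R by rewrite /q; field; rewrite !lt0r_neq0.
  have -> : (q / n%:R) ^+ p = (q / n%:R) ^+ 4 * (q / n%:R) ^+ (p - 4).
    by rewrite -exprD subnKC // ltnW.
  have qn : q / n%:R <= 8 * p%:R * t / (L%:R * Y).
    have -> : 8 * p%:R * t / (L%:R * Y) = q * (4 / L%:R) by rewrite /q; field; rewrite !lt0r_neq0.
    rewrite ler_pM2l // ler_pdivlMr // mulrC ler_pdivrMr // -natrM ler_nat; exact: ltnW.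
  have qn' : (q / n%:R) ^+ (p - 4) <= (8 * p%:R * t / (L%:R * Y)) ^+ (p - 4).
    by apply: lerXn2r; rewrite ?nnegrE // ?divr_ge0 ?mulr_ge0 // ltW // ?mulr_gt0.
  move=> h; set z := (8 * p%:R * t / _) ^+ (p - 4) in htail qn'.
  have K0 : 0 <= n%:R ^+ 2 * Num.sqrt Y * (2 * r * (1 + t ^+ 2)) * (q / n%:R) ^+ 4.
    apply: mulr_ge0; last by apply: exprn_ge0; apply: divr_ge0; exact: ltW.
    apply: mulr_ge0; first by rewrite mulr_ge0 ?sqrtr_ge0 // exprn_ge0.
    by rewrite !mulr_ge0 ?addr_ge0 ?sqr_ge0 // ltW.
  have h2 : `|a n| <= n%:R ^+ 2 * Num.sqrt Y * (2 * r * (1 + t ^+ 2)) * (q / n%:R) ^+ 4 * z.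
    apply: (le_trans h); have := ler_wpM2l K0 qn'; lra_from hphi t1000 Y0 osc tail.
  have E2 : n%:R ^+ 2 * Num.sqrt Y * (2 * r * (1 + t ^+ 2)) * (q / n%:R) ^+ 4 * z
     = Num.sqrt Y * r / 2 * (n%:R ^+ 2)^-1 * (4 * (1 + t ^+ 2) * q ^+ 4 * z).
    by field; rewrite !lt0r_neq0.
  have c0 : 0 <= Num.sqrt Y * r / 2 * (n%:R ^+ 2)^-1 by rewrite !mulr_ge0 ?invr_ge0 ?exprn_ge0 // ltW.
  have h3 := ler_wpM2l c0 htail; rewrite mulr1 in h3.
  by rewrite E2 in h2; rewrite /B; lra_from hphi t1000 Y0 osc tail h2 h3.
have split : `|\sum_(1 <= n < M.+1) 2 * a n * (smooth_factor R L n * cos (grid_angle R L n j)) - B * trig_poly L beta j| <= B.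
  rewrite /trig_poly (bigID (fun n => (4 * n <= L)%N)) /=.
  have -> : \sum_(1 <= n < M.+1 | (4 * n <= L)%N) 2 * a n * (smooth_factor R L n * cos (grid_angle R L n j))
     = B * \sum_(1 <= n < L | (4 * n <= L)%N) beta n * cos (grid_angle R L n j).
    rewrite (@big_cat_nat _ _ _ L 1 M.+1) //=; last by apply: leqW.
    rewrite [X in _ + X]big_nat_cond [X in _ + X]big1 ?addr0; last first.
      by move=> n /andP[/andP[Ln _]]; rewrite leqNgt; case/negP; apply: (leq_ltn_trans Ln); rewrite ltn_Pmull // (leq_trans L0 Ln).
    rewrite mulr_sumr big_nat_cond [RHS]big_nat_cond; apply: eq_bigr => n /andP[/andP[n0 _] _].
    by rewrite [LHS]mulrA aE // -[LHS]mulrA.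
  rewrite addrAC subrr add0r; apply: (le_trans (ler_norm_sum _ _ _)).
  apply: (@le_trans _ _ (\sum_(1 <= n < M.+1) B / 2 * (n%:R ^+ 2)^-1)).
    rewrite big_mkcond big_nat_cond [leRHS]big_nat_cond; apply: ler_sum => n /andP[/andP[n0 _] _].
    case: ifP => [h|_]; first by apply: abd; rewrite // ltnNge.
    by rewrite mulr_ge0 ?invr_ge0 ?exprn_ge0 ?divr_ge0 // ltW.
  rewrite -mulr_sumr; have := sum_inv_sqr_le2 R M.
  have : 0 < B / 2 by rewrite divr_gt0.
  by move=> b1 b2; have := ler_wpM2l (ltW b1) b2; lra.
rewrite -/B; apply: le_trans (ler_distD (\sum_(1 <= n < M.+1) 2 * a n * (smooth_factor R L n * cos (grid_angle R L n j))) _ _) _.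
by rewrite addrC lerD.
Qed.

(** The signs are those of the averaged samples, which inherit the variation bound. They can
    disagree with the sign of the polynomial only where it is at most 1 in size, whence the summand
    2. Cauchy-Schwarz is applied with the weights $n^{\pm1/2}$. *)
Lemma norm_le_zeros V : few_changes L u V ->
  grid_norm L (trig_poly L beta) <= 2 + Num.sqrt ((\sum_(1 <= n < L | (4 * n <= L)%N) beta n ^+ 2 / n%:R) * (2 * J%:R * V)).
Proof.
move=> fu; have [r0 _ _] := osc; have sY : 0 < Num.sqrt Y by rewrite sqrtr_gt0.
have [_ [s [ps s1 sv sV]]] := few_changes_iter L0 L.*2 samples_periodic fu.
set v := iter _ _ _ in sv; set P := trig_poly L beta.
pose B := 2 * (Num.sqrt Y * r); have B0 : 0 < B by rewrite !mulr_gt0.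
have pt j : `|P j| <= s j * P j + 2.
  have := smoothed_samples j; rewrite -/v -/P -/B; have := sv j.
  set a := v j => h0 h1.
  have h2 : `|a / B - P j| <= 1.
    rewrite -(ler_pM2l B0) mulr1 -{1}(gtr0_norm B0) -normrM mulrBr mulrC divfK ?lt0r_neq0 //.
  have h3 : 0 <= s j * (a / B) by rewrite mulrA divr_ge0 // ltW.
  move: h2 h3; set b := a / B; rewrite ler_norml => /andP[h4 h5] h6.
  case: (s1 j) h6 => ->; rewrite ?mul1r ?mulN1r => h6; rewrite ler_norml; apply/andP; split; lra.
have sn j : `|s j| <= 1 by case: (s1 j) => ->; rewrite ?normrN normr1.
have var := cos_coef_variation ps sn sV.
have cs := cauchy_schwarz_sum (index_iota 1 L) (fun n => (4 * n <= L)%N) (fun n => beta n / Num.sqrt n%:R) (fun n => Num.sqrt n%:R * cos_coef L s n).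
have E1 : \sum_(1 <= n < L | (4 * n <= L)%N) beta n / Num.sqrt n%:R * (Num.sqrt n%:R * cos_coef L s n)
   = L%:R^-1 * \sum_(0 <= j < L) s j * P j.
  under [in RHS]eq_bigr do rewrite /P /trig_poly mulr_sumr.
  rewrite exchange_big /= mulr_sumr big_nat_cond [RHS]big_nat_cond; apply: eq_bigr => n /andP[/andP[n0 _] _].
  have gen (b c d : R) : d != 0 -> b / d * (d * c) = b * c by move=> d0; field.
  rewrite gen; last by rewrite lt0r_neq0 // sqrtr_gt0 ltr0n.
  rewrite /cos_coef mulrCA; congr (_ * _); rewrite mulr_sumr; apply: eq_bigr => j _; ring.
have E2 : \sum_(1 <= n < L | (4 * n <= L)%N) (beta n / Num.sqrt n%:R) ^+ 2 = \sum_(1 <= n < L | (4 * n <= L)%N) beta n ^+ 2 / n%:R.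
  by apply: eq_bigr => n _; rewrite expr_div_n sqr_sqrtr.
have E3 : \sum_(1 <= n < L | (4 * n <= L)%N) (Num.sqrt n%:R * cos_coef L s n) ^+ 2 = \sum_(1 <= n < L | (4 * n <= L)%N) n%:R * cos_coef L s n ^+ 2.
  by apply: eq_bigr => n _; rewrite exprMn sqr_sqrtr.
rewrite E1 E2 E3 in cs; set Q := \sum_(1 <= n < L | _) beta n ^+ 2 / n%:R in cs *.
have Q0 : 0 <= Q by apply: sumr_ge0 => n _; rewrite divr_ge0 // sqr_ge0.
set S := L%:R^-1 * _ in cs.
have S1 : S <= Num.sqrt (Q * (2 * J%:R * V)).
  apply: (le_trans (ler_norm _)); rewrite -sqrtr_sqr ler_wsqrtr //; apply: (le_trans cs).
  by rewrite ler_wpM2l.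
apply: (@le_trans _ _ (2 + S)); last by rewrite lerD2l.
rewrite /grid_norm /S -(ler_pM2l LR) mulVKf ?lt0r_neq0 // mulrDr mulVKf ?lt0r_neq0 //.
apply: (@le_trans _ _ (\sum_(0 <= j < L) (s j * P j + 2))); first by apply: ler_sum => j _; exact: pt.
by rewrite big_split /= sumr_const_nat subn0 -[2 *+ L]mulr_natl addrC.
Qed.

Lemma zeros_on_horocycle (zs : seq R) : uniq zs -> (forall z, z \in zs -> 0 <= z < 1 /\ f (z, Y) = 0) ->
  ((size zs)%:R%:E <= counting (horocycle_zeros phi Y) :> \bar R)%E.
Proof.
move=> uz hz; pose g (z : R) := if z <= 2^-1 then z else z - 1.
have gE z : f (g z, Y) = f (z, Y).
  by rewrite /g; case: ifP => // _; rewrite -(form_periodic hphi (z - 1) Y0) subrK.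
rewrite -(size_map (fun z => (g z +i* Y)%C)); apply: counting_ge.
  rewrite map_inj_in_uniq // => a b /hz[/andP[a0 a1] _] /hz[/andP[b0 b1] _] [].
  rewrite /g; case: (leP a 2^-1) => ha; case: (leP b 2^-1) => hb; lra.
move=> w /mapP[z zI ->]; have [/andP[z0 z1] fz] := hz z zI; split; last by rewrite -/(f (g z, Y)) gE.
by exists (g z) => //=; rewrite /g; case: (leP z 2^-1) => h; apply/andP; split; lra.
Qed.

End KnownSigns.

Lemma exp2_dominates K w : (0 < K)%N -> (2 * K ^ K <= w)%N -> (2 * w ^ K.-1 <= 2 ^ w)%N.
Proof.
move=> K0 Kw; have K1 : (0 < K ^ K)%N by rewrite expn_gt0 K0.
have w0 : (0 < w)%N by apply: leq_trans Kw; rewrite muln_gt0.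
pose a := (w %/ K)%N.
have h1 : (w <= K * 2 ^ a)%N.
  apply: (@leq_trans (K * a.+1)); last by rewrite leq_mul2l ltn_expl // orbT.
  by rewrite mulnC ltnW // ltn_ceil.
have h2 : (w ^ K <= K ^ K * 2 ^ w)%N.
  apply: (@leq_trans ((K * 2 ^ a) ^ K)); first by rewrite leq_exp2r.
  by rewrite expnMn -expnM leq_mul2l leq_exp2l // leq_trunc_div orbT.
have E : (w ^ K = w * w ^ K.-1)%N by rewrite -expnS prednK.
rewrite -(leq_pmul2l K1); apply: leq_trans h2; rewrite E mulnCA mulnA leq_mul2r.
by rewrite Kw orbT.
Qed.

(** * The lower bound *)

Section LowerBound.
Variable R : realType.
Variables (phi : R[i] -> R) (t Y : R).
Hypothesis hphi : even_hecke_maass_cusp_form phi t.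
Hypothesis Y0 : 0 < Y.
Variables (w m k : nat).
Local Notation W := (w%:R : R).
Local Notation f := (in_coords phi).
Local Notation kp := (2 * pi * Y).

Hypothesis lb : large_base (lam hphi) w m t kp.
Hypothesis k1 : (400 * m <= 2 ^ k)%N.
Hypothesis k2 : (2 ^ k <= w)%N.
Hypothesis tauw : forall l, (0 < l <= w ^ (60 * m * 2 ^ k))%N -> (tau l <= w)%N.

Let t1000 : 1000 <= t.
Proof.
apply: le_trans (lb_t1 lb); apply: (@le_trans _ _ (10 ^+ 6)); first by lra.
by apply: (wX_ge lb); have := lb_m lb; case: (m).
Qed.

Let wn0 : (0 < w)%N. Proof. by apply: leq_trans (lb_w lb). Qed.

Lemma wX_le_2X a : (w ^ (24 * m * a) <= 2 ^ (w * a))%N.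
Proof.
case: a => [|a]; first by rewrite !muln0.
rewrite expnM [X in (_ <= X)%N]expnM leq_exp2r //; apply: leq_trans (lb_exp lb); exact: leq_pmull.
Qed.

(** At the length $w^{60m\cdot2^k}$ the polynomial bound, with its factor $t^{14}$, is below
    $W^{400m}\le W^{2^k}$; the $2^k$-th root leaves one power of W, and the loss $2T^2$ with T = w
    adds little. *)
Lemma square_sum_small N : (N <= w ^ (60 * m))%N -> square_sum (lam hphi) N <= W ^+ 4.
Proof.
move=> hN; apply: (le_trans (le_square_sum _ hN)); set M := (w ^ (60 * m))%N.
have m20 := lb_m lb; have w0 := w_gt0 lb; have w6 := w_ge lb; have T := t1000; have t0 : 0 < t by lra.
have [r [al osc]] := radial_oscillates hphi t1000.
have it := @square_sum_iter R (lam hphi) (hecke_relation hphi) k M w wn0.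
have {}it : square_sum (lam hphi) M ^+ (2 ^ k) <= (2 * W ^+ 2) ^+ (2 ^ k) * square_sum (lam hphi) (M ^ (2 ^ k)).
  by apply: it => l; rewrite -expnM; exact: tauw.
have M2 : (M ^ (2 ^ k) <= 2 ^ (w * 3 * 2 ^ k))%N.
  rewrite expnM leq_exp2r ?expn_gt0 //; apply: leq_trans (wX_le_2X 3); rewrite leq_pexp2l //; mlia.
have ss : square_sum (lam hphi) (M ^ (2 ^ k)) <= W ^+ (2 ^ k).
  apply: (le_trans (le_square_sum _ M2)); apply: (le_trans (square_sum_dyadic hphi t1000 osc _)).
  have h1 : t ^+ 14 <= W ^+ (336 * m + 1).
    apply: (@le_trans _ _ ((2 * W ^+ (24 * m)) ^+ 14)).
      by apply: lerXn2r; rewrite ?nnegrE ?mulr_ge0 ?exprn_ge0 ?(ltW t0) ?(ltW w0) // (lb_t2 lb).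
    rewrite exprMn -exprM (_ : 24 * m * 14 = 336 * m)%N; last by mlia.
    apply: (le_wX_gap lb); last by rewrite addn1.
    by rewrite -!natrX ler_nat.
  have h2 : (w * 3 * 2 ^ k).+1%:R <= 4 * W ^+ 2 :> R.
    rewrite -natrX -(natrM _ 4) ler_nat; apply: (@leq_trans (4 * (w * 2 ^ k))).
      have : (0 < w * 2 ^ k)%N by rewrite muln_gt0 wn0 expn_gt0.
      by rewrite mulnAC => z0; rewrite (mulnC (w * _)%N) -(addn1 (3 * _)%N) -[4%N]/(3 + 1)%N mulnDl leq_add2l mul1n.
    by rewrite leq_mul2l /= -mulnn leq_mul2l k2 orbT.
  have h3 : 50 * 10 ^+ 16 <= W ^+ 3.
    apply: (@le_trans _ _ ((10 ^+ 6) ^+ 3)); last by apply: lerXn2r; rewrite ?nnegrE ?exprn_ge0 ?(ltW w0).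
    by rewrite -exprM -(natrX _ 10 16) -(natrX _ 10 18) -natrM ler_nat -[18%N]/(2 + 16)%N expnD leq_mul2r orbT.
  apply: (@le_trans _ _ (W ^+ 3 * W ^+ (336 * m + 1) * (4 * W ^+ 2))).
    apply: ler_pM => //; first by rewrite !mulr_ge0 ?exprn_ge0 // ltW.
    by apply: ler_pM => //; rewrite ?exprn_ge0 // ltW.
  have -> : W ^+ 3 * W ^+ (336 * m + 1) * (4 * W ^+ 2) = 4 * W ^+ (336 * m + 6).
    by rewrite (_ : 336 * m + 6 = 3 + (336 * m + 1) + 2)%N; [rewrite [in RHS]exprD [in RHS]exprD; ring|mlia].
  apply: (@le_trans _ _ (W ^+ (400 * m))); last exact: (le_wX lb).
  by apply: (le_wX_gap lb); [lra|mlia].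
have s0 := square_sum_ge0 (lam hphi) M.
have p2 : (0 < 2 ^ k)%N by rewrite expn_gt0.
apply: (@le_trans _ _ (2 * W ^+ 2 * W)).
  rewrite -(@ler_pXn2r _ (2 ^ k)) ?nnegrE //.
  apply: (le_trans it); rewrite [leRHS]exprMn ler_wpM2l // exprn_ge0 // mulr_ge0 // exprn_ge0 // ltW.
have : 2 * W ^+ 3 <= W ^+ 4 by apply: (le_wX_gap lb); [lra|].
by rewrite exprSr; lra.
Qed.

Variables (r al : R).
Hypothesis osc : oscillates phi t r al.
Local Notation kap := (fun n => radial phi (ln (n%:R * Y)) / r).

Let expR_kp n : (0 < n)%N -> 2 * pi * expR (ln (n%:R * Y)) = kp * n%:R.
Proof. by move=> n0; rewrite lnK ?posrE ?mulr_gt0 ?ltr0n //; ring. Qed.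

Lemma kap_oscillates n : (0 < n)%N -> 25 * (kp * n%:R) <= t ->
  `|kap n - cos (phase t (kp * n%:R) - al)| <= 1 / 100.
Proof.
move=> n0 nt; have [r0 os _] := osc; have := os (ln (n%:R * Y)); rewrite expR_kp // => /(_ nt) h.
rewrite -(ler_pM2l r0) -{1}(gtr0_norm r0) -normrM mulrBr mulrC divfK ?lt0r_neq0 //; lra.
Qed.

Lemma kap_bounded n : `|kap n| <= 2 * (1 + t ^+ 2).
Proof.
have [r0 _ sup] := osc; rewrite normrM normfV (gtr0_norm r0) ler_pdivrMr //.
by apply: (le_trans (sup _)); lra.
Qed.

Lemma kap_small_sqr n : (0 < n)%N -> 25 * (kp * n%:R) <= t -> kap n ^+ 2 <= 2.
Proof.
move=> n0 nt; have := kap_oscillates n0 nt; have := cos_max (phase t (kp * n%:R) - al).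
set c := cos _; set q := kap n; rewrite !ler_norml => /andP[a1 a2] /andP[b1 b2]; nra.
Qed.

(** Below the turning point $\kappa^2\le2$. Where this is not known, $n\ge W^{24m-1}$, and the
    smoothing for $L\le128W^{48m-4}$ outweighs the polynomial bound for $\kappa$. *)
Lemma weighted_mass L : (L <= 128 * (w ^ (24 * m - 2)) ^ 2)%N ->
  \sum_(1 <= n < L | (4 * n <= L)%N) (lam hphi n * kap n * smooth_factor R L n) ^+ 2 / n%:R <= W ^+ 5.
Proof.
move=> hL; have m20 := lb_m lb; have w0 := w_gt0 lb; have w6 := w_ge lb.
have T := t1000; have t0 : 0 < t by lra.
have LW : L%:R <= 128 * W ^+ (48 * m - 4).
  have : L%:R <= (128 * (w ^ (24 * m - 2)) ^ 2)%N%:R :> R by rewrite ler_nat.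
  by rewrite natrM !natrX -exprM (_ : (24 * m - 2) * 2 = 48 * m - 4)%N //; mlia.
have one n : (0 < n)%N -> (4 * n <= L)%N -> (kap n * smooth_factor R L n) ^+ 2 <= 2.
  move=> n0 n4; have nR : 0 < n%:R :> R by rewrite ltr0n.
  have sm0 := smooth_factor_ge0 R L n; have sm1 := smooth_factor_le1 R L n.
  rewrite exprMn; have [h|h] := leP (25 * (kp * n%:R)) t.
    apply: (@le_trans _ _ (2 * 1)); last by rewrite mulr1.
    by apply: ler_pM; rewrite ?sqr_ge0 ?(kap_small_sqr n0 h) // expr_le1.
  have nW : W ^+ (24 * m - 1) <= n%:R.
    have h1 : W ^+ (24 * m) <= W * n%:R.
      apply: (le_trans (lb_t1 lb)); apply: (le_trans (ltW h)); rewrite mulrA ler_wpM2r //.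
      by have := lb_kp1 lb; have := lb_kp0 lb; lra.
    rewrite -(ler_pM2l w0) -exprS (_ : (24 * m - 1).+1 = 24 * m)%N //; mlia.
  have L0 : 0 < L%:R :> R by rewrite ltr0n; apply: leq_trans n4; rewrite muln_gt0.
  have n2 : (n.*2 <= L)%N by apply: leq_trans n4; rewrite -mul2n leq_mul2r orbT.
  have s2 : smooth_factor R L n ^+ 2 <= expR (- (W ^+ 2 / 64)).
    apply: (@le_trans _ _ (expR (- (n%:R ^+ 2 / L%:R)) ^+ 2)).
      by apply: lerXn2r; rewrite ?nnegrE ?expR_ge0 // smooth_factor_small.
    rewrite -expRM_natl ler_expR.
    have : W ^+ 2 / 128 <= n%:R ^+ 2 / L%:R.
      rewrite ler_pdivlMr //; apply: (@le_trans _ _ (W ^+ 2 / 128 * (128 * W ^+ (48 * m - 4)))).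
        by rewrite ler_wpM2l // divr_ge0 // sqr_ge0.
      have -> : W ^+ 2 / 128 * (128 * W ^+ (48 * m - 4)) = (W ^+ (24 * m - 1)) ^+ 2.
        rewrite -exprM (_ : (24 * m - 1) * 2 = 2 + (48 * m - 4))%N; last by mlia.
        by rewrite exprD; field.
      by apply: lerXn2r; rewrite ?nnegrE // ltW // (wX_gt0 lb).
    lra.
  have KW : kap n ^+ 2 <= W ^+ (24 * m * 5).
    have h1 : t ^+ 2 <= (2 * W ^+ (24 * m)) ^+ 2.
      by apply: lerXn2r; rewrite ?nnegrE ?mulr_ge0 ?exprn_ge0 ?(ltW t0) ?(ltW w0) // (lb_t2 lb).
    have h2 : 10 ^+ 6 * W ^+ (48 * m) <= W ^+ (49 * m) by apply: (le_wX_gap lb) => //; mlia.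
    have h3 : 10 ^+ 6 <= W ^+ (48 * m) by apply: (wX_ge lb); mlia.
    have h4 : 2 * (1 + t ^+ 2) <= W ^+ (49 * m).
      move: h1; rewrite exprMn -exprM (_ : 24 * m * 2 = 48 * m)%N; last by mlia.
      by lra.
    apply: (@le_trans _ _ ((W ^+ (49 * m)) ^+ 2)); last by rewrite -exprM; apply: (le_wX lb); mlia.
    rewrite -real_normK ?num_real //; apply: lerXn2r; rewrite ?nnegrE ?exprn_ge0 ?(ltW w0) //.
    exact: le_trans (kap_bounded n) h4.
  apply: (@le_trans _ _ (expR (5 * W) * expR (- (W ^+ 2 / 64)))).
    apply: ler_pM; rewrite ?sqr_ge0 //; apply: (le_trans KW); exact: (wX_le_exp lb).
  rewrite -expRD; apply: (@le_trans _ _ 1); last by lra.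
  rewrite -[leRHS]expR0 ler_expR.
  have : 64 * 5 * W <= W * W by rewrite ler_pM2r //; lra.
  by rewrite expr2; lra.
have [L00|L0'] := posnP L; first by rewrite L00 big_geq // ltW // (wX_gt0 lb).
apply: (@le_trans _ _ (\sum_(1 <= n < L.+1) 2 * (lam hphi n ^+ 2 / n%:R))).
  rewrite big_mkcond [leRHS]big_nat_recr //=.
  rewrite -[leLHS]addr0; apply: lerD; last by rewrite mulr_ge0 // divr_ge0 // sqr_ge0.
  rewrite big_nat_cond [leRHS]big_nat_cond; apply: ler_sum => n /andP[/andP[n0 nL] _].
  have q0 : 0 <= lam hphi n ^+ 2 / n%:R by rewrite divr_ge0 // sqr_ge0.
  case: ifP => n4; last by rewrite mulr_ge0.
  rewrite -(mulrA (lam hphi n)) exprMn mulrAC mulrC ler_wpM2r //.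
  exact: one.
rewrite -mulr_sumr -/(square_sum (lam hphi) L).
have Lm : (L <= w ^ (60 * m))%N.
  rewrite -(ler_nat R) natrX; apply: (le_trans LW); apply: (le_wX_gap lb); [lra|mlia].
apply: (@le_trans _ _ (2 * W ^+ 4)); first by rewrite ler_pM2l // square_sum_small.
by apply: (le_wX_gap lb); [lra|].
Qed.

(** A norm of at least $W^{m-16}$ is compared with $2+4W^3N^{1/2}$, where N is the number of zeros
    found; squaring gives the exponent 2m - 39, with room for constants. *)
Lemma many_zeros : exists zs : seq R, [/\ uniq zs, forall z, z \in zs -> 0 <= z < 1 /\ f (z, Y) = 0
  & W ^+ (2 * m - 39) <= (size zs)%:R].
Proof.
have m20 := lb_m lb; have w0 := w_gt0 lb; have w6 := w_ge lb.
have T := t1000; have t0 : 0 < t by lra.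
have kb n : (0 < n)%N -> `|kap n| <= 2 * (1 + t ^+ 2) by move=> _; exact: kap_bounded.
have ls n : (0 < n)%N -> `|lam hphi n| <= n%:R ^+ 2 by apply: lam_le_sqr; lra.
have [J [J1 J2 big]] := test_norm lb kap_oscillates kb ls.
have [zs [uz hz fc]] := few_changes_zeros hphi Y0 J.
exists zs; split => //; set N := size zs in fc *.
have LR : 64 * W ^+ (32 * m) <= (2 ^ J)%:R.
  have : (64 * (w ^ (16 * m)) ^ 2)%N%:R <= (2 ^ J)%:R :> R by rewrite ler_nat.
  by rewrite natrM !natrX -exprM (_ : 16 * m * 2 = 32 * m)%N //; mlia.
have L0 : 0 < (2 ^ J)%:R :> R by rewrite ltr0n expn_gt0.
have Yi : Y^-1 <= W / 10 ^+ 5.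
  have h := kp_inv_le lb; have p4 : pi <= 4 :> R by have := @pihalf_lt2 R; lra.
  have p0 := pi_gt0 R; have Yi0 : 0 < Y^-1 by rewrite invr_gt0.
  have gen (q : R) : 0 < q -> Y^-1 = 2 * q * (2 * q * Y)^-1 by move=> q0; field; rewrite !lt0r_neq0.
  rewrite (gen _ p0).
  have kpi0 : 0 < kp^-1 by rewrite invr_gt0 !mulr_gt0.
  by apply: (@le_trans _ _ (8 * kp^-1)); [rewrite ler_pM2r //; lra|lra].
have tail : exists2 p, (4 < p)%N &
  4 * (1 + t ^+ 2) * (2 * p%:R * t / Y) ^+ 4 * (8 * p%:R * t / ((2 ^ J)%:R * Y)) ^+ (p - 4) <= 1.
  (* Ample: the 36 remaining powers, each at most $W^{-(8m-1)}$, have to outweigh $W^{144m+5}$. *)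
  exists 40%N => //; have t2 := lb_t2 lb; have Yi0 : 0 <= Y^-1 by rewrite invr_ge0 ltW.
  have tY : t / Y <= W ^+ (24 * m + 1) / 10 ^+ 4.
    apply: (@le_trans _ _ (2 * W ^+ (24 * m) * (W / 10 ^+ 5))); first by apply: ler_pM => //; exact: ltW.
    by rewrite exprD expr1; have := wX_gt0 lb (24 * m); have := mulr_gt0 (wX_gt0 lb (24 * m)) w0; lra.
  have q1 : 2 * 40%:R * t / Y <= W ^+ (24 * m + 1).
    by rewrite -mulrA; have := wX_gt0 lb (24 * m + 1); lra_from hphi Y0 lb k1 k2 tauw osc tY.
  have q2 : 8 * 40%:R * t / ((2 ^ J)%:R * Y) <= (W ^+ (8 * m - 1))^-1.
    have -> : 8 * 40%:R * t / ((2 ^ J)%:R * Y) = 320 * (t / Y) / (2 ^ J)%:R by field; rewrite !lt0r_neq0.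
    rewrite ler_pdivrMr // ler_pdivlMl ?(wX_gt0 lb) //.
    have h1 : 320 * (t / Y) <= W ^+ (24 * m + 1) by have := wX_gt0 lb (24 * m + 1); lra_from hphi Y0 lb k1 k2 tauw osc tY.
    have h2 := ler_wpM2l (ltW (wX_gt0 lb (8 * m - 1))) h1; apply: (le_trans h2).
    rewrite -exprD (_ : 8 * m - 1 + (24 * m + 1) = 32 * m)%N; last by mlia.
    by apply: le_trans LR; have := wX_gt0 lb (32 * m); lra.
  have q3 : 4 * (1 + t ^+ 2) <= W ^+ (48 * m + 1).
    have h1 : t ^+ 2 <= (2 * W ^+ (24 * m)) ^+ 2.
      by apply: lerXn2r; rewrite ?nnegrE ?mulr_ge0 ?exprn_ge0 ?(ltW t0) ?(ltW w0).
    have h2 : 10 ^+ 6 * W ^+ (48 * m) <= W ^+ (48 * m + 1) by apply: (le_wX_gap lb) => //; rewrite addn1.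
    have h3 : 10 ^+ 6 <= W ^+ (48 * m) by apply: (wX_ge lb); mlia.
    move: h1; rewrite exprMn -exprM (_ : 24 * m * 2 = 48 * m)%N; last by mlia.
    by lra.
  have q10 : 0 <= 2 * 40%:R * t / Y by rewrite !mulr_ge0 // ltW.
  have q20 : 0 <= 8 * 40%:R * t / ((2 ^ J)%:R * Y) by rewrite divr_ge0 ?mulr_ge0 // ltW.
  apply: (@le_trans _ _ (W ^+ (48 * m + 1) * (W ^+ (24 * m + 1)) ^+ 4 * ((W ^+ (8 * m - 1))^-1) ^+ 36)).
    apply: ler_pM; rewrite ?exprn_ge0 //.
    - by rewrite mulr_ge0 ?exprn_ge0 // mulr_ge0 // addr_ge0 // sqr_ge0.
    - apply: ler_pM; rewrite ?exprn_ge0 //; first by rewrite mulr_ge0 // addr_ge0 // sqr_ge0.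
      by apply: lerXn2r; rewrite ?nnegrE // ltW // (wX_gt0 lb).
    - by apply: lerXn2r; rewrite ?nnegrE // invr_ge0 ltW // (wX_gt0 lb).
  have z : 0 < (W ^+ (8 * m - 1)) ^+ 36 by rewrite exprn_gt0 // (wX_gt0 lb).
  rewrite exprVn (ler_pdivrMr _ _ z) mul1r -!exprM -exprD.
  by apply: (le_wX lb); mlia.
have J2W : J%:R <= 2 * W.
  rewrite -(natrM _ 2) ler_nat mulnC -(leq_exp2l J _ (ltnSn 1)); apply: (leq_trans J2).
  apply: leq_trans (wX_le_2X 2); rewrite -(ler_nat R) natrM !natrX -exprM.
  by apply: (le_wX_gap lb); [lra|mlia].
have := norm_le_zeros hphi t1000 Y0 osc tail fc.
have := weighted_mass J2; set Q := \sum_(1 <= n < _ | _) _ => Q5.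
set G := grid_norm _ _ in big *; set b := Num.sqrt _ => hG.
have b4 : b <= 4 * W ^+ 3 * Num.sqrt N%:R.
  have -> : 4 * W ^+ 3 * Num.sqrt N%:R = Num.sqrt ((4 * W ^+ 3) ^+ 2 * N%:R).
    by rewrite sqrtrM ?sqr_ge0 // sqrtr_sqr ger0_norm // mulr_ge0 // exprn_ge0 // ltW.
  rewrite /b ler_wsqrtr //; apply: (@le_trans _ _ (W ^+ 5 * (2 * (2 * W) * (4 * N%:R)))).
    have Q0 : 0 <= Q by apply: sumr_ge0 => n _; rewrite divr_ge0 // sqr_ge0.
    apply: ler_pM => //; rewrite ?mulr_ge0 //.
    by rewrite ler_wpM2r ?mulr_ge0 // ler_pM2l.
  by rewrite le_eqVlt; apply/orP; left; apply/eqP; ring.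
have N0 : 0 <= Num.sqrt N%:R :> R by exact: sqrtr_ge0.
have E : W ^+ m = W ^+ 16 * W ^+ (m - 16) by rewrite -exprD; congr (_ ^+ _); mlia.
have g1 : W ^+ (m - 16) <= G by rewrite -(ler_pM2l (wX_gt0 lb 16)) -E.
have g2 : 10 ^+ 6 <= W ^+ (m - 16) by apply: (wX_ge lb); mlia.
have g3 : W ^+ (m - 16) <= 8 * W ^+ 3 * Num.sqrt N%:R by lra.
have g4 : W ^+ (2 * m - 32) <= 64 * W ^+ 6 * N%:R.
  have := lerXn2r 2 (ltW (wX_gt0 lb (m - 16)) : W ^+ (m - 16) \is Num.nneg) _ g3.
  rewrite nnegrE !mulr_ge0 ?exprn_ge0 ?(ltW w0) // => /(_ isT).
  have E2 : (8 * W ^+ 3 * Num.sqrt N%:R) ^+ 2 = 64 * W ^+ 6 * N%:R.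
    by rewrite -[in RHS](@sqr_sqrtr R N%:R) //; ring.
  have E3 : (W ^+ (m - 16)) ^+ 2 = W ^+ (2 * m - 32) by rewrite -exprM; congr (_ ^+ _); mlia.
  by rewrite E2 E3.
have g5 : 10 ^+ 6 * W ^+ 6 * W ^+ (2 * m - 39) <= W ^+ (2 * m - 32).
  rewrite -mulrA -exprD; apply: (le_wX_gap lb) => //; mlia.
rewrite -(ler_pM2l (wX_gt0 lb 6)).
have := mulr_gt0 (wX_gt0 lb 6) (wX_gt0 lb (2 * m - 39)); lra_from hphi Y0 lb k1 k2 tauw osc g4 g5.
Qed.

End LowerBound.

Section LowerBoundTheorem.
Variable R : realType.

Lemma floor_root M (t : R) : (0 < M)%N -> 0 <= t -> exists w, w%:R ^+ M <= t < w.+1%:R ^+ M.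
Proof.
move=> M0 t0.
have P0 : exists w : nat, (fun w => w%:R ^+ M <= t) w by exists 0%N; rewrite expr0n gtn_eqF.
have bd w : w%:R ^+ M <= t -> (w <= Num.bound t)%N.
  move=> h; have := archi_boundP t0 => b; case: w h => // w h.
  rewrite -(ler_nat R); apply: ltW; apply: le_lt_trans b; apply: le_trans h.
  by rewrite ler_eXnr // ler1n.
have [w Pw wmax] := ex_maxnP P0 bd; exists w; rewrite Pw /= ltNge; apply/negP => h.
by have := wmax _ h; rewrite ltnn.
Qed.

Lemma double_succ_pow w M : (2 * M <= w)%N -> (0 < w)%N -> (w.+1%:R : R) ^+ M <= 2 * w%:R ^+ M.
Proof.
move=> Mw w0; have wR : 0 < w%:R :> R by rewrite ltr0n.
have -> : w.+1%:R = w%:R * (1 + w%:R^-1) :> R by rewrite -natr1 mulrDr divff ?lt0r_neq0 // mulr1.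
rewrite exprMn mulrC ler_wpM2r ?exprn_ge0 //.
have h1 : (1 + w%:R^-1 : R) ^+ M <= expR (w%:R^-1) ^+ M.
  by apply: lerXn2r; rewrite ?nnegrE ?expR_ge0 ?addr_ge0 ?invr_ge0 // expR_ge1Dx.
apply: (le_trans h1); rewrite -expRM_natl.
have h2 : M%:R * w%:R^-1 <= 1 / 2 :> R.
  by rewrite ler_pdivrMr //; have : (2 * M)%:R <= w%:R :> R by [rewrite ler_nat]; rewrite natrM; lra.
apply: (@le_trans _ _ (expR (1 / 2))); first by rewrite ler_expR.
have := expR_ge1Dx (- (1 / 2) : R); rewrite expRN; set e := expR _ => h3.
have e0 : 0 < e by exact: expR_gt0.
by have := ler_wpM2r (ltW e0) h3; rewrite mulVf ?gt_eqF //; lra.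
Qed.

Lemma zeros_lower_bound (Y eps : R) : 0 < Y -> 0 < eps ->
  exists2 c : R, 0 < c & \forall t \near (pinfty_nbhs R), forall phi : R[i] -> R,
    even_hecke_maass_cusp_form phi t ->
    ((c * t `^ (12^-1 - eps))%R%:E <= counting (horocycle_zeros phi Y))%E.
Proof.
move=> Y0 e0; have p0 := pi_gt0 R; pose kp := 2 * pi * Y; have kp0 : 0 < kp by rewrite !mulr_gt0.
(* As $t\le2w^{24m}\le w^{24m+1}$, the target is at most $w^{(1/12-\varepsilon)(24m+1)}$, and
   $\varepsilon m\ge2$ pays for the loss of 39 in the exponent. *)
pose m := maxn 20 (Num.bound (2 / eps)).
have m20 : (20 <= m)%N by rewrite leq_maxl.
have me : 2 <= eps * m%:R.
  rewrite -ler_pdivrMl // mulrC; apply: ltW.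
  have e2 : 0 <= 2 / eps by rewrite divr_ge0 // ltW.
  by apply: (lt_le_trans (archi_boundP e2)); rewrite ler_nat leq_maxr.
pose k := (400 * m)%N; have k1 : (400 * m <= 2 ^ k)%N by rewrite ltnW // ltn_expl.
pose K := (60 * m * 2 ^ k).+1.
have [C C0 hC] := tau_bound (ltn0Sn (60 * m * 2 ^ k)).
(* The summands are the thresholds that w must exceed: one for each of the size conditions of
   [large_base] and of the lemmas of the previous section. *)
pose w1 := (10 ^ 6 + 2 ^ k + C + 2 * (24 * m).+1 ^ (24 * m).+1 + 2 * (24 * m) + Num.bound (10 ^+ 6 * kp) + Num.bound (10 ^+ 6 / kp))%N.
exists 1 => //; exists (w1%:R ^+ (24 * m)); split; first exact: num_real.
move=> t tw phi hphi; rewrite mul1r.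
have t0 : 0 <= t by apply: ltW; apply: le_lt_trans tw; rewrite exprn_ge0.
have M0 : (0 < 24 * m)%N by rewrite muln_gt0 /=; apply: leq_trans m20.
(* The base is the integer part of the root of order 24m of t; for w at least 48m, passing from w to
   w + 1 at most doubles this power. *)
have [w /andP[wt tw']] := floor_root M0 t0.
have ww : (w1 <= w)%N.
  rewrite -ltnS -(ltr_nat R); have h := lt_trans tw tw'.
  by move: h; rewrite ltr_pXn2r ?nnegrE.
have w0 : (0 < w)%N by apply: leq_trans ww; rewrite /w1 -!addnA addn_gt0.
have le1 a b : (a + b <= w)%N -> (a <= w)%N by apply: leq_trans; rewrite leq_addr.
have le2 a b : (a + b <= w)%N -> (b <= w)%N by apply: leq_trans; rewrite leq_addl.
have b7 : (Num.bound (10 ^+ 6 / kp) <= w)%N := le2 _ _ ww.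
have ww1 := le1 _ _ ww; have b6 : (Num.bound (10 ^+ 6 * kp) <= w)%N := le2 _ _ ww1.
have ww2 := le1 _ _ ww1; have b5 : (2 * (24 * m) <= w)%N := le2 _ _ ww2.
have ww3 := le1 _ _ ww2; have b4 : (2 * (24 * m).+1 ^ (24 * m).+1 <= w)%N := le2 _ _ ww3.
have ww4 := le1 _ _ ww3; have b3 : (C <= w)%N := le2 _ _ ww4.
have ww5 := le1 _ _ ww4; have b2 : (2 ^ k <= w)%N := le2 _ _ ww5.
have b1 : (10 ^ 6 <= w)%N := le1 _ _ ww5.
clear ww ww1 ww2 ww3 ww4 ww5 le1 le2.
have tauw l : (0 < l <= w ^ (60 * m * 2 ^ k))%N -> (tau l <= w)%N.
  move=> /andP[l0 lw]; rewrite -(@leq_exp2r _ _ K) //; apply: (leq_trans (hC l l0)).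
  by rewrite /K expnS; exact: leq_mul.
have kR (x : R) : 0 <= x -> (Num.bound x <= w)%N -> x <= w%:R.
  by move=> x0 h; apply: ltW; apply: (lt_le_trans (archi_boundP x0)); rewrite ler_nat.
have lb : large_base (lam hphi) w m t kp.
  split => //.
  - exact: hecke_relation.
  - have [y y0 cy] := coef1_neq0 hphi; have := coef_lam hphi (ltn0Sn 0) y0; rewrite sqrtr1 divr1 mul1r => h.
    by apply: (mulIf cy); rewrite mul1r -h.
  - by have := exp2_dominates (ltn0Sn (24 * m)) b4.
  - move=> n /andP[n0 nw]; apply: tauw; rewrite n0 /=; apply: (leq_trans nw).
    rewrite leq_pexp2l //; apply: (@leq_trans (60 * m)); first by rewrite leq_mul2r orbT.
    by rewrite leq_pmulr // expn_gt0.
  - by apply: kR => //; rewrite mulr_ge0 ?exprn_ge0 // ltW.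
  - by rewrite mulrC -ler_pdivrMr //; apply: kR => //; rewrite divr_ge0 ?exprn_ge0 // ltW.
  - apply: (le_trans (ltW tw')); exact: double_succ_pow.
have W6 := w_ge lb; have W0 := w_gt0 lb.
have t6 : 10 ^+ 6 <= t by apply: le_trans wt; exact: (wX_ge lb).
have t1000 : 1000 <= t by apply: le_trans t6; rewrite -(natrX R 10) ler_nat.
have [r [al osc]] := radial_oscillates hphi t1000.
have [zs [uz hz big]] := many_zeros Y0 lb k1 b2 tauw osc.
apply: le_trans (zeros_on_horocycle hphi Y0 uz hz); rewrite lee_fin; apply: le_trans big.
have tp : 0 < t by apply: lt_le_trans t1000; rewrite ltr0n.
have WE n : w%:R ^+ n = expR (n%:R * ln (w%:R : R)) by rewrite expRM_natl lnK ?posrE.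
rewrite /powR gt_eqF // WE ler_expR.
have W1 : 1 <= w%:R :> R by rewrite ler1n -(ltr_nat R).
have l0 : 0 <= ln (w%:R : R) by exact: ln_ge0.
have lt0 : 0 <= ln t by apply: ln_ge0; apply: le_trans t1000; rewrite ler1n.
have [h|h] := leP (12^-1 - eps) 0.
  by apply: (@le_trans _ _ 0); [rewrite mulr_le0_ge0|rewrite mulr_ge0].
have l2 : ln (2 : R) <= ln (w%:R : R) by rewrite ler_ln ?posrE //; lra_from W6.
have lt1 : ln t <= (24 * m + 1)%:R * ln (w%:R : R).
  rewrite natrD mulrDl mul1r.
  have : ln t <= ln (2 * w%:R ^+ (24 * m)) by rewrite ler_ln ?posrE ?mulr_gt0 ?exprn_gt0 // (lb_t2 lb).
  by rewrite lnM ?posrE ?exprn_gt0 // lnXn // -[ln _ *+ _]mulr_natl; lra_from l2.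
apply: (@le_trans _ _ ((12^-1 - eps) * ((24 * m + 1)%:R * ln (w%:R : R)))); first by rewrite ler_pM2l.
rewrite mulrA ler_wpM2r // natrB; last by clear -m20; lia.
by rewrite natrD !natrM; lra_from e0 me.
Qed.

End LowerBoundTheorem.

(** * The upper bound *)

Section Rolle.
Variable R : realType.

Lemma rolle_step (g g' : R -> R) (z : nat -> R) n : (forall x : R, is_derive x 1 g (g' x)) ->
  (forall i, (i < n)%N -> z i < z i.+1) -> (forall i, (i <= n)%N -> g (z i) = 0) ->
  exists z' : nat -> R, forall i, (i < n)%N -> [/\ z i < z' i, z' i < z i.+1 & g' (z' i) = 0].
Proof.
move=> dg zi gz; have cg := is_derive_continuous dg.
have one i : exists y : R, (i < n)%N -> [/\ z i < y, y < z i.+1 & g' y = 0].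
  have [h|h] := ltnP i n; last by exists 0.
  have dv (x : R) : x \in `]z i, z i.+1[ -> derivable g x 1 by move=> _; have [] := dg x.
  have cw : {within `[z i, z i.+1], continuous g} by apply: continuous_subspaceT => x; exact: cg.
  have e : g (z i) = g (z i.+1) by rewrite !gz // ltnW.
  have [y] := Rolle (zi i h) dv cw e; rewrite in_itv /= => /andP[y1 y2] dy; exists y => _; split => //.
  by have := dg y; have [_ <-] := dy; move=> [_ <-].
by have [z' hz'] := choice one; exists z'.
Qed.

Lemma rolle_zeros (H : nat -> R -> R) a b (z : nat -> R) n i :
  (forall i (x : R), is_derive x 1 (H i) (H i.+1 x)) ->
  (i <= n)%N -> (forall j, (j < n)%N -> z j < z j.+1) ->
  (forall j, (j <= n)%N -> a <= z j <= b /\ H 0 (z j) = 0) ->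
  exists z' : nat -> R, (forall j, (j < n - i)%N -> z' j < z' j.+1) /\
    (forall j, (j <= n - i)%N -> a <= z' j <= b /\ H i (z' j) = 0).
Proof.
move=> dH ni zi hz; elim: i ni => [|i IH] ni; first by exists z; rewrite subn0.
have [z' [zi' hz']] := IH (ltnW ni).
have [z2 h2] := rolle_step (dH i) zi' (fun j hj => (hz' j hj).2).
have ni0 : (0 < n - i)%N by rewrite subn_gt0.
exists z2; split => j; rewrite subnS => hj.
  have j1 : (j.+1 < n - i)%N by rewrite -(prednK ni0) ltnS.
  have [_ a1 _] := h2 j (ltnW j1); have [a2 _ _] := h2 j.+1 j1; exact: lt_trans a2.
have j1 : (j < n - i)%N by rewrite -(prednK ni0) ltnS.
have [a1 a2 a3] := h2 j j1; split => //.
have [/andP[b1 _] _] := hz' j (ltnW j1); have [/andP[_ b2] _] := hz' j.+1 j1.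
by rewrite (le_trans b1 (ltW a1)) (le_trans (ltW a2) b2).
Qed.

Lemma increasing_enum (s : seq R) : uniq s -> exists z : nat -> R,
  (forall j, (j.+1 < size s)%N -> z j < z j.+1) /\ (forall j, (j < size s)%N -> z j \in s).
Proof.
move=> us; pose s' := sort <=%R s; exists (fun j => nth 0 s' j).
have ss : size s' = size s by rewrite size_sort.
split=> j hj; last by rewrite -(mem_sort <=%R) mem_nth ?ss.
have st : sorted <%R s' by rewrite lt_sorted_uniq_le sort_uniq us sort_le_sorted.
by rewrite (lt_sorted_ltn_nth 0 st) ?inE ?ss // ltnW.
Qed.

Lemma monic_derivn (p : {poly R}) n : p \is monic -> size p = n.+1 -> p^`(n) = (n`!%:R)%:P.
Proof.
move=> mp sp; apply/polyP => i; rewrite coef_derivn coefC; case: i => [|i] /=.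
  rewrite addn0 ffactnn; have := monicP mp; rewrite lead_coefE sp /= => ->.
  by [].
by rewrite nth_default ?mul0rn // sp addnS ltnS leq_addr.
Qed.

(* The error formula of polynomial interpolation at the zeros. *)
Lemma interpolation_bound (H : nat -> R -> R) a b S (zs : seq R) (x : R) :
  (forall i (x : R), is_derive x 1 (H i) (H i.+1 x)) -> uniq zs ->
  (forall z, z \in zs -> a <= z <= b /\ H 0 z = 0) -> a <= x <= b ->
  (forall y, a <= y <= b -> `|H (size zs) y| <= S) ->
  `|H 0 x| * (size zs)`!%:R <= S * (b - a) ^+ size zs.
Proof.
move=> dH uz hz xab hS; set n := size zs in hS *.
have S0 : 0 <= S by apply: le_trans (hS x xab).
have ab : 0 <= b - a by rewrite subr_ge0; have /andP[h1 h2] := xab; exact: le_trans h2.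
have [xz|xz] := boolP (x \in zs).
  by have [_ ->] := hz x xz; rewrite normr0 mul0r mulr_ge0 // exprn_ge0.
pose p : {poly R} := \prod_(z <- zs) ('X - z%:P).
have mp : p \is monic by exact: monic_prod_XsubC.
have sp : size p = n.+1 by rewrite size_prod_XsubC.
have px0 : p.[x] != 0 by rewrite -rootE root_prod_XsubC.
pose c := H 0 x / p.[x].
pose Hc i y := H i y - c * (p^`(i)).[y].
have dHc i (y : R) : is_derive y 1 (Hc i) (Hc i.+1 y).
  apply: (der_eq (derD (dH i y) (derN (derZ c (is_derive_poly p^`(i) y))))).
  by rewrite /Hc derivnS.
have [z [zi hz']] := @increasing_enum (x :: zs) (introT andP (conj xz uz)).
have zz j : (j <= n)%N -> a <= z j <= b /\ Hc 0 (z j) = 0.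
  move=> jn; have := hz' j; rewrite /= ltnS => /(_ jn); rewrite inE => /predU1P[->|zI].
    by split => //; rewrite /Hc derivn0 /c divfK // subrr.
  have [h1 h2] := hz _ zI; split => //.
  rewrite /Hc derivn0 h2 sub0r (_ : p.[z j] = 0) ?mulr0 ?oppr0 //.
  by apply/eqP; rewrite -rootE root_prod_XsubC.
have zi' j : (j < n)%N -> z j < z j.+1 by move=> h; apply: zi; rewrite /= ltnS.
have [z2 [_ h2]] := rolle_zeros dHc (leqnn n) zi' zz.
have [zab] := h2 0 (leq0n _); rewrite /Hc (monic_derivn mp sp) hornerC => /eqP; rewrite subr_eq0 => /eqP e.
have cS : `|c| * n`!%:R <= S by rewrite -[n`!%:R]ger0_norm // -normrM -e; exact: hS.
have -> : `|H 0 x| = `|c| * `|p.[x]| by rewrite -normrM /c divfK.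
rewrite mulrAC; apply: (ler_pM (mulr_ge0 (normr_ge0 _) (ler0n _ _)) (normr_ge0 _) cS).
rewrite /p horner_prod normr_prod; have -> : (b - a) ^+ n = \prod_(z <- zs) (b - a).
  by rewrite big_const_seq count_predT iter_mulr_1.
rewrite big_seq [leRHS]big_seq; apply: ler_prod => u uI; rewrite normr_ge0 hornerXsubC /=.
have [/andP[u1 u2] _] := hz u uI; have /andP[x1 x2] := xab.
by rewrite ler_norml; apply/andP; split; lra.
Qed.

End Rolle.

(** * Propagation of smallness by majorants *)

Section Propagation.
Variable R : realType.

(** The i-th derivative of $1/(1-cs)$ in s. *)
Definition majorant (c : R) i s := i`!%:R * c ^+ i * ((1 - c * s)^-1) ^+ i.+1.

Lemma der_majorant (c s : R) i : 0 < 1 - c * s -> is_derive s (1 : R) (majorant c i) (majorant c i.+1 s).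
Proof.
move=> cs; have d1 : is_derive s (1 : R) (fun z => 1 - c * z) (- c).
  by apply: (der_eq (derD (derC 1 s) (derN (derZ c (derI s))))); ring.
have d2 : is_derive s (1 : R) (fun z => (1 - c * z)^-1) (c * ((1 - c * s)^-1) ^+ 2).
  have := @is_deriveV R (fun z => 1 - c * z) s _ 1 (lt0r_neq0 cs) d1.
  by move=> /der_eq; apply; rewrite /GRing.scale /= exprVn; ring.
apply: (der_eq (derZ (i`!%:R * c ^+ i) (der_comp d2 (der_pow _ i.+1)))).
by rewrite /majorant factS natrM /= !exprS; ring.
Qed.

(** Cauchy's method of majorants: the estimate for order i + 1 is integrated from the starting
    point, by descending induction from order m. *)
Lemma majorize (F Phi : nat -> R -> R) m h p :
  (forall i (x : R), is_derive x 1 (F i) (F i.+1 x)) ->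
  (forall i (s : R), 0 <= s <= h -> is_derive s 1 (Phi i) (Phi i.+1 s)) ->
  (forall i, (i < m)%N -> `|F i p| <= Phi i 0) ->
  (forall s, 0 <= s <= h -> `|F m (p + s)| <= Phi m s) ->
  forall i s, (i <= m)%N -> 0 <= s <= h -> `|F i (p + s)| <= Phi i s.
Proof.
move=> dF dP P0 Pm i s im; move: s; have [d dE] : exists d, d = (m - i)%N by exists (m - i)%N.
elim: d i im dE => [|d IH] i im dE s sh.
  have -> : i = m by apply/eqP; rewrite eqn_leq im -subn_eq0 -dE.
  exact: Pm.
have im1 : (i < m)%N by rewrite -subn_gt0 -dE.
have {}IH := IH i.+1 im1 _; have d' : d = (m - i.+1)%N by rewrite subnS -dE.
have {}IH := IH d'.
have /andP[s0 s1] := sh.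
have dshift (x : R) : is_derive x 1 (fun z => F i (p + z)) (F i.+1 (p + x)).
  apply: (der_eq (der_comp (derD (derC p x) (derI x)) (dF i (p + x)))); ring.
have inh (x : R) : 0 <= x <= s -> 0 <= x <= h by move=> /andP[x0 xs]; rewrite x0 (le_trans xs).
have a1 : Phi i 0 - F i (p + 0) <= Phi i s - F i (p + s).
  apply: (ge0_der_le (fun x xI => derD (dP i x (inh x xI)) (derN (dshift x))) _ s0) => x xI.
  by have := IH x (inh x xI); rewrite ler_norml => /andP[]; lra.
have a2 : Phi i 0 + F i (p + 0) <= Phi i s + F i (p + s).
  apply: (ge0_der_le (fun x xI => derD (dP i x (inh x xI)) (dshift x)) _ s0) => x xI.
  by have := IH x (inh x xI); rewrite ler_norml => /andP[]; lra.
have := P0 i im1; rewrite addr0 in a1 a2; rewrite !ler_norml => /andP[b1 b2]; apply/andP; split; lra.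
Qed.

Variables (F : nat -> R -> R) (G rho : R).
Hypothesis dF : forall i (x : R), is_derive x 1 (F i) (F i.+1 x).
Hypothesis rho0 : 0 < rho.
Hypothesis G0 : 0 <= G.
Hypothesis bdF : forall i x, `|F i x| * rho ^+ i <= G * i`!%:R.

(** The derivatives of order below m at p are smaller by the factor $4^{-m}$ than the a priori
    bounds $Gi!\rho^{-i}$. *)
Definition small_jet p m := forall i, (i < m)%N -> `|F i p| * rho ^+ i * 4 ^+ m <= G * i`!%:R.

(** The majorant is $d/(1-s/\rho)+d/(1-4s/\rho)$ with $d=G4^{-4m}$. The first term covers the small
    derivatives at p; the derivative of order 4m of the second reaches the a priori bound, because
    $4^{4m}d=G$. For $s\le\rho/8$ both denominators are at least 1/2, the loss is at most $8^m$, and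
    $4^{-4m}8^m\le4^{-m}$. *)
Lemma small_jet_step p m s : (0 < m)%N -> small_jet p (4 * m) -> 0 <= s <= rho / 8 -> small_jet (p + s) m.
Proof.
move=> m0 sj /andP[s0 s8] i im.
set d := G / 4 ^+ (4 * m).
have d0 : 0 <= d by rewrite divr_ge0 // exprn_ge0.
pose Phi i s := d * majorant rho^-1 i s + d * majorant (4 / rho) i s.
have den c (z : R) : 0 <= z <= rho / 8 -> 0 <= c <= 4 -> 1 / 2 <= 1 - c / rho * z <= 1.
  move=> /andP[z0 z8] /andP[c0 c4].
  have e : c / rho * z = c * (z / rho) by ring.
  have z1 : z / rho <= 1 / 8 by rewrite ler_pdivrMr //; lra.
  have z2 : 0 <= z / rho by rewrite divr_ge0 // ltW.
  by rewrite e; apply/andP; split; nra.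
have den1 (z : R) : 0 <= z <= rho / 8 -> 1 / 2 <= 1 - rho^-1 * z <= 1.
  move=> zI; have I1 : (0 <= 1 :> R) && (1 <= 4 :> R) by rewrite ler01 ler1n.
  by have := den 1 z zI I1; rewrite [1 / rho]div1r.
have den4 (z : R) : 0 <= z <= rho / 8 -> 1 / 2 <= 1 - 4 / rho * z <= 1.
  by move=> zI; apply: den => //; apply/andP; split; lra.
have dP j (z : R) : 0 <= z <= rho / 8 -> is_derive z 1 (Phi j) (Phi j.+1 z).
  move=> zI; apply: (derD (derZ d (der_majorant _ _)) (derZ d (der_majorant _ _))).
    by have /andP[] := den1 z zI; lra.
  by have /andP[] := den4 z zI; lra.
have mj0 c j (z : R) : 0 <= c -> 0 <= 1 - c * z -> 0 <= majorant c j z.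
  by move=> c0 h; rewrite !mulr_ge0 ?exprn_ge0 // invr_ge0.
have P0 j : (j < 4 * m)%N -> `|F j p| <= Phi j 0.
  move=> jm; apply: (@le_trans _ _ (d * majorant rho^-1 j 0)); last first.
    by rewrite lerDl mulr_ge0 // mj0 ?divr_ge0 ?(ltW rho0) // mulr0; lra.
  rewrite /majorant mulr0 subr0 invr1 expr1n mulr1 exprVn /d.
  have := sj j jm; have r0 : 0 < rho ^+ j by rewrite exprn_gt0.
  have q0 : 0 < 4 ^+ (4 * m) :> R by rewrite exprn_gt0.
  have -> : G / 4 ^+ (4 * m) * (j`!%:R / rho ^+ j) = G * j`!%:R / 4 ^+ (4 * m) / rho ^+ j by ring.
  by rewrite !ler_pdivlMr.
have Pm (z : R) : 0 <= z <= rho / 8 -> `|F (4 * m) (p + z)| <= Phi (4 * m)%N z.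
  move=> zI; apply: (@le_trans _ _ (d * majorant (4 / rho) (4 * m) z)); last first.
    by rewrite lerDr mulr_ge0 // mj0 ?invr_ge0 ?(ltW rho0) //; have /andP[] := den1 z zI; lra.
  have /andP[z1 z2] := den4 z zI.
  have r0 : 0 < rho ^+ (4 * m) by rewrite exprn_gt0.
  have q0 : 0 < 4 ^+ (4 * m) :> R by rewrite exprn_gt0.
  have E : d * majorant (4 / rho) (4 * m) z = (G * (4 * m)`!%:R / rho ^+ (4 * m)) * ((1 - 4 / rho * z)^-1) ^+ (4 * m).+1.
    by rewrite /d /majorant expr_div_n; field; rewrite !lt0r_neq0.
  rewrite E; apply: (@le_trans _ _ (G * (4 * m)`!%:R / rho ^+ (4 * m))); first by rewrite ler_pdivlMr.
  rewrite ler_peMr ?divr_ge0 ?mulr_ge0 ?(ltW r0) // exprn_ege1 // invf_ge1 //; lra.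
have sI : 0 <= s <= rho / 8 by rewrite s0.
have i4 : (i <= 4 * m)%N by apply: ltnW; apply: (leq_trans im); rewrite leq_pmull.
have h := majorize dF dP P0 Pm i4 sI.
have r0 : 0 < rho ^+ i by rewrite exprn_gt0.
have M1 : majorant rho^-1 i s * rho ^+ i <= i`!%:R * 2 ^+ i.+1.
  have /andP[z1 z2] := den1 s sI.
  have -> : majorant rho^-1 i s * rho ^+ i = i`!%:R * ((1 - rho^-1 * s)^-1) ^+ i.+1.
    by rewrite /majorant (exprVn rho) mulrAC divfK ?lt0r_neq0.
  rewrite ler_wpM2l //; apply: lerXn2r; rewrite ?nnegrE ?invr_ge0 //; first by lra.
  by rewrite -[2]invrK lef_pV2 ?posrE ?invr_gt0 //; lra.
have M4 : majorant (4 / rho) i s * rho ^+ i <= i`!%:R * (4 ^+ i * 2 ^+ i.+1).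
  have /andP[z1 z2] := den4 s sI.
  have -> : majorant (4 / rho) i s * rho ^+ i = i`!%:R * (4 ^+ i * ((1 - 4 / rho * s)^-1) ^+ i.+1).
    rewrite /majorant (expr_div_n 4 rho) [in LHS]mulrAC; set X := ((1 - _)^-1) ^+ _.
    by rewrite [_ * (_ / _)]mulrA divfK ?lt0r_neq0 // mulrA.
  rewrite ler_wpM2l // ler_wpM2l ?exprn_ge0 //; apply: lerXn2r; rewrite ?nnegrE ?invr_ge0 //; first by lra.
  by rewrite -[2]invrK lef_pV2 ?posrE ?invr_gt0 //; lra.
have tot : `|F i (p + s)| * rho ^+ i <= d * (i`!%:R * 8 ^+ m).
  apply: (@le_trans _ _ (Phi i s * rho ^+ i)); first by rewrite ler_pM2r.
  rewrite /Phi -mulrDr -mulrA ler_wpM2l // mulrDl.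
  apply: (@le_trans _ _ (i`!%:R * 2 ^+ i.+1 + i`!%:R * (4 ^+ i * 2 ^+ i.+1))); first exact: lerD.
  rewrite -mulrDr ler_wpM2l //.
  apply: (@le_trans _ _ (8 ^+ i.+1)); last by rewrite ler_weXn2l //; lra.
  have e8 : 8 ^+ i.+1 = 8 * (4 ^+ i * 2 ^+ i) :> R by rewrite -exprMn exprS; congr (_ * _ ^+ _); ring.
  rewrite e8 exprS; have p2 : 0 < 2 ^+ i :> R by rewrite exprn_gt0.
  have p4 : 1 <= 4 ^+ i :> R by rewrite exprn_ege1 //; lra.
  by nra.
have p4 : 0 < 4 ^+ m :> R by rewrite exprn_gt0.
apply: (@le_trans _ _ (d * (i`!%:R * 8 ^+ m) * 4 ^+ m)); first by rewrite ler_pM2r.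
have -> : d * (i`!%:R * 8 ^+ m) * 4 ^+ m = G * i`!%:R * (8 ^+ m * 4 ^+ m / 4 ^+ (4 * m)) by rewrite /d; ring.
rewrite ler_piMr ?mulr_ge0 // ler_pdivrMr ?exprn_gt0 // mul1r -exprMn exprM.
by apply: lerXn2r; rewrite ?nnegrE //; lra.
Qed.

Lemma small_jet_iter p n s0 h : (0 < n)%N -> 0 <= h <= rho / 8 -> small_jet p (4 ^ s0 * n) ->
  small_jet (p + s0%:R * h) n.
Proof.
move=> n0 hI; elim: s0 p => [|k IH] p; first by rewrite expn0 mul1n mul0r addr0.
rewrite expnS -mulnA => sj; have -> : p + k.+1%:R * h = (p + h) + k%:R * h by rewrite -natr1; ring.
by apply: IH; apply: small_jet_step => //; rewrite muln_gt0 expn_gt0 n0.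
Qed.

Lemma bin_le_exp2 n k : ('C(n, k) <= 2 ^ n)%N.
Proof.
elim: n k => [|n IH] [|k]; rewrite ?bin0 ?expn_gt0 //.
by rewrite binS expnS mul2n -addnn leq_add.
Qed.

(** By Rolle the derivative of order i has 2m - i zeros in the interval, and interpolation at them
    yields a factor $16^{-(2m-i)}\le16^{-m}$; the binomial coefficient from the factorials is at
    most $4^m$. *)
Lemma small_jet_of_zeros a b m (zs : seq R) : (0 < m)%N -> uniq zs -> size zs = (2 * m)%N ->
  (forall z, z \in zs -> a <= z <= b /\ F 0 z = 0) -> a <= b -> b - a <= rho / 16 -> small_jet a m.
Proof.
move=> m0 uz sz hz ab len i im.
have [z [zi hz']] := increasing_enum uz; rewrite sz in zi hz'.
have n0 : (0 < 2 * m)%N by rewrite muln_gt0.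
have zi' j : (j < (2 * m).-1)%N -> z j < z j.+1 by move=> h; apply: zi; rewrite -(prednK n0) ltnS.
have zz j : (j <= (2 * m).-1)%N -> a <= z j <= b /\ F 0 (z j) = 0.
  by move=> h; apply: hz; apply: hz'; rewrite -(prednK n0) ltnS.
have i2 : (i <= (2 * m).-1)%N by rewrite -ltnS prednK // (leq_trans im) // leq_pmull.
have [z2 [z2i h2]] := rolle_zeros dF i2 zi' zz.
set k := (2 * m - i)%N.
have k0 : (0 < k)%N by rewrite subn_gt0 (leq_trans im) // leq_pmull.
have kE : ((2 * m).-1 - i)%N = k.-1 by rewrite /k -subn1 subnAC subn1.
rewrite kE in z2i h2.
have mono j l : (j < l)%N -> (l < k)%N -> z2 j < z2 l.
  elim: l => // l IH; rewrite ltnS leq_eqVlt => /predU1P[->|jl] lk.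
    by apply: z2i; rewrite -(prednK k0) ltnS in lk.
  by apply: (lt_trans (IH jl (ltnW lk))); apply: z2i; rewrite -(prednK k0) ltnS in lk.
pose zs' := [seq z2 j | j <- iota 0 k].
have sz' : size zs' = k by rewrite size_map size_iota.
have uz' : uniq zs'.
  rewrite map_inj_in_uniq ?iota_uniq // => j l; rewrite !mem_iota !add0n /= => jk lk e.
  by case: (ltngtP j l) => // h; [have := mono j l h lk|have := mono l j h jk]; rewrite e ltxx.
have hz2 u : u \in zs' -> a <= u <= b /\ F i u = 0.
  by move=> /mapP[j]; rewrite mem_iota add0n => /andP[_ jk] ->; apply: h2; rewrite -ltnS prednK.
have r0 j : 0 < rho ^+ j by rewrite exprn_gt0.
have aI : a <= a <= b by rewrite lexx.
have ik : (k + i = 2 * m)%N by rewrite subnK // (leq_trans (ltnW im)) // leq_pmull.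
have hS y : a <= y <= b -> `|F (size zs' + i)%N y| <= G * (2 * m)`!%:R / rho ^+ (2 * m).
  by move=> _; rewrite sz' ik ler_pdivlMr.
have dFi l (x : R) : is_derive x 1 ((fun l => F (l + i)%N) l) ((fun l => F (l + i)%N) l.+1 x) by rewrite addSn.
have := interpolation_bound dFi uz' hz2 aI hS; rewrite sz' /= add0n => h.
have k1 : 0 < k`!%:R :> R by rewrite ltr0n fact_gt0.
have ln : (b - a) ^+ k <= rho ^+ k / 16 ^+ k.
  by rewrite -expr_div_n; apply: lerXn2r; rewrite ?nnegrE ?subr_ge0 // divr_ge0 // ltW.
have B : (2 * m)`!%:R = 'C(2 * m, i)%:R * i`!%:R * k`!%:R :> R.
  by rewrite -!natrM -mulnA bin_fact // (leq_trans (ltnW im)) // leq_pmull.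
have Bc : 'C(2 * m, i)%:R <= 4 ^+ m :> R.
  apply: (@le_trans _ _ (2 ^ (2 * m))%N%:R); first by rewrite ler_nat bin_le_exp2.
  by rewrite natrX exprM -natrX.
have key : `|F i a| * rho ^+ i <= G * i`!%:R * ('C(2 * m, i)%:R / 16 ^+ k).
  rewrite -(ler_pM2r k1).
  have e1 : G * (2 * m)`!%:R / rho ^+ (2 * m) * (rho ^+ k / 16 ^+ k) * rho ^+ i = G * i`!%:R * ('C(2 * m, i)%:R / 16 ^+ k) * k`!%:R.
    rewrite B -ik exprD; field; rewrite !lt0r_neq0 ?exprn_gt0 //.
  rewrite -e1 mulrAC ler_pM2r //; apply: (le_trans h); apply: ler_wpM2l => //.
  by rewrite divr_ge0 ?mulr_ge0 // ltW.
have mk : (m <= k)%N by rewrite /k mul2n -addnn leq_subRL ?leq_add2r; [rewrite ltnW|rewrite (leq_trans (ltnW im)) // leq_addr].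
have e16 : 'C(2 * m, i)%:R / 16 ^+ k <= (4 ^+ m)^-1 :> R.
  have p4 : 0 < 4 ^+ m :> R by rewrite exprn_gt0.
  rewrite ler_pdivrMr ?exprn_gt0 // -ler_pdivrMl ?invr_gt0 // invrK.
  apply: (@le_trans _ _ (4 ^+ m * 4 ^+ m)); first by rewrite ler_pM2l.
  apply: (@le_trans _ _ (16 ^+ m)); first by rewrite -exprMn; apply: lerXn2r; rewrite ?nnegrE //; lra.
  by rewrite ler_weXn2l //; lra.
have p4 : 0 < 4 ^+ m :> R by rewrite exprn_gt0.
apply: (@le_trans _ _ (G * i`!%:R * (4 ^+ m)^-1 * 4 ^+ m)); last by rewrite divfK ?lt0r_neq0.
rewrite ler_pM2r //; apply: (le_trans key); apply: ler_wpM2l => //; exact: mulr_ge0.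
Qed.

(** The period is cut into R0 cells of length at most $\rho/16$, one of which contains 2m zeros.
    From its left end, s0 steps of length at most $\rho/8$ reach every point of a period to the
    right; each step divides the order of the jet by 4. *)
Lemma small_everywhere n s0 R0 (zs : seq R) q : (0 < n)%N -> (0 < s0)%N -> 8 / rho <= s0%:R -> 16 / rho <= R0%:R ->
  (forall x : R, F 0 (x + 1) = F 0 x) -> uniq zs -> (forall z, z \in zs -> 0 <= z < 1 /\ F 0 z = 0) ->
  (R0 * (2 * (4 ^ s0 * n)) <= size zs)%N -> 0 <= q <= 1 -> `|F 0 q| * 4 ^+ n <= G.
Proof.
move=> n0 s1 s8 R16 per uz hz big /andP[q0 q1].
have Rp : 0 < R0%:R :> R by apply: lt_le_trans R16; rewrite divr_gt0.
have R0n : (0 < R0)%N by rewrite -(ltr0n R).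
have sp : 0 < s0%:R :> R by rewrite ltr0n.
set m := (4 ^ s0 * n)%N in big.
have m0 : (0 < m)%N by rewrite muln_gt0 expn_gt0 n0.
pose f (z : R) := Num.truncn (z * R0%:R).
have fz z : z \in zs -> (f z < R0)%N /\ (f z)%:R / R0%:R <= z <= (f z).+1%:R / R0%:R.
  move=> /hz [/andP[z0 z1] _]; have zR : 0 <= z * R0%:R by rewrite mulr_ge0.
  have /andP[f1 f2] := truncn_itv zR; rewrite -/(f z) in f1 f2; split.
    by rewrite -(ltr_nat R); apply: (le_lt_trans f1); rewrite gtr_pMl.
  by rewrite ler_pdivrMr // f1 ler_pdivlMr // ltW.
have cnt : size zs = (\sum_(j < R0) count (fun z => f z == j) zs)%N.
  have : forall z, z \in zs -> (f z < R0)%N by move=> z /fz [].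
  elim: (zs) => [|z l IH] hl /=; first by rewrite big1.
  rewrite big_split /= -IH; last by move=> u ul; apply: hl; rewrite inE ul orbT.
  have zR : (f z < R0)%N by apply: hl; rewrite mem_head.
  rewrite (bigD1 (Ordinal zR)) //= eqxx big1 ?addn0 ?add1n // => j; rewrite -val_eqE /=.
  by rewrite eq_sym => /negbTE ->.
have [j hj] : exists j : 'I_R0, (2 * m <= count (fun z => f z == j) zs)%N.
  apply: contrapT => /forallNP no; move: big; rewrite leqNgt => /negP; apply.
  rewrite cnt; apply: (@leq_ltn_trans (\sum_(j < R0) (2 * m).-1)%N).
    by apply: leq_sum => j _; have /negP := no j; rewrite -ltnNge => h; move: h; case: (2 * m)%N.
  have m2 : (0 < 2 * m)%N by rewrite muln_gt0.
  by rewrite sum_nat_const card_ord ltn_mul2l R0n ltn_predL.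
pose zs' := take (2 * m) [seq z <- zs | f z == j].
have sz' : size zs' = (2 * m)%N by rewrite size_takel // size_filter.
have uz' : uniq zs' by rewrite take_uniq // filter_uniq.
have hz' z : z \in zs' -> j%:R / R0%:R <= z <= j.+1%:R / R0%:R /\ F 0 z = 0.
  by move=> /mem_take; rewrite mem_filter => /andP[/eqP e zI]; have [_] := fz z zI; rewrite e; have [_] := hz z zI.
have ab : j%:R / R0%:R <= j.+1%:R / R0%:R :> R by rewrite ler_pM2r ?invr_gt0 // ler_nat.
have len : j.+1%:R / R0%:R - j%:R / R0%:R <= rho / 16.
  rewrite -mulrBl -natr1 addrAC subrr add0r div1r -[rho / 16]invrK lef_pV2 ?posrE ?invr_gt0 ?divr_gt0 //.
  by rewrite invf_div.
have sj := small_jet_of_zeros m0 uz' sz' hz' ab len.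
set p := j%:R / R0%:R in sj.
have p0 : 0 <= p by rewrite divr_ge0.
have p1 : p <= 1 by rewrite ler_pdivrMr // mul1r ler_nat ltnW.
have [q' [q'p q'1 qE]] : exists q', [/\ p <= q', q' <= p + 1 & F 0 q' = F 0 q].
  have [h|h] := leP p q; first by exists q; split => //; lra.
  by exists (q + 1); split; rewrite ?per //; lra.
have hI : 0 <= (q' - p) / s0%:R <= rho / 8.
  rewrite divr_ge0 ?subr_ge0 //=; apply: (@le_trans _ _ s0%:R^-1).
    by rewrite ler_pdivrMr // mulVf ?lt0r_neq0 //; lra.
  by rewrite -[rho / 8]invrK lef_pV2 ?posrE ?invr_gt0 ?divr_gt0 // invf_div.
have := small_jet_iter n0 hI sj; rewrite mulrC divfK ?lt0r_neq0 // subrKC => /(_ 0%N n0).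
by rewrite qE expr0 fact0 !mulr1.
Qed.

End Propagation.

(** * Derivatives of all orders from the Fourier series *)

Section SmoothSeries.
Variable R : realType.
Implicit Types x h : R.

Lemma der_of_quadratic (f : R -> R) x l C :
  (forall h, `|f (x + h) - f x - h * l| <= C * h ^+ 2) -> is_derive x 1 f l.
Proof.
move=> hq.
have cv : h^-1 *: ((f \o shift x) (h *: 1) - f x) @[h --> (0 : R)^'] --> l.
  apply/cvgrPdist_le => e e0; near=> h.
  have h0 : h != 0 by near: h; exact: nbhs_dnbhs_neq.
  have hs : `|h| <= e / (`|C| + 1).
    by near: h; apply: dnbhs0_le; rewrite divr_gt0 // ltr_wpDl.
  have np : 0 < `|h| by rewrite normr_gt0.
  rewrite /= /GRing.scale /= mulr1 [h + x]addrC.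
  have -> : l - h^-1 * (f (x + h) - f x) = - (h^-1 * (f (x + h) - f x - h * l)) by field.
  rewrite normrN normrM normfV ler_pdivrMl //; apply: (le_trans (hq h)).
  apply: (@le_trans _ _ (`|C| * (`|h| * `|h|))).
    rewrite -normrM -expr2 [`|h ^+ 2|]ger0_norm ?sqr_ge0 //; apply: ler_wpM2r; first exact: sqr_ge0.
    exact: ler_norm.
  rewrite mulrCA ler_pM2l //; apply: (@le_trans _ _ ((`|C| + 1) * `|h|)).
    by rewrite ler_wpM2r // lerDl.
  by rewrite mulrC -ler_pdivlMr // ltr_wpDl.
apply: DeriveDef; first by apply/cvg_ex; exists l.
exact: cvg_lim cv.
Unshelve. all: by end_near. Qed.

(** The limit is the supremum of the lower estimates $s_K-D/K$, none of which exceeds any upper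
    estimate $s_M+D/M$. *)
Lemma cauchy_limit (s : nat -> R) D : 0 <= D ->
  (forall K M, (0 < K)%N -> (K <= M)%N -> `|s M - s K| <= D / K%:R) ->
  exists l, forall K, (0 < K)%N -> `|s K - l| <= D / K%:R.
Proof.
move=> D0 hs; pose A := [set s K - D / K%:R | K in [set K | (0 < K)%N]].
have le1 K M : (0 < K)%N -> (0 < M)%N -> s M - D / M%:R <= s K + D / K%:R.
  move=> K0 M0; have q L : 0 <= D / L%:R by rewrite divr_ge0.
  have [KM|MK] := leqP K M.
    by have := hs K M K0 KM; rewrite ler_norml => /andP[_]; have := q M; lra.
  by have := hs M K M0 (ltnW MK); rewrite ler_norml => /andP[]; have := q K; lra.
have A0 : A !=set0 by exists (s 1%N - D / 1%:R); exists 1%N.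
have uA : has_ubound A by exists (s 1%N + D / 1%:R) => _ [M /= M0 <-]; exact: le1.
exists (sup A) => K K0; rewrite ler_norml; apply/andP; split.
  suff : sup A <= s K + D / K%:R by lra.
  by apply: ge_sup => // _ [M /= M0 <-]; exact: le1.
suff : s K - D / K%:R <= sup A by lra.
by apply: ub_le_sup => //; exists K.
Qed.

Lemma cos_taylor x h : `|cos (x + h) - cos x - h * cos (x + pi / 2)| <= h ^+ 2.
Proof.
have E : cos (x + pi / 2) = - sin x by rewrite cosD cos_pihalf sin_pihalf; ring.
rewrite E.
have lipsin (u v : R) : `|sin u - sin v| <= `|u - v|.
  rewrite -[leRHS]mul1r; apply: (lipschitz_of_bound (fun z => is_derive_sin z) (a := Num.min u v) (b := Num.max u v)).
  - by move=> z _; exact: cos_max.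
  - by rewrite ge_min lexx le_max lexx.
  - by rewrite ge_min lexx orbT le_max lexx orbT.
pose g z := cos z + z * sin x.
have dg (z : R) : is_derive z 1 g (- sin z + sin x).
  by apply: (der_eq (derD (is_derive_cos z) (derM (derI z) (derC (sin x) z)))); ring.
have -> : cos (x + h) - cos x - h * - sin x = g (x + h) - g x by rewrite /g; ring.
have hh : `|h| * `|(x + h) - x| = h ^+ 2 by rewrite addrAC subrr add0r -normrM -expr2 ger0_norm ?sqr_ge0.
have nh := ler_norm h; have nNh : - `|h| <= h by rewrite lerNl -normrN ler_norm.
rewrite -hh; apply: (lipschitz_of_bound dg (a := x - `|h|) (b := x + `|h|)).
- move=> z /andP[z1 z2]; rewrite addrC; apply: (le_trans (lipsin x z)).
  by rewrite ler_norml; apply/andP; split; lra.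
- by apply/andP; split; lra.
- by have := normr_ge0 h; move=> ?; apply/andP; split; lra.
Qed.

Variables (a : nat -> R) (f : R -> R) (C : R) (B : nat -> R).
Hypothesis hf : forall K x, (0 < K)%N ->
  `|f x - 2 * \sum_(1 <= n < K.+1) a n * cos (2 * pi * n%:R * x)| <= C / K%:R.
Hypothesis hB : forall i n, (0 < n)%N -> `|a n| * (2 * pi * n%:R) ^+ i * n%:R ^+ 2 <= B i.

Let S i K x := 2 * \sum_(1 <= n < K.+1) a n * (2 * pi * n%:R) ^+ i * cos (2 * pi * n%:R * x + i%:R * (pi / 2)).

Let w0 n : 0 <= 2 * pi * n%:R :> R.
Proof. by rewrite !mulr_ge0 // ltW // pi_gt0. Qed.

Let B0 i : 0 <= B i.
Proof. by apply: le_trans (hB i (ltn0Sn 0)); rewrite !mulr_ge0 ?exprn_ge0. Qed.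

Let term i n : (0 < n)%N -> `|a n| * (2 * pi * n%:R) ^+ i <= B i * n%:R ^- 2.
Proof. by move=> n0; rewrite ler_pdivlMr ?exprn_gt0 ?ltr0n // hB. Qed.

(** The series differentiated i times has the terms $a_n(2\pi n)^i\cos(2\pi nx+i\pi/2)$, and the
    spare factor $n^2$ in [hB] makes its remainder $O(1/K)$. Termwise Taylor expansion bounds the
    error of the linear approximation quadratically, with the constant of order i + 2, which
    identifies the derivative of the limit. *)
Lemma derivative_sequence : exists F : nat -> R -> R,
  [/\ F 0 = f, forall i x, is_derive x 1 (F i) (F i.+1 x) & forall i x, `|F i x| <= 4 * B i].
Proof.
have S0 K x : S 0 K x = 2 * \sum_(1 <= n < K.+1) a n * cos (2 * pi * n%:R * x).
  by rewrite /S; congr (_ * _); apply: eq_bigr => n _; rewrite expr0 mulr1 mul0r addr0.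
have cau i x K M : (0 < K)%N -> (K <= M)%N -> `|S i M x - S i K x| <= 2 * B i / K%:R.
  move=> K0 KM; rewrite /S -mulrBr normrM ger0_norm // -mulrA ler_pM2l //.
  rewrite (big_cat_nat (n := K.+1)) //= addrAC subrr add0r.
  apply: (le_trans (ler_norm_sum _ _ _)).
  apply: (@le_trans _ _ (\sum_(K.+1 <= n < M.+1) B i * n%:R ^- 2)).
    rewrite big_nat [leRHS]big_nat; apply: ler_sum => n /andP[Kn _].
    have n0 : (0 < n)%N by exact: leq_trans Kn.
    apply: le_trans (term i n0); rewrite !normrM [`|_ ^+ i|]ger0_norm ?exprn_ge0 //.
    by apply: ler_piMr; rewrite ?mulr_ge0 ?exprn_ge0 // cos_max.
  by rewrite -mulr_sumr ler_wpM2l // sum_inv_sqr.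
have B20 i : 0 <= 2 * B i by rewrite mulr_ge0.
have [F hF] := choice (fun p : nat * R => cauchy_limit (B20 p.1) (cau p.1 p.2)).
have Sb i K x : `|S i K x| <= 4 * B i.
  rewrite /S normrM ger0_norm // (_ : 4 = 2 * 2); last by ring.
  rewrite -mulrA ler_pM2l //; apply: (le_trans (ler_norm_sum _ _ _)).
  apply: (@le_trans _ _ (\sum_(1 <= n < K.+1) B i * n%:R ^- 2)).
    rewrite big_nat [leRHS]big_nat; apply: ler_sum => n /andP[n0 _].
    apply: le_trans (term i n0); rewrite !normrM [`|_ ^+ i|]ger0_norm ?exprn_ge0 //.
    by apply: ler_piMr; rewrite ?mulr_ge0 ?exprn_ge0 // cos_max.
  by rewrite -mulr_sumr mulrC ler_wpM2r // sum_inv_sqr_le2.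
exists (fun i x => F (i, x)); split.
- apply: funext => x; apply/eqP; rewrite -subr_eq0 -normr_le0.
  apply: (@le_of_le_div _ _ _ (2 * B 0 + C) 1) => L L1; rewrite add0r.
  have h1 := hF (0%N, x) L L1; rewrite /= S0 in h1; have h2 := hf x L1.
  rewrite mulrDl; apply: le_trans (lerD h1 h2); rewrite distrC; apply: le_trans (ler_normD _ _).
  by set X := 2 * _; rewrite (_ : X - F (0%N, x) + (f x - X) = f x - F (0%N, x)) //; ring.
- move=> i x; apply: (@der_of_quadratic _ _ _ (4 * B i.+2)) => h.
  apply: (@le_of_le_div _ _ _ (2 * B i + 2 * B i + `|h| * (2 * B i.+1)) 1) => L L1.
  have h1 := hF (i, x + h) L L1; have h2 := hF (i, x) L L1; have h3 := hF (i.+1, x) L L1.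
  rewrite /= in h1 h2 h3.
  have q : `|S i L (x + h) - S i L x - h * S i.+1 L x| <= 4 * B i.+2 * h ^+ 2.
    pose T n := cos (2 * pi * n%:R * (x + h) + i%:R * (pi / 2)) - cos (2 * pi * n%:R * x + i%:R * (pi / 2)) -
      2 * pi * n%:R * h * cos (2 * pi * n%:R * x + i%:R * (pi / 2) + pi / 2).
    have -> : S i L (x + h) - S i L x - h * S i.+1 L x = 2 * \sum_(1 <= n < L.+1) a n * (2 * pi * n%:R) ^+ i * T n.
      rewrite /S [h * (2 * _)]mulrCA -!mulrBr; congr (2 * _).
      rewrite mulr_sumr -!sumrB; apply: eq_bigr => n _.
      have -> : 2 * pi * n%:R * x + i.+1%:R * (pi / 2) = 2 * pi * n%:R * x + i%:R * (pi / 2) + pi / 2 by rewrite -natr1; ring.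
      by rewrite /T exprS; ring.
    rewrite normrM ger0_norm // (_ : 4 * B i.+2 * h ^+ 2 = 2 * (B i.+2 * h ^+ 2 * 2)); last by ring.
    rewrite ler_pM2l //; apply: (le_trans (ler_norm_sum _ _ _)).
    apply: (@le_trans _ _ (\sum_(1 <= n < L.+1) B i.+2 * h ^+ 2 * n%:R ^- 2)).
      rewrite big_nat [leRHS]big_nat; apply: ler_sum => n /andP[n0 _].
      rewrite [leRHS]mulrAC; apply: (@le_trans _ _ (`|a n| * (2 * pi * n%:R) ^+ i.+2 * h ^+ 2)); last first.
        by apply: ler_wpM2r; [exact: sqr_ge0|exact: term].
      rewrite !normrM [`|_ ^+ i|]ger0_norm ?exprn_ge0 //.
      have -> : `|a n| * (2 * pi * n%:R) ^+ i.+2 * h ^+ 2 = `|a n| * (2 * pi * n%:R) ^+ i * (2 * pi * n%:R * h) ^+ 2.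
        by rewrite (exprS _ i.+1) (exprS _ i) exprMn; ring.
      apply: ler_wpM2l; first by apply: mulr_ge0 => //; exact: exprn_ge0.
      have := cos_taylor (2 * pi * n%:R * x + i%:R * (pi / 2)) (2 * pi * n%:R * h).
      by rewrite [_ + _ + 2 * pi * n%:R * h]addrAC -mulrDr.
    by rewrite -mulr_sumr ler_wpM2l ?sum_inv_sqr_le2 // mulr_ge0 ?sqr_ge0.
  have h4 : `|h * (S i.+1 L x - F (i.+1, x))| <= `|h| * (2 * B i.+1 / L%:R) by rewrite normrM ler_wpM2l.
  have e : (2 * B i + 2 * B i + `|h| * (2 * B i.+1)) / L%:R = 2 * B i / L%:R + 2 * B i / L%:R + `|h| * (2 * B i.+1 / L%:R) by ring.
  have e2 : F (i, x + h) - F (i, x) - h * F (i.+1, x) = (S i L (x + h) - S i L x - h * S i.+1 L x)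
    - (S i L (x + h) - F (i, x + h)) + (S i L x - F (i, x)) + h * (S i.+1 L x - F (i.+1, x)) by ring.
  rewrite e e2; move: q h1 h2 h4; rewrite !ler_norml => /andP[? ?] /andP[? ?] /andP[? ?] /andP[? ?].
  by apply/andP; split; lra.
- move=> i x; apply: (@le_of_le_div _ _ _ (2 * B i) 1) => L L1.
  have h1 := hF (i, x) L L1; apply: le_trans (lerD (Sb i L x) h1); rewrite distrC /=.
  by rewrite -[X in `|X| <= _](subrKC (S i L x)) ler_normD.
Qed.

End SmoothSeries.

Lemma pow_le_fact_exp (R : realType) (x : R) i : 0 <= x -> x ^+ i <= i`!%:R * expR x.
Proof.
move=> x0; case: i => [|i]; first by rewrite expr0 fact0 mul1r; have := expR_ge1Dx x; lra.
have f0 : 0 < i.+1`!%:R :> R by rewrite ltr0n fact_gt0.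
by rewrite mulrC -ler_pdivrMr //; apply: le_trans (expR_ge1Dxn i x0); rewrite lerDr.
Qed.

Lemma poly_expR_le (R : realType) (c b t : R) : 0 <= c -> 0 <= b -> 1 <= t ->
  c * (t ^+ 3 * (1 + t ^+ 2) * expR (b * t)) <= expR ((c + (5%:R + b)) * t).
Proof.
move=> c0 b0 t1; have t0 : 0 <= t by lra.
have et : 1 + t <= expR t by exact: expR_ge1Dx.
have -> : (c + (5%:R + b)) * t = c * t + (5%:R * t + b * t) by ring.
rewrite !expRD; apply: ler_pM => //.
- by rewrite mulr_ge0 ?expR_ge0 // mulr_ge0 ?exprn_ge0 ?addr_ge0 ?sqr_ge0.
- have h : c * 1 <= c * t by exact: ler_wpM2l.
  by have := expR_ge1Dx (c * t); lra.
apply: ler_wpM2r; first exact: expR_ge0.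
rewrite expRM_natl (exprD _ 3 2); apply: ler_pM.
- exact: exprn_ge0.
- by rewrite addr_ge0 ?sqr_ge0.
- by apply: lerXn2r; rewrite ?nnegrE ?expR_ge0 //; lra.
- have tt : 0 <= 1 + t by lra.
  by have := ler_pM tt tt et et; rewrite expr2; nra.
Qed.

(** * Upper and lower exponential bounds for the coefficients *)

Section CoefficientSize.
Variable R : realType.
Variables (phi : R[i] -> R) (t r al Y : R).
Hypothesis hphi : even_hecke_maass_cusp_form phi t.
Hypothesis t1000 : 1000 <= t.
Hypothesis osc : oscillates phi t r al.
Hypothesis Y0 : 0 < Y.

Let K := radial phi.
Let t2 : 2 <= t. Proof. by have T := t1000; lra. Qed.
Let t0 : 0 < t. Proof. by have T := t1000; lra. Qed.
Let r0 : 0 < r. Proof. by case: osc. Qed.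
Let K_le s : `|K s| <= 2 * r * (1 + t ^+ 2). Proof. by case: osc. Qed.

Lemma radial_le_exp z : 0 < z -> `|K (ln z)| <= 2 * r * (1 + t ^+ 2) * expR (t - z).
Proof.
move=> z0; have M0 : 0 <= 2 * r * (1 + t ^+ 2) by apply: le_trans (K_le 0).
have [tz|zt] := leP t z; last first.
  apply: (le_trans (K_le _)); rewrite -[leLHS]mulr1; apply: ler_wpM2l => //.
  by rewrite -expR0 ler_expR subr_ge0 ltW.
have e1 : t <= expR (ln t) by rewrite lnK ?posrE.
have e2 : ln t <= ln z by rewrite ler_ln ?posrE.
have := K_decay t2 (radial_derive hphi) (radial_derive2 hphi) (radial_not_growing hphi) e1 e2.
rewrite !lnK ?posrE // => h; apply: (le_trans h); apply: ler_wpM2r; [exact: expR_ge0|exact: K_le].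
Qed.

(** The decay $e^{-nY}$ is split into two halves. One absorbs $(2\pi n)^i$ at the price of i! and
    yields the radius $\rho=Y/(4\pi)$; the other absorbs $n^4$, two powers from the trivial bound
    for the eigenvalue and two from the statement. *)
Lemma coef_derivative_le i n : (0 < n)%N -> `|coef phi n Y| * (2 * pi * n%:R) ^+ i * n%:R ^+ 2 <=
  Num.sqrt Y * (2 * r * (1 + t ^+ 2)) * expR t * (8 / Y) ^+ 4 * (i`!%:R / (Y / (4 * pi)) ^+ i).
Proof.
move=> n0; have n1 : 0 < n%:R :> R by rewrite ltr0n.
set M := 2 * r * (1 + t ^+ 2).
have M0 : 0 <= M by apply: le_trans (K_le 0).
have p0 : 0 < pi :> R by exact: pi_gt0.
set w := n%:R * Y; have w0 : 0 < w by rewrite mulr_gt0.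
have sY : 0 <= Num.sqrt Y by exact: sqrtr_ge0.
have c1 : `|coef phi n Y| <= n%:R ^+ 2 * (Num.sqrt Y * (M * expR (t - w))).
  rewrite (coef_radial hphi n0 Y0) normrM; apply: ler_pM => //; first exact: lam_le_sqr.
  rewrite normrM [`|Num.sqrt Y|]ger0_norm //; apply: ler_wpM2l => //; exact: radial_le_exp.
have w2 : 0 <= w / 2 by rewrite divr_ge0 // ltW.
have e1 := pow_le_fact_exp i w2.
have e2 : (w / 8) ^+ 4 <= expR (w / 2).
  have -> : w / 2 = 4%:R * (w / 8) by field.
  rewrite expRM_natl; apply: lerXn2r; rewrite ?nnegrE ?expR_ge0 ?divr_ge0 ?(ltW w0) //.
  by apply: le_trans (expR_ge1Dx _); rewrite lerDr.
have rho0 : 0 < (Y / (4 * pi)) ^+ i by rewrite exprn_gt0 // divr_gt0 // mulr_gt0.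
have eN : (2 * pi * n%:R) ^+ i = (w / 2) ^+ i / (Y / (4 * pi)) ^+ i.
  have gen (q : R) : 0 < q -> 2 * q * n%:R = w / 2 / (Y / (4 * q)).
    by move=> q0; rewrite /w; field; rewrite !lt0r_neq0.
  by rewrite -expr_div_n -gen.
have e4 : n%:R ^+ 2 * n%:R ^+ 2 = (8 / Y) ^+ 4 * (w / 8) ^+ 4 :> R.
  by rewrite /w; field; rewrite lt0r_neq0.
have N0 : 0 <= (2 * pi * n%:R) ^+ i :> R by apply: exprn_ge0; rewrite !mulr_ge0 // ltW.
apply: (@le_trans _ _ (n%:R ^+ 2 * (Num.sqrt Y * (M * expR (t - w))) * (2 * pi * n%:R) ^+ i * n%:R ^+ 2)).
  by apply: ler_wpM2r; [exact: sqr_ge0|exact: ler_wpM2r].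
have -> : n%:R ^+ 2 * (Num.sqrt Y * (M * expR (t - w))) * (2 * pi * n%:R) ^+ i * n%:R ^+ 2 =
    Num.sqrt Y * M * expR (t - w) * (2 * pi * n%:R) ^+ i * (n%:R ^+ 2 * n%:R ^+ 2) by ring.
rewrite e4 eN expRD -[w in expR (- w)](_ : w / 2 + w / 2 = w); last by field.
rewrite expRN expRD.
set A := expR (w / 2) in e1 e2 *; have A0 : 0 < A by exact: expR_gt0.
set q := (Y / _) ^+ i in rho0 *; set u := (w / 2) ^+ i in e1 *; set v := (w / 8) ^+ 4 in e2 *.
set c := (8 / Y) ^+ 4; have c0 : 0 <= c by rewrite exprn_ge0 // divr_ge0 // ltW.
have -> : Num.sqrt Y * M * (expR t * (A * A)^-1) * (u / q) * (c * v) =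
   Num.sqrt Y * M * expR t * c * (u * v / (A * A) / q) by field; rewrite !lt0r_neq0.
apply: ler_wpM2l; first by apply: (mulr_ge0 (mulr_ge0 (mulr_ge0 sY M0) (expR_ge0 t)) c0).
apply: ler_wpM2r; first by rewrite invr_ge0 ltW.
have u0 : 0 <= u by exact: exprn_ge0.
have v0 : 0 <= v by apply: exprn_ge0; rewrite divr_ge0 // ltW.
rewrite ler_pdivrMr; last exact: mulr_gt0.
by rewrite [_ * (A * A)]mulrA; exact: (ler_pM u0 v0 e1 e2).
Qed.

Lemma lam_pow2_step k : lam hphi 2 * lam hphi (2 ^ k.+1) = lam hphi (2 ^ k.+2) + lam hphi (2 ^ k).
Proof.
rewrite (hecke_relation hphi) ?expn_gt0 // expnS gcdnMr.
have -> : divisors 2 = [:: 1%N; 2%N] by [].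
rewrite !big_cons big_nil addr0 exp1n divn1 -!expnS; congr (_ + lam _ _).
by rewrite !expnS mulnA mulKn.
Qed.

(** By the three-term recurrence and $|\lambda(2)|\le4$, the larger of two consecutive values
    shrinks by a factor of at most 5 at each step. *)
Lemma lam_pow2_large k : 1 <= 5 ^+ k * Num.max `|lam hphi (2 ^ k)| `|lam hphi (2 ^ k.+1)|.
Proof.
elim: k => [|k IH].
  rewrite expr0 mul1r le_max; apply/orP; left; rewrite expn0.
  have [y y0 cy] := coef1_neq0 hphi.
  have := coef_lam hphi (ltn0Sn 0) y0; rewrite sqrtr1 divr1 mul1r -[LHS]mul1r => /(mulIf cy) <-.
  by rewrite normr1.
apply: (le_trans IH); rewrite exprSr -mulrA; apply: ler_wpM2l; first by rewrite exprn_ge0.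
set m := Num.max _ _ in IH *; set a := `|lam hphi (2 ^ k.+1)|; set b := `|lam hphi (2 ^ k.+2)|.
have l2 : `|lam hphi 2| <= 4 by have := lam_le_sqr hphi t2 (isT : (0 < 2)%N); rewrite (_ : 2%:R ^+ 2 = 4 :> R) //; ring.
have a1 : a <= Num.max a b by rewrite le_max lexx.
have b1 : b <= Num.max a b by rewrite le_max lexx orbT.
have a0 : 0 <= a by exact: normr_ge0.
rewrite /m ge_max -/a; apply/andP; split; last by lra.
have -> : lam hphi (2 ^ k) = lam hphi 2 * lam hphi (2 ^ k.+1) - lam hphi (2 ^ k.+2) by rewrite lam_pow2_step; ring.
apply: (le_trans (ler_normB _ _)); rewrite normrM -/a -/b.
by have := ler_wpM2r a0 l2; lra.
Qed.

(** One of two heights below 1 has $|K|$ comparable to the amplitude, and its energy is carried to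
    $y=t$ by [K_le_at_t]. *)
Lemma radial_at_t_ge : r <= 200 * expR (pi ^+ 2 * t) * `|K (ln t)|.
Proof.
have p0 : 0 < pi :> R by exact: pi_gt0.
have p4 : pi <= 4 :> R by have := @pihalf_lt2 R; lra.
have T := t1000.
pose s := -1 : R; pose s' := s + pi / (2 * t).
have s0 : s <= 0 by rewrite /s; lra.
have h := two_heights t1000 osc s0; rewrite -/s' -/K in h.
have st (u : R) : u <= 0 -> expR u <= t.
  by move=> u0; apply: (@le_trans _ _ 1); [rewrite -expR0 ler_expR|lra].
have s'0 : s' <= 0.
  have : pi / (2 * t) <= 1 by rewrite ler_pdivrMr; lra.
  by rewrite /s' /s; lra.
have en (u : R) : u <= 0 -> K u ^+ 2 <= 300 * expR (2 * pi ^+ 2 * t) * K (ln t) ^+ 2.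
  move=> u0; have := K_le_at_t t2 (radial_derive hphi) (radial_derive2 hphi) (radial_not_growing hphi) (st u u0).
  rewrite /energy -/K => e; have tt : 0 < t ^+ 2 by rewrite exprn_gt0.
  rewrite -(ler_pM2l tt); have e' : t ^+ 2 * K u ^+ 2 <= radial' phi u ^+ 2 + t ^+ 2 * K u ^+ 2 by rewrite lerDr sqr_ge0.
  apply: (le_trans e'); apply: (le_trans e).
  by apply: eq_ler; ring.
have h1 := en s s0; have h2 := en s' s'0.
have ee : expR (2 * pi ^+ 2 * t) = expR (pi ^+ 2 * t) ^+ 2 by rewrite -expRM_natl; congr expR; ring.
rewrite ee in h1 h2.
have rr : 0 <= r by exact: ltW.
have R0 : 0 <= 200 * expR (pi ^+ 2 * t) * `|K (ln t)|.
  by apply: mulr_ge0; [apply: mulr_ge0; rewrite ?ler0n // expR_ge0|exact: normr_ge0].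
rewrite -(@ler_pXn2r _ 2) ?nnegrE //.
rewrite exprMn real_normK ?num_real // exprMn.
set X := expR _ ^+ 2 in h1 h2 *; set k := K (ln t) ^+ 2 in h1 h2 *.
have : 0 <= X * k by rewrite mulr_ge0 ?sqr_ge0.
lra.
Qed.

(** For the least k with $2^kY\ge t$, both $2^kY$ and $2^{k+1}Y$ lie between t and 4t, where K is at
    least exponentially small in t only; one of the two eigenvalues is at least $5^{-k}$, and
    $5^k\le(2^k)^3$ is polynomial in t. *)
Lemma large_coef : Y <= t -> exists2 n, (0 < n)%N &
  r <= `|coef phi n Y| * (200 * (2 * t / Y) ^+ 3 / Num.sqrt Y * expR ((pi ^+ 2 + 12 * pi) * t)).
Proof.
move=> Yt; have p0 : 0 < pi :> R by exact: pi_gt0.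
have ex : exists k, t <= (2 ^ k)%N%:R * Y.
  exists (Num.bound (t / Y)); rewrite -ler_pdivrMr //; apply: ltW.
  have := archi_boundP (divr_ge0 (ltW t0) (ltW Y0)) => h; apply: (lt_le_trans h).
  by rewrite ler_nat ltnW // ltn_expl.
have [k tk kmin] := ex_minnP ex.
have k2 : (2 ^ k)%N%:R <= 2 * t / Y.
  rewrite ler_pdivlMr //; case: k tk kmin => [|k] tk kmin; first by rewrite expn0 mul1r; have T := t0; lra.
  have : (2 ^ k)%N%:R * Y < t by rewrite ltNge; apply/negP => /kmin; rewrite ltnn.
  by rewrite expnS natrM; lra.
have k5 : 5 ^+ k <= (2 * t / Y) ^+ 3.
  apply: (@le_trans _ _ ((2 ^ k)%N%:R ^+ 3)); last by apply: lerXn2r; rewrite ?nnegrE // divr_ge0 ?mulr_ge0 // ltW.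
  rewrite natrX -exprM mulnC exprM; apply: lerXn2r; rewrite ?nnegrE ?exprn_ge0 //; lra.
have [m mk [m1 m2]] : exists2 m, (0 < m)%N & 1 <= 5 ^+ k * `|lam hphi m| /\ t <= m%:R * Y <= 4 * t.
  have := lam_pow2_large k; rewrite maxr_pMr ?exprn_ge0 // le_max => /orP[h|h].
    exists (2 ^ k)%N; rewrite ?expn_gt0 //; split => //; rewrite tk /=.
    by move: k2; rewrite ler_pdivlMr //; have T := t0; lra.
  exists (2 ^ k.+1)%N; rewrite ?expn_gt0 //; split => //; rewrite expnS natrM.
  move: k2; rewrite ler_pdivlMr // => k2; have T := t0; apply/andP; split; lra.
exists m => //; have /andP[tm m4] := m2.
have mY : 0 < m%:R * Y by exact: lt_le_trans tm.
have e1 : t <= expR (ln t) by rewrite lnK ?posrE.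
have e2 : ln t <= ln (m%:R * Y) by rewrite ler_ln ?posrE.
have low := K_decay_lower t2 (radial_derive hphi) (radial_derive2 hphi) (radial_not_growing hphi) e1 e2.
rewrite !lnK ?posrE // -/K in low.
have low2 : `|K (ln t)| <= `|K (ln (m%:R * Y))| * expR (12 * pi * t).
  rewrite -ler_pdivrMr ?expR_gt0 // -expRN; apply: le_trans low.
  apply: ler_wpM2l => //; rewrite ler_expR; nra.
have sY : 0 < Num.sqrt Y by rewrite sqrtr_gt0.
apply: (le_trans radial_at_t_ge).
set a := `|lam hphi m| in m1; set b := `|K (ln (m%:R * Y))| in low2.
have -> : `|coef phi m Y| = a * (Num.sqrt Y * b).
  by rewrite (coef_radial hphi mk Y0) normrM [`|Num.sqrt Y * _|]normrM [`|Num.sqrt Y|]gtr0_norm.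
have -> : a * (Num.sqrt Y * b) * (200 * (2 * t / Y) ^+ 3 / Num.sqrt Y * expR ((pi ^+ 2 + 12 * pi) * t)) =
   200 * expR (pi ^+ 2 * t) * ((2 * t / Y) ^+ 3 * a * (b * expR (12 * pi * t))).
  rewrite [(pi ^+ 2 + _) * t]mulrDl expRD; set y := Num.sqrt Y in sY *; set c := (_ / _) ^+ 3; field.
  by rewrite lt0r_neq0.
apply: ler_wpM2l; first by apply: mulr_ge0; rewrite ?ler0n // expR_ge0.
apply: (le_trans low2); rewrite -[leLHS]mul1r; apply: ler_wpM2r.
  by apply: mulr_ge0; [exact: normr_ge0|exact: expR_ge0].
by apply: (le_trans m1); apply: ler_wpM2r; first exact: normr_ge0.
Qed.

End CoefficientSize.

(** * Counting zeros from above *)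

Section UpperBound.
Variable R : realType.

(** Lists suffice: an infinite set would contain lists longer than N, so its count $+\infty$ does
    not arise. *)
Lemma counting_le (T : choiceType) (A : set T) (N : R) :
  (forall zs : seq T, uniq zs -> (forall z, z \in zs -> A z) -> (size zs)%:R <= N) ->
  (counting A <= N%:E)%E.
Proof.
move=> hN; rewrite /counting; case: asboolP => [fA|/infinite_set_fset infA].
  rewrite lee_fin; apply: hN; first exact: finmap.fset_uniq.
  by move=> z; rewrite in_fset_set // inE.
have N0 : 0 <= N by have := hN [::] isT; apply.
have [B BA] := infA (Num.bound N); have := archi_boundP N0 => b sB.
have : (size (finmap.enum_fset B))%:R <= N by apply: hN; [exact: finmap.fset_uniq|move=> z zB; exact: BA].
by move=> h; have := le_lt_trans h b; rewrite ltr_nat ltnNge sB.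
Qed.

(* Real parts in (-1/2, 1/2] are moved to [0, 1) by the period 1. *)
Lemma horocycle_zeros_segment (phi : R[i] -> R) (t Y : R) (zs : seq R[i]) :
  even_hecke_maass_cusp_form phi t -> 0 < Y -> uniq zs -> (forall z, z \in zs -> horocycle_zeros phi Y z) ->
  exists xs : seq R, [/\ uniq xs, size xs = size zs & forall x, x \in xs -> 0 <= x < 1 /\ in_coords phi (x, Y) = 0].
Proof.
move=> hphi Y0 uz hz; pose g (z : R[i]) := if complex.Re z < 0 then complex.Re z + 1 else complex.Re z.
have hx z : z \in zs -> exists2 x, z = (x +i* Y)%C & - 2^-1 < x <= 2^-1 /\ phi z = 0.
  by move=> /hz [[x /= xI <-] p0]; exists x.
exists [seq g z | z <- zs]; split; last first.
- move=> _ /mapP[z /hx[x -> [/andP[x1 x2] p0]] ->]; rewrite /g /=; case: (ltP x 0) => h.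
    by rewrite (form_periodic hphi) //; split => //; apply/andP; split; lra.
  by split => //; apply/andP; split; lra.
- by rewrite size_map.
rewrite map_inj_in_uniq // => z z' /hx[x -> [/andP[x1 x2] _]] /hx[x' -> [/andP[x1' x2'] _]].
rewrite /g /=; case: (ltP x 0) => h; case: (ltP x' 0) => h' e; congr (_ +i* _)%C; lra.
Qed.

Variable Y : R.
Hypothesis Y0 : 0 < Y.

(** More than Pn zeros would make every coefficient at most $4G_04^{-n}$, where $G_0$ is r times an
    exponential in t, while [large_coef] provides one that is at least r times an exponentially
    small factor. The amplitude cancels, and $4^n>e^{C_0t}$ is a contradiction. *)
Lemma zeros_upper_bound : exists2 C : R, 0 < C &
  \forall t \near (pinfty_nbhs R), forall phi : R[i] -> R, even_hecke_maass_cusp_form phi t ->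
    (counting (horocycle_zeros phi Y) <= (C * t)%R%:E)%E.
Proof.
have p0 : 0 < pi :> R by exact: pi_gt0.
pose rho := Y / (4 * pi); have rho0 : 0 < rho by rewrite divr_gt0 // mulr_gt0.
pose nat_above (x : R) := (Num.truncn x).+1.
have above x : 0 <= x -> x <= (nat_above x)%:R by move=> x0; have /andP[_ /ltW] := truncn_itv x0.
pose s0 := nat_above (8 / rho); pose R0 := nat_above (16 / rho).
pose c0 := 8 * (8 / Y) ^+ 4 * 200 * (2 / Y) ^+ 3.
have y8 : 0 <= 8 / Y by rewrite divr_ge0 // ltW.
have y2 : 0 <= 2 / Y by rewrite divr_ge0 // ltW.
have c00 : 0 <= c0.
  apply: mulr_ge0; last exact: exprn_ge0.
  apply: mulr_ge0; last by rewrite ler0n.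
  by apply: mulr_ge0; [rewrite ler0n|exact: exprn_ge0].
pose b0 : R := 1 + pi ^+ 2 + 12 * pi.
have b00 : 0 <= b0 by rewrite !addr_ge0 ?sqr_ge0 ?mulr_ge0 // ltW.
(* The exponent is assembled from [c0] for the constant factor, 5 for $t^3(1+t^2)$ and [b0] for the
   exponentials, as in [poly_expR_le]. *)
pose C0 := c0 + (5%:R + b0).
have C00 : 0 < C0 by rewrite ltr_wpDl // ltr_pwDl.
have l4 : 0 < ln (4 : R) by rewrite ln_gt0 //; lra.
pose D := C0 / ln 4 + 2; have D0 : 0 < D by rewrite ltr_wpDl // divr_ge0 // ltW.
(* The number of zeros per unit of n: R0 cells, each needing $2\cdot4^{s_0}n$ zeros so that s0 steps
   of propagation still leave a jet of order n. *)
pose P := (R0 * (2 * 4 ^ s0))%N.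
have P0 : (0 < P)%N by rewrite /P !muln_gt0 expn_gt0.
exists (P%:R * D); first by rewrite mulr_gt0 // ltr0n.
exists (Num.max 1000 Y); split; first exact: num_real.
move=> t; rewrite gt_max => /andP[/ltW t1000 /ltW Yt] phi hphi.
have t0 : 0 < t by lra.
have [r [al osc]] := radial_oscillates hphi t1000.
have r0 : 0 < r by case: osc.
apply: counting_le => zs uz /(horocycle_zeros_segment hphi Y0 uz)[xs [ux <- hx]] {zs uz}.
(* The least integer above $C_0t/\ln4$, so that $4^n>e^{C_0t}$ while n remains of order t. *)
pose n := nat_above (C0 * t / ln 4).
have n1 : C0 * t / ln 4 < n%:R by have /andP[] := truncn_itv (divr_ge0 (mulr_ge0 (ltW C00) (ltW t0)) (ltW l4)).
have n2 : n%:R <= D * t.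
  have /andP[h _] := truncn_itv (divr_ge0 (mulr_ge0 (ltW C00) (ltW t0)) (ltW l4)).
  rewrite /n /nat_above -natr1; have -> : D * t = C0 * t / ln 4 + 2 * t by rewrite /D; ring.
  by apply: lerD => //; lra.
apply: (@le_trans _ _ (P * n)%N%:R); last by rewrite natrM -mulrA ler_wpM2l.
rewrite ler_nat leqNgt; apply/negP => big.
have [n3 n3n n3r] := large_coef hphi t1000 osc Y0 Yt.
pose M := 2 * r * (1 + t ^+ 2).
have M0 : 0 <= M by rewrite !mulr_ge0 ?(ltW r0) // addr_ge0 ?sqr_ge0.
pose G0 := Num.sqrt Y * M * expR t * (8 / Y) ^+ 4.
have sY : 0 < Num.sqrt Y by rewrite sqrtr_gt0.
have G00 : 0 <= G0.
  apply: mulr_ge0; last by apply: exprn_ge0; rewrite divr_ge0 // ltW.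
  by apply: mulr_ge0; [apply: mulr_ge0 => //; exact: ltW|exact: expR_ge0].
have [C _ hf] := slice_fourier hphi Y0.
have hB i m : (0 < m)%N -> `|coef phi m Y| * (2 * pi * m%:R) ^+ i * m%:R ^+ 2 <= G0 * (i`!%:R / rho ^+ i).
  by move=> m0; exact: coef_derivative_le hphi t1000 osc Y0 i m m0.
have [F [F0 dF bF]] := derivative_sequence hf hB.
have bF' i x : `|F i x| * rho ^+ i <= 4 * G0 * i`!%:R.
  rewrite -ler_pdivlMr ?exprn_gt0 //; apply: (le_trans (bF i x)); rewrite !mulrA //.
have per (x : R) : F 0 (x + 1) = F 0 x by rewrite F0; exact: (form_periodic hphi x Y0).
have n0 : (0 < n)%N by [].
have s00 : (0 < s0)%N by [].
have hs0 : 8 / rho <= s0%:R by apply: above; rewrite divr_ge0 // ltW.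
have hR0 : 16 / rho <= R0%:R by apply: above; rewrite divr_ge0 // ltW.
have hx0 x : x \in xs -> 0 <= x < 1 /\ F 0 x = 0 by rewrite F0; exact: hx.
have big' : (R0 * (2 * (4 ^ s0 * n)) <= size xs)%N by apply: ltnW; rewrite [(2 * _)%N]mulnA mulnA.
have G40 : 0 <= 4 * G0 by rewrite mulr_ge0.
have small q : 0 <= q <= 1 -> `|F 0 q| <= 4 * G0 / 4 ^+ n.
  move=> qI; rewrite ler_pdivlMr ?exprn_gt0 //.
  exact: (small_everywhere dF rho0 G40 bF' n0 s00 hs0 hR0 per ux hx0 big' qI).
have an : `|coef phi n3 Y| <= 4 * G0 / 4 ^+ n.
  by apply: (fcoef_le (slice_derive hphi Y0)) => x x01; have := small x x01; rewrite F0.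
pose W := 200 * (2 * t / Y) ^+ 3 / Num.sqrt Y * expR ((pi ^+ 2 + 12 * pi) * t).
have W0 : 0 <= W.
  apply: mulr_ge0; last exact: expR_ge0.
  apply: divr_ge0; last exact: ltW.
  apply: mulr_ge0; first by rewrite ler0n.
  by apply: exprn_ge0; rewrite divr_ge0 ?mulr_ge0 // ltW.
have h1 : r * 4 ^+ n <= 4 * G0 * W.
  rewrite -ler_pdivlMr ?exprn_gt0 //; apply: (le_trans n3r); rewrite -/W.
  by apply: (le_trans (ler_wpM2r W0 an)); rewrite [leLHS]mulrAC.
have h2 : 4 * G0 * W = r * (c0 * (t ^+ 3 * (1 + t ^+ 2) * expR (b0 * t))).
  have -> : expR (b0 * t) = expR t * expR ((pi ^+ 2 + 12 * pi) * t).
    by rewrite -expRD /b0; congr expR; ring.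
  rewrite /G0 /W /M /c0; set a := Num.sqrt Y in sY *; set b := expR t; set b' := expR _.
  by field; rewrite !lt0r_neq0.
have t1 : 1 <= t by apply: le_trans t1000; rewrite ler1n.
have h3 := poly_expR_le c00 b00 t1.
have h4 : expR (C0 * t) < 4 ^+ n.
  have e4 : 4 = expR (ln 4) :> R by rewrite lnK ?posrE.
  rewrite [X in X ^+ n]e4 -expRM_natl ltr_expR.
  by move: n1; rewrite ltr_pdivrMr.
move: h1; rewrite h2 ler_pM2l // => h1.
by have := lt_le_trans h4 (le_trans h1 h3); rewrite ltxx.
Qed.

End UpperBound.

Theorem theorem5p2 (R : realType) (Y : R) (hY : 0 < Y) :
  (forall eps : R, 0 < eps ->
     exists2 c : R, 0 < c &
       \forall t \near (pinfty_nbhs R), forall phi : R[i] -> R,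
         even_hecke_maass_cusp_form phi t ->
         ((c * t `^ (12^-1 - eps))%R%:E
            <= counting (horocycle_zeros phi Y))%E)
  /\
  (exists2 C : R, 0 < C &
     \forall t \near (pinfty_nbhs R), forall phi : R[i] -> R,
       even_hecke_maass_cusp_form phi t ->
       (counting (horocycle_zeros phi Y)
          <= (C * t)%R%:E)%E).
Proof.
by split; [move=> eps eps0; exact: zeros_lower_bound|exact: zeros_upper_bound].
Qed.
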